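(* Let $n\ge3$ and let $G$ be one of the groups $C(n,k/\ell)$ ($k,\ell\ge1$, $\gcd(k,\ell)=1$) or, if $n$ is odd, $C'(n,2)$. (1) The set of connected components of $\mathrm{Fix}(G,\Lambda X^{(n)})$ is in 1–1 correspondence with the following set: (a) if $G=C(n,k/\ell)$ with $\gcd(n,k)=1$: the set of $P_n$-conjugacy classes in the coset $\delta^bP_n\subset CB_n$, where $bk\equiv-1\bmod n$; (b) if $G=C(n,k/\ell)$ with $\gcd(n,k)=c>1$: the set of $P_{\hat n,1(c)}$-conjugacy classes in the coset $\hat\delta^{\,b}P_{\hat n,1(c)}\subset B_{\hat n,1}$, where $\hat n=n/c$, $\hat\delta=\mathfrak{b}_0^{2}\mathfrak{b}_1\mathfrak{b}_2\cdots\mathfrak{b}_{\hat n-1}$ and $bk\equiv-c\bmod n$; (c) if $G=C'(n,2)$: the set of orbits of the twisted conjugacy action $p\cdot\mathfrak{b}=p\,\mathfrak{b}\,\bar p^{-1}$ of $P_n$ on the coset $\delta'P_n$, where $\delta'=\delta^{(n+1)/2}$. (2) The connected component of $\mathrm{Fix}(G,\Lambda X^{(n)})$ containing $u$ is aspherical, with fundamental group isomorphic to the following group $\Pi_u$: (a) if $G=C(n,k/\ell)$ with $\gcd(n,k)=1$: $\Pi_u=\{p\in P_n: p\,\mathfrak{b}=\mathfrak{b}\,p\}$, where $\mathfrak{b}\in\delta^bP_n\subset B_n$ is the braid corresponding to the path $t\mapsto u(t/nk)$, $t\in[0,1]$, and $bk\equiv-1\bmod n$; (b) if $G=C(n,k/\ell)$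 with $\gcd(n,k)=c>1$: $\Pi_u=\{p\in P_{\hat n,1(c)}: p\,\mathfrak{b}=\mathfrak{b}\,p\}$, where $\mathfrak{b}\in\hat\delta^{\,b}P_{\hat n,1(c)}\subset B_{\hat n,1}$ is the braid corresponding to the path $t\mapsto u(ct/nk)$, $t\in[0,1]$, and $bk\equiv-c\bmod n$; (c) if $G=C'(n,2)$: $\Pi_u=\{p\in P_n: p\,\mathfrak{b}=\mathfrak{b}\,\bar p\}$, where $\mathfrak{b}\in B_n$ is the braid corresponding to the path $t\mapsto u(t/2n)$, $t\in[0,1]$.
   Context: Loops and groups. Identify the plane with $\mathbb{C}$; $X^{(n)}=\{(z_1,\dots,z_n)\in\mathbb{C}^n:\sum_jz_j=0,\ z_i\ne z_j\ \forall i\ne j\}$; $\mathbb{T}=\mathbb{R}/\mathbb{Z}$. $\Gamma=\mathsf{O}(2)\times S_n$ acts on $X^{(n)}$ by $(A,\sigma)\cdot(z_1,\dots,z_n)=(Az_{\sigma^{-1}(1)},\dots,Az_{\sigma^{-1}(n)})$, and $\Gamma\times\mathsf{S}^1$ ($\mathsf{S}^1=\mathbb{R}/\mathbb{Z}$) acts on the space $\Lambda X^{(n)}$ of continuous loops $\mathbb{T}\to X^{(n)}$ (compact-open topology) by $((A,\sigma,\theta)\cdot u)(t)=(A,\sigma)\cdot u(t-\theta)$. $\mathrm{Fix}(G,\Lambda X^{(n)})$ is the space of loops fixed by $G$. $R_\theta$ is rotation by $\theta$, $\kappa$ complex conjugation, $I$ and $e$ the identities of $\mathsf{O}(2)$ and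 $S_n$, $\sigma_1=(1\;2\cdots n)$, $\mathfrak{c}=(I,\sigma_1,-\frac1n)$, and for $n$ odd $\sigma_2=\sigma_1^{(n+1)/2}$. $C(n,k/\ell)$ is generated by $\mathfrak{c}$ and $(R_{2\pi\ell/k},e,\frac1k)$; $C'(n,2)$ ($n$ odd) is generated by $(\kappa,\sigma_2,-\frac1{2n})$. A space is aspherical if its universal cover is contractible. Braids. Take as base point $x\in X^{(n)}$ real points $z_1<\dots<z_n$. $B_n$ is the set of homotopy classes (rel endpoints) of paths in $X^{(n)}$ from $x$ to $\sigma\cdot x$, $\sigma\in S_n$, with $\pi(\mathfrak{b})=\sigma$ and product $\mathfrak{b}\mathfrak{b}'=\mathfrak{b}*(\pi(\mathfrak{b})\cdot\mathfrak{b}')$; $P_n=\ker(\pi:B_n\to S_n)$. The standard generator $\mathfrak{b}_i$ is the clockwise interchange of points $i$ and $i+1$; $\delta=\mathfrak{b}_1\mathfrak{b}_2\cdots\mathfrak{b}_{n-1}$, so $\pi(\delta)=\sigma_1$. $CB_n=\pi^{-1}(\langle\sigma_1\rangle)$ is the subgroup generated by $P_n$ and $\delta$. The involution $\mathfrak{b}\mapsto\bar{\mathfrak{b}}$ of $B_n$ is the automorphism with $\mathfrak{b}_i\mapsto\mathfrak{b}_i^{-1}$ (every overcrossing is changed into an undercrossing and vice versa; it is induced by $\kappa$). For $c\mid n$, $\hat n=n/c$: label the strings of $B_{\hat n+1}$ by $0,1,\dots,\hat n$, with generators $\mathfrak{b}_0,\dots,\mathfrak{b}_{\hat n-1}$ ($\mathfrak{b}_i$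 the clockwise interchange of $i,i+1$). $B_{\hat n,1}=\{\mathfrak{b}\in B_{\hat n+1}:\pi(\mathfrak{b})(0)=0\}$. $P_{\hat n,1(c)}$ is the set of $p\in P_{\hat n+1}$ such that for each $j=1,\dots,\hat n$ the number of times string $j$ winds around string $0$ is $\equiv0\bmod c$. The element $\hat\delta=\mathfrak{b}_0^{2}\mathfrak{b}_1\mathfrak{b}_2\cdots\mathfrak{b}_{\hat n-1}$ lies in $B_{\hat n,1}$ and has $\pi(\hat\delta)=(1\;2\cdots\hat n)$. $B_{\hat n,1}$ is identified with the group of homotopy classes of paths from $\hat x$ to $\sigma\cdot\hat x$ ($\sigma\in S_{\hat n}$) in $X^{(\hat n)}_*$, the space of $\hat n$ distinct points of $\mathbb{C}\setminus\{0\}$ (string $0$ being constant at the origin), with base point $\hat x$: $0<w_1<\dots<w_{\hat n}$. Corresponding braids. For $\theta\in\mathbb{R}$ and a configuration $q$ let $\theta_q$ be the path $t\mapsto R_{2\pi t\theta}q$; a bar over a path denotes the reversed path. (a) Let $a=(1+bk)/n$, $g=(R_{2\pi a\ell/k},\sigma_1^b)$, $\theta=a\ell/k$, $\gamma(t)=u(t/nk)$, so $\gamma(1)=g\cdot\gamma(0)$. Choose a path $\eta$ in $X^{(n)}$ from $x$ to $u(0)$. The corresponding braid is the class of $\eta*\gamma*(g\cdot\bar\eta)*(-\theta)_{g\cdot x}$, a path from $x$ to $\sigma_1^b\cdot x$ (well defined up to $P_n$-conjugacy). (b) Let $a=(c+bk)/n$, $g=(R_{2\pi a\ell/k},\sigma_1^b)$,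 $\gamma(t)=u(ct/nk)$, so $\gamma(1)=g\cdot\gamma(0)$ and $\gamma$ lies in $Y=\{z\in X^{(n)}:z_{j+\hat n}=e^{2\pi i\ell/c}z_j\ \forall j\}$ (indices mod $n$). Let $\Psi:Y\to X_*^{(\hat n)}$, $\Psi(z)=(z_1^c,\dots,z_{\hat n}^c)$, and let $y\in Y$ have $y_j>0$ for $1\le j\le\hat n$ and $\Psi(y)=\hat x$. Choose a path $\eta$ in $Y$ from $y$ to $u(0)$. The corresponding braid is the class of $\Psi(\eta*\gamma*(g\cdot\bar\eta))*(-\hat\theta)_{\Psi(g\cdot y)}$ with $\hat\theta=ac\ell/k$, a path in $X_*^{(\hat n)}$ from $\hat x$ to $\hat\sigma_1^b\cdot\hat x$, $\hat\sigma_1=(1\;2\cdots\hat n)$ (well defined up to $P_{\hat n,1(c)}$-conjugacy). (c) Let $g=(\kappa,\sigma_2^{-1})$ and $\gamma(t)=u(t/2n)$, so $\gamma(1)=g\cdot\gamma(0)$. With $\eta$ a path in $X^{(n)}$ from $x$ to $u(0)$, the corresponding braid is the class of $\eta*\gamma*(g\cdot\bar\eta)$, a path from $x$ to $g\cdot x=\sigma_2^{-1}\cdot x$ (well defined up to twisted conjugacy).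
   Formalization: In (2)(b) the claim that the corresponding braid lies in the coset of δ̂^b fails if ℓ≢1 mod c (e.g. n=k=3, ℓ=2, b=1) and is dropped; for ℓ≢1 mod c, (1)(b) is just a bijection of sets, while for ℓ≡1 it sends each component to the class of its corresponding braid. *)

(* Defs.v *)
From HB Require Import structures.
From mathcomp Require Import all_boot all_order all_fingroup all_algebra.
From mathcomp Require Import generic_quotient ring_quotient complex ring lra.
From mathcomp Require Import all_classical all_reals all_analysis.

Set Implicit Arguments.
Unset Strict Implicit.
Unset Printing Implicit Defensive.

Import Order.TTheory GRing.Theory Num.Theory numFieldNormedType.Exports.

Local Open Scope classical_set_scope.
Local Open Scope ring_scope.
Local Open Scope quotient_scope.

(** * Groups *)

Definition expgz (G : groupType) (x : G) (m : int) : G :=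
  match m with Posz k => (x ^+ k)%g | Negz k => (x ^- k.+1)%g end.

Definition subgroup (G : groupType) (H : set G) :=
  [/\ H 1%g, forall x y, H x -> H y -> H (x * y)%g & forall x, H x -> H (x^-1)%g].

Definition generated (G : groupType) (S : set G) : set G :=
  \bigcap_(H in [set H | subgroup H /\ S `<=` H]) H.

Definition left_coset (G : groupType) (x : G) (P : set G) : set G :=
  [set (x * p)%g | p in P].

Definition conj_class (G : groupType) (P : set G) (x : G) : set G :=
  [set (p * x * p^-1)%g | p in P].

Definition group_iso_onto (G H : groupType) (K : set H) :=
  exists phi : G -> H,
    {morph phi : x y / (x * y)%g} /\ set_bij setT K phi.

Lemma unit_mulA : associative (fun _ _ : unit => tt). Proof. by []. Qed.
Lemma unit_mul1 : left_id tt (fun _ _ : unit => tt). Proof. by case. Qed.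
Lemma unit_1mul : right_id tt (fun _ _ : unit => tt). Proof. by case. Qed.
Lemma unit_mulV : left_inverse tt (fun _ => tt) (fun _ _ : unit => tt).
Proof. by []. Qed.
Lemma unit_Vmul : right_inverse tt (fun _ => tt) (fun _ _ : unit => tt).
Proof. by []. Qed.

HB.instance Definition _ :=
  isGroup.Build unit unit_mulA unit_mul1 unit_1mul unit_mulV unit_Vmul.

(* The symmetric group with product (s * t)(i) = s (t i); the library's group
   law on ['S_n] is the opposite one. *)
Definition Sym (n : nat) : Type := 'S_n.

Section Sym.
Variable n : nat.
Implicit Types s t : 'S_n.

HB.instance Definition _ := Choice.copy (Sym n) 'S_n.

Lemma sym_mulA : associative (fun s t => (t * s)%g).
Proof. by move=> s t r; rewrite mulgA. Qed.

HB.instance Definition _ := isGroup.Build (Sym n)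
  sym_mulA (@mulg1 _) (@mul1g _) (@mulgV _) (@mulVg _).

End Sym.

(* The cycle (1 2 ... n). *)
Definition sigma1 (n : nat) : Sym n := perm (@ordS_inj n).

Definition sigma2 (n : nat) : Sym n := (sigma1 n ^+ (n.+1)./2)%g.

(** * Paths and homotopies *)

(* A path is represented by a continuous function on the real line, of which
   only the restriction to [0, 1] matters; every continuous function on [0, 1]
   extends by constants. *)
Section Paths.
Context {R : realType} {T : topologicalType}.
Implicit Types (A : set T) (f g : R -> T) (x y : T).

Definition unitI (t : R) := 0 <= t <= 1.

Definition is_path A x y f :=
  [/\ continuous f, forall t, unitI t -> A (f t), f 0 = x & f 1 = y].

Definition path_concat f g (t : R) : T :=
  if t <= 2^-1 then f (2 * t) else g (2 * t - 1).

Definition path_rev f (t : R) : T := f (1 - t).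

(* Homotopy in A relative to the endpoints. *)
Definition path_homotopic A f g :=
  exists H : R * R -> T, continuous H /\
    forall t s, unitI t -> unitI s ->
      [/\ A (H (t, s)), H (t, 0) = f t, H (t, 1) = g t,
          H (0, s) = f 0 & H (1, s) = f 1].

Definition path_connected A :=
  A !=set0 /\ forall x y, A x -> A y -> exists f, is_path A x y f.

Definition simply_connected A :=
  path_connected A /\
  forall x f, is_path A x x f -> path_homotopic A f (cst x).

End Paths.

Section PathLemmas.
Context {R : realType} {T : topologicalType}.
Implicit Types (A : set T) (f g : R -> T) (x y : T).

Let I0 : unitI (0 : R). Proof. by rewrite /unitI lexx ler01. Qed.
Let I1 : unitI (1 : R). Proof. by rewrite /unitI lexx ler01. Qed.

Lemma glue_continuous (S U : topologicalType) (h : S -> R) (c : R)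
    (f g : S -> U) :
  continuous h -> continuous f -> continuous g ->
  (forall p, h p = c -> f p = g p) ->
  continuous (fun p => if h p <= c then f p else g p).
Proof.
move=> ch cf cg fg p V; have [hp|hp|hp] := ltgtP (h p) c => /= pV;
  suff: nbhs p [set q | V (if h q <= c then f q else g q)] by [].
- have fV : nbhs p (f @^-1` V) := cf p _ pV.
  have hV : nbhs p [set q | h q < c].
    exact: ch p _ (open_nbhs_nbhs (conj (@open_lt R c) hp)).
  by move: hV fV; apply: filterS2 => q /= hq; rewrite (ltW hq).
- have gV : nbhs p (g @^-1` V) := cg p _ pV.
  have hV : nbhs p [set q | h q > c].
    exact: ch p _ (open_nbhs_nbhs (conj (@open_gt R c) hp)).
  by move: hV gV; apply: filterS2 => q /= hq; rewrite leNgt hq.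
- have fV : nbhs p (f @^-1` V) := cf p _ pV.
  have gV : nbhs p (g @^-1` V) by apply: cg; rewrite /= -fg.
  by move: fV gV; apply: filterS2 => q /= fq gq; case: ifP.
Qed.

Lemma continuous_pairR (S U V : topologicalType) (a : S -> U) (b : S -> V) :
  continuous a -> continuous b -> continuous (fun p => (a p, b p)).
Proof. by move=> ca cb p; exact: (cvg_pair (ca p) (cb p)). Qed.

Definition clamp (t : R) : R := Num.max 0 (Num.min t 1).

Lemma continuous_maxR (f g : R -> R) : continuous f -> continuous g ->
  continuous (fun t => Num.max (f t) (g t)).
Proof. by move=> cf cg t; exact: (@continuous_max R R f g t (cf t) (cg t)). Qed.

Lemma continuous_minR (f g : R -> R) : continuous f -> continuous g ->
  continuous (fun t => Num.min (f t) (g t)).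
Proof. by move=> cf cg t; exact: (@continuous_min R R f g t (cf t) (cg t)). Qed.

Lemma clamp_continuous : continuous clamp.
Proof.
apply: continuous_maxR; first exact: cst_continuous.
apply: continuous_minR; last exact: cst_continuous.
by move=> t; exact: cvg_id.
Qed.

Lemma clampI t : unitI (clamp t).
Proof. by rewrite /unitI /clamp /Num.max /Num.min; do ![case: ifP]; lra. Qed.

Lemma clamp_id t : unitI t -> clamp t = t.
Proof. by rewrite /unitI /clamp /Num.max /Num.min; do ![case: ifP]; lra. Qed.

Lemma path_concat_continuous f g : continuous f -> continuous g -> f 1 = g 0 ->
  continuous (path_concat f g).
Proof.
move=> cf cg fg; apply: (@glue_continuous _ _ id).
- by move=> t; exact: cvg_id.
- by move=> t; apply: continuous_comp; [exact: mulrl_continuous|exact: cf].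
- move=> t; apply: (@continuous_comp _ _ _ (fun t : R => 2 * t - 1)); last exact: cg.
  by apply: cvgB; [exact: mulrl_continuous|exact: cvg_cst].
- by move=> t ->; rewrite mulfV ?pnatr_eq0// subrr.
Qed.

Lemma path_concatP A x y z f g :
  is_path A x y f -> is_path A y z g -> is_path A x z (path_concat f g).
Proof.
move=> [cf Af f0 f1] [cg Ag g0 g1]; split.
- by apply: path_concat_continuous => //; rewrite f1.
- move=> t; rewrite /unitI /path_concat => t01; case: ifPn => th.
    by apply: Af; rewrite /unitI; lra.
  by apply: Ag; rewrite /unitI; lra.
- by rewrite /path_concat ifT ?mulr0 // invr_ge0 ler0n.
- rewrite /path_concat ifF; last by apply/negbTE; rewrite -ltNge; lra.
  by rewrite -g1; congr g; lra.
Qed.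

Lemma path_revP A x y f : is_path A x y f -> is_path A y x (path_rev f).
Proof.
move=> [cf Af f0 f1]; split.
- move=> t; apply: (@continuous_comp _ _ _ (fun t : R => 1 - t)); last exact: cf.
  by apply: cvgB; [exact: cvg_cst|exact: cvg_id].
- by move=> t; rewrite /unitI => t01; apply: Af; rewrite /unitI; lra.
- by rewrite /path_rev subr0.
- by rewrite /path_rev subrr.
Qed.

Lemma homotopic_reparam A x y f (phi psi : R -> R) :
  is_path A x y f -> continuous phi -> continuous psi ->
  (forall t, unitI t -> unitI (phi t)) -> (forall t, unitI t -> unitI (psi t)) ->
  phi 0 = psi 0 -> phi 1 = psi 1 ->
  path_homotopic A (f \o phi) (f \o psi).
Proof.
move=> [cf Af f0 f1] cphi cpsi Iphi Ipsi e0 e1.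
exists (fun p => f ((1 - p.2) * phi p.1 + p.2 * psi p.1)); split.
  move=> p; apply: (@continuous_comp _ _ _
    (fun p : R * R => (1 - p.2) * phi p.1 + p.2 * psi p.1)); last exact: cf.
  have c1 (k : R -> R) : continuous k -> (fun p : R * R => k p.1) @ p --> k p.1.
    move=> ck; apply: (@continuous_comp _ _ _ fst k); last exact: ck.
    exact: cvg_fst.
  apply: cvgD; apply: cvgM; try exact: c1; last exact: cvg_snd.
  by apply: cvgB; [exact: cvg_cst|exact: cvg_snd].
move=> t s t01 s01; split => /=.
- apply: Af; move: (Iphi _ t01) (Ipsi _ t01) s01; rewrite /unitI.
  by move=> /andP[a b] /andP[c d] /andP[e g]; apply/andP; split; nra.
- by rewrite subr0 mul1r mul0r addr0.
- by rewrite subrr mul1r mul0r add0r.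
- by rewrite e0 -mulrDl subrK mul1r.
- by rewrite e1 -mulrDl subrK mul1r.
Qed.

Lemma homotopic_eq A x y f g : is_path A x y f ->
  (forall t, unitI t -> f t = g t) -> path_homotopic A f g.
Proof.
move=> [cf Af f0 f1] fg; exists (f \o fst); split.
  by move=> p; apply: continuous_comp; [exact: cvg_fst|exact: cf].
by move=> t s t01 s01; split => //=; [exact: Af|exact: fg].
Qed.

Lemma homotopic_refl A x y f : is_path A x y f -> path_homotopic A f f.
Proof. by move=> pf; exact: homotopic_eq pf _. Qed.

Lemma homotopic_sym A f g : path_homotopic A f g -> path_homotopic A g f.
Proof.
move=> [H [cH HP]]; exists (fun p => H (p.1, 1 - p.2)); split.
  move=> p; apply: (@continuous_comp _ _ _ (fun p : R * R => (p.1, 1 - p.2)));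
    last exact: cH.
  apply: continuous_pairR p; first by move=> q; exact: cvg_fst.
  by move=> q; apply: cvgB; [exact: cvg_cst|exact: cvg_snd].
move=> t s t01 s01 /=.
have s01' : unitI (1 - s) by move: s01; rewrite /unitI; lra.
have [e1 _ _ e2 e3] := HP t (1 - s) t01 s01'.
have [_ a0 a1 a2 a3] := HP t 0 t01 I0; have [_ b0 b1 b2 b3] := HP t 1 t01 I1.
have [_ _ g0 _ _] := HP 0 0 I0 I0; have [_ _ g1 _ _] := HP 1 0 I1 I0.
have [_ _ _ h0 _] := HP 0 1 I0 I1; have [_ _ _ _ h1] := HP 1 1 I1 I1.
by split; rewrite ?subr0 ?subrr // ?e2 ?e3 -?g0 -?g1 ?h0 ?h1.
Qed.

Lemma homotopic_trans A f g h :
  path_homotopic A f g -> path_homotopic A g h -> path_homotopic A f h.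
Proof.
move=> [H [cH HP]] [K [cK KP]].
exists (fun p => if p.2 <= 2^-1 then H (clamp p.1, 2 * p.2)
                 else K (clamp p.1, 2 * p.2 - 1)); split.
  have cc (p : R * R) : (fun p : R * R => clamp p.1) @ p --> clamp p.1.
    apply: (@continuous_comp _ _ _ fst clamp); first exact: cvg_fst.
    exact: clamp_continuous.
  have c2 (p : R * R) : (fun p : R * R => 2 * p.2) @ p --> 2 * p.2.
    by apply: cvgM; [exact: cvg_cst|exact: cvg_snd].
  apply: (@glue_continuous _ _ snd).
  - by move=> p; exact: cvg_snd.
  - move=> p; apply: (@continuous_comp _ _ _
      (fun p : R * R => (clamp p.1, 2 * p.2))); last exact: cH.
    exact: continuous_pairR.
  - move=> p; apply: (@continuous_comp _ _ _
      (fun p : R * R => (clamp p.1, 2 * p.2 - 1))); last exact: cK.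
    apply: continuous_pairR p => //.
    by move=> q; apply: cvgB; [exact: c2|exact: cvg_cst].
  - move=> p ->; rewrite mulfV ?pnatr_eq0// subrr.
    have [_ _ -> _ _] := HP _ 1 (clampI p.1) I1.
    by have [_ -> _ _ _] := KP _ 0 (clampI p.1) I0.
move=> t s t01 s01 /=; rewrite !clamp_id // ?mulr0.
have [_ _ g0 h0 _] := HP 0 1 I0 I1; have [_ _ g1 _ h1] := HP 1 1 I1 I1.
have hr : (0 : R) <= 2^-1 by lra.
have hl : ((1 : R) <= 2^-1) = false by apply/negbTE; rewrite -ltNge; lra.
rewrite hr hl; have -> : (2 : R) * 1 - 1 = 1 by lra.
have [_ a0 _ _ _] := HP t 0 t01 I0; have [_ _ b1 _ _] := KP t 1 t01 I1.
case: ifPn => sh.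
  have s2 : unitI (2 * s) by move: s01; rewrite /unitI; lra.
  by have [] := HP t _ t01 s2.
have s2 : unitI (2 * s - 1) by move: s01; rewrite /unitI; lra.
have [k1 _ _ k2 k3] := KP t _ t01 s2.
by split => //; rewrite ?k2 ?k3 -?g0 -?g1 ?h0 ?h1.
Qed.

Lemma homotopic_comp (U : topologicalType) (k : T -> U) A (B : set U) f g :
  continuous k -> (forall z, A z -> B (k z)) ->
  path_homotopic A f g -> path_homotopic B (k \o f) (k \o g).
Proof.
move=> ck AB [H [cH HP]]; exists (k \o H); split.
  by move=> p; apply: continuous_comp; [exact: cH|exact: ck].
move=> t s t01 s01 /=; have [a b c d e] := HP t s t01 s01.
by rewrite b c d e; split => //; exact: AB.
Qed.

Lemma homotopic_concat A f f' g g' : f 1 = g 0 ->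
  path_homotopic A f f' -> path_homotopic A g g' ->
  path_homotopic A (path_concat f g) (path_concat f' g').
Proof.
move=> fg [H [cH HP]] [K [cK KP]].
exists (fun p => if p.1 <= 2^-1 then H (2 * p.1, clamp p.2)
                 else K (2 * p.1 - 1, clamp p.2)); split.
  have cc (p : R * R) : (fun p : R * R => clamp p.2) @ p --> clamp p.2.
    apply: (@continuous_comp _ _ _ snd clamp); first exact: cvg_snd.
    exact: clamp_continuous.
  have c2 (p : R * R) : (fun p : R * R => 2 * p.1) @ p --> 2 * p.1.
    by apply: cvgM; [exact: cvg_cst|exact: cvg_fst].
  apply: (@glue_continuous _ _ fst).
  - by move=> p; exact: cvg_fst.
  - move=> p; apply: (@continuous_comp _ _ _
      (fun p : R * R => (2 * p.1, clamp p.2))); last exact: cH.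
    exact: continuous_pairR.
  - move=> p; apply: (@continuous_comp _ _ _
      (fun p : R * R => (2 * p.1 - 1, clamp p.2))); last exact: cK.
    apply: continuous_pairR p => //.
    by move=> q; apply: cvgB; [exact: c2|exact: cvg_cst].
  - move=> p ->; rewrite mulfV ?pnatr_eq0// subrr.
    have [_ _ _ _ ->] := HP _ _ I1 (clampI p.2).
    by have [_ _ _ -> _] := KP _ _ I0 (clampI p.2).
move=> t s t01 s01 /=; rewrite /path_concat !clamp_id // ?mulr0.
have hr : (0 : R) <= 2^-1 by lra.
have hl : ((1 : R) <= 2^-1) = false by apply/negbTE; rewrite -ltNge; lra.
rewrite hr hl; have -> : (2 : R) * 1 - 1 = 1 by lra.
have [_ _ _ -> _] := HP 0 s I0 s01; have [_ _ _ _ ->] := KP 1 s I1 s01.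
case: ifPn => th.
  have t2 : unitI (2 * t) by move: t01; rewrite /unitI; lra.
  by have [a -> -> _ _] := HP _ _ t2 s01; split.
have t2 : unitI (2 * t - 1) by move: t01; rewrite /unitI; lra.
by have [a -> -> _ _] := KP _ _ t2 s01; split.
Qed.

Lemma homotopic_assoc A x y z w f g h :
  is_path A x y f -> is_path A y z g -> is_path A z w h ->
  path_homotopic A (path_concat (path_concat f g) h)
                   (path_concat f (path_concat g h)).
Proof.
move=> pf pg ph.
have pl := path_concatP (path_concatP pf pg) ph.
have pr := path_concatP pf (path_concatP pg ph).
pose phi (t : R) := Num.min (2 * t) (Num.min (t + 4^-1) (2^-1 * t + 2^-1)).
have cphi : continuous phi.
  apply: continuous_minR; first exact: mulrl_continuous.
  apply: continuous_minR => t; apply: cvgD; try exact: cvg_cst.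
    exact: cvg_id.
  exact: mulrl_continuous.
have Iphi t : unitI t -> unitI (phi t).
  by rewrite /unitI /phi /Num.min; do ![case: ifPn]; lra.
apply: (@homotopic_trans _ _ (path_concat f (path_concat g h) \o phi)).
  apply: homotopic_eq pl _ => t; rewrite /unitI => t01 /=.
  have [_ _ f0 f1] := pf; have [_ _ g0 g1] := pg; have [_ _ h0 h1] := ph.
  have [t4|t4] := leP t 4^-1.
    have -> : phi t = 2 * t by rewrite /phi /Num.min; do ![case: ifPn]; lra.
    by rewrite /path_concat !ifT //; lra.
  have [t2|t2] := leP t 2^-1.
    have -> : phi t = t + 4^-1.
      by rewrite /phi /Num.min; do ![case: ifPn]; lra.
    rewrite /path_concat ifT // ifF; last by apply/negbTE; rewrite -ltNge; lra.
    rewrite ifF; last by apply/negbTE; rewrite -ltNge; lra.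
    by rewrite ifT; [congr g|]; lra.
  have -> : phi t = 2^-1 * t + 2^-1.
    by rewrite /phi /Num.min; do ![case: ifPn]; lra.
  rewrite /path_concat ifF; last by apply/negbTE; rewrite -ltNge; lra.
  rewrite ifF; last by apply/negbTE; rewrite -ltNge; lra.
  rewrite ifF; last by apply/negbTE; rewrite -ltNge; lra.
  by congr h; lra.
apply: (homotopic_reparam (psi := id) pr) => //.
- by move=> t; exact: cvg_id.
- by rewrite /phi /Num.min; do ![case: ifPn]; lra.
- by rewrite /phi /Num.min; do ![case: ifPn]; lra.
Qed.

Lemma homotopic_concat_1l A x y f : is_path A x y f ->
  path_homotopic A (path_concat (cst x) f) f.
Proof.
move=> pf; have [cf Af f0 f1] := pf.
have pc : is_path A x x (cst x : R -> T).
  by split => //= [|t _]; [exact: cst_continuous|rewrite -f0; exact: Af].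
have pl := path_concatP pc pf.
pose phi (t : R) := Num.max 0 (2 * t - 1).
apply: (@homotopic_trans _ _ (f \o phi)).
  apply: homotopic_eq pl _ => t; rewrite /unitI => t01 /=.
  rewrite /path_concat; case: ifPn => th.
    have -> : phi t = 0 by rewrite /phi /Num.max; case: ifPn; lra.
    by rewrite f0.
  by congr f; rewrite /phi /Num.max; case: ifPn; lra.
apply: (homotopic_reparam (psi := id) pf) => //.
- apply: continuous_maxR; first exact: cst_continuous.
  by move=> t; apply: cvgB; [exact: mulrl_continuous|exact: cvg_cst].
- by move=> t; exact: cvg_id.
- by move=> t; rewrite /unitI /phi /Num.max; case: ifPn; lra.
- by rewrite /phi /Num.max; case: ifPn; lra.
- by rewrite /phi /Num.max; case: ifPn; lra.
Qed.

Lemma homotopic_concat_1r A x y f : is_path A x y f ->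
  path_homotopic A (path_concat f (cst y)) f.
Proof.
move=> pf; have [cf Af f0 f1] := pf.
have pc : is_path A y y (cst y : R -> T).
  by split => //= [|t _]; [exact: cst_continuous|rewrite -f1; exact: Af].
have pl := path_concatP pf pc.
pose phi (t : R) := Num.min (2 * t) 1.
apply: (@homotopic_trans _ _ (f \o phi)).
  apply: homotopic_eq pl _ => t; rewrite /unitI => t01 /=.
  rewrite /path_concat; case: ifPn => th.
    by congr f; rewrite /phi /Num.min; case: ifPn; lra.
  have -> : phi t = 1 by rewrite /phi /Num.min; case: ifPn; lra.
  by rewrite f1.
apply: (homotopic_reparam (psi := id) pf) => //.
- apply: continuous_minR; first exact: mulrl_continuous.
  exact: cst_continuous.
- by move=> t; exact: cvg_id.
- by move=> t; rewrite /unitI /phi /Num.min; case: ifPn; lra.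
- by rewrite /phi /Num.min; case: ifPn; lra.
- by rewrite /phi /Num.min; case: ifPn; lra.
Qed.

Lemma homotopic_concat_rev A x y f : is_path A x y f ->
  path_homotopic A (path_concat f (path_rev f)) (cst x).
Proof.
move=> pf; have [cf Af f0 f1] := pf.
have pl := path_concatP pf (path_revP pf).
pose phi (t : R) := Num.min (2 * t) (2 - 2 * t).
apply: (@homotopic_trans _ _ (f \o phi)).
  apply: homotopic_eq pl _ => t; rewrite /unitI => t01 /=.
  rewrite /path_concat /path_rev; case: ifPn => th;
  by congr f; rewrite /phi /Num.min; case: ifPn; lra.
have -> : cst x = f \o cst 0 :> (R -> T) by apply/funext => t /=; rewrite f0.
apply: (homotopic_reparam pf) => //.
- apply: continuous_minR; first exact: mulrl_continuous.
  by move=> t; apply: cvgB; [exact: cvg_cst|exact: mulrl_continuous].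
- exact: cst_continuous.
- by move=> t; rewrite /unitI /phi /Num.min; case: ifPn; lra.
- by rewrite /phi /Num.min /=; case: ifPn; lra.
- by rewrite /phi /Num.min /=; case: ifPn; lra.
Qed.

End PathLemmas.

(** * Groups of homotopy classes of paths into an orbit *)

(* A left action of a group on a subset of a space, and a point of the
   subset. *)
Record based_gspace := BasedGSpace {
  bg_space : topologicalType;
  bg_set : set bg_space;
  bg_group : groupType;
  bg_act : bg_group -> bg_space -> bg_space;
  bg_base : bg_space;
  bg_act1 : forall z, bg_act 1%g z = z;
  bg_actM : forall g h z, bg_act (g * h)%g z = bg_act g (bg_act h z);
  bg_act_continuous : forall g, continuous (bg_act g);
  bg_act_set : forall g z, bg_set z -> bg_set (bg_act g z);
  bg_baseP : bg_set bg_base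
}.

Section OrbitGroup.
Variables (R : realType) (S : based_gspace).

Local Notation A := (@bg_set S).
Local Notation G := (bg_group S).
Local Notation act := (@bg_act S).
Local Notation x0 := (bg_base S).

Definition is_orbit_path (g : G) (f : R -> bg_space S) :=
  is_path A x0 (act g x0) f.

Definition orbit_path :=
  {gf : G * (R -> bg_space S) | `[< is_orbit_path gf.1 gf.2 >]}.

HB.instance Definition _ := Choice.on orbit_path.

Definition orbit_path_eq (p q : orbit_path) : bool :=
  `[< (val p).1 = (val q).1 /\ path_homotopic A (val p).2 (val q).2 >].

Lemma orbit_path_equiv : equiv_class_of orbit_path_eq.
Proof.
split=> [p|p q|q p r].
- apply/asboolP; split => //=.
  by have /asboolP := valP p; exact: homotopic_refl.
- by apply: asbool_equiv_eq; split=> -[e h]; split => //; exact: homotopic_sym.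
- move=> /asboolP[e1 h1] /asboolP[e2 h2]; apply/asboolP.
  by split; [rewrite e1|exact: homotopic_trans h1 h2].
Qed.

Canonical orbit_path_equiv_rel := EquivRelPack orbit_path_equiv.
Canonical orbit_path_enc := defaultEncModRel orbit_path_eq.

Definition orbit_group := {eq_quot orbit_path_eq}.

HB.instance Definition _ := EqQuotient.on orbit_group.
HB.instance Definition _ := Choice.on orbit_group.

Definition mk_orbit_path g f (pf : is_orbit_path g f) : orbit_path :=
  exist _ (g, f) (asboolT pf).

Lemma orbit_pathP (p : orbit_path) : is_orbit_path (val p).1 (val p).2.
Proof. by case: p => gf /= /asboolP. Qed.

Lemma orbit_one_subproof : is_orbit_path 1%g (cst x0).
Proof.
rewrite /is_orbit_path bg_act1; split => //=; first exact: cst_continuous.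
by move=> t _; exact: bg_baseP.
Qed.

Lemma is_path_act g x y f : is_path A x y f ->
  is_path A (act g x) (act g y) (act g \o f : R -> _).
Proof.
move=> [cf Af f0 f1]; split => /=; rewrite ?f0 ?f1 //.
- move=> t; apply: continuous_comp; first exact: cf.
  exact: bg_act_continuous.
- by move=> t t01; apply: bg_act_set; exact: Af.
Qed.

Lemma orbit_mul_subproof (p q : orbit_path) :
  is_orbit_path ((val p).1 * (val q).1)%g
    (path_concat (val p).2 (act (val p).1 \o (val q).2)).
Proof.
have := is_path_act (val p).1 (orbit_pathP q); rewrite -bg_actM => h.
exact: path_concatP (orbit_pathP p) h.
Qed.

Lemma orbit_inv_subproof (p : orbit_path) :
  is_orbit_path ((val p).1^-1)%g
    (act ((val p).1^-1)%g \o path_rev (val p).2).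
Proof.
have := is_path_act ((val p).1^-1)%g (path_revP (orbit_pathP p)).
by rewrite -bg_actM mulVg bg_act1.
Qed.

Definition orbit_path_mul (p q : orbit_path) :=
  mk_orbit_path (orbit_mul_subproof p q).
Definition orbit_path_inv (p : orbit_path) :=
  mk_orbit_path (orbit_inv_subproof p).

Definition orbit_one : orbit_group :=
  \pi_orbit_group (mk_orbit_path orbit_one_subproof).
Definition orbit_mul (a b : orbit_group) : orbit_group :=
  \pi_orbit_group (orbit_path_mul (repr a) (repr b)).
Definition orbit_inv (a : orbit_group) : orbit_group :=
  \pi_orbit_group (orbit_path_inv (repr a)).

Lemma orbit_piP (p q : orbit_path) : (val p).1 = (val q).1 ->
  path_homotopic A (val p).2 (val q).2 ->
  \pi_orbit_group p = \pi_orbit_group q.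
Proof. by move=> e h; apply/eqmodP/asboolP. Qed.

Lemma orbit_reprP (p : orbit_path) :
  (val (repr (\pi_orbit_group p))).1 = (val p).1 /\
  path_homotopic A (val (repr (\pi_orbit_group p))).2 (val p).2.
Proof.
have /eqmodP/asboolP : \pi_orbit_group (repr (\pi_orbit_group p)) =
  \pi_orbit_group p by rewrite reprK.
by [].
Qed.

Lemma homotopic_act g (f f' : R -> bg_space S) :
  path_homotopic A f f' -> path_homotopic A (act g \o f) (act g \o f').
Proof.
apply: homotopic_comp; first exact: bg_act_continuous.
exact: bg_act_set.
Qed.

Lemma orbit_pi_mul (p q : orbit_path) :
  orbit_mul (\pi_orbit_group p) (\pi_orbit_group q) =
  \pi_orbit_group (orbit_path_mul p q).
Proof.
have [e1 h1] := orbit_reprP p; have [e2 h2] := orbit_reprP q.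
apply: orbit_piP => /=; first by rewrite e1 e2.
rewrite e1; apply: homotopic_concat => //; last exact: homotopic_act.
rewrite /=; have [_ _ _ ->] := orbit_pathP (repr (\pi_orbit_group p)).
by have [_ _ -> _] := orbit_pathP (repr (\pi_orbit_group q)); rewrite e1.
Qed.

Lemma orbit_mulA : associative orbit_mul.
Proof.
move=> a b c; rewrite -[a]reprK -[b]reprK -[c]reprK.
move: (repr a) (repr b) (repr c) => p q r.
rewrite (orbit_pi_mul p q) (orbit_pi_mul q r) !orbit_pi_mul.
apply: orbit_piP => /=; first by rewrite mulgA.
have hq := is_path_act (val p).1 (orbit_pathP q).
have hr := is_path_act ((val p).1 * (val q).1)%g (orbit_pathP r).
rewrite -bg_actM in hq.
have := homotopic_assoc (orbit_pathP p) hq hr.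
move=> /homotopic_sym; congr path_homotopic.
apply/funext => t /=; rewrite /path_concat; case: ifP => //= _.
by case: ifP => //= _; rewrite bg_actM.
Qed.

Lemma orbit_mul1 : left_id orbit_one orbit_mul.
Proof.
move=> a; rewrite -[a]reprK; move: (repr a) => p; rewrite orbit_pi_mul.
apply: orbit_piP => /=; first by rewrite mul1g.
have -> : act 1%g \o (val p).2 = (val p).2.
  by apply/funext => t /=; rewrite bg_act1.
exact: homotopic_concat_1l (orbit_pathP p).
Qed.

Lemma orbit_1mul : right_id orbit_one orbit_mul.
Proof.
move=> a; rewrite -[a]reprK; move: (repr a) => p; rewrite orbit_pi_mul.
apply: orbit_piP => /=; first by rewrite mulg1.
exact: homotopic_concat_1r (orbit_pathP p).
Qed.

Lemma orbit_pi_inv (p : orbit_path) :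
  orbit_inv (\pi_orbit_group p) = \pi_orbit_group (orbit_path_inv p).
Proof.
have [e1 [H [cH HP]]] := orbit_reprP p.
apply: orbit_piP => /=; rewrite e1 //.
apply: homotopic_act; exists (fun p => H (1 - p.1, p.2)); split.
  move=> q; apply: (@continuous_comp _ _ _ (fun q : R * R => (1 - q.1, q.2)));
    last exact: cH.
  apply: continuous_pairR q => q; last exact: cvg_snd.
  by apply: cvgB; [exact: cvg_cst|exact: cvg_fst].
move=> t s t01 s01 /=; rewrite /path_rev subr0 subrr.
have t01' : unitI (1 - t) by move: t01; rewrite /unitI; lra.
by have [h0 h1 h2 h3 h4] := HP (1 - t) s t01' s01; split.
Qed.

Lemma orbit_mulV : right_inverse orbit_one orbit_inv orbit_mul.
Proof.
move=> a; rewrite -[a]reprK; move: (repr a) => p; rewrite orbit_pi_inv orbit_pi_mul.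
apply: orbit_piP => /=; first by rewrite mulgV.
have := homotopic_concat_rev (orbit_pathP p); congr path_homotopic.
congr path_concat; apply/funext => t /=.
by rewrite -bg_actM mulgV bg_act1.
Qed.

Lemma orbit_Vmul : left_inverse orbit_one orbit_inv orbit_mul.
Proof.
move=> a; rewrite -[a]reprK; move: (repr a) => p; rewrite orbit_pi_inv orbit_pi_mul.
apply: orbit_piP => /=; first by rewrite mulVg.
have := homotopic_concat_rev
  (path_revP (is_path_act ((val p).1^-1)%g (orbit_pathP p))).
rewrite -bg_actM mulVg bg_act1; congr path_homotopic.
apply/funext => t; rewrite /path_concat /path_rev /=; case: ifP => //= _.
by rewrite opprB addrC subrK.
Qed.

HB.instance Definition _ := isGroup.Build orbit_group
  orbit_mulA orbit_mul1 orbit_1mul orbit_Vmul orbit_mulV.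

Definition orbit_elt (a : orbit_group) : G := (val (repr a)).1.

Definition orbit_rep (a : orbit_group) : R -> bg_space S := (val (repr a)).2.

(* The class of the path [f] from [x0] to [act g x0]; by convention the unit
   if [f] is not such a path. *)
Definition orbit_class (g : G) (f : R -> bg_space S) : orbit_group :=
  if pselect (is_orbit_path g f) is left pf then
    \pi_orbit_group (mk_orbit_path pf)
  else 1%g.

Lemma orbit_repP a : is_orbit_path (orbit_elt a) (orbit_rep a).
Proof. exact: orbit_pathP. Qed.

Lemma orbit_repK a : orbit_class (orbit_elt a) (orbit_rep a) = a.
Proof.
rewrite /orbit_class; case: pselect => [pf|/(_ (orbit_repP a))//].
rewrite -[RHS]reprK; apply: orbit_piP => //=.
exact: homotopic_refl (orbit_repP a).
Qed.

Lemma orbit_classP g f g' f' : is_orbit_path g f -> is_orbit_path g' f' ->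
  orbit_class g f = orbit_class g' f' <-> g = g' /\ path_homotopic A f f'.
Proof.
move=> pf pf'; rewrite /orbit_class.
case: pselect => // qf; case: pselect => // qf'; split.
  by move=> /eqmodP/asboolP.
by move=> [e h]; exact: orbit_piP.
Qed.

End OrbitGroup.

Section FundamentalGroup.
Variables (R : realType) (T : topologicalType) (A : set T) (x : T) (Ax : A x).

Definition pi1_gspace : based_gspace :=
  @BasedGSpace T A unit (fun _ => id) x (fun _ => erefl) (fun _ _ _ => erefl)
    (fun _ z => @cvg_id _ (nbhs z)) (fun _ _ => id) Ax.

Definition pi1 : groupType := orbit_group R pi1_gspace.

End FundamentalGroup.

Arguments pi1 R {T A x} Ax.

(** * Asphericity *)

Section Asphericity.
Variable R : realType.
Implicit Types E B : topologicalType.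

Definition covering_map E B (p : E -> B) :=
  [/\ continuous p, set_surj setT setT p & forall b, exists U : set B,
    [/\ open U, U b & exists F : set (set E),
      [/\ p @^-1` U = \bigcup_(V in F) V, trivIset F id &
        forall V, F V -> open V /\ exists s : B -> E,
          [/\ set_bij V U p, {within U, continuous s} &
            forall y, U y -> V (s y) /\ p (s y) = y]]]].

Definition universal_cover E B (p : E -> B) :=
  covering_map p /\ simply_connected (R := R) [set: E].

Definition contractible E := exists (e : E) (H : E * R -> E),
  continuous H /\ forall z, H (z, 0) = z /\ H (z, 1) = e.

Definition aspherical B :=
  exists (E : topologicalType) (p : E -> B),
    universal_cover p /\ contractible E.

End Asphericity.

(** * The circle R/Z *)

Section Circle.
Variable R : realType.

Definition integers : zmodClosed R :=
  GRing.ZmodClosed.clone R (@Num.int_num_subdef R) _.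

Definition circle : Type := quotient_topology (Quotient.quot integers).

HB.instance Definition _ := Topological.on circle.

Definition to_circle (t : R) : circle := \pi_(Quotient.quot integers) t.

(* R/Z as an additive group, and as the multiplicative group acting on loops. *)
HB.instance Definition _ := GRing.Zmodule.copy circle (Quotient.quot integers).

Definition rotations : Type := circle.

HB.instance Definition _ := Choice.on rotations.
HB.instance Definition _ := isGroup.Build rotations
  (@addrA circle) (@add0r circle) (@addr0 circle) (@addNr circle) (@addrN circle).

End Circle.

(** * Configurations of points in the plane *)

Notation plane R := (R[i]^o).

Section Configurations.
Variable R : realType.

Local Notation C := (plane R).

Definition O2 := {A : 'M[R]_2 | A *m A^T == 1%:M}.

Local Notation mkO2 := (@exist 'M[R]_2 (fun A => A *m A^T == 1%:M) _).

Lemma O2_one_subproof : (1%:M : 'M[R]_2) *m (1%:M)^T == 1%:M.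
Proof. by rewrite trmx1 mulmx1. Qed.

Lemma O2_mul_subproof (A B : O2) :
  (val A *m val B) *m (val A *m val B)^T == 1%:M.
Proof.
rewrite trmx_mul mulmxA -[val A *m _ *m _]mulmxA.
by rewrite (eqP (valP B)) mulmx1 (valP A).
Qed.

Lemma O2_inv_subproof (A : O2) : (val A)^T *m ((val A)^T)^T == 1%:M.
Proof. by rewrite trmxK; apply/eqP/mulmx1C/eqP; exact: (valP A). Qed.

Definition O2_one : O2 := mkO2 O2_one_subproof.
Definition O2_mul (A B : O2) : O2 := mkO2 (O2_mul_subproof A B).
Definition O2_inv (A : O2) : O2 := mkO2 (O2_inv_subproof A).

Lemma O2_mulA : associative O2_mul.
Proof. by move=> A B D; apply: val_inj => /=; rewrite mulmxA. Qed.
Lemma O2_mul1 : left_id O2_one O2_mul.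
Proof. by move=> A; apply: val_inj => /=; rewrite mul1mx. Qed.
Lemma O2_1mul : right_id O2_one O2_mul.
Proof. by move=> A; apply: val_inj => /=; rewrite mulmx1. Qed.
Lemma O2_mulV : right_inverse O2_one O2_inv O2_mul.
Proof. by move=> A; apply: val_inj => /=; exact/eqP/(valP A). Qed.
Lemma O2_Vmul : left_inverse O2_one O2_inv O2_mul.
Proof. by move=> A; apply: val_inj => /=; exact/mulmx1C/eqP/(valP A). Qed.

HB.instance Definition _ := Choice.on O2.
HB.instance Definition _ :=
  isGroup.Build O2 O2_mulA O2_mul1 O2_1mul O2_Vmul O2_mulV.

Definition rot_mx (theta : R) : 'M[R]_2 := \matrix_(i, j)
  if i == j then cos theta else if i == 0 then - sin theta else sin theta.

Definition conj_mx : 'M[R]_2 := \matrix_(i, j)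
  if i == j then (-1) ^+ i else 0.

Lemma rot_subproof theta : rot_mx theta *m (rot_mx theta)^T == 1%:M.
Proof.
apply/eqP/matrixP => i j; rewrite !mxE big_ord_recl big_ord1 !mxE.
have := cos2Dsin2 theta.
by case: i => -[|[|//]] ?; case: j => -[|[|//]] ? //=; rewrite ?mulr1n ?mulr0n;
  move=> e; rewrite -?[RHS]e; ring.
Qed.

Lemma conj_subproof : conj_mx *m conj_mx^T == 1%:M.
Proof.
apply/eqP/matrixP => i j; rewrite !mxE big_ord_recl big_ord1 !mxE.
by case: i => -[|[|//]] ?; case: j => -[|[|//]] ? //=; rewrite ?mulr1n ?mulr0n;
  ring.
Qed.

(* Rotation by [theta], and complex conjugation. *)
Definition rot (theta : R) : O2 := mkO2 (rot_subproof theta).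
Definition kappa : O2 := mkO2 conj_subproof.

Definition plane_act (A : O2) (z : C) : C :=
  Complex (val A 0 0 * complex.Re z + val A 0 1 * complex.Im z)
          (val A 1 0 * complex.Re z + val A 1 1 * complex.Im z).

Definition perm_act n (s : Sym n) (z : 'rV[C]_n) : 'rV[C]_n :=
  \row_j z 0 ((s : {perm _})^-1%g j).

Definition conf_act n (g : O2 * Sym n) (z : 'rV[C]_n) : 'rV[C]_n :=
  map_mx (plane_act g.1) (perm_act g.2 z).

(* The space X^(n). *)
Definition conf_space n : set 'rV[C]_n :=
  [set z | \sum_j z 0 j = 0 /\ injective (fun j => z 0 j)].

(* The space of configurations of m distinct points in C \ {0}. *)
Definition punctured_conf m : set 'rV[C]_m :=
  [set w | (forall j, w 0 j != 0) /\ injective (fun j => w 0 j)].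

End Configurations.
Arguments conf_space R n : clear implicits.
Arguments punctured_conf R m : clear implicits.

(** * Symmetric loops *)

Section Loops.
Variables (R : realType) (n : nat).

Local Notation C := (plane R).
Local Notation loop := {compact-open, circle R -> 'rV[C]_n}.

Definition sym_group : groupType := (O2 R * Sym n * rotations R)%type.

Definition loop_act (g : sym_group) (u : loop) : loop :=
  fun t => conf_act g.1 (u (t - (g.2 : circle R))).

(* The loop space of X^(n), with the topology induced from that of the space
   of all maps from the circle to C^n. *)
Definition loop_space : set loop :=
  [set u | continuous (u : circle R -> 'rV[C]_n) /\ forall t, conf_space R n (u t)].

Definition fixed_loops (H : set sym_group) : set loop :=
  [set u | loop_space u /\ forall g, H g -> loop_act g u = u].

Definition components (T : topologicalType) (A : set T) : set (set T) :=
  [set connected_component A u | u in A].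

Definition sym_elt (A : O2 R) (s : Sym n) (theta : R) : sym_group :=
  (A, s, to_circle theta).

(* C(n, k/l) *)
Definition C_group (k l : nat) : set sym_group :=
  generated [set sym_elt 1%g (sigma1 n) (- n%:R^-1);
                 sym_elt (rot (2 * pi * l%:R / k%:R)) 1%g k%:R^-1].

(* C'(n, 2) *)
Definition C'2_group : set sym_group :=
  generated [set sym_elt (kappa R) (sigma2 n) (- (2 * n%:R)^-1)].

(* The path [t |-> u (a t)]. *)
Definition loop_path (u : loop) (a : R) : R -> 'rV[C]_n :=
  fun t => u (to_circle (a * t)).

End Loops.
Arguments C_group R n k l : clear implicits.
Arguments C'2_group R n : clear implicits.

(** * Braids *)

Section Braids.
Variable R : realType.

Local Notation C := (plane R).

(* The base point: n equally spaced real points centred at 0. *)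
Definition base_conf n : 'rV[C]_n :=
  \row_j (j%:R - n.-1%:R / 2)%:C%C.

Lemma perm_act1 n z : perm_act (1%g : Sym n) z = z :> 'rV[C]_n.
Proof.
by apply/rowP => j; rewrite mxE (_ : (1%g : Sym n) = (1%g : 'S_n)) // invg1 perm1.
Qed.

Lemma perm_actM n (s t : Sym n) (z : 'rV[C]_n) :
  perm_act (s * t)%g z = perm_act s (perm_act t z).
Proof.
apply/rowP => j; rewrite !mxE; congr (z 0 _).
rewrite (_ : (s * t)%g = ((t : 'S_n) * (s : 'S_n))%g :> 'S_n) //.
by rewrite invMg permM.
Qed.

Lemma perm_act_continuous n (s : Sym n) :
  continuous (@perm_act R n s).
Proof.
move=> z V [P zP PV].
exists (fun i j => P i (((s : 'S_n)^-1)^-1%g j)).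
  by move=> i j; have := zP i ((s : 'S_n) j); rewrite mxE permK ord1 invgK.
move=> w wP; apply: PV => i j; rewrite mxE ord1.
by have := wP 0 ((s : 'S_n)^-1%g j); rewrite invgK permKV.
Qed.

Lemma perm_act_conf n (s : Sym n) (z : 'rV[C]_n) :
  conf_space R n z -> conf_space R n (perm_act s z).
Proof.
move=> [z0 zi]; split.
  rewrite -[RHS]z0 [RHS](reindex_inj (@perm_inj _ ((s : 'S_n)^-1%g))).
  by apply: eq_bigr => j _; rewrite mxE.
by move=> i j; rewrite !mxE => /zi /perm_inj.
Qed.

Lemma base_confP n : conf_space R n (base_conf n).
Proof.
split; last first.
  move=> i j; rewrite !mxE => -[] /addIr/eqP; rewrite eqr_nat => /eqP.
  exact: val_inj.
set S := \sum_j _; suff : S *+ 2 = 0 by move=> /eqP; rewrite mulrn_eq0 => /eqP.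
rewrite mulr2n {2}/S (reindex_inj rev_ord_inj) -big_split /= big1 // => j _.
rewrite !mxE -rmorphD /=; case: n j {S} => [[]//|n] j /=.
rewrite subSS natrB ?leq_ord// (_ : _ + _ = 0 :> R) //; lra.
Qed.

Definition braid_gspace n : based_gspace :=
  BasedGSpace (@perm_act1 n) (@perm_actM n) (@perm_act_continuous n)
    (@perm_act_conf n) (base_confP n).

(* B_n, with its map to S_n. *)
Definition braid n : groupType := orbit_group R (braid_gspace n).

Definition braid_perm n (b : braid n) : Sym n := orbit_elt b.

Definition braid_path n (b : braid n) : R -> 'rV[C]_n := orbit_rep b.

Definition braid_class n (s : Sym n) (f : R -> 'rV[C]_n) : braid n :=
  @orbit_class R (braid_gspace n) s f.

Definition pure_braids n : set (braid n) := [set b | braid_perm b = 1%g].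

(* The half turn about their midpoint, clockwise, of the points of indices [i]
   and [i + 1] (only used for [i + 1 < n]). *)
Definition half_turn n (i : 'I_n) (t : R) : 'rV[C]_n :=
  let x := base_conf n in let m := (x 0 i + x 0 (ordS i)) / 2 in
  \row_j if j \in [:: i; ordS i] then
           m + plane_act (rot (- pi * t)) (x 0 j - m)
         else x 0 j.

Definition braid_gen n (i : 'I_n) : braid n :=
  braid_class (tperm i (ordS i) : Sym n) (half_turn i).

Definition delta n : braid n :=
  (\prod_(i < n | (i.+1 < n)%N) braid_gen i)%g.

(* The points of B_{m+1} are labelled 0, ..., m. *)
Definition delta_hat m : braid m.+1 :=
  (braid_gen ord0 ^+ 2 * \prod_(i < m.+1 | (0 < i)%N && (i < m)%N) braid_gen i)%g.

(* The involution changing every crossing: it is induced by complex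
   conjugation, which fixes the base point and maps each generator to its
   inverse. *)
Definition braid_bar n (b : braid n) : braid n :=
  braid_class (braid_perm b)
    (fun t => map_mx (plane_act (kappa R)) (braid_path b t)).

Definition twisted_class n (P : set (braid n)) (b : braid n) : set (braid n) :=
  [set (p * b * (braid_bar p)^-1)%g | p in P].

(* The loop [f] winds [w] times around the origin. *)
Definition winds (f : R -> C) (w : int) :=
  exists theta : R -> R, [/\ continuous theta,
    forall t, unitI t ->
      f t = plane_act (rot (2 * pi * theta t)) `|f t| &
    theta 1 - theta 0 = w%:~R].

(* B_{m,1} *)
Definition braids_fix0 m : set (braid m.+1) :=
  [set b | (braid_perm b : 'S_m.+1) ord0 = ord0].

(* P_{m,1(c)} *)
Definition pure_braids_mod m (c : nat) : set (braid m.+1) :=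
  [set p | pure_braids p /\ forall j : 'I_m, exists w : int,
    winds (fun t => braid_path p t 0 (lift ord0 j) - braid_path p t 0 ord0) w
    /\ (c %| w)%Z].

(* Placing the point 0 at the origin identifies X^(m+1) with the space of m
   distinct points of C \ {0}, and B_{m,1} with the classes of paths in the
   latter from the image of the base point to its permutations. *)
Definition centre_point0 m (z : 'rV[C]_m.+1) : 'rV[C]_m :=
  \row_j (z 0 (lift ord0 j) - z 0 ord0).

End Braids.
Arguments pure_braids R n : clear implicits.
Arguments braids_fix0 R m : clear implicits.
Arguments pure_braids_mod R m c : clear implicits.

(** * The braids corresponding to a symmetric loop *)

Section CorrespondingBraids.
Variable R : realType.

Local Notation C := (plane R).

Definition rotation_path m (theta : R) (q : 'rV[C]_m) : R -> 'rV[C]_m :=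
  fun t => conf_act (rot (2 * pi * t * theta), 1%g) q.

Definition braid_of_loop_coprime n (k l : nat) (b : int)
    (u : {compact-open, circle R -> 'rV[C]_n}) (beta : braid R n) :=
  let a : R := (1 + b%:~R * k%:R) / n%:R in
  let s := expgz (sigma1 n) b in
  let g := (rot (2 * pi * a * l%:R / k%:R), s) in
  let theta := a * l%:R / k%:R in
  let gamma := loop_path u (n%:R * k%:R)^-1 in
  exists eta, is_path (conf_space R n) (base_conf R n) (u (to_circle 0)) eta /\
    beta = braid_class s
      (path_concat
         (path_concat (path_concat eta gamma) (conf_act g \o path_rev eta))
         (rotation_path (- theta) (conf_act g (base_conf R n)))).

(* The space Y. *)
Definition sym_conf_space n (l c : nat) : set 'rV[C]_n :=
  [set z | conf_space R n z /\ forall j,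
     z 0 (iter (n %/ c) (@ordS n) j) =
     plane_act (rot (2 * pi * l%:R / c%:R)) (z 0 j)].

(* The map Psi. *)
Definition power_map n (c : nat) (z : 'rV[C]_n) : 'rV[C]_(n %/ c) :=
  \row_j z 0 (widen_ord (leq_div n c) j) ^+ c.

Definition braid_of_loop_gcd n (k l : nat) (b : int)
    (u : {compact-open, circle R -> 'rV[C]_n})
    (beta : braid R (n %/ gcdn n k).+1) :=
  let c := gcdn n k in
  let a : R := (c%:R + b%:~R * k%:R) / n%:R in
  let g := (rot (2 * pi * a * l%:R / k%:R), expgz (sigma1 n) b) in
  let theta := a * c%:R * l%:R / k%:R in
  let gamma := loop_path u (c%:R / (n%:R * k%:R)) in
  let Y := @sym_conf_space n l c in
  exists y eta,
    [/\ Y y, forall j : 'I_(n %/ c), 0 < y 0 (widen_ord (leq_div n c) j)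
      & power_map c y = centre_point0 (base_conf R (n %/ c).+1)] /\
    [/\ is_path Y y (u (to_circle 0)) eta, braids_fix0 R _ beta &
      path_homotopic (punctured_conf R (n %/ c))
        (@centre_point0 R _ \o braid_path beta)
        (path_concat
           (@power_map n c \o
             path_concat (path_concat eta gamma) (conf_act g \o path_rev eta))
           (rotation_path (- theta) (power_map c (conf_act g y))))].

Definition braid_of_loop_conj n
    (u : {compact-open, circle R -> 'rV[C]_n}) (beta : braid R n) :=
  let s := ((sigma2 n)^-1)%g in
  let g := (kappa R, s) in
  let gamma := loop_path u (2 * n%:R)^-1 in
  exists eta, is_path (conf_space R n) (base_conf R n) (u (to_circle 0)) eta /\
    beta = braid_class s
      (path_concat (path_concat eta gamma) (conf_act g \o path_rev eta)).

End CorrespondingBraids.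
Arguments braid_of_loop_coprime {R n} k l b u beta.
Arguments braid_of_loop_gcd {R n} k l b u beta.
Arguments braid_of_loop_conj {R n} u beta.

(* Main.v *)
(* Configuration spaces are iterated bundles of punctured planes. Over a
   contractible base finitely many disjoint sections of the plane can be
   straightened, so X^(n) and the space Y of symmetric configurations have
   contractible covering spaces, and homotopy classes of paths become end points
   of lifts. A loop fixed by G is a path u with u(1) = g u(0). Given a lift phi of
   g to the contractible cover M, the pairs (u, x) of such a path u and a point x
   of M above u(0) from which the lift of u ends at phi(x) form a contractible
   cover of a component of the space of these paths, as is seen by contracting x
   in M and then the path to a standard one. Its deck transformations are those
   of M commuting with phi, and phi is the monodromy of the component up to
   conjugation. Rotating back by the angle of g turns phi into a braid.

   When c = gcd(n, k) > 1, Y is a cover of X^(n/c + 1) through c-th powers, and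
   P_{n/c, 1(c)} consists of the braids whose lift to Y is closed: the end point
   of the lift is computed by dividing winding angles by c. When l = 1 mod c, the
   braid delta_hat lifts to a path ending at the rotation of the base point by
   sigma_1, so its b-th power lies in the coset of the braids of loops. For other
   values of l both sets in part (1) are countably infinite, as is seen from the
   total winding angle around the point 0. *)

Require Import Defs.
From HB Require Import structures.
From mathcomp Require Import all_boot all_order all_fingroup all_algebra.
From mathcomp Require Import complex ring lra zify.
From mathcomp Require Import all_classical all_reals all_analysis.
Import Defs.

Set Implicit Arguments.
Unset Strict Implicit.
Unset Printing Implicit Defensive.

Import Order.TTheory GRing.Theory Num.Theory numFieldNormedType.Exports.

Local Open Scope classical_set_scope.
Local Open Scope ring_scope.

(** * Coverings with local sections *)

(** Coverings are handled through lifting properties (record [covers]), because these survive each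
    construction made here: products over a tower, the c-th power map, spaces of lifted paths.
    Evenly covered sets are exhibited for the covers of components only at the end, from
    contractions of small neighbourhoods. The parameter spaces of homotopies to be lifted are
    arbitrary, so that they may be spaces of loops.

    The base of each stage of the tower is not compact, so the number of moves that straighten a
    section cannot be bounded: the homeomorphisms used are locally finite compositions.

    Once a contractible cover is available, a braid is known from its permutation and the end point
    of one lift, and identities between braids are checked on end points.

    In case (c) the path of a loop ends at the image of the base point by the inverse of sigma_2,
    while the coset is that of sigma_2. Inversion of braids exchanges the two families of twisted
    classes, which is why the bijection attaches to a loop the class of the inverse braid. *)

Section UnitInterval.
Context {R : realType}.

Lemma unitI0 : unitI (0 : R). Proof. by rewrite /unitI lexx ler01. Qed.
Lemma unitI1 : unitI (1 : R). Proof. by rewrite /unitI lexx ler01. Qed.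

(** Induction along the interval: the supremum of the times up to which [P] holds throughout has a
    neighbourhood on which [P] spreads, so it is attained and equal to 1. *)
Lemma unit_induction (P : R -> Prop) : P 0 ->
  (forall t, unitI t -> exists2 e : R, 0 < e & forall s s', unitI s -> unitI s' ->
     `|s - t| < e -> `|s' - t| < e -> P s -> P s') ->
  forall t, unitI t -> P t.
Proof.
move=> P0 Ploc.
pose S : set R := [set t | unitI t /\ forall s, 0 <= s <= t -> P s].
have S0 : S 0.
  split; first exact: unitI0.
  by move=> s s0; have -> : s = 0 by lra.
have hS : has_sup S.
  by split; [exists 0 | exists 1 => t [/andP[]]].
set m := sup S.
have m01 : unitI m.
  rewrite /unitI (ub_le_sup hS.2 S0) /=.
  by apply: ge_sup; [exists 0 | move=> t [/andP[]]].
have [e e0 He] := Ploc m m01.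
have [s0 [s01 Ps0] ms0] := sup_adherent e0 hS.
have s0m : s0 <= m by apply: ub_le_sup => //; exact: hS.2.
have Ps : forall s, unitI s -> s < m + e -> P s.
  move=> s sI sm; have [ss0|ss0] := leP s s0.
    by apply: Ps0; move: sI; rewrite /unitI; lra.
  apply: (He s0 s) => //.
  - by rewrite ltr_distl; move: ms0; rewrite -/m; lra.
  - by rewrite ltr_distl; move: ms0; rewrite -/m; lra.
  - by apply: Ps0; move: s01; rewrite /unitI; lra.
have m1 : m = 1.
  apply/eqP; apply: contraT => m1.
  have Smin : S (Num.min 1 (m + e / 2)).
    split; first by rewrite /Num.min; case: ifPn; move: m01; rewrite /unitI; lra.
    move=> s; rewrite /Num.min; case: ifPn => h1 h2; apply: Ps;
      move: h1 h2 m01; rewrite /unitI; lra.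
  have := ub_le_sup hS.2 Smin; rewrite -/m /Num.min.
  by case: ifPn; move: m01 m1; rewrite /unitI => /andP[] ? ? /eqP ?; lra.
by move=> t tI; apply: Ps => //; rewrite m1; move: tI; rewrite /unitI; lra.
Qed.

Lemma continuous_comp2 (S T U : topologicalType) (f : S -> T) (g : T -> U) :
  continuous f -> continuous g -> continuous (g \o f).
Proof. by move=> cf cg x; apply: continuous_comp; [exact: cf|exact: cg]. Qed.

Lemma continuous_idE (T : topologicalType) : continuous (fun x : T => x).
Proof. by move=> x; exact: cvg_id. Qed.

Lemma continuous_fstE (S T : topologicalType) : continuous (@fst S T).
Proof. by move=> x; exact: cvg_fst. Qed.

Lemma continuous_sndE (S T : topologicalType) : continuous (@snd S T).
Proof. by move=> x; exact: cvg_snd. Qed.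

Lemma continuous_at_near (S T : topologicalType) (f g : S -> T) x :
  (\forall y \near x, f y = g y) -> {for x, continuous g} -> {for x, continuous f}.
Proof.
move=> fg cg V; rewrite (nbhs_singleton fg) => gV.
have := cg V gV; apply: filterS2 fg => y e /=; by rewrite e.
Qed.

Definition clampi (a b t : R) : R := Num.max a (Num.min t b).

Lemma clampi_continuous a b : continuous (clampi a b).
Proof.
apply: continuous_maxR; first exact: cst_continuous.
apply: continuous_minR; last exact: cst_continuous.
exact: continuous_idE.
Qed.

Lemma clampiP a b t : a <= b -> a <= clampi a b t <= b.
Proof. by rewrite /clampi /Num.max /Num.min; do ![case: ifPn]; lra. Qed.

Lemma clampi_id a b t : a <= t <= b -> clampi a b t = t.
Proof. by rewrite /clampi /Num.max /Num.min; do ![case: ifPn]; lra. Qed.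

Lemma continuous_affine (a b : R) : continuous (fun t : R => a + t * b).
Proof.
move=> t; apply: cvgD; first exact: cvg_cst.
by apply: cvgM; [exact: cvg_id|exact: cvg_cst].
Qed.

Lemma nbhs_R (t : R) (V : set R) : nbhs t V ->
  exists2 e : R, 0 < e & forall s, `|s - t| < e -> V s.
Proof.
move=> /nbhs_ballP[e /= e0 H]; exists e => // s st; apply: H.
by rewrite /ball/= distrC.
Qed.

Lemma near_R (t e : R) : 0 < e -> \forall s \near t, `|s - t| < e.
Proof.
by move=> e0; apply/nbhs_ballP; exists e => // s; rewrite /ball/= distrC.
Qed.

Lemma nbhs_prodR (Z : topologicalType) (z : Z) (t : R) (V : set (Z * R)) :
  nbhs (z, t) V ->
  exists2 N, nbhs z N & exists2 e : R, 0 < e &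
    forall z' s, N z' -> `|s - t| < e -> V (z', s).
Proof.
move=> [[N J] /= [zN tJ] NJ]; exists N => //.
have [e e0 He] := nbhs_R tJ; exists e => // z' s Nz st.
by apply: NJ; split => //=; exact: He.
Qed.

Lemma nbhs_prodR' (Z : topologicalType) (z : Z) (t : R) (V : set (Z * R)) N e :
  nbhs z N -> 0 < e -> (forall z' s, N z' -> `|s - t| < e -> V (z', s)) ->
  nbhs (z, t) V.
Proof.
move=> zN e0 H; exists (N, [set s | `|s - t| < e]) => /=.
  by split => //; exact: near_R.
by move=> [z' s] /= [? ?]; exact: H.
Qed.

End UnitInterval.

(** * Coverings through their lifting properties *)

Section Coverings.
Variable R : realType.
Implicit Types M T Z : topologicalType.

(** A covering of the subset [A] by the whole of [M]. Maps are defined on the line but constrained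
    on [0, 1] only, as for paths. Countable fibres serve to count braids when two sets of classes
    are compared by cardinality. *)
Record covers M T (A : set T) (q : M -> T) : Prop := Covers {
  cov_cont : continuous q;
  cov_in : forall m, A (q m);
  cov_surj : forall a, A a -> exists m, q m = a;
  cov_locinj : forall m : M, exists2 V : set M, nbhs m V &
    forall m1 m2, V m1 -> V m2 -> q m1 = q m2 -> m1 = m2;
  cov_upl : forall G G' : R -> M, continuous G -> continuous G' ->
    (forall t, unitI t -> q (G t) = q (G' t)) -> G 0 = G' 0 ->
    forall t, unitI t -> G t = G' t;
  cov_hlp : forall Z (f : Z * R -> T) (f0 : Z -> M), continuous f ->
    (forall z t, unitI t -> A (f (z, t))) -> continuous f0 ->
    (forall z, q (f0 z) = f (z, 0)) ->
    exists F : Z * R -> M, continuous F /\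
      forall z, F (z, 0) = f0 z /\ forall t, unitI t -> q (F (z, t)) = f (z, t);
  cov_count : forall a, countable (q @^-1` [set a])
}.

(* [s m] is the local section of [q] through [m]. *)
Definition sheet_chart M T (q : M -> T) (U : set T) (s : M -> T -> M) :=
  open U /\ forall m, U (q m) -> [/\ s m (q m) = m,
    forall y, U y -> q (s m y) = y /\ {for y, continuous (s m)} &
    \forall m' \near m, forall y, U y -> s m' y = s m y].

Definition locally_trivial M T (A : set T) (q : M -> T) :=
  forall a, A a -> exists U s, U a /\ sheet_chart q U s.

Section LocallyTrivial.
Variables (M T : topologicalType) (A : set T) (q : M -> T).
Hypotheses (qc : continuous q) (qA : forall m, A (q m)).
Hypothesis lt : locally_trivial A q.

Lemma lt_locinj (m : M) : exists2 V : set M, nbhs m V &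
    forall m1 m2, V m1 -> V m2 -> q m1 = q m2 -> m1 = m2.
Proof.
have [U [s [Ua [oU HU]]]] := lt (qA m).
have [_ _ H3] := HU m Ua.
have nU : nbhs m (q @^-1` U) by apply: qc; exact: open_nbhs_nbhs.
exists [set m' | U (q m') /\ forall y, U y -> s m' y = s m y].
  exact: (filterI nU H3).
move=> m1 m2 [U1 e1] [U2 e2] e12.
have [<- _ _] := HU m1 U1; have [<- _ _] := HU m2 U2.
by rewrite e12 e1 // e2.
Qed.

(** Near a time t both lifts are read off the fixed sections through [G t] and [G' t], so equality
    at one nearby time passes to the others. *)
Lemma lt_upl (G G' : R -> M) : continuous G -> continuous G' ->
    (forall t, unitI t -> q (G t) = q (G' t)) -> G 0 = G' 0 ->
    forall t, unitI t -> G t = G' t.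
Proof.
move=> cG cG' e e0; apply: unit_induction => // t tI.
have [U [s [Ua [oU HU]]]] := lt (qA (G t)).
have [_ _ H3] := HU (G t) Ua.
have Ua' : U (q (G' t)) by rewrite -e.
have [_ _ H3'] := HU (G' t) Ua'.
have n1 : nbhs t (G @^-1` (q @^-1` U)) :=
  cG t _ (@qc (G t) _ (open_nbhs_nbhs (conj oU Ua))).
have n2 : nbhs t (G @^-1` [set m | forall y, U y -> s m y = s (G t) y]) := cG t _ H3.
have n3 : nbhs t (G' @^-1` [set m | forall y, U y -> s m y = s (G' t) y]) := cG' t _ H3'.
have [d d0 Hd] := nbhs_R (filterI n1 (filterI n2 n3)).
exists d => // r r' rI r'I /Hd [Ur [/= er er']] /Hd [Ur' [/= er1 er1']] E.
have U1 : U (q (G' r')) by rewrite -e.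
have [<- _ _] := HU _ Ur'; have [<- _ _] := HU _ U1.
rewrite -e // er1 // er1' // -er // -er' //; congr s; exact: E.
Qed.

Lemma lt_upl_seg (G G' : R -> M) a b : continuous G -> continuous G' ->
    unitI a -> unitI b ->
    (forall t, unitI t -> q (G (a + t * (b - a))) = q (G' (a + t * (b - a)))) ->
    G a = G' a -> G b = G' b.
Proof.
move=> cG cG' aI bI e e0.
have ca := @continuous_affine R a (b - a).
have := @lt_upl (fun t => G (a + t * (b - a))) (fun t => G' (a + t * (b - a))).
rewrite mul0r addr0 => /(_ (continuous_comp2 ca cG) (continuous_comp2 ca cG')).
by move=> /(_ e e0 1 unitI1); rewrite mul1r addrC subrK.
Qed.

Lemma lt_path (f : R -> T) m : continuous f -> (forall t, unitI t -> A (f t)) ->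
  q m = f 0 -> exists G : R -> M, [/\ continuous G, G 0 = m &
    forall t, unitI t -> q (G t) = f t].
Proof.
move=> cf Af mf.
pose P (r : R) := exists G : R -> M, [/\ continuous G, G 0 = m &
    forall t, 0 <= t <= r -> q (G t) = f t].
suff : P 1 by [].
apply: (@unit_induction R P) => [|t tI|]; last exact: unitI1.
  exists (cst m); split => //; first exact: cst_continuous.
  by move=> t t0; have -> : t = 0 by lra.
have [U [s [Ua [oU HU]]]] := lt (Af t tI).
have [e e0 He] := nbhs_R (cf t _ (open_nbhs_nbhs (conj oU Ua))).
exists e => // r r' rI r'I re r'e [G [cG G0 HG]].
have [rr|rr] := leP r' r.
  by exists G; split => // x xr; apply: HG; lra.
have qGr : q (G r) = f r by apply: HG; move: rI; rewrite /unitI; lra.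
have Ur : U (q (G r)) by rewrite qGr; exact: He.
have [E1 E2 _] := HU _ Ur.
have Uc x : U (f (clampi r r' x)).
  apply: He; have := @clampiP R r r' x (ltW rr).
  by move: re r'e; rewrite !ltr_distl; lra.
(* The section is continuous on [U] only, so its argument is frozen outside [r, r'], where [f] may
   leave [U]. *)
exists (fun x => if x <= r then G x else s (G r) (f (clampi r r' x))); split.
- apply: (@glue_continuous _ _ _ id) => //.
  + exact: continuous_idE.
  + move=> x; apply: (@continuous_comp _ _ _ (fun x => f (clampi r r' x))).
      by apply: continuous_comp2; [exact: clampi_continuous|].
    by have [] := E2 _ (Uc x).
  + by move=> x ->; rewrite clampi_id ?lexx ?ltW // -qGr E1.
- by rewrite ifT ?G0 //; move: rI; rewrite /unitI; lra.
- move=> x x0; case: ifPn => xr; first by apply: HG; lra.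
  have [-> _] := E2 _ (Uc x); rewrite clampi_id //; lra.
Qed.

(** The paths are lifted one by one; joint continuity remains. Near a given time the lifts at nearby
    parameters all follow one section ([key]), provided that the lift is continuous in the parameter
    at one time of the neighbourhood; this proviso spreads from time 0 by [unit_induction] ([Q]). *)
Lemma lt_hlp Z (f : Z * R -> T) (f0 : Z -> M) : continuous f ->
    (forall z t, unitI t -> A (f (z, t))) -> continuous f0 ->
    (forall z, q (f0 z) = f (z, 0)) ->
    exists F : Z * R -> M, continuous F /\
      forall z, F (z, 0) = f0 z /\ forall t, unitI t -> q (F (z, t)) = f (z, t).
Proof.
move=> cf Af cf0 e0.
have cfz z : continuous (fun t : R => f (z, t)).
  move=> t; apply: continuous_comp; last exact: cf.
  by apply: continuous_pairR; [exact: cst_continuous|exact: continuous_idE].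
have /choice[G HG] z := @lt_path (fun t => f (z, t)) (f0 z) (cfz z) (Af z) (e0 z).
have key z0 t : unitI t -> exists U s (e : R) N, [/\ sheet_chart q U s, 0 < e, nbhs z0 N,
    (forall z r, N z -> unitI r -> `|r - t| < e -> U (f (z, r))) &
    forall r, unitI r -> `|r - t| < e -> {for z0, continuous (fun z => G z r)} ->
      \forall z \near z0, forall r', unitI r' -> `|r' - t| < e ->
        G z r' = s (G z0 r) (f (z, r'))].
  move=> tI.
  have [U [s [Ua [oU HU]]]] := lt (Af z0 t tI).
  have [N zN [e e1 He]] := nbhs_prodR (cf (z0, t) _ (open_nbhs_nbhs (conj oU Ua))).
  exists U, s, e, N; split => // [z r Nz rI re|r rI re cr]; first exact: He.
  have qG z r' : unitI r' -> q (G z r') = f (z, r').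
    by have [_ _ H] := HG z; apply: H.
  have Ur : U (q (G z0 r)) by rewrite qG //; apply: He => //; exact: nbhs_singleton.
  have [E1 E2 E3] := HU _ Ur.
  have n1 := cr _ E3.
  apply: filterS2 zN n1 => z Nz Ez r' r'I r'e.
  have Uz : U (q (G z r)) by rewrite qG //; apply: He.
  have [F1 F2 F3] := HU _ Uz.
  rewrite -Ez; last exact: He.
  have [cG _ _] := HG z.
  (* [r'] may lie on either side of [r]. Between the two, both [G z] and the section lift the path,
     so they agree at [r']. *)
  pose lo := Num.min r r'; pose hi := Num.max r r'.
  have lohi : lo <= hi by rewrite /lo /hi /Num.min /Num.max; do ![case: ifPn]; lra.
  have Uc x : U (f (z, clampi lo hi x)).
    apply: He => //; have := @clampiP R lo hi x lohi.
    move: re r'e; rewrite !ltr_distl /lo /hi /Num.min /Num.max.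
    by do ![case: ifPn]; lra.
  have ck x : unitI x -> clampi lo hi (r + x * (r' - r)) = r + x * (r' - r).
    move=> /andP[x0 x1]; apply: clampi_id.
    by rewrite /lo /hi /Num.min /Num.max; do ![case: ifPn]; nra.
  have ckr : clampi lo hi r = r by rewrite -[r in LHS]addr0 -(mul0r (r' - r)) ck ?mul0r ?addr0 //; exact: unitI0.
  have ckr' : clampi lo hi r' = r'.
    have -> : r' = r + 1 * (r' - r) by lra.
    by rewrite ck //; exact: unitI1.
  have := @lt_upl_seg (G z) (fun x => s (G z r) (f (z, clampi lo hi x))) r r' cG.
  rewrite ckr'; apply => //.
  - move=> x; apply: (@continuous_comp _ _ _ (fun x : R => f (z, clampi lo hi x))).
      have cfc : continuous (fun x => f (z, clampi lo hi x)) by exact: (@continuous_comp2 _ _ _ _ (fun t => f (z, t)) (@clampi_continuous R lo hi) (cfz z)).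
      exact: (cfc x).
    by have [] := F2 _ (Uc x).
  - move=> x xI; rewrite ck // qG; last first.
      by move: rI r'I xI; rewrite /unitI => /andP[? ?] /andP[? ?] /andP[? ?]; apply/andP; split; nra.
    by have := Uc (r + x * (r' - r)); rewrite ck // => /F2[->].
  - by rewrite ckr -qG // F1.
have Q z0 t : unitI t -> {for z0, continuous (fun z => G z t)}.
  move: t; apply: unit_induction => [|t tI].
    rewrite (_ : (fun z => G z 0) = f0); first exact: cf0.
    by apply/funext => z; have [] := HG z.
  have [U [s [e [N [[oU HU] e1 zN HN H]]]]] := key z0 t tI.
  exists e => // r r' rI r'I re r'e /(H r rI re) n1.
  apply: (@continuous_at_near _ _ _ (fun z => s (G z0 r) (f (z, r')))).
    by apply: filterS n1 => z; exact.
  have [_ _ qG] := HG z0.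
  have Ur : U (q (G z0 r)) by rewrite qG //; apply: HN => //; exact: nbhs_singleton.
  have [_ E2 _] := HU _ Ur.
  apply: (@continuous_comp _ _ _ (fun z => f (z, r'))).
    apply: (continuous_comp2 _ cf).
    by apply: continuous_pairR; [exact: continuous_idE|exact: cst_continuous].
  by have [|] := E2 (f (z0, r')); first by apply: HN => //; exact: nbhs_singleton.
exists (fun p => G p.1 (clamp p.2)); split; last first.
  move=> z /=; have [_ G0 qG] := HG z.
  by split => [|t tI]; rewrite clamp_id //; [exact: unitI0|exact: qG].
move=> [z0 t0].
have cc : continuous (fun p : Z * R => f (p.1, clamp p.2)).
  apply: (continuous_comp2 _ cf).
  apply: continuous_pairR; first exact: continuous_fstE.
  by apply: continuous_comp2; [exact: continuous_sndE|exact: clamp_continuous].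
have tI := clampI t0; set t := clamp t0 in tI.
have [U [s [e [N [[oU HU] e1 zN HN H]]]]] := key z0 t tI.
have te : `|t - t| < e by rewrite subrr normr0.
have n1 := H t tI te (Q z0 t tI).
apply: (@continuous_at_near _ _ _ (fun p => s (G z0 t) (f (p.1, clamp p.2)))).
  have ct : nbhs t0 (clamp @^-1` [set r : R | `|r - t| < e]) := clamp_continuous (near_R _ e1).
  exists ([set z | forall r', unitI r' -> `|r' - t| < e ->
      G z r' = s (G z0 t) (f (z, r'))], clamp @^-1` [set r : R | `|r - t| < e]).
    by split.
  by move=> [z r] /= [h1 h2]; apply: h1 => //; exact: clampI.
have [_ _ qG] := HG z0.
have Ut : U (f (z0, t)) by apply: HN => //; exact: nbhs_singleton.
have Ur : U (q (G z0 t)) by rewrite qG.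
have [_ E2 _] := HU _ Ur.
apply: (@continuous_comp _ _ _ (fun p : Z * R => f (p.1, clamp p.2))); first exact: cc.
by have [_] := E2 _ Ut.
Qed.

Lemma lt_covers : (forall a, A a -> exists m, q m = a) ->
  (forall a, countable (q @^-1` [set a])) -> covers A q.
Proof.
by move=> h1 h2; constructor => //;
  [exact: lt_locinj | exact: lt_upl | exact: lt_hlp].
Qed.

End LocallyTrivial.

End Coverings.

(** * A contractible cover of the punctured plane *)

Lemma near_all (T : topologicalType) (x : T) (P : T -> Prop) :
  (forall y, P y) -> \forall y \near x, P y.
Proof. by move=> h; apply: filterS (@filterT _ (nbhs x) _) => y _; exact: h. Qed.

Lemma near_ltc {R : realType} (T : topologicalType) (f : T -> R) c x :
  continuous f -> f x < c -> \forall y \near x, f y < c.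
Proof.
by move=> cf fx; exact: (cf x _ (open_nbhs_nbhs (conj (@open_lt R c) fx))).
Qed.

Lemma near_gtc {R : realType} (T : topologicalType) (f : T -> R) c x :
  continuous f -> c < f x -> \forall y \near x, c < f y.
Proof.
by move=> cf fx; exact: (cf x _ (open_nbhs_nbhs (conj (@open_gt R c) fx))).
Qed.

Lemma near_neqc {R : realType} (T : topologicalType) (f : T -> R) c x :
  continuous f -> f x != c -> \forall y \near x, f y != c.
Proof.
move=> cf; rewrite neq_lt => /orP[] h.
  by have := near_ltc cf h; apply: filterS => y; rewrite neq_lt => ->.
by have := near_gtc cf h; apply: filterS => y; rewrite neq_lt orbC => ->.
Qed.

Section PuncturedPlane.
Variables (R : realType) (N : nat).
Local Notation P2 := (R * R)%type.
Local Notation word := (seq 'I_N.+1).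

Definition unpunct (z : P2) := (z.2 != 0) || [forall i : 'I_N, z.1 != i%:R].

(* The intervals of the real line cut out by the points 0, ..., N - 1. *)
Definition in_gap (j : 'I_N.+1) (x : R) :=
  ((0 < j)%N ==> (j%:R - 1 < x)) && ((j < N)%N ==> (x < j%:R)).

Lemma in_gap_ex x : unpunct (x, 0) -> exists j, in_gap j x.
Proof.
rewrite /unpunct /= eqxx /= => /forallP ux.
pose P j := (j == N) || (x < j%:R).
have exP : exists j, P j by exists N; rewrite /P eqxx.
have [j Pj jmin] := ex_minnP exP.
have jN : (j < N.+1)%N by rewrite ltnS jmin // /P eqxx.
exists (Ordinal jN); rewrite /in_gap /=; apply/andP; split; apply/implyP => h.
  have j1 : (j.-1 < N)%N by rewrite -ltnS prednK.
  have : ~~ P j.-1.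
    by apply/negP => /jmin; rewrite leqNgt prednK // leqnn.
  rewrite /P negb_or -leNgt => /andP[_]; rewrite le_eqVlt eq_sym.
  by rewrite (negbTE (ux (Ordinal j1))) /= -subn1 natrB.
by move: Pj; rewrite /P => /orP[/eqP e|//]; rewrite e ltnn in h.
Qed.

Lemma in_gap_inj i j x : in_gap i x -> in_gap j x -> i = j.
Proof.
wlog ij : i j / (i <= j)%N => [H|].
  by have [?|/ltnW ?] := leqP i j; [exact: H|move=> ? ?; symmetry; exact: H].
move=> /andP[_ h1] /andP[h2 _]; apply/val_inj/eqP.
rewrite eqn_leq ij /= leqNgt; apply/negP => ltij.
have iN : (i < N)%N by rewrite -ltnS (leq_trans _ (ltn_ord j)).
have j0 : (0 < j)%N by exact: leq_ltn_trans ltij.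
move: h1 h2; rewrite iN j0 /= => h1 h2.
have : (i.+1%:R : R) <= j%:R by rewrite ler_nat.
by rewrite -natr1; lra.
Qed.

Lemma in_gap_unpunct j (z : P2) : in_gap j z.1 -> unpunct z.
Proof.
move=> /andP[h1 h2]; apply/orP; right; apply/forallP => i; apply/eqP => e.
have [ij|ij] := ltnP i j.
  move: h1; rewrite (leq_ltn_trans _ ij) //= e.
  have : (i.+1%:R : R) <= j%:R by rewrite ler_nat.
  by rewrite -natr1; lra.
move: h2; rewrite (leq_ltn_trans ij) //= e.
by rewrite ltNge ler_nat ij.
Qed.

Definition gap (x : R) : 'I_N.+1 := odflt ord0 [pick j | in_gap j x].

Lemma gapP x : unpunct (x, 0) -> in_gap (gap x) x.
Proof.
move=> /in_gap_ex[j xj]; rewrite /gap; case: pickP => //= /(_ j).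
by rewrite xj.
Qed.

Lemma gapE j x : in_gap j x -> gap x = j.
Proof.
move=> xj; apply: (in_gap_inj _ xj); apply: gapP.
exact: (@in_gap_unpunct j (x, 0) xj).
Qed.

Lemma near_in_gap (T : topologicalType) (f : T -> R) j x : continuous f ->
  in_gap j (f x) -> \forall y \near x, in_gap j (f y).
Proof.
move=> cf /andP[h1 h2].
have n1 : \forall y \near x, (0 < j)%N ==> (j%:R - 1 < f y).
  case: (0 < j)%N h1 => /= h1; last exact: near_all.
  exact: near_gtc.
have n2 : \forall y \near x, (j < N)%N ==> (f y < j%:R).
  case: (j < N)%N h2 => /= h2; last exact: near_all.
  exact: near_ltc.
by move: n1 n2; apply: filterS2 => y h h'; apply/andP.
Qed.

(* Words are read from the last letter; [step j w] is the half plane across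
   the interval [j] of the half plane [w]. *)
Definition step (j : 'I_N.+1) (w : word) : word :=
  if w is i :: w' then if i == j then w' else j :: w else [:: j].

Definition reduced (w : word) := sorted (fun a b => a != b) w.

Lemma step_reduced j w : reduced w -> reduced (step j w).
Proof.
case: w => // i w /=; case: eqVneq => [->|ij] /=.
  by case: w => //= k w /andP[].
by rewrite eq_sym ij.
Qed.

Lemma stepK j w : reduced w -> step j (step j w) = w.
Proof.
case: w => [|i w] /=; first by rewrite eqxx.
case: eqVneq => [->|ij] /=; last by rewrite eqxx.
by case: w => //= k w /andP[jk _]; rewrite eq_sym (negbTE jk).
Qed.

Lemma odd_step j w : odd (size (step j w)) = ~~ odd (size w).
Proof.
by case: w => // i w /=; case: eqVneq => //= _; rewrite negbK.
Qed.

(** The cover consists of copies of the half planes, glued along the gaps in the pattern of the tree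
    of reduced words. An even word labels an upper half plane together with the gaps on its edge, an
    odd word an open lower half plane, so that each point has one label. *)
Definition valid (m : P2 * word) :=
  [&& unpunct m.1, reduced m.2 & odd (size m.2) == (m.1.2 < 0)].

Definition pcover := {m : P2 * word | valid m}.

Definition pproj (m : pcover) : P2 := (sval m).1.
Definition plab (m : pcover) : word := (sval m).2.

Lemma pcoverP (m m' : pcover) : pproj m = pproj m' -> plab m = plab m' -> m = m'.
Proof.
rewrite /pproj /plab => e1 e2; apply: val_inj.
by move: e1 e2 => /=; case: (sval m) => a b; case: (sval m') => c d /= -> ->.
Qed.

Lemma pproj_unpunct m : unpunct (pproj m).
Proof. by have /and3P[] := valP m. Qed.

Lemma plab_reduced m : reduced (plab m).
Proof. by have /and3P[] := valP m. Qed.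

Lemma plab_parity m : odd (size (plab m)) = ((pproj m).2 < 0).
Proof. by have /and3P[_ _ /eqP] := valP m. Qed.

Lemma pbase_subproof : valid ((0, 1), [::]).
Proof. by rewrite /valid /unpunct /= oner_neq0 /= ltr10. Qed.

Definition pbase : pcover := exist (fun m => is_true (valid m)) _ pbase_subproof.

Definition ppt (z : P2) (w : word) : pcover := insubd pbase (z, w).

Lemma pptP z w : valid (z, w) -> pproj (ppt z w) = z /\ plab (ppt z w) = w.
Proof. by move=> v; rewrite /pproj /plab /ppt insubdK. Qed.

(** Transport of labels from [z] to a nearby [z']. Since the gaps belong to the upper half planes, a
    label changes only when a real point is left downwards. *)
Definition trans (z z' : P2) (w : word) : word :=
  if (z.2 == 0) && (z'.2 < 0) then step (gap z.1) w else w.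

Definition pnbhs (m : pcover) : set_system pcover := [set A |
  \forall z \near pproj m, forall m', pproj m' = z ->
    plab m' = trans (pproj m) z (plab m) -> A m'].

HB.instance Definition _ := Choice.on pcover.
HB.instance Definition _ := hasNbhs.Build pcover pnbhs.

Lemma trans_refl z w : trans z z w = w.
Proof. by rewrite /trans; case: eqP => //= ->; rewrite ltxx. Qed.

Lemma near_sign (z : P2) : \forall z' \near z,
  (z.2 != 0 -> z'.2 != 0 /\ (z'.2 < 0) = (z.2 < 0)) /\
  (forall j, in_gap j z.1 -> in_gap j z'.1).
Proof.
have n1 : \forall z' \near z, z.2 != 0 -> z'.2 != 0 /\ (z'.2 < 0) = (z.2 < 0).
  have [z0|z0|z0] := ltgtP z.2 0.
  - have := near_ltc (@continuous_sndE R R) z0.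
    by apply: filterS => z' /= h _; rewrite neq_lt h.
  - have := near_gtc (@continuous_sndE R R) z0.
    by apply: filterS => z' /= h _; rewrite neq_lt h orbT ltNge (ltW h).
  - by apply: near_all => z' //; rewrite z0 eqxx.
have n2 : \forall z' \near z, forall j, in_gap j z.1 -> in_gap j z'.1.
  have [[j zj]|nj] := pselect (exists j, in_gap j z.1); last first.
    by apply: (@near_all _ z) => z' j zj; exfalso; apply: nj; exists j.
  have := near_in_gap (@continuous_fstE R R) zj; apply: filterS => z' h k zk.
  by rewrite -(in_gap_inj zj zk).
by move: n1 n2; exact: filterS2.
Qed.

(** The cocycle rule of transport: it makes the neighbourhoods of nearby points compatible, so that
    [pnbhs] defines a topology. *)
Lemma trans_near (z : P2) : unpunct z -> \forall z' \near z, \forall z'' \near z',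
  forall w, trans z' z'' (trans z z' w) = trans z z'' w.
Proof.
move=> uz; have := near_sign z; apply: filterS => z' [h1 h2].
have := near_sign z'; apply: filterS => z'' [h1' h2'] w; rewrite /trans.
have [z0|z0] /= := eqVneq z.2 0; last first.
  by have [/negbTE -> _] := h1 z0.
have zj : in_gap (gap z.1) z.1.
  by apply: gapP; case: z z0 {h1 h2} uz => x y /= ->.
have z'j := h2 _ zj; rewrite (gapE z'j).
have [z'0|z'0] /= := eqVneq z'.2 0; first by rewrite z'0 ltxx.
by have [_ ->] := h1' z'0.
Qed.

Lemma pnbhs_filter m : ProperFilter (pnbhs m).
Proof.
apply: Build_ProperFilter_ex.
  move=> A mA; exists m; have := nbhs_singleton mA.
  by apply => //; rewrite trans_refl.
split.
- exact: near_all.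
- move=> A B; rewrite /pnbhs /=; apply: filterS2 => z h1 h2 m' e1 e2.
  by split; [exact: h1|exact: h2].
- by move=> A B AB; rewrite /pnbhs /=; apply: filterS => z h m' e1 e2; apply: AB; exact: h.
Qed.

Lemma pnbhs_singleton m A : pnbhs m A -> A m.
Proof. by move=> /nbhs_singleton; apply => //; rewrite trans_refl. Qed.

Lemma pnbhs_nbhs m A : pnbhs m A -> pnbhs m (pnbhs^~ A).
Proof.
rewrite /pnbhs /= => /nbhs_interior mA.
have := trans_near (pproj_unpunct m).
move: mA; apply: filterS2 => z mA mt m' e1 e2; rewrite e1.
move: mA mt; rewrite /interior /=; apply: filterS2 => z' h1 h2 m'' e1' e2'.
by apply: h1 => //; rewrite -h2 -e2.
Qed.

HB.instance Definition _ := Nbhs_isNbhsTopological.Build pcover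
  pnbhs_filter pnbhs_singleton pnbhs_nbhs.

Lemma pproj_continuous : continuous pproj.
Proof.
by move=> m A mA; rewrite /nbhs /= /pnbhs /=; apply: filterS mA => z Az m' ->.
Qed.

Lemma near_plab m : \forall m' \near m, plab m' = trans (pproj m) (pproj m') (plab m).
Proof. by apply: (@near_all _ (pproj m)) => z m' ->. Qed.

(** Both open half planes joined through one gap. Over this simply connected set a sheet has two
    labels, exchanged by [step j]. *)
Definition pchart (j : 'I_N.+1) : set P2 := [set y | (y.2 != 0) || in_gap j y.1].

Definition psheet j (m : pcover) (y : P2) : pcover :=
  ppt y (if ((pproj m).2 < 0) == (y.2 < 0) then plab m else step j (plab m)).

Lemma psheetP j m y : pchart j y -> pproj (psheet j m y) = y /\
  plab (psheet j m y) =
    if ((pproj m).2 < 0) == (y.2 < 0) then plab m else step j (plab m).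
Proof.
move=> Uy; apply: pptP; rewrite /valid /=; apply/and3P; split.
- by case/orP: Uy => [y0|/in_gap_unpunct//]; rewrite /unpunct y0.
- by case: ifP => _; rewrite ?step_reduced // plab_reduced.
- case: ifP => [/eqP e|]; first by rewrite plab_parity e.
  rewrite odd_step plab_parity.
  by case: ((pproj m).2 < 0); case: (y.2 < 0).
Qed.

Lemma pproj_locally_trivial : locally_trivial [set z | unpunct z] pproj.
Proof.
move=> a ua.
have [j aj] : exists j, pchart j a.
  have [a0|a0] := eqVneq a.2 0; last by exists ord0; rewrite /pchart /= a0.
  exists (gap a.1); apply/orP; right; apply: gapP.
  by case: a a0 ua => x y /= ->.
exists (pchart j), (psheet j); split => //; split.
  rewrite openE => y /orP[y0|yj].
    have := near_neqc (@continuous_sndE R R) y0.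
    by apply: filterS => z /= h; rewrite /pchart /= h.
  have := near_in_gap (@continuous_fstE R R) yj.
  by apply: filterS => z /= h; rewrite /pchart /= h orbT.
move=> m Um; split.
- have [e1 e2] := psheetP m Um; apply: pcoverP => //.
  by rewrite e2 eqxx.
- move=> y Uy; have [e1 e2] := psheetP m Uy; split => // A.
  rewrite {1}/nbhs /= /pnbhs /= e1 => nA.
  have nU : \forall z \near y, pchart j z.
    case/orP: Uy => [y0|yj].
      have := near_neqc (@continuous_sndE R R) y0.
      by apply: filterS => z /= h; rewrite /pchart /= h.
    have := near_in_gap (@continuous_fstE R R) yj.
    by apply: filterS => z /= h; rewrite /pchart /= h orbT.
  have ns := near_sign y.
  suff : \forall z \near y, A (psheet j m z) by [].
  near=> z.
  have Uz : pchart j z by near: z.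
  have nAz : forall m', pproj m' = z ->
      plab m' = trans y z (plab (psheet j m y)) -> A m' by near: z.
  have [h1 h2] : (y.2 != 0 -> z.2 != 0 /\ (z.2 < 0) = (y.2 < 0)) /\
    (forall j, in_gap j y.1 -> in_gap j z.1) by near: z.
  have [e1' e2'] := psheetP m Uz; apply: nAz => //; rewrite e2 e2' /trans.
  have [y0|y0] /= := eqVneq y.2 0; last by have [_ ->] := h1 y0.
  have yj : in_gap j y.1 by move: Uy; rewrite /pchart /= y0 eqxx.
  rewrite y0 ltxx (gapE yj); case: ((pproj m).2 < 0); case: (z.2 < 0) => //=.
  by rewrite stepK // plab_reduced.
- have n : nbhs m (pproj @^-1` [set z' | ((pproj m).2 != 0 -> z'.2 != 0 /\
      (z'.2 < 0) = ((pproj m).2 < 0)) /\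
      (forall j, in_gap j (pproj m).1 -> in_gap j z'.1)]) :=
    pproj_continuous (near_sign (pproj m)).
  move: n (near_plab m); apply: filterS2 => m' [h1 h2] e y Uy; congr ppt; rewrite e /trans.
  have [m0|m0] /= := eqVneq (pproj m).2 0; last by have [_ ->] := h1 m0.
  have mj : in_gap j (pproj m).1 by move: Um; rewrite /pchart /= m0 eqxx.
  rewrite (gapE mj) m0 ltxx; case: ((pproj m').2 < 0); case: (y.2 < 0) => //=.
  by rewrite stepK // plab_reduced.
Unshelve. all: end_near.
Qed.

Lemma pproj_covers : covers R [set z | unpunct z] pproj.
Proof.
apply: lt_covers => //=.
- exact: pproj_continuous.
- exact: pproj_unpunct.
- exact: pproj_locally_trivial.
- move=> z uz; exists (ppt z (if z.2 < 0 then [:: ord0] else [::])).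
  apply: (pptP _).1; rewrite /valid /= uz /=.
  by case: (z.2 < 0).
- move=> z; apply/countable_injP.
  exists (fun m => pickle (plab m)) => m m' /set_mem /= e /set_mem /= e'.
  move=> /(pcan_inj pickleK) ee; apply: pcoverP; rewrite ?e ?e' //.
Qed.

End PuncturedPlane.

(** * Continuity of real formulas *)

Section ContinuityRules.
Context {R : realType} {T : topologicalType}.
Implicit Types f g : T -> R.

Lemma contD f g : continuous f -> continuous g -> continuous (fun x => f x + g x).
Proof. by move=> cf cg x; apply: cvgD; [exact: cf|exact: cg]. Qed.

Lemma contN f : continuous f -> continuous (fun x => - f x).
Proof. by move=> cf x; apply: cvgN; exact: cf. Qed.

Lemma contM f g : continuous f -> continuous g -> continuous (fun x => f x * g x).
Proof. by move=> cf cg x; apply: cvgM; [exact: cf|exact: cg]. Qed.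

Lemma contV f : (forall x, f x != 0) -> continuous f ->
  continuous (fun x => (f x)^-1).
Proof. by move=> f0 cf x; apply: cvgV; [exact: f0|exact: cf]. Qed.

Lemma contnorm f : continuous f -> continuous (fun x => `|f x|).
Proof. by move=> cf x; apply: cvg_norm; exact: cf. Qed.

Lemma contmax f g : continuous f -> continuous g ->
  continuous (fun x => Num.max (f x) (g x)).
Proof. by move=> cf cg x; exact: (@continuous_max R T f g x (cf x) (cg x)). Qed.

Lemma contmin f g : continuous f -> continuous g ->
  continuous (fun x => Num.min (f x) (g x)).
Proof. by move=> cf cg x; exact: (@continuous_min R T f g x (cf x) (cg x)). Qed.

Lemma contclamp f : continuous f -> continuous (fun x => clamp (f x)).
Proof. by move=> cf; exact: (continuous_comp2 cf (@clamp_continuous R)). Qed.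

Lemma contcst (U : topologicalType) (c : U) : continuous (fun _ : T => c).
Proof. exact: cst_continuous. Qed.

Lemma contfst (U V : topologicalType) (f : T -> U * V) :
  continuous f -> continuous (fun x => (f x).1).
Proof. by move=> cf; exact: (continuous_comp2 cf (@continuous_fstE U V)). Qed.

Lemma contsnd (U V : topologicalType) (f : T -> U * V) :
  continuous f -> continuous (fun x => (f x).2).
Proof. by move=> cf; exact: (continuous_comp2 cf (@continuous_sndE U V)). Qed.

End ContinuityRules.

(** Structural rules for real formulas, pairs and projections; any other map has to enter by
    composition or as a hypothesis. *)
Ltac cont := repeat match goal with
  | H : ?P |- ?P => exact: H
  | |- (forall x0, continuous_at x0 (fun x => x)) => exact: continuous_idE
  | |- (forall x0, continuous_at x0 (fun x => GRing.add (@?f x) (@?g x))) =>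
      refine (@contD _ _ f g _ _)
  | |- (forall x0, continuous_at x0 (fun x => GRing.opp (@?f x))) =>
      refine (@contN _ _ f _)
  | |- (forall x0, continuous_at x0 (fun x => GRing.mul (@?f x) (@?g x))) =>
      refine (@contM _ _ f g _ _)
  | |- (forall x0, continuous_at x0 (fun x => Num.norm (@?f x))) =>
      refine (@contnorm _ _ f _)
  | |- (forall x0, continuous_at x0 (fun x => Order.max (@?f x) (@?g x))) =>
      refine (@contmax _ _ f g _ _)
  | |- (forall x0, continuous_at x0 (fun x => Order.min (@?f x) (@?g x))) =>
      refine (@contmin _ _ f g _ _)
  | |- (forall x0, continuous_at x0 (fun x => clamp (@?f x))) =>
      refine (@contclamp _ _ f _)
  | |- (forall x0, continuous_at x0 (fun x => (@?f x, @?g x))) =>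
      refine (@continuous_pairR _ _ _ f g _ _)
  | |- (forall x0, continuous_at x0 (fun x => fst (@?f x))) =>
      refine (@contfst _ _ _ f _)
  | |- (forall x0, continuous_at x0 (fun x => snd (@?f x))) =>
      refine (@contsnd _ _ _ f _)
  | |- (forall x0, continuous_at x0 clamp) => exact: clamp_continuous
  | |- (forall x0, continuous_at x0 fst) => exact: continuous_fstE
  | |- (forall x0, continuous_at x0 snd) => exact: continuous_sndE
  | |- (forall x0, continuous_at x0 (fun x => ?c)) => exact: contcst
  end.

(** * Canonical paths and the contraction of the glued half planes *)

Section PuncturedPlaneContraction.
Variables (R : realType) (N : nat).
Local Notation P2 := (R * R)%type.
Local Notation word := (seq 'I_N.+1).
Local Notation upt := (@unpunct R N).

(* A path from [a] to [z] whose interior lies in the open upper half plane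
   unless it is constant. *)
Definition arc (a z : P2) (s : R) : P2 :=
  ((1 - s) * a.1 + s * z.1,
   (1 - s) * a.2 + s * z.2 + s * (1 - s) * `|a.1 - z.1|).

Lemma arc0 a z : arc a z 0 = a.
Proof. by case: a => x y; rewrite /arc /=; congr (_, _); ring. Qed.

Lemma arc1 a z : arc a z 1 = z.
Proof. by case: z => x y; rewrite /arc /=; congr (_, _); ring. Qed.

Lemma arc_id a s : arc a a s = a.
Proof.
by case: a => x y; rewrite /arc /= subrr normr0; congr (_, _); ring.
Qed.

(** At an inner time the bump s (1 - s) |a.1 - z.1| lifts the point off the axis unless the
    abscissas agree; then the segment is vertical and meets the axis only at an end, or is
    constant. *)
Lemma arc_unpunct a z s : upt a -> upt z -> 0 <= a.2 -> 0 <= z.2 -> unitI s ->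
  upt (arc a z s) /\ 0 <= (arc a z s).2.
Proof.
move=> ua uz a0 z0 /andP[s0 s1].
have n0 := normr_ge0 (a.1 - z.1).
have p1 : 0 <= (1 - s) * a.2 by nra.
have p2 : 0 <= s * z.2 by nra.
have p3 : 0 <= s * (1 - s) by nra.
have p4 : 0 <= s * (1 - s) * `|a.1 - z.1| by exact: mulr_ge0.
split; last by rewrite /=; lra.
have [->|s0'] := eqVneq s 0; first by rewrite arc0.
have [->|s1'] := eqVneq s 1; first by rewrite arc1.
have s0'' : 0 < s by rewrite lt_neqAle eq_sym s0'.
have s1'' : 0 < 1 - s by rewrite subr_gt0 lt_neqAle s1'.
have [e1|e1] := eqVneq a.1 z.1; last first.
  apply/orP; left => /=; rewrite gt_eqF //.
  have : 0 < s * (1 - s) * `|a.1 - z.1|.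
    by rewrite !mulr_gt0 // normr_gt0 subr_eq0.
  lra.
have [e2|e2] := eqVneq a.2 0; last first.
  have : 0 < (1 - s) * a.2 by rewrite mulr_gt0 // lt_neqAle eq_sym e2.
  by move=> p; apply/orP; left => /=; rewrite gt_eqF //; lra.
have [e3|e3] := eqVneq z.2 0; last first.
  have : 0 < s * z.2 by rewrite mulr_gt0 // lt_neqAle eq_sym e3.
  by move=> p; apply/orP; left => /=; rewrite gt_eqF //; lra.
have -> : a = z by case: a z e1 e2 e3 {ua uz a0 z0 n0 p1 p2 p4} => ? ? [? ?] /= -> -> ->.
by rewrite arc_id.
Qed.

Definition sdist (c : R) (z : P2) := Num.max `|z.1 - c| `|z.2|.

(** The margin kept by [to_gap] from the ends of the gap: at most 1/2, so that the value stays
    strictly inside a gap of length 1, and at most the distance to the ends, so that real points of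
    the gap do not move. *)
Definition gap_eps (j : 'I_N.+1) (z : P2) := Num.min 2^-1
  (Num.min (if (0 < j)%N then sdist (j%:R - 1) z else 1)
           (if (j < N)%N then sdist j%:R z else 1)).

(* A retraction of the punctured plane onto the [j]-th interval. *)
Definition to_gap (j : 'I_N.+1) (z : P2) : R :=
  let a := if (0 < j)%N then Num.max z.1 (j%:R - 1 + gap_eps j z) else z.1 in
  if (j < N)%N then Num.min a (j%:R - gap_eps j z) else a.

Lemma sdist_gt0 (i : nat) z : (i < N)%N -> upt z -> 0 < sdist i%:R z.
Proof.
move=> iN /orP[z0|/forallP /(_ (Ordinal iN)) /= z0];
  rewrite /sdist lt_max !normr_gt0.
  by rewrite z0 orbT.
by rewrite subr_eq0 z0.
Qed.

Lemma gap_eps_gt0 j z : upt z -> 0 < gap_eps j z.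
Proof.
move=> uz; rewrite /gap_eps !lt_min invr_gt0 ltr0n /=; apply/andP; split.
  case: ifP => // j0; have e : (j : nat) = j.-1.+1 by rewrite prednK.
  rewrite e -natr1 addrK; apply: sdist_gt0 => //.
  by rewrite -ltnS -e.
by case: ifP => // jN; exact: sdist_gt0.
Qed.

Lemma to_gapP j z : upt z -> in_gap j (to_gap j z).
Proof.
move=> /(gap_eps_gt0 j) e0.
have e1 : gap_eps j z <= 2^-1 by rewrite /gap_eps ge_min lexx.
rewrite /in_gap /to_gap; apply/andP; split; apply/implyP => ->;
  move: e0 e1; move: (gap_eps j z) => e e0 e1.
  by case: ifP => _; rewrite /Num.min /Num.max; do ![case: ifP]; lra.
by case: ifP => _; rewrite /Num.min /Num.max; do ![case: ifP]; lra.
Qed.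

Lemma to_gap_id j x : in_gap j x -> to_gap j (x, 0) = x.
Proof.
move=> /andP[h1 h2]; rewrite /to_gap /=.
have e1 : (0 < j)%N -> j%:R - 1 + gap_eps j (x, 0) <= x.
  move=> j0; have : gap_eps j (x, 0) <= sdist (j%:R - 1) (x, 0).
    by rewrite /gap_eps j0 !ge_min lexx /= orbT.
  rewrite /sdist /= normr0 j0 /= in h1 *; rewrite max_l ?normr_ge0 //.
  by rewrite gtr0_norm; lra.
have e2 : (j < N)%N -> x <= j%:R - gap_eps j (x, 0).
  move=> jN; have : gap_eps j (x, 0) <= sdist j%:R (x, 0).
    by rewrite /gap_eps jN !ge_min lexx /= !orbT.
  rewrite /sdist /= normr0 jN /= in h2 *; rewrite max_l ?normr_ge0 //.
  by rewrite ltr0_norm; lra.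
case: ifP => jN; case: ifP => j0; rewrite ?(max_l (e1 _)) ?(min_l (e2 _)) //.
Qed.

Lemma to_gap_continuous j : continuous (to_gap j).
Proof.
by rewrite /to_gap /gap_eps /sdist; case: (0 < j)%N; case: (j < N)%N; cont.
Qed.

Definition flip (b : bool) (z : P2) : P2 := if b then (z.1, - z.2) else z.

Lemma flip_unpunct b z : upt (flip b z) = upt z.
Proof. by case: b => //; rewrite /unpunct /= oppr_eq0. Qed.

Lemma flip_real b x : flip b (x, 0) = (x, 0).
Proof. by case: b => //=; rewrite oppr0. Qed.

Lemma flip_continuous (T : topologicalType) b (f : T -> P2) :
  continuous f -> continuous (fun x => flip b (f x)).
Proof. by case: b => //= cf; cont. Qed.

(* The canonical path to the point [z] of the closed half plane [w], folded
   into the upper half plane when computing crossing points: its first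
   [i + 1] units of time are spent in the first [i] half planes. *)
Fixpoint wpath (w : word) (z : P2) (t : R) : P2 :=
  if w is j :: w' then
    if t <= (size w').+1%:R then wpath w' (to_gap j z, 0) t
    else flip (odd (size w)) (arc (to_gap j z, 0) z (clamp (t - (size w').+1%:R)))
  else arc (0, 1) z (clamp t).

Lemma clamp0 : clamp (0 : R) = 0. Proof. by rewrite clamp_id //; exact: unitI0. Qed.

Lemma clamp_ge1 (t : R) : 1 <= t -> clamp t = 1.
Proof. by rewrite /clamp /Num.max /Num.min; do ![case: ifPn]; lra. Qed.

Lemma wpath_end w z t : (size w).+1%:R <= t -> wpath w z t = flip (odd (size w)) z.
Proof.
case: w => [|j w] /= h; first by rewrite clamp_ge1 // arc1.
rewrite ifF; last by apply/negbTE; rewrite -ltNge (lt_le_trans _ h) // ltr_nat.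
by rewrite clamp_ge1 ?arc1 //; move: h; rewrite -[(size w).+2%:R]natr1; lra.
Qed.

Lemma wpath0 w z : wpath w z 0 = (0, 1).
Proof.
elim: w z => [|j w IH] z /=; first by rewrite clamp0 arc0.
by rewrite ler0n.
Qed.

Lemma arc_continuous (T : topologicalType) (a z : T -> P2) (s : T -> R) :
  continuous a -> continuous z -> continuous s ->
  continuous (fun x => arc (a x) (z x) (s x)).
Proof. by move=> ca cz cs; rewrite /arc; cont. Qed.

Lemma wpath_continuous w : continuous (fun p : P2 * R => wpath w p.1 p.2).
Proof.
elim: w => [|j w IH] /=; first by apply: arc_continuous; cont.
have cg : continuous (fun p : P2 * R => to_gap j p.1).
  exact: (continuous_comp2 (@continuous_fstE P2 R) (@to_gap_continuous j)).
apply: (@glue_continuous _ _ _ snd); first exact: continuous_sndE.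
- have cp : continuous (fun p : P2 * R => ((to_gap j p.1, 0 : R), p.2)) by cont.
  exact: (continuous_comp2 cp IH).
- by apply: (@flip_continuous _ (~~ odd (size w))); apply: arc_continuous; cont.
- move=> [z t] /= ->; rewrite wpath_end // subrr clamp0 arc0 flip_real.
  by case: (odd _) => //=; rewrite oppr0.
Qed.

Lemma wpath_unpunct w z t : upt z -> 0 <= z.2 -> upt (wpath w z t).
Proof.
elim: w z t => [|j w IH] z t uz z0 /=.
  apply: (arc_unpunct _ uz _ z0 (clampI t)).1 => //=.
  by rewrite /unpunct /= oner_neq0.
have ug : upt (to_gap j z, 0) by apply: in_gap_unpunct; exact: to_gapP.
case: ifP => _; first exact: IH.
have : upt (arc (to_gap j z, 0) z (clamp (t - (size w).+1%:R))).
  exact: (arc_unpunct ug uz (lexx 0) z0 (clampI _)).1.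
by case: (odd _) => //=; rewrite /unpunct /= oppr_eq0.
Qed.

Lemma wpath_cons j w x t : in_gap j x -> wpath (j :: w) (x, 0) t = wpath w (x, 0) t.
Proof.
move=> xj /=; rewrite to_gap_id // arc_id; case: ifPn => // h.
by rewrite wpath_end ?flip_real; [case: (odd _) => //=; rewrite oppr0|rewrite ltW // ltNge].
Qed.

(** A point of the gap [j] is on the edge of both half planes [w] and [step j w]; continuity across
    the axis rests on the agreement of the two canonical paths there. *)
Lemma wpath_step j w x t : in_gap j x -> wpath (step j w) (x, 0) t = wpath w (x, 0) t.
Proof.
move=> xj; case: w => [|i w]; first by rewrite -(wpath_cons [::] t xj).
rewrite /step; case: eqVneq => [->|_]; first by rewrite wpath_cons.
by rewrite (wpath_cons (i :: w) t xj).
Qed.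

Definition fold (z : P2) : P2 := (z.1, `|z.2|).

Lemma fold_unpunct z : upt (fold z) = upt z.
Proof. by rewrite /unpunct /= normr_eq0. Qed.

Lemma flip_fold z : flip (z.2 < 0) (fold z) = z.
Proof.
case: z => x y; rewrite /flip /fold /=; have [y0|y0] := ltP y 0.
  by rewrite ltr0_norm // opprK.
by rewrite ger0_norm.
Qed.

Definition cpath (p : pcover R N * R) : P2 :=
  wpath (plab p.1) (fold (pproj p.1)) p.2.

(** Off the axis labels are locally constant. Near a real point two labels occur, each giving a
    continuous family of paths, and at the point itself the families agree by [wpath_step]. *)
Lemma cpath_continuous : continuous cpath.
Proof.
have cw w : continuous (fun p : pcover R N * R => wpath w (fold (pproj p.1)) p.2).
  have cp : continuous (fun p : pcover R N * R => (fold (pproj p.1), p.2)).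
    apply: continuous_pairR; last exact: continuous_sndE.
    have c1 : continuous (fun p : pcover R N * R => pproj p.1).
      exact: (continuous_comp2 (@continuous_fstE _ _) (@pproj_continuous R N)).
    by rewrite /fold; cont.
  exact: (continuous_comp2 cp (@wpath_continuous w)).
move=> [m t] V mV.
have n1 : nbhs (m, t) [set p : pcover R N * R |
    plab p.1 = trans (pproj m) (pproj p.1) (plab m)] :=
  @continuous_fstE (pcover R N) R (m, t) _ (near_plab m).
have [m0|m0] := eqVneq (pproj m).2 0; last first.
  apply: (@continuous_at_near _ _ _ _ (m, t) _ (cw (plab m) (m, t)) V mV).
  apply: filterS n1 => p /= e.
  by rewrite /cpath e /trans (negbTE m0).
set j := gap N (pproj m).1.
have mj : in_gap j (pproj m).1.
  apply: gapP; have := pproj_unpunct m.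
  by case: (pproj m) m0 => x y /= ->.
have V1 : nbhs (m, t) [set p | V (wpath (plab m) (fold (pproj p.1)) p.2)] := cw _ _ _ mV.
have mV' : nbhs (wpath (step j (plab m)) (fold (pproj m)) t) V.
  rewrite /fold m0 normr0 wpath_step //.
  by move: mV; rewrite /cpath /fold /= m0 normr0.
have V2 : nbhs (m, t) [set p | V (wpath (step j (plab m)) (fold (pproj p.1)) p.2)] :=
  cw (step j (plab m)) (m, t) V mV'.
suff : nbhs (m, t) [set p | V (cpath p)] by [].
apply: filterS (filterI n1 (filterI V1 V2)) => p [/= e [h1 h2]].
by rewrite /cpath e /trans; case: ifP.
Qed.

(** The duration of a canonical path depends on the label. The time change t = s / (1 - s) fits them
    all in [0, 1), and the end is filled by the point itself. *)
Definition hpath (p : pcover R N * R) : P2 :=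
  if p.2 < 1 then cpath (p.1, p.2 / (1 - p.2)) else pproj p.1.

Lemma cpath_end m t : (size (plab m)).+1%:R <= t -> cpath (m, t) = pproj m.
Proof. by move=> h; rewrite /cpath wpath_end //= plab_parity flip_fold. Qed.

Lemma size_step j (w : word) : (size (step j w) <= (size w).+1)%N.
Proof. by case: w => //= i w; case: ifP => //= _; rewrite ltnW. Qed.

Lemma hpath_continuous : continuous hpath.
Proof.
move=> [m s]; have [s1|s1] := ltP s 1.
  apply: (@continuous_at_near _ _ hpath
    (fun p : pcover R N * R => cpath (p.1, p.2 / (1 - p.2))) (m, s)).
    have := near_ltc (@continuous_sndE (pcover R N) R) (s1 : (m, s).2 < 1).
    by apply: filterS => p /= h; rewrite /hpath h.
  apply: (@continuous_comp _ _ _ (fun p : pcover R N * R => (p.1, p.2 / (1 - p.2)))).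
    apply: (@cvg_pair _ _ _ (nbhs (m, s)) (nbhs m) (nbhs (s / (1 - s)))); first exact: cvg_fst.
    apply: cvgM; first exact: cvg_snd.
    apply: cvgV => /=; first by rewrite subr_eq0 gt_eqF.
    by apply: cvgB; [exact: cvg_cst|exact: cvg_snd].
  exact: cpath_continuous.
apply: (@continuous_at_near _ _ hpath
  (fun p : pcover R N * R => pproj p.1) (m, s)); last first.
  exact: (continuous_comp2 (@continuous_fstE _ _) (@pproj_continuous R N)).
(* Nearby labels have at most one letter more, so their canonical paths are over by time [K]; and s
   / (1 - s) exceeds K once s exceeds K / (1 + K). *)
pose K : R := (size (plab m)).+2%:R.
have K0 : 0 < K by rewrite ltr0n.
have K1 : K / (1 + K) < s.
  by apply: lt_le_trans s1; rewrite ltr_pdivrMr; lra.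
have n1 : nbhs (m, s) [set p : pcover R N * R |
    plab p.1 = trans (pproj m) (pproj p.1) (plab m)] :=
  @continuous_fstE (pcover R N) R (m, s) _ (near_plab m).
have n2 := near_gtc (@continuous_sndE (pcover R N) R) (K1 : _ < (m, s).2).
move: n1 n2; apply: filterS2 => -[m' s'] /= e h.
rewrite /hpath /=; case: ifP => // s'1; apply: cpath_end.
apply: (@le_trans _ _ K).
  rewrite ler_nat ltnS e /trans; case: ifP => // _; exact: size_step.
have d0 : 0 < 1 - s' by lra.
rewrite ler_pdivlMr //; move: h; rewrite ltr_pdivrMr; last lra.
by nra.
Qed.

(* The point [z] of the closed half plane [w]. *)
Definition wpt (w : word) (z : P2) : pcover R N :=
  ppt (flip (odd (size w)) z)
    (if (z.2 == 0) && odd (size w) then step (gap N z.1) w else w).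

Lemma wptP w z : reduced w -> upt z -> 0 <= z.2 ->
  pproj (wpt w z) = flip (odd (size w)) z /\ plab (wpt w z) =
    if (z.2 == 0) && odd (size w) then step (gap N z.1) w else w.
Proof.
move=> rw uz z0; apply: pptP; rewrite /valid /= flip_unpunct uz /=.
apply/andP; split; first by case: ifP => // _; exact: step_reduced.
case: (boolP (odd (size w))) => ow /=; last first.
  by rewrite andbF (negbTE ow) ltNge z0.
rewrite andbT; have [e|e] := eqVneq z.2 0.
  rewrite odd_step ow e oppr0 ltxx //.
by rewrite ow oppr_lt0 lt0r e z0.
Qed.

Lemma wpt_continuous w (f : R -> P2) : reduced w -> continuous f ->
  (forall s, upt (f s)) -> (forall s, 0 <= (f s).2) ->
  continuous (fun s => wpt w (f s)).
Proof.
move=> rw cf uf f0 s A.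
have [e1 e2] := wptP rw (uf s) (f0 s).
rewrite {1}/nbhs /= /pnbhs /= e1 => nA.
have cff : continuous (fun s => flip (odd (size w)) (f s)) by exact: flip_continuous.
have n1 : nbhs s [set s' | forall m', pproj m' = flip (odd (size w)) (f s') ->
   plab m' = trans (flip (odd (size w)) (f s)) (flip (odd (size w)) (f s'))
    (plab (wpt w (f s))) -> A m'] := cff s _ nA.
have n2 : nbhs s (f @^-1` [set z' | ((f s).2 != 0 -> z'.2 != 0 /\
   (z'.2 < 0) = ((f s).2 < 0)) /\ (forall j : 'I_N.+1, in_gap j (f s).1 -> in_gap j z'.1)])
  := cf s _ (near_sign N (f s)).
suff : \forall s' \near s, A (wpt w (f s')) by [].
move: n1 n2; apply: filterS2 => s' h [h1 h2].
have [e1' e2'] := wptP rw (uf s') (f0 s').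
apply: h => //; rewrite e2 e2' /trans.
have [z0|z0] := eqVneq (f s).2 0; last first.
  have [z0' _] := h1 z0; rewrite (negbTE z0') /=.
  by case: (odd (size w)) => /=; rewrite ?oppr_eq0 (negbTE z0).
have gs : in_gap (gap N (f s).1) (f s).1.
  by apply: gapP; have := uf s; case: (f s) z0 => x y /= ->.
have gs' := h2 _ gs; rewrite (gapE gs').
case: (odd (size w)) => /=.
  rewrite z0 oppr0 eqxx andbT /= oppr_lt0.
  have := f0 s'; rewrite le_eqVlt => /orP[/eqP <-|h0]; first by rewrite eqxx ltxx.
  by rewrite gt_eqF // h0 stepK.
by rewrite andbF z0 eqxx /= ltNge f0.
Qed.

Lemma wpt_cons j w x : reduced (j :: w) -> in_gap j x ->
  wpt (j :: w) (x, 0) = wpt w (x, 0).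
Proof.
move=> rw xj; have rw' : reduced w.
  by move: rw; rewrite /reduced /=; exact: path_sorted.
have ux : upt (x, 0) by exact: (in_gap_unpunct (j := j)).
have [e1 e2] := wptP rw ux (lexx 0); have [e1' e2'] := wptP rw' ux (lexx 0).
apply: pcoverP; first by rewrite e1 e1' !flip_real.
rewrite e2 e2' /= !eqxx /= (gapE xj) /= eqxx; case: (odd (size w)) => //=.
by case: (w) rw => //= i w0 /andP[]; rewrite eq_sym => /negbTE ->.
Qed.

(** Each arc stays in one closed half plane, over which its lift is explicit ([wpt]), and
    consecutive arcs fit by [wpt_cons]. Hence the canonical path attached to a point of the cover,
    lifted from the base point, ends at that point. *)
Lemma wpath_lift w z (G : R -> pcover R N) : reduced w -> upt z -> 0 <= z.2 ->
  continuous G -> G 0 = pbase R N ->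
  (forall t, 0 <= t <= (size w).+1%:R -> pproj (G t) = wpath w z t) ->
  G (size w).+1%:R = wpt w z.
Proof.
move=> rw uz z0 cG G0; elim: w z rw uz z0 => [|j w IH] z rw uz z0 HG.
  have ub : upt (0, 1) by rewrite /unpunct /= oner_neq0.
  have harc s : upt (arc (0, 1) z (clamp s)) /\ 0 <= (arc (0, 1) z (clamp s)).2.
    by apply: arc_unpunct => //; exact: clampI.
  pose G' s := wpt [::] (arc (0, 1) z (clamp s)).
  have cG' : continuous G'.
    apply: wpt_continuous => // [|s|s]; [|by have [] := harc s|by have [] := harc s].
    by apply: arc_continuous; cont.
  have := cov_upl (pproj_covers R N) cG cG' _ _ unitI1.
  have -> : G' 1 = wpt [::] z by rewrite /G' clamp_ge1 // arc1.
  apply.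
    move=> t tI; rewrite HG //.
    by have [-> _] := wptP (isT : reduced [::]) (harc t).1 (harc t).2.
  rewrite G0 /G' clamp0 arc0; apply/esym; apply: pcoverP.
    by have [-> _] := wptP (isT : reduced [::]) ub ler01.
  by have [_ ->] := wptP (isT : reduced [::]) ub ler01; rewrite andbF.
have rw' : reduced w by move: rw; rewrite /reduced /=; exact: path_sorted.
have gj := to_gapP j uz.
have ug : upt (to_gap j z, 0) by exact: (in_gap_unpunct (j := j)).
have harc s : upt (arc (to_gap j z, 0) z (clamp s)) /\
    0 <= (arc (to_gap j z, 0) z (clamp s)).2.
  by apply: arc_unpunct => //; exact: clampI.
have e1 : G (size w).+1%:R = wpt (j :: w) (to_gap j z, 0).
  rewrite wpt_cons //; apply: IH => // t /andP[t0 t1].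
  rewrite HG /= ?t1 // t0 /= (le_trans t1) // ler_nat //.
pose G' s := wpt (j :: w) (arc (to_gap j z, 0) z (clamp s)).
have cG' : continuous G'.
  apply: wpt_continuous => // [|s|s]; [|by have [] := harc s|by have [] := harc s].
  by apply: arc_continuous; cont.
pose G1 s := G ((size w).+1%:R + s).
have cG1 : continuous G1.
  have ca : continuous (fun s : R => (size w).+1%:R + s) by cont.
  exact: (continuous_comp2 ca cG).
have := cov_upl (pproj_covers R N) cG1 cG' _ _ unitI1.
have -> : G' 1 = wpt (j :: w) z by rewrite /G' clamp_ge1 // arc1.
have -> : G1 1 = G (size (j :: w)).+1%:R by rewrite /G1 natr1.
apply; last by rewrite /G1 /G' clamp0 arc0 addr0.
move=> t tI; rewrite /G1 HG; last first.
  by move: tI; rewrite /unitI /= -[(size w).+2%:R]natr1; have := ler0n R (size w).+1; lra.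
have [-> _] := wptP rw (harc t).1 (harc t).2.
rewrite /=; case: ifPn => [h|_]; last by rewrite addrAC subrr add0r.
have -> : t = 0 by move: tI; rewrite /unitI; lra.
rewrite clamp0 arc0 addr0 wpath_end // flip_real.
by case: (odd _) => //=; rewrite oppr0.
Qed.

Lemma wpt_fold m : wpt (plab m) (fold (pproj m)) = m.
Proof.
have u : upt (fold (pproj m)) by rewrite fold_unpunct pproj_unpunct.
have [e1 e2] := wptP (plab_reduced m) u (normr_ge0 _ : 0 <= (fold (pproj m)).2).
apply: pcoverP; first by rewrite e1 plab_parity flip_fold.
rewrite e2 plab_parity /= normr_eq0; case: eqP => //= ->.
by rewrite ltxx.
Qed.

(** The lift of [hpath] from the base point joins it to each point of the cover, continuously in
    that point; it is run backwards. *)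
Lemma pcover_contractible : contractible R (pcover R N).
Proof.
have hp z t : unitI t -> upt (hpath (z, t)).
  move=> _; rewrite /hpath; case: ifP => _; last exact: pproj_unpunct.
  by apply: wpath_unpunct; [rewrite fold_unpunct pproj_unpunct|exact: normr_ge0].
have h0 (z : pcover R N) : pproj (pbase R N) = hpath (z, 0).
  by rewrite /hpath /= ltr01 mul0r /cpath /= wpath0.
have [F [cF HF]] := cov_hlp (pproj_covers R N) hpath_continuous hp
  (@contcst (pcover R N) _ (pbase R N)) h0.
have F1 m : F (m, 1) = m.
  (* For t >= 0 this inverts the time change of [hpath], so that [G] lifts the canonical path; the
     absolute value keeps it defined on the line. *)
  pose G t := F (m, t / (1 + `|t|)).
  have d0 (t : R) : 1 + `|t| != 0 by rewrite gt_eqF // ltr_pwDl.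
  have cG : continuous G.
    have ci : continuous (fun t : R => (1 + `|t|)^-1) by apply: contV => //; cont.
    have ca : continuous (fun t : R => (m, t / (1 + `|t|))) by cont.
    exact: (continuous_comp2 ca cF).
  have gI (t : R) : 0 <= t -> unitI (t / (1 + `|t|)) /\ t / (1 + `|t|) < 1.
    move=> t0; rewrite ger0_norm // /unitI ltr_pdivrMr; last lra.
    rewrite divr_ge0 ?ler_pdivrMr /=; try lra.
  have qG t : 0 <= t -> pproj (G t) = cpath (m, t).
    move=> t0; have [u1 u2] := gI t t0.
    have [_ ->//] := HF m; rewrite /hpath /= u2; congr (cpath (_, _)).
    by rewrite ger0_norm //; field; apply/andP; split; lra.
  have um : upt (fold (pproj m)) by rewrite fold_unpunct pproj_unpunct.
  pose K : R := (size (plab m)).+1%:R.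
  have K0 : 0 <= K by rewrite ler0n.
  have GK : G K = m.
    rewrite -[RHS]wpt_fold; apply: wpath_lift => //; first exact: plab_reduced.
      by rewrite /= normr_ge0.
      by rewrite /G mul0r; have [->] := HF m.
    by move=> t /andP[t0 _]; rewrite qG.
  have [s0 s1] := gI K K0; set s := K / (1 + `|K|) in s0 s1.
  rewrite -[RHS]GK; pose G1 t := F (m, s + t * (1 - s)).
  have cG1 : continuous G1.
    have ca : continuous (fun t : R => (m, s + t * (1 - s))) by cont.
    exact: (continuous_comp2 ca cF).
  (* From the time when the canonical path is over, the projection of the lift is constant, hence so
     is the lift. *)
  have e1 : F (m, 1) = G1 1 by rewrite /G1 mul1r addrC subrK.
  rewrite e1 -/s; apply: (cov_upl (pproj_covers R N) cG1 (@contcst R _ (G K))) => //.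
  - move=> t tI; have tI' : unitI (s + t * (1 - s)).
      by move: s0 tI; rewrite /unitI => /andP[? ?] /andP[? ?]; apply/andP; split; nra.
    rewrite GK /G1; have [_ ->//] := HF m.
    rewrite /hpath /=; case: ifP => // h; apply: cpath_end.
    rewrite ler_pdivlMr; last lra.
    have : K = s * (1 + K) by rewrite /s ger0_norm //; field; lra.
    rewrite -/K; move: s0 tI h; rewrite /unitI => /andP[? ?] /andP[? ?] h e.
    have : s <= s + t * (1 - s) by nra.
    by move: (s + t * (1 - s)) => r; nra.
  - by rewrite /G1 mul0r addr0.
  - exact: unitI1.
exists (pbase R N), (fun p => F (p.1, 1 - p.2)); split.
  have ca : continuous (fun p : pcover R N * R => (p.1, 1 - p.2)) by cont.
  exact: (continuous_comp2 ca cF).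
by move=> z /=; rewrite subr0 subrr F1; have [->] := HF z.
Qed.

End PuncturedPlaneContraction.

(** * Trivialising disjoint sections of the plane *)

(** Compactness of [K] makes the infimum of [phi (b, _)] over it positive and continuous in [b];
    half of it is a strict bound. *)
Lemma continuous_lower_bound {R : realType} (B X : topologicalType) (K : set X)
    (phi : B * X -> R) : compact K -> K !=set0 -> continuous phi ->
  (forall b x, K x -> 0 < phi (b, x)) ->
  exists delta : B -> R, [/\ continuous delta, forall b, 0 < delta b &
    forall b x, K x -> delta b < phi (b, x)].
Proof.
move=> cK [x0 Kx0] cphi phi0.
have near0 b0 (e : R) : 0 < e ->
    \forall b \near b0, forall x, K x -> `|phi (b, x) - phi (b0, x)| < e.
  move=> e0; move/compact_near_coveringP : cK => /(_ B (nbhs b0)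
    (fun b x => `|phi (b, x) - phi (b0, x)| < e)); apply => x Kx.
  have c1 : continuous (fun p : X * B => `|phi (p.2, p.1) - phi (b0, p.1)|).
    have ca : continuous (fun p : X * B => phi (p.2, p.1)).
      have cs : continuous (fun p : X * B => (p.2, p.1)) by cont.
      exact: (continuous_comp2 cs cphi).
    have cb : continuous (fun p : X * B => phi (b0, p.1)).
      have cs : continuous (fun p : X * B => (b0, p.1)) by cont.
      exact: (continuous_comp2 cs cphi).
    by cont.
  have e1 : `|phi ((x, b0).2, (x, b0).1) - phi (b0, (x, b0).1)| < e.
    by rewrite subrr normr0.
  exact: (near_ltc c1 e1).
pose S b : set R := [set phi (b, x) | x in K].
have Slb b : has_lbound (S b) by exists 0 => _ [x Kx <-]; exact/ltW/phi0.
have S0 b : S b !=set0 by exists (phi (b, x0)); exists x0.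
pose m b := inf (S b).
have mle b x : K x -> m b <= phi (b, x).
  by move=> Kx; apply: ge_inf => //; exists x.
have mpos b : 0 < m b.
  have [x Kx xmin] : exists2 x, K x & forall y, K y -> phi (b, x) <= phi (b, y).
    have cb : continuous (fun x => phi (b, x)).
      have cs : continuous (fun x : X => (b, x)) by cont.
      exact: (continuous_comp2 cs cphi).
    have [c cK' h] := compact_EVT_min (ex_intro _ x0 Kx0) cK
      (continuous_subspaceT cb).
    by exists c => [|y Ky]; [exact: set_mem|apply: h; exact: mem_set].
  apply: lt_le_trans (phi0 b x Kx) _; apply: lb_le_inf => //.
  by move=> _ [y Ky <-]; exact: xmin.
have mc : continuous m.
  move=> b V mV; have [e e0 He] := nbhs_R mV.
  have e20 : 0 < e / 2 by lra.
  suff : \forall b' \near b, V (m b') by [].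
  have := near0 b _ e20; apply: filterS => b' h; apply: He.
  have h1 : m b - e / 2 <= m b'.
    apply: lb_le_inf => // _ [x Kx <-]; have := mle b x Kx.
    by have := h x Kx; rewrite ltr_distl; lra.
  have h2 : m b' - e / 2 <= m b.
    apply: lb_le_inf => // _ [x Kx <-]; have := mle b' x Kx.
    by have := h x Kx; rewrite ltr_distl; lra.
  by rewrite ltr_distl; lra.
exists (fun b => m b / 2); split.
- by cont.
- by move=> b; have := mpos b; lra.
- by move=> b x Kx; have := mle b x Kx; have := mpos b; lra.
Qed.

(** * Homeomorphisms moving one point and supported in a square *)

Section Cone.
Variable R : realType.
Local Notation P2 := (R * R)%type.

(* The gauge, seen from a point at offset [u] from its centre, of a square of
   radius [r]. *)
Definition gauge (u : P2) (r : R) (f : P2) : R :=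
  Num.max (Num.max (f.1 / (r - u.1)) (- f.1 / (r + u.1)))
          (Num.max (f.2 / (r - u.2)) (- f.2 / (r + u.2))).

Definition in_square (u : P2) (r : R) :=
  [/\ - r < u.1, u.1 < r, - r < u.2 & u.2 < r].

(* The homeomorphism of the plane, supported in a square, moving the point [a]
   of offset [u] by [d] and linear on the segments from [a] to the boundary. *)
Definition cone (a u d : P2) (r : R) (w : P2) : P2 :=
  let l := Num.max 0 (1 - gauge u r (w.1 - a.1, w.2 - a.2)) in
  (w.1 + l * d.1, w.2 + l * d.2).

Lemma gauge_le u r f y : in_square u r -> (gauge u r f <= y) =
  [&& f.1 <= y * (r - u.1), - f.1 <= y * (r + u.1),
      f.2 <= y * (r - u.2) & - f.2 <= y * (r + u.2)].
Proof.
move=> [h1 h2 h3 h4]; rewrite /gauge !ge_max !ler_pdivrMr; try lra.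
Qed.

Lemma gauge_lt u r f y : in_square u r -> (gauge u r f < y) =
  [&& f.1 < y * (r - u.1), - f.1 < y * (r + u.1),
      f.2 < y * (r - u.2) & - f.2 < y * (r + u.2)].
Proof.
move=> [h1 h2 h3 h4]; rewrite /gauge !gt_max !ltr_pdivrMr; try lra.
Qed.

(** A cone map carries the gauge centred at the apex to the gauge centred at the displaced apex: [w]
    and its image have the same gauge value if it is at most 1, so the opposite displacement cancels
    with the same coefficient. *)
Lemma coneK a u d r w : in_square u r -> in_square (u.1 + d.1, u.2 + d.2) r ->
  cone (a.1 + d.1, a.2 + d.2) (u.1 + d.1, u.2 + d.2) (- d.1, - d.2) r
    (cone a u d r w) = w.
Proof.
move=> su sd; have [s1 s2 s3 s4] := su; have [t1 t2 t3 t4] : [/\ - r < u.1 + d.1, u.1 + d.1 < r,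
  - r < u.2 + d.2 & u.2 + d.2 < r] := sd.
rewrite {2}/cone; set f := (w.1 - a.1, _); set g := gauge u r f.
have [g1|g1] := leP g 1.
  have -> : Num.max 0 (1 - g) = 1 - g by apply: max_r; lra.
  rewrite /cone /=; set f' := (X in gauge _ r X).
  have -> : gauge (u.1 + d.1, u.2 + d.2) r f' = g.
    have := lexx g; rewrite {1}/g gauge_le // /f /= => /and4P[p1 p2 p3 p4].
    apply/eqP; rewrite eq_le; apply/andP; split.
      by rewrite gauge_le // /f' /=; apply/and4P; split; nra.
    rewrite leNgt; apply/negP => lt; set y := gauge _ _ f' in lt.
    have := lexx y; rewrite {1}/y gauge_le // /f' /= => /and4P[q1 q2 q3 q4].
    have m1 : y * (r - (u.1 + d.1)) < g * (r - (u.1 + d.1)) by rewrite ltr_pM2r //; lra.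
    have m2 : y * (r + (u.1 + d.1)) < g * (r + (u.1 + d.1)) by rewrite ltr_pM2r //; lra.
    have m3 : y * (r - (u.2 + d.2)) < g * (r - (u.2 + d.2)) by rewrite ltr_pM2r //; lra.
    have m4 : y * (r + (u.2 + d.2)) < g * (r + (u.2 + d.2)) by rewrite ltr_pM2r //; lra.
    suff : g < g by rewrite ltxx.
    by rewrite {1}/g gauge_lt // /f /=; apply/and4P; split; lra.
  rewrite max_r; last lra.
  by case: w @f @g g1 @f' => x y /= *; congr (_, _); ring.
have -> : Num.max 0 (1 - g) = 0 by apply: max_l; lra.
rewrite /cone /=; set f' := (X in gauge _ r X).
rewrite max_l; first by case: w @f @g g1 @f' => x y /= *; congr (_, _); ring.
rewrite subr_le0 leNgt gauge_lt // /f' /=; apply/negP => /and4P[q1 q2 q3 q4].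
have : g < 1 by rewrite /g gauge_lt // /f /=; apply/and4P; split; lra.
by lra.
Qed.

Lemma coneK' a u d r w : in_square u r -> in_square (u.1 + d.1, u.2 + d.2) r ->
  cone a u d r (cone (a.1 + d.1, a.2 + d.2) (u.1 + d.1, u.2 + d.2)
    (- d.1, - d.2) r w) = w.
Proof.
move=> su sd.
have := @coneK (a.1 + d.1, a.2 + d.2) (u.1 + d.1, u.2 + d.2) (- d.1, - d.2) r w sd.
rewrite /= !addrK !opprK -!surjective_pairing => /(_ su); apply.
Qed.

Lemma cone_apex a u d r : cone a u d r a = (a.1 + d.1, a.2 + d.2).
Proof.
by rewrite /cone /gauge /= !subrr oppr0 !mul0r !maxxx subr0 max_r // !mul1r.
Qed.

Lemma cone_fix a d r w :
  0 < r -> r <= Num.max `|w.1 - a.1| `|w.2 - a.2| -> cone a (0, 0) d r w = w.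
Proof.
move=> r0 h; have s0 : in_square (0, 0) r by split => /=; lra.
rewrite /cone max_l; first by case: w h => x y /= _; rewrite !mul0r !addr0.
rewrite subr_le0 leNgt gauge_lt //=; apply/negP.
rewrite !subr0 !addr0 !mul1r => /and4P[h1 h2 h3 h4]; move: h; rewrite leNgt.
by rewrite gt_max !ltr_norml; lra.
Qed.

Lemma cone0 a u r w : cone a u (0, 0) r w = w.
Proof. by case: w => x y; rewrite /cone /= !mulr0 !addr0. Qed.

Lemma cone_continuous (T : topologicalType) (a u d w : T -> P2) (r : T -> R) :
  (forall x, in_square (u x) (r x)) -> continuous a -> continuous u ->
  continuous d -> continuous r -> continuous w ->
  continuous (fun x => cone (a x) (u x) (d x) (r x) (w x)).
Proof.
move=> sq ca cu cd cr cw.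
have c1 : continuous (fun x => (r x - (u x).1)^-1).
  by apply: contV; [move=> x; have [? ? ? ?] := sq x; apply/eqP; lra|cont].
have c2 : continuous (fun x => (r x + (u x).1)^-1).
  by apply: contV; [move=> x; have [? ? ? ?] := sq x; apply/eqP; lra|cont].
have c3 : continuous (fun x => (r x - (u x).2)^-1).
  by apply: contV; [move=> x; have [? ? ? ?] := sq x; apply/eqP; lra|cont].
have c4 : continuous (fun x => (r x + (u x).2)^-1).
  by apply: contV; [move=> x; have [? ? ? ?] := sq x; apply/eqP; lra|cont].
by rewrite /cone /gauge /=; cont.
Qed.

End Cone.

(** * Pushing a point along a homotopy in the punctured plane *)

Section Push.
Variables (R : realType) (N : nat) (B : topologicalType).
Local Notation P2 := (R * R)%type.
Local Notation upt := (@unpunct R N).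

(** The cap 1 gives a value when there are no punctures. *)
Definition puncture_radius (z : P2) : R := \big[Num.min/1]_(i < N) sdist i%:R z.

Lemma puncture_radius_gt0 z : upt z -> 0 < puncture_radius z.
Proof.
move=> uz; rewrite /puncture_radius; elim/big_ind : _ => // [x y x0 y0|i _].
  by rewrite lt_min x0.
exact: (@sdist_gt0 R N).
Qed.

Lemma puncture_radius_le z (i : 'I_N) : puncture_radius z <= sdist i%:R z.
Proof. by rewrite /puncture_radius (bigD1 i) //= ge_min lexx. Qed.

Lemma puncture_radius_continuous : continuous puncture_radius.
Proof.
rewrite /puncture_radius.
elim: (index_enum _) => [|i s IH].
  by rewrite (_ : (fun _ => _) = fun _ => 1);
    [exact: contcst|apply/funext => z; rewrite big_nil].
rewrite (_ : (fun _ => _) = fun z => Num.min (sdist i%:R z)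
  (\big[Num.min/1]_(j <- s) sdist j%:R z)).
  by apply: contmin => //; rewrite /sdist; cont.
by apply/funext => z; rewrite big_cons.
Qed.

Definition homeo_family (h h' : B * P2 -> P2) :=
  [/\ continuous h, continuous h', forall b w, h' (b, h (b, w)) = w &
      forall b w, h (b, h' (b, w)) = w].

(** Point pushing: each track is cut into steps so short that a cone map, in an open square without
    punctures, performs each of them. The length [delta b] of a step varies with [b], so the number
    of steps is unbounded; the composition is still locally finite, because the steps past time 1
    are trivial. *)
Lemma push_homotopy (F : B * R -> P2) : continuous F ->
  (forall b t, unitI t -> upt (F (b, t))) ->
  exists h h', [/\ homeo_family h h',
    forall b (i : 'I_N), h (b, (i%:R, 0)) = (i%:R, 0) &
    forall b, h (b, F (b, 0)) = F (b, 1)].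
Proof.
move=> cF uF.
pose nrm (z z' : P2) := Num.max `|z.1 - z'.1| `|z.2 - z'.2|.
(* Positive, since the second term is when the two times agree. Two times no farther apart than a
   strict lower bound of [phi] force the second term to exceed that bound: the displacement is less
   than half the distance to the punctures. *)
pose phi (p : B * (R * R)) := Num.max `|p.2.1 - p.2.2|
  (puncture_radius (F (p.1, p.2.1)) / 2 - nrm (F (p.1, p.2.1)) (F (p.1, p.2.2))).
have cphi : continuous phi.
  have c1 : continuous (fun p : B * (R * R) => F (p.1, p.2.1)).
    have cs : continuous (fun p : B * (R * R) => (p.1, p.2.1)) by cont.
    exact: (continuous_comp2 cs cF).
  have c2 : continuous (fun p : B * (R * R) => F (p.1, p.2.2)).
    have cs : continuous (fun p : B * (R * R) => (p.1, p.2.2)) by cont.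
    exact: (continuous_comp2 cs cF).
  have c3 : continuous (fun p : B * (R * R) => puncture_radius (F (p.1, p.2.1))).
    exact: (continuous_comp2 c1 puncture_radius_continuous).
  by rewrite /phi /nrm; cont.
pose K : set (R * R) := [set t | unitI t] `*` [set t | unitI t].
have cK : compact K.
  have c1 : compact [set t : R | unitI t].
    rewrite (_ : [set t | unitI t] = `[0, 1]%classic).
      exact: segment_compact.
    by apply/seteqP; split => t; rewrite /= in_itv.
  exact: compact_setX.
have [||delta [cd d0 dlt]] := continuous_lower_bound cK _ cphi.
- by exists (0, 0); split; exact: unitI0.
- move=> b [t t'] [/= tI t'I]; rewrite /phi /= lt_max normr_gt0 subr_eq0.
  have [->|//] := eqVneq t t'.
  by rewrite /nrm !subrr !normr0 maxxx subr0 divr_gt0 // puncture_radius_gt0 // uF.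
pose a (k : nat) b := F (b, clamp (k%:R * delta b)).
have ca k : continuous (a k).
  have cs : continuous (fun b => (b, clamp (k%:R * delta b))) by cont.
  exact: (continuous_comp2 cs cF).
have ua k b : upt (a k b) by apply: uF; exact: clampI.
pose v k b : P2 := ((a k.+1 b).1 - (a k b).1, (a k.+1 b).2 - (a k b).2).
have cv k : continuous (v k).
  by have := ca k; have := ca k.+1 => c1 c2; rewrite /v; cont.
pose r k b := puncture_radius (a k b).
have cr k : continuous (r k).
  exact: (continuous_comp2 (ca k) puncture_radius_continuous).
have r0 k b : 0 < r k b by exact: puncture_radius_gt0.
have sq0 k b : in_square (0, 0) (r k b) by have := r0 k b; split => /=; lra.
have dk k b : `|clamp (k%:R * delta b) - clamp (k.+1%:R * delta b)| <= delta b.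
  rewrite -natr1 mulrDl mul1r; move: (k%:R * delta b) (d0 b) => x dd.
  rewrite /clamp /Num.max /Num.min ler_norml.
  by do ![case: ifP]; lra.
have sqv k b : in_square (v k b) (r k b).
  have h : delta b < phi (b, (clamp (k%:R * delta b), clamp (k.+1%:R * delta b))).
    by apply: dlt; split; exact: clampI.
  move: h; rewrite /phi lt_max /= ltNge dk /= => h.
  have : nrm (a k b) (a k.+1 b) < r k b.
    by move: h (d0 b) (r0 k b); rewrite /r /a; lra.
  by rewrite /nrm gt_max !ltr_norml /v; split => /=; lra.
pose h := fix h k b w := if k is k'.+1 then
  cone (a k' b) (0, 0) (v k' b) (r k' b) (h k' b w) else w : P2.
pose h' := fix h' k b w := if k is k'.+1 then
  h' k' b (cone (a k'.+1 b) (v k' b) (- (v k' b).1, - (v k' b).2) (r k' b) w)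
  else w : P2.
have ae k b : a k.+1 b = ((a k b).1 + (v k b).1, (a k b).2 + (v k b).2).
  by rewrite /v /= !subrKC -surjective_pairing.
have ve k b : v k b = ((0 : R, 0 : R).1 + (v k b).1, (0 : R, 0 : R).2 + (v k b).2).
  by rewrite [LHS]surjective_pairing /= !add0r.
have cK1 k b w : cone (a k.+1 b) (v k b) (- (v k b).1, - (v k b).2) (r k b)
    (cone (a k b) (0, 0) (v k b) (r k b) w) = w.
  have := @coneK R (a k b) (0, 0) (v k b) (r k b) w (sq0 k b).
  by rewrite -ae -ve; apply; exact: sqv.
have cK2 k b w : cone (a k b) (0, 0) (v k b) (r k b)
    (cone (a k.+1 b) (v k b) (- (v k b).1, - (v k b).2) (r k b) w) = w.
  have := @coneK' R (a k b) (0, 0) (v k b) (r k b) w (sq0 k b).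
  by rewrite -ae -ve; apply; exact: sqv.
have hK k b w : h' k b (h k b w) = w.
  by elim: k w => //= k IH w; rewrite cK1.
have h'K k b w : h k b (h' k b w) = w.
  by elim: k w => //= k IH w; rewrite IH cK2.
have ch k : continuous (fun p : B * P2 => h k p.1 p.2).
  elim: k => [|k IH] /=; first by cont.
  have c1 := continuous_comp2 (@continuous_fstE B P2) (ca k).
  have c2 := continuous_comp2 (@continuous_fstE B P2) (cv k).
  have c3 := continuous_comp2 (@continuous_fstE B P2) (cr k).
  by apply: cone_continuous => //; cont.
(* In the inverse the newest cone is applied first, so the induction has to let [w] vary. *)
have ch' k (T : topologicalType) (b : T -> B) (w : T -> P2) :
    continuous b -> continuous w -> continuous (fun x => h' k (b x) (w x)).
  elim: k w => [|k IH] w cb cw //=; apply: IH => //.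
  have c0 : continuous (fun x => a k (b x)) := continuous_comp2 cb (ca k).
  have c1 : continuous (fun x => a k.+1 (b x)) := continuous_comp2 cb (ca k.+1).
  have c2 : continuous (fun x => v k (b x)) := continuous_comp2 cb (cv k).
  have c3 : continuous (fun x => r k (b x)) := continuous_comp2 cb (cr k).
  by apply: cone_continuous => //; cont.
have stable k b : 1 <= k%:R * delta b -> v k b = (0, 0).
  move=> kd; rewrite /v /a !clamp_ge1 ?subrr //.
  by apply: le_trans kd _; rewrite ler_pM2r // ler_nat.
have stableh k n b w : 1 <= k%:R * delta b -> h (n + k)%N b w = h k b w.
  move=> kd; elim: n => //= n <-; rewrite stable ?cone0 //.
  by apply: le_trans kd _; rewrite ler_pM2r // ler_nat leq_addl.
have stableh' k n b w : 1 <= k%:R * delta b -> h' (n + k)%N b w = h' k b w.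
  move=> kd; elim: n w => //= n IH w.
  have kd' : 1 <= (n + k)%:R * delta b.
    by apply: le_trans kd _; rewrite ler_pM2r // ler_nat leq_addl.
  have := stable _ _ kd'; rewrite /v => -[e1 e2].
  by rewrite e1 e2 /= oppr0 cone0.
(* The number of steps is not continuous in [b], but beyond 1 / delta b the composition does not
   depend on it, so near any point a common number serves. *)
pose n b := Num.bound (delta b)^-1.
have nP b : 1 <= (n b)%:R * delta b.
  have : (delta b)^-1 < (n b)%:R.
    by apply: archi_boundP; rewrite invr_ge0 ltW.
  by rewrite -(ltr_pM2r (d0 b)) mulVf ?gt_eqF // => /ltW.
have he k b w : 1 <= k%:R * delta b -> h (n b) b w = h k b w.
  move=> kd; rewrite -(stableh _ k b w (nP b)) addnC.
  by rewrite -(stableh _ (n b) b w kd).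
have he' k b w : 1 <= k%:R * delta b -> h' (n b) b w = h' k b w.
  move=> kd; rewrite -(stableh' _ k b w (nP b)) addnC.
  by rewrite -(stableh' _ (n b) b w kd).
have nearn (b : B) : exists k : nat, \forall b' \near b, 1 <= k%:R * delta b'.
  exists (Num.bound (delta b / 2)^-1).
  have hd : delta b / 2 < delta b by have := d0 b; lra.
  have := near_gtc cd hd; apply: filterS => b' hb.
  have : (delta b / 2)^-1 < (Num.bound (delta b / 2)^-1)%:R.
    by apply: archi_boundP; rewrite invr_ge0; have := d0 b; lra.
  have d2 : 0 < delta b / 2 by have := d0 b; lra.
  rewrite -(ltr_pM2r d2) mulVf ?gt_eqF // => /ltW h1; apply: le_trans h1 _.
  by rewrite ler_wpM2l ?ler0n // ltW.
exists (fun p => h (n p.1) p.1 p.2), (fun p => h' (n p.1) p.1 p.2); split.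
- split => //.
  + move=> [b w]; have [k nk] := nearn b.
    apply: (@continuous_at_near _ _ _ (fun p : B * P2 => h k p.1 p.2) (b, w)); last exact: ch.
    have nk' : nbhs (b, w) [set p : B * P2 | 1 <= k%:R * delta p.1] :=
      @continuous_fstE B P2 (b, w) _ nk.
    by apply: filterS nk' => p /= hp; exact: he.
  + move=> [b w]; have [k nk] := nearn b.
    apply: (@continuous_at_near _ _ _ (fun p : B * P2 => h' k p.1 p.2) (b, w)).
      have nk' : nbhs (b, w) [set p : B * P2 | 1 <= k%:R * delta p.1] :=
        @continuous_fstE B P2 (b, w) _ nk.
      by apply: filterS nk' => p /= hp; exact: he'.
    by apply: ch'; [exact: continuous_fstE|exact: continuous_sndE].
  + by move=> b w; exact: hK.
  + by move=> b w; exact: h'K.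
- move=> b i; change (h (n b) b (i%:R, 0) = (i%:R, 0)).
  elim: (n b) => //= k ->; apply: cone_fix => //=.
  have := puncture_radius_le (a k b) i; rewrite /sdist -/(r k b) => h1.
  by rewrite distrC [`|0 - _|]distrC subr0.
- move=> b; change (h (n b) b (F (b, 0)) = F (b, 1)); have e k : h k b (F (b, 0)) = a k b.
    elim: k => [|k /= ->]; first by rewrite /a /= mul0r clamp0.
    by rewrite cone_apex -ae.
  by rewrite e /a clamp_ge1.
Qed.

End Push.

(** Once the earlier sections are the points 0, ..., N - 1, the last one is a map from the
    contractible [B] to the plane punctured there. It is homotopic to the constant N, and pushing
    along the homotopy moves it there without moving the punctures. *)
Lemma trivialise_sections (R : realType) (B : topologicalType) (N : nat)
    (f : nat -> B -> R * R) : contractible R B -> (forall i, continuous (f i)) ->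
  (forall i j b, (i < N)%N -> (j < N)%N -> f i b = f j b -> i = j) ->
  exists h h', homeo_family h h' /\
    forall b i, (i < N)%N -> h (b, f i b) = (i%:R, 0).
Proof.
move=> [e [H [cH HH]]] cf; elim: N => [|N IH] f_inj.
  exists snd, snd; split => //; split => //; exact: continuous_sndE.
have [|h [h' [[ch ch' hK h'K] hf]]] := IH.
  by move=> i j b iN jN; apply: f_inj; exact: ltnW.
pose g b := h (b, f N b).
have cg : continuous g.
  have cs : continuous (fun b => (b, f N b)).
    by apply: continuous_pairR; [exact: continuous_idE|exact: cf].
  exact: (continuous_comp2 cs ch).
have ug b : unpunct N (g b).
  rewrite /unpunct; case: eqVneq => //= g2; apply/forallP => i; apply/eqP => g1.
  have /(congr1 (fun w => h' (b, w))) : g b = h (b, f i b).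
    by rewrite hf // [LHS]surjective_pairing g1 g2.
  rewrite /g !hK => /f_inj => /(_ (leqnn _) (ltnW (ltn_ord i))) Ni.
  by have := ltn_ord i; rewrite -Ni ltnn.
have uN : unpunct N (N%:R : R, 0 : R).
  apply/orP; right; apply/forallP => i /=.
  by rewrite eqr_nat gtn_eqF.
(* After the contraction to the constant [g e], an arc within one closed half plane leads to the
   point N; it is run backwards since this arc starts at N. *)
pose p (t : R) := flip ((g e).2 < 0) (arc (N%:R, 0) (fold (g e)) (1 - clamp t)).
have cp : continuous p by apply: flip_continuous; apply: arc_continuous; cont.
have up t : unpunct N (p t).
  rewrite /p flip_unpunct; apply: (arc_unpunct uN _ (lexx 0) _ _).1.
    by rewrite fold_unpunct.
    exact: normr_ge0.
  by have := clampI t; rewrite /unitI; lra.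
have p0 : p 0 = g e by rewrite /p clamp0 subr0 arc1 flip_fold.
have p1 : p 1 = (N%:R, 0).
  by rewrite /p clamp_ge1 // subrr arc0 flip_real.
pose F (q : B * R) := if q.2 <= 2^-1 then g (H (q.1, 2 * q.2)) else p (2 * q.2 - 1).
have cF : continuous F.
  apply: (@glue_continuous _ _ _ snd); first exact: continuous_sndE.
  - have cs : continuous (fun q : B * R => (q.1, 2 * q.2)) by cont.
    exact: (continuous_comp2 (continuous_comp2 cs cH) cg).
  - have cs : continuous (fun q : B * R => 2 * q.2 - 1) by cont.
    exact: (continuous_comp2 cs cp).
  - move=> [b t] /= ->; rewrite mulfV ?pnatr_eq0 // subrr p0.
    by have [_ ->] := HH b.
have [|k [k' [[ck ck' kK k'K] kfix kF]]] := push_homotopy cF (N := N).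
  by move=> b t _; rewrite /F; case: ifP.
have F0 b : F (b, 0) = g b.
  by rewrite /F /= mulr0 invr_ge0 ler0n; have [->] := HH b.
have F1 b : F (b, 1) = (N%:R, 0).
  rewrite /F /= ifF; last by apply/negbTE; rewrite -ltNge; lra.
  by rewrite -[RHS]p1; congr p; lra.
exists (fun q => k (q.1, h q)), (fun q => h' (q.1, k' q)); split; first split.
- have cs : continuous (fun q : B * (R * R) => (q.1, h q)) by cont.
  exact: (continuous_comp2 cs ck).
- have cs : continuous (fun q : B * (R * R) => (q.1, k' q)) by cont.
  exact: (continuous_comp2 cs ch').
- by move=> b w /=; rewrite kK hK.
- by move=> b w /=; rewrite h'K k'K.
- move=> b i /=; rewrite ltnS leq_eqVlt => /orP[/eqP ->|iN].
    by rewrite -/(g b) -F0 kF F1.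
  by rewrite hf // (kfix b (Ordinal iN)).
Qed.

(** * Contractible covers of configuration spaces *)

Section PlaneTopology.
Variable R : realType.
Local Notation C := (plane R).

Lemma plane_nbhs (z : C) (V : set C) : nbhs z V ->
  exists2 e : R, 0 < e & forall w, `|complex.Re (w - z)| < e ->
    `|complex.Im (w - z)| < e -> V w.
Proof.
move=> /nbhs_ballP[[d d'] /= d0 HV]; move: d0; rewrite ltcE /= => /andP[/eqP e0 d0].
(* Half the radius is enough, as 2 (d / 2)^2 < d^2. *)
exists (d / 2); first by lra.
move=> w hr hi; apply: HV; rewrite /ball /= distrC normc_def ltcE /= e0 eqxx /=.
rewrite -(gtr0_norm d0) -sqrtr_sqr ltr_sqrt; last by rewrite exprn_gt0.
have q2 : (d ^+ 2 / 4) = (d / 2) ^+ 2 by field.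
have h1 : complex.Re (w - z) ^+ 2 < d ^+ 2 / 4.
  by rewrite q2 -real_normK ?num_real // ltrXn2r ?nnegrE //; lra.
have h2 : complex.Im (w - z) ^+ 2 < d ^+ 2 / 4.
  by rewrite q2 -real_normK ?num_real // ltrXn2r ?nnegrE //; lra.
have d2 : 0 < d ^+ 2 by rewrite exprn_gt0.
lra.
Qed.

Lemma plane_nbhsP (z : C) (e : R) : 0 < e ->
  \forall w \near z, `|complex.Re (w - z)| < e /\ `|complex.Im (w - z)| < e.
Proof.
move=> e0; apply/nbhs_ballP; exists (e%:C)%C => /=; first by rewrite ltcR.
move=> w; rewrite /ball /= distrC => h.
have hI : (`|complex.Im (w - z)|%:C)%C <= `|w - z|.
  rewrite normc_def lecR -sqrtr_sqr ler_wsqrtr // lerDr sqr_ge0 //.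
split; rewrite -ltcR; first exact: le_lt_trans (normc_ge_Re _) h.
exact: le_lt_trans hI h.
Qed.

Lemma ReB (z w : C) : complex.Re (z - w) = complex.Re z - complex.Re w.
Proof. by case: z; case: w. Qed.

Lemma ImB (z w : C) : complex.Im (z - w) = complex.Im z - complex.Im w.
Proof. by case: z; case: w. Qed.

Lemma Re_continuous : continuous (fun z : C => complex.Re z).
Proof.
move=> z V zV; have [e e0 He] := nbhs_R zV.
suff : \forall w \near z, V (complex.Re w) by [].
have := plane_nbhsP z e0; apply: filterS => w [h _].
by apply: He; rewrite -ReB.
Qed.

Lemma Im_continuous : continuous (fun z : C => complex.Im z).
Proof.
move=> z V zV; have [e e0 He] := nbhs_R zV.
suff : \forall w \near z, V (complex.Im w) by [].
have := plane_nbhsP z e0; apply: filterS => w [_ h].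
by apply: He; rewrite -ImB.
Qed.

Lemma Complex_continuous (T : topologicalType) (f g : T -> R) :
  continuous f -> continuous g -> continuous (fun x => Complex (f x) (g x) : C).
Proof.
move=> cf cg x V xV; have [e e0 He] := plane_nbhs xV.
have n1 : nbhs x (f @^-1` [set s : R | `|s - f x| < e]) := cf x _ (near_R (f x) e0).
have n2 : nbhs x (g @^-1` [set s : R | `|s - g x| < e]) := cg x _ (near_R (g x) e0).
suff : \forall y \near x, V (Complex (f y) (g y)) by [].
by move: n1 n2; apply: filterS2 => y h1 h2; exact: He.
Qed.

Definition to_plane (p : R * R) : C := Complex p.1 p.2.
Definition of_plane (z : C) : R * R := (complex.Re z, complex.Im z).

Lemma to_planeK p : of_plane (to_plane p) = p. Proof. by case: p. Qed.
Lemma of_planeK z : to_plane (of_plane z) = z. Proof. by case: z. Qed.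

Lemma to_plane_continuous : continuous to_plane.
Proof. by apply: Complex_continuous; [exact: continuous_fstE|exact: continuous_sndE]. Qed.

Lemma of_plane_continuous : continuous of_plane.
Proof. by apply: continuous_pairR; [exact: Re_continuous|exact: Im_continuous]. Qed.

Section Rules.
Variable T : topologicalType.
Implicit Types f g : T -> C.

Lemma contDC f g : continuous f -> continuous g -> continuous (fun x => f x + g x).
Proof. by move=> cf cg x; apply: cvgD; [exact: cf|exact: cg]. Qed.

Lemma contNC f : continuous f -> continuous (fun x => - f x).
Proof. by move=> cf x; apply: cvgN; exact: cf. Qed.

Lemma contMC f g : continuous f -> continuous g -> continuous (fun x => f x * g x).
Proof. by move=> cf cg x; apply: cvgM; [exact: cf|exact: cg]. Qed.

Lemma contXC f n : continuous f -> continuous (fun x => f x ^+ n).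
Proof.
move=> cf; elim: n => [|n IH]; first exact: cst_continuous.
rewrite (_ : (fun x => _) = fun x => f x * f x ^+ n); first exact: contMC.
by apply/funext => x; rewrite exprS.
Qed.

Lemma cont_sumC (I : finType) (f : I -> T -> C) :
  (forall i, continuous (f i)) -> continuous (fun x => \sum_i f i x).
Proof.
move=> cf; elim: (index_enum I) => [|i s IH].
  rewrite (_ : (fun x => _) = fun=> 0); first exact: cst_continuous.
  by apply/funext => x; rewrite big_nil.
rewrite (_ : (fun x => _) = fun x => f i x + \sum_(j <- s) f j x).
  exact: (contDC (cf i) IH).
by apply/funext => x; rewrite big_cons.
Qed.

Lemma cont_row n (f : T -> 'rV[C]_n) :
  (forall j, continuous (fun x => f x 0 j)) -> continuous f.
Proof.
move=> cf x V [P xP PV].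
have H : \forall y \near x, forall j, P 0 j (f y 0 j).
  suff : \forall y \near x, forall j, j \in enum 'I_n -> P 0 j (f y 0 j).
    by apply: filterS => y h j; apply: h; rewrite mem_enum.
  elim: (enum 'I_n) => [|j s IH]; first exact: near_all.
  have n1 : nbhs x [set y | P 0 j (f y 0 j)] := cf j x _ (xP 0 j).
  move: n1 IH; apply: filterS2 => y h1 h2 i.
  by rewrite inE => /orP[/eqP ->|/h2].
suff : \forall y \near x, V (f y) by [].
by apply: filterS H => y h; apply: PV => i j; rewrite (ord1 i).
Qed.

Lemma cont_entry n (f : T -> 'rV[C]_n) j :
  continuous f -> continuous (fun x => f x 0 j).
Proof.
move=> cf x V xV.
have : nbhs (f x) [set w : 'rV[C]_n | V (w 0 j)].
  exists (fun i k => if k == j then V else setT).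
    move=> i k; case: eqP => [->|_]; last exact: filterT.
    by rewrite (ord1 i).
  by move=> w /(_ 0 j); rewrite eqxx.
exact: (cf x).
Qed.

End Rules.

End PlaneTopology.

Section CoverTransfer.
Variable R : realType.

Lemma covers_homeo (M T T' : topologicalType) (A : set T) (A' : set T')
    (q : M -> T) (phi : T -> T') (psi : T' -> T) :
  covers R A q -> continuous phi -> continuous psi ->
  (forall x, A x -> A' (phi x) /\ psi (phi x) = x) ->
  (forall y, A' y -> A (psi y) /\ phi (psi y) = y) -> covers R A' (phi \o q).
Proof.
move=> cq cphi cpsi h1 h2.
have inj m m' : phi (q m) = phi (q m') -> q m = q m'.
  move=> e; have [_ <-] := h1 _ (cov_in cq m).
  by have [_ <-] := h1 _ (cov_in cq m'); rewrite e.
constructor.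
- exact: (continuous_comp2 (cov_cont cq) cphi).
- by move=> m; have [] := h1 _ (cov_in cq m).
- move=> y /h2[/(cov_surj cq)[m qm] e]; exists m; by rewrite /= qm.
- move=> m; have [V mV HV] := cov_locinj cq m; exists V => // m1 m2 v1 v2 /inj.
  exact: HV.
- move=> G G' cG cG' e; apply: (cov_upl cq) => // t tI; apply: inj; exact: e.
- move=> Z f f0 cf Af cf0 e0.
  have [||||F [cF HF]] := cov_hlp cq (f := psi \o f) (f0 := f0).
  + exact: (continuous_comp2 cf cpsi).
  + by move=> z t tI; have [] := h2 _ (Af z t tI).
  + by [].
  + move=> z /=; rewrite -e0 /=; by have [_ ->] := h1 _ (cov_in cq (f0 z)).
  exists F; split => // z; have [-> H] := HF z; split => // t tI /=.
  by rewrite H //=; have [_ ->] := h2 _ (Af z t tI).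
- move=> a; have [[m mq]|no] := pselect (exists m, phi (q m) = a).
    apply: sub_countable (cov_count cq (q m)); apply: subset_card_le => m' /= e.
    by apply: inj; rewrite e mq.
  rewrite (_ : _ @^-1` _ = set0); first exact: countable0.
  by apply/seteqP; split => // m /= e; exfalso; apply: no; exists m.
Qed.

Lemma covers_id (T : topologicalType) : covers R [set: T] (@idfun T).
Proof.
constructor => //.
- by move=> x; exact: cvg_id.
- by move=> a _; exists a.
- by move=> m; exists setT => //; exact: filterT.
- by move=> Z f f0 cf _ cf0 e0; exists f; split => // z; split => //; rewrite -e0.
- move=> a; rewrite (_ : _ @^-1` _ = [set a]); first exact: countable1.
  by apply/seteqP; split.
Qed.

Lemma contractible_prod (M M' : topologicalType) :
  contractible R M -> contractible R M' -> contractible R (M * M')%type.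
Proof.
move=> [e [H [cH HH]]] [e' [H' [cH' HH']]].
exists (e, e'), (fun p => (H (p.1.1, p.2), H' (p.1.2, p.2))); split.
  apply: continuous_pairR.
    have cs : continuous (fun p : (M * M') * R => (p.1.1, p.2)) by cont.
    exact: (continuous_comp2 cs cH).
  have cs : continuous (fun p : (M * M') * R => (p.1.2, p.2)) by cont.
  exact: (continuous_comp2 cs cH').
by move=> [m m'] /=; have [-> ->] := HH m; have [-> ->] := HH' m'.
Qed.

End CoverTransfer.

(** * The tower of configurations with distinct powers *)

Section Tower.
Variable R : realType.
Local Notation C := (plane R).
Variables (c : nat) (zeta : C).
Hypothesis prim : c.-primitive_root zeta.

(** Nonzero points in distinct orbits of the c-th roots of unity, that is, with distinct c-th
    powers. The case c = 1 leads to X^(n) and the general one to Y, so that one tower serves for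
    both. *)
Definition sep_conf m : set 'rV[C]_m := [set w | (forall j, w 0 j != 0) /\
  forall i j (k : nat), w 0 i = zeta ^+ k * w 0 j -> i = j].

Definition row_snoc m (w : 'rV[C]_m) (z : C) : 'rV[C]_m.+1 :=
  \row_j (if unlift ord_max j is Some i then w 0 i else z).
Definition row_init m (w : 'rV[C]_m.+1) : 'rV[C]_m := \row_i w 0 (lift ord_max i).

Lemma row_snocK m (w : 'rV[C]_m) z : row_init (row_snoc w z) = w.
Proof. by apply/rowP => i; rewrite !mxE liftK. Qed.

Lemma row_snoc_last m (w : 'rV[C]_m) z : row_snoc w z 0 ord_max = z.
Proof. by rewrite mxE unlift_none. Qed.

Lemma row_snoc_eta m (w : 'rV[C]_m.+1) : row_snoc (row_init w) (w 0 ord_max) = w.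
Proof.
apply/rowP => j; rewrite mxE; case: unliftP => [i ->|->//]; by rewrite mxE.
Qed.

Lemma row_snoc_continuous m (T : topologicalType) (w : T -> 'rV[C]_m) (z : T -> C) :
  continuous w -> continuous z -> continuous (fun x => row_snoc (w x) (z x)).
Proof.
move=> cw cz; apply: cont_row => j.
rewrite (_ : (fun x => _) = fun x => if unlift ord_max j is Some i then w x 0 i else z x).
  by case: unlift => [i|]; [exact: (@cont_entry R T m w i cw)|exact: cz].
by apply/funext => x; rewrite mxE.
Qed.

Lemma row_init_continuous m : continuous (@row_init m).
Proof.
apply: cont_row => j; rewrite (_ : (fun x => _) = fun x : 'rV[C]_m.+1 => x 0 (lift ord_max j)).
  by apply: cont_entry; exact: continuous_idE.
by apply/funext => x; rewrite mxE.
Qed.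

Definition row_nth m (w : 'rV[C]_m) (j : nat) : C := oapp (w 0) 0 (insub j).

(** The m c + 1 values forbidden to a further point: the origin at index 0, then the c rotated
    copies of each point of [w]. *)
Definition section m (w : 'rV[C]_m) (k : nat) : C :=
  if k is k'.+1 then zeta ^+ (k' %% c) * row_nth w (k' %/ c) else 0.

Let c0 : (0 < c)%N := prim_order_gt0 prim.

Let zeta0 : zeta != 0.
Proof.
apply/eqP => z0; have := prim_expr_order prim; rewrite z0 expr0n.
by case: (c) c0 => //= ? _ /eqP; rewrite eq_sym oner_eq0.
Qed.

Lemma row_nthE m (w : 'rV[C]_m) (j : nat) (jm : (j < m)%N) :
  row_nth w j = w 0 (Ordinal jm).
Proof. by rewrite /row_nth insubT. Qed.

Lemma section_inj m (w : 'rV[C]_m) k k' : sep_conf w ->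
  (k < (m * c).+1)%N -> (k' < (m * c).+1)%N ->
  section w k = section w k' -> k = k'.
Proof.
move=> [w0 wi]; case: k k' => [|k] [|k'] //=; rewrite ?ltnS.
- move=> _ h /esym /eqP; rewrite mulf_eq0 expf_eq0 (negbTE zeta0) andbF /=.
  have h' : (k' %/ c < m)%N by rewrite ltn_divLR.
  by rewrite row_nthE (negbTE (w0 _)).
- move=> h _ /eqP; rewrite mulf_eq0 expf_eq0 (negbTE zeta0) andbF /=.
  have h' : (k %/ c < m)%N by rewrite ltn_divLR.
  by rewrite row_nthE (negbTE (w0 _)).
move=> h h'; have hk : (k %/ c < m)%N by rewrite ltn_divLR.
have hk' : (k' %/ c < m)%N by rewrite ltn_divLR.
rewrite !row_nthE => e.
have e' : w 0 (Ordinal hk) = zeta ^+ ((c - k %% c) + k' %% c) * w 0 (Ordinal hk').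
  rewrite exprD -mulrA -e mulrA -exprD subnK ?prim_expr_order // ?mul1r //.
  by rewrite ltnW // ltn_pmod.
have := wi _ _ _ e' => -[dkk']; move: e; rewrite (_ : Ordinal hk = Ordinal hk'); last exact/val_inj.
move=> /(mulIf (w0 _)) /eqP; rewrite (eq_prim_root_expr prim) !modn_mod => /eqP ee.
by rewrite (divn_eq k c) (divn_eq k' c) dkk' ee.
Qed.

Lemma section_continuous m k : continuous (fun w : 'rV[C]_m => section w k).
Proof.
case: k => [|k] /=; first exact: contcst.
apply: contMC; first exact: contcst.
rewrite /row_nth; case: insubP => [i _ _|_] /=; last exact: contcst.
by apply: cont_entry; exact: continuous_idE.
Qed.

Lemma sep_conf_init m (w : 'rV[C]_m.+1) : sep_conf w ->
  sep_conf (row_init w) /\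
  forall k, (k < (m * c).+1)%N -> w 0 ord_max != section (row_init w) k.
Proof.
move=> [w0 wi]; split.
  split => [j|i j k]; rewrite !mxE // => /wi; exact: lift_inj.
case=> [_|k] /=; first exact: w0.
rewrite ltnS => h; have h' : (k %/ c < m)%N by rewrite ltn_divLR.
rewrite row_nthE mxE; apply/eqP => /wi e.
by have := neq_lift ord_max (Ordinal h'); rewrite -e eqxx.
Qed.

Lemma sep_conf_snoc m (w : 'rV[C]_m) z : sep_conf w ->
  (forall k, (k < (m * c).+1)%N -> z != section w k) -> sep_conf (row_snoc w z).
Proof.
move=> [w0 wi] zs.
have zw (j : 'I_m) (k : nat) : z != zeta ^+ k * w 0 j.
  have h : (j * c + k %% c < m * c)%N.
    apply: (@leq_trans (j * c + c)); first by rewrite ltn_add2l ltn_pmod.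
    by rewrite addnC -mulSn leq_mul2r ltn_ord orbT.
  have := zs (j * c + k %% c).+1; rewrite ltnS h /= => /(_ isT).
  rewrite modnMDl divnMDl // modn_mod (divn_small (ltn_pmod _ _)) // addn0.
  rewrite (row_nthE _ (ltn_ord j)) (prim_expr_mod prim) (_ : Ordinal _ = j) //.
  exact: val_inj.
split.
  move=> j; rewrite mxE; case: unliftP => [i _|_]; first exact: w0.
  exact: (zs 0%N).
move=> i j k; rewrite !mxE.
case: (unliftP ord_max i) => [i' ->|->]; case: (unliftP ord_max j) => [j' ->|->] //.
- by move=> /wi ->.
- move=> e; exfalso; have := zw i' (c - k %% c)%N; rewrite e -(prim_expr_mod prim k).
  rewrite mulrA -exprD subnK ?prim_expr_order // ?mul1r ?eqxx //.
  by rewrite ltnW // ltn_pmod.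
- by move=> e; exfalso; have := zw j' k; rewrite e eqxx.
Qed.

(** Over the contractible cover for m points, the forbidden values are disjoint sections and are
    straightened to 0, ..., m c. The fibration becomes a product with a fixed punctured plane,
    covered by the product of the two covers. Lifts are computed factor by factor, the second in the
    straightened coordinate. *)
Theorem sep_conf_cover m : exists (M : topologicalType) (q : M -> 'rV[C]_m),
  covers R (@sep_conf m) q /\ contractible R M.
Proof.
elim: m => [|m [M [q [cq cM]]]].
  exists 'rV[C]_0, idfun; split.
    rewrite (_ : @sep_conf 0 = setT); first exact: covers_id.
    by apply/seteqP; split => // w _; split => -[].
  exists 0, (fun p => p.1); split; first exact: continuous_fstE.
  by move=> z /=; split => //; apply/rowP => -[].
pose N := (m * c).+1.
pose f k (b : M) := of_plane (section (q b) k).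
have cf k : continuous (f k).
  exact: (continuous_comp2 (continuous_comp2 (cov_cont cq) (@section_continuous m k))
    (@of_plane_continuous R)).
have [|h [h' [[ch ch' hK h'K] hf]]] := @trivialise_sections R M N f cM cf.
  move=> i j b iN jN /(congr1 (@to_plane R)); rewrite !of_planeK.
  exact: section_inj (cov_in cq b) iN jN.
pose q' (p : M * pcover R N) : 'rV[C]_m.+1 :=
  row_snoc (q p.1) (to_plane (h' (p.1, pproj p.2))).
have cl b z : unpunct N (h (b, of_plane z)) <->
    forall k, (k < N)%N -> z != section (q b) k.
  split.
    move=> u k kN; apply/eqP => e; move: u; rewrite e hf // /unpunct /= eqxx /=.
    by move=> /forallP /(_ (Ordinal kN)); rewrite eqxx.
  move=> zs; rewrite /unpunct; case: eqVneq => //= e2; apply/forallP => i.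
  apply/eqP => e1; have := zs i (ltn_ord i); apply/negP; rewrite negbK; apply/eqP.
  have : h (b, of_plane z) = h (b, f i b).
    by rewrite hf // [LHS]surjective_pairing e1 e2.
  move=> /(congr1 (fun w => h' (b, w))); rewrite !hK => /(congr1 (@to_plane R)).
  by rewrite !of_planeK.
have q'1 p : row_init (q' p) = q p.1 by rewrite row_snocK.
have q'2 p : h (p.1, of_plane (q' p 0 ord_max)) = pproj p.2.
  by rewrite row_snoc_last to_planeK h'K.
have cp1 := continuous_comp2 (@continuous_fstE M (pcover R N)) (cov_cont cq).
exists (M * pcover R N)%type, q'; split; last first.
  exact: contractible_prod cM (@pcover_contractible R N).
have cqN := pproj_covers R N.
constructor.
- apply: row_snoc_continuous => //.
  have c2 : continuous (fun p : M * pcover R N => (p.1, pproj p.2)).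
    apply: continuous_pairR; first exact: continuous_fstE.
    exact: (continuous_comp2 (@continuous_sndE M (pcover R N)) (@pproj_continuous R N)).
  exact: (continuous_comp2 (continuous_comp2 c2 ch') (@to_plane_continuous R)).
- move=> p; apply: sep_conf_snoc; first exact: (cov_in cq).
  by apply/cl; rewrite to_planeK h'K pproj_unpunct.
- move=> w /sep_conf_init[/(cov_surj cq)[b qb] ws].
  have : unpunct N (h (b, of_plane (w 0 ord_max))) by apply/cl; rewrite qb.
  move=> /(cov_surj cqN)[mu qmu]; exists (b, mu).
  by rewrite /q' /= qmu hK qb of_planeK row_snoc_eta.
- move=> [b mu]; have [V1 n1 H1] := cov_locinj cq b.
  have [V2 n2 H2] := cov_locinj cqN mu.
  exists (V1 `*` V2); first by exists (V1, V2).
  move=> [b1 m1] [b2 m2] [/= v1 v2] [/= v1' v2'] e.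
  have e1 : b1 = b2.
    by apply: H1 => //; rewrite -[LHS](q'1 (b1, m1)) e q'1.
  congr (_, _) => //; apply: H2 => //.
  by rewrite -[LHS](q'2 (b1, m1)) e /= e1 (q'2 (b2, m2)).
- move=> G G' cG cG' e e0 t tI.
  have e1 s : unitI s -> (G s).1 = (G' s).1.
    move=> sI; apply: (cov_upl cq (G := fun s => (G s).1) (G' := fun s => (G' s).1)) => //.
    + by cont.
    + by cont.
    + by move=> r rI; rewrite -q'1 e // q'1.
    + by rewrite e0.
  rewrite [LHS]surjective_pairing [RHS]surjective_pairing; congr (_, _); first exact: e1.
  apply: (cov_upl cqN (G := fun s => (G s).2) (G' := fun s => (G' s).2)) => //.
  + by cont.
  + by cont.
  + by move=> r rI; rewrite -q'2 e // e1 // q'2.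
  + by rewrite e0.
- move=> Z g g0 cg Ag cg0 e0.
  have [||||F1 [cF1 HF1]] := cov_hlp cq (f := fun p => row_init (g p)) (f0 := fun z => (g0 z).1).
  + exact: (continuous_comp2 cg (@row_init_continuous m)).
  + by move=> z t tI; have [] := sep_conf_init (Ag z t tI).
  + by cont.
  + by move=> z; rewrite -e0 q'1.
  pose g2 (p : Z * R) := h (F1 p, of_plane (g p 0 ord_max)).
  have [||||F2 [cF2 HF2]] := cov_hlp cqN (f := g2) (f0 := fun z => (g0 z).2).
  + have cs : continuous (fun p : Z * R => (F1 p, of_plane (g p 0 ord_max))).
      apply: continuous_pairR => //.
      have c1 : continuous (fun p : Z * R => g p 0 ord_max) by exact: (@cont_entry R _ _ g ord_max cg).
      exact: (continuous_comp2 c1 (@of_plane_continuous R)).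
    exact: (continuous_comp2 cs ch).
  + move=> z t tI; apply/cl; have [_ ->] := HF1 z; last by [].
    by have [_] := sep_conf_init (Ag z t tI).
  + by cont.
  + by move=> z; rewrite /g2 -e0 -q'2; have [-> _] := HF1 z.
  exists (fun p => (F1 p, F2 p)); split; first exact: continuous_pairR.
  move=> z; have [a1 b1] := HF1 z; have [a2 b2] := HF2 z; split.
    by rewrite a1 a2 -surjective_pairing.
  move=> t tI; rewrite /q' /= b1 // b2 // /g2 hK of_planeK row_snoc_eta //.
- move=> w.
  pose S b := [set (b, mu) | mu in (@pproj R N) @^-1` [set h (b, of_plane (w 0 ord_max))]].
  apply: (@sub_countable _ _ _ (\bigcup_(b in q @^-1` [set row_init w]) S b)).
    apply: subset_card_le => -[b mu] /= e; exists b => /=.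
      by rewrite -e q'1.
    by exists mu => //=; rewrite -e (q'2 (b, mu)).
  apply: bigcup_countable; first exact: (cov_count cq).
  move=> b _; apply: (card_le_trans (card_image_le _ _)).
  exact: (cov_count cqN).
Qed.

End Tower.

(** * Lifts of paths *)

Section SquareHomotopy.
Context {R : realType} {T : topologicalType}.

Lemma comp_path_concat (U : topologicalType) (k : T -> U) (f g : R -> T) :
  k \o path_concat f g = path_concat (k \o f) (k \o g).
Proof. by apply/funext => t; rewrite /= /path_concat; case: ifP. Qed.

Lemma square_homotopy (A : set T) (S : R * R -> T) : continuous S ->
  (forall t s, unitI t -> unitI s -> A (S (t, s))) ->
  path_homotopic A (fun t => S (t, 0))
    (path_concat (fun s => S (0, s)) (path_concat (fun t => S (t, 1))
      (fun s => S (1, 1 - s)))).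
Proof.
move=> cS AS.
pose sq : set (R * R) := [set p | unitI p.1 /\ unitI p.2].
pose p0 (t : R) : R * R := (t, 0).
pose a (s : R) : R * R := (0, s).
pose b (t : R) : R * R := (t, 1).
pose c (s : R) : R * R := (1, 1 - s).
have p0P : is_path sq (0, 0) (1, 0) p0.
  split => //; first by rewrite /p0; cont.
  by move=> t tI; split => //; exact: unitI0.
have aP : is_path sq (0, 0) (0, 1) a.
  split => //; first by rewrite /a; cont.
  by move=> t tI; split => //; exact: unitI0.
have bP : is_path sq (0, 1) (1, 1) b.
  split => //; first by rewrite /b; cont.
  by move=> t tI; split => //; exact: unitI1.
have cP : is_path sq (1, 1) (1, 0) c.
  split; first by rewrite /c; cont.
  - move=> t tI; split => /=; first exact: unitI1.
    by move: tI; rewrite /unitI; lra.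
  - by rewrite /c subr0.
  - by rewrite /c subrr.
have p1P := path_concatP aP (path_concatP bP cP).
set p1 := path_concat a _ in p1P.
have h : path_homotopic sq p0 p1.
  exists (fun x => ((1 - x.2) * (p0 x.1).1 + x.2 * (p1 x.1).1,
                    (1 - x.2) * (p0 x.1).2 + x.2 * (p1 x.1).2)); split.
    have [cp1 _ _ _] := p1P.
    have c1 : continuous (fun x : R * R => p1 x.1).
      exact: (continuous_comp2 (@continuous_fstE R R) cp1).
    by rewrite /p0; cont.
  move=> t s tI sI; have [_ Ap _ _] := p0P; have [_ Ap1 p10 p11] := p1P.
  have [_ _ p00 p01] := p0P.
  have /andP[x1 x2] := tI.
  have [/andP[y1 y2] /andP[y3 y4]] := Ap1 t tI.
  move: sI => /andP[s0 s1]; split => /=.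
  - by split; rewrite /unitI /=; apply/andP; split; nra.
  - by rewrite subr0 !mul1r !mul0r !addr0.
  - by rewrite subrr !mul0r !mul1r !add0r -surjective_pairing.
  - by rewrite p10 /=; congr (_, _); ring.
  - by rewrite p11 /=; congr (_, _); ring.
have ASq z : sq z -> A (S z) by case: z => t s [/= tI sI]; exact: AS.
have := homotopic_comp cS ASq h.
have -> // : S \o p1 = path_concat (fun s => S (0, s))
    (path_concat (fun t => S (t, 1)) (fun s => S (1, 1 - s))).
by apply/funext => t; rewrite /= /p1 /path_concat; do ![case: ifP].
Qed.

End SquareHomotopy.

(** * Paths in contractible spaces *)

Section Contractible.
Variables (R : realType) (M : topologicalType).
Hypothesis cM : contractible R M.

(** Pulled along the contraction, a path becomes the track of its origin followed by the reversed
    track of its end, and this depends on its two ends only. *)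
Lemma contractible_homotopic (F F' : R -> M) : continuous F -> continuous F' ->
  F 0 = F' 0 -> F 1 = F' 1 -> path_homotopic [set: M] F F'.
Proof.
move: cM => [e [H [cH HH]]] cF cF' e0 e1.
have key (G : R -> M) : continuous G -> path_homotopic [set: M] G
    (path_concat (fun s => H (G 0, s)) (path_concat (cst e) (fun s => H (G 1, 1 - s)))).
  move=> cG.
  have cs : continuous (fun p : R * R => H (G p.1, p.2)).
    have c1 : continuous (fun p : R * R => (G p.1, p.2)).
      apply: continuous_pairR; last exact: continuous_sndE.
      exact: (continuous_comp2 (@continuous_fstE R R) cG).
    exact: (continuous_comp2 c1 cH).
  have := @square_homotopy R M setT _ cs (fun _ _ _ _ => I).
  rewrite /= (_ : (fun t => H (G t, 0)) = G); last first.
    by apply/funext => t; have [-> _] := HH (G t).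
  rewrite (_ : (fun t => H (G t, 1)) = cst e) //.
  by apply/funext => t; have [_ ->] := HH (G t).
apply: (homotopic_trans (key F cF)); rewrite e0 e1.
exact: homotopic_sym (key F' cF').
Qed.

Lemma contractible_path (x y : M) : exists F : R -> M,
  [/\ continuous F, F 0 = x & F 1 = y].
Proof.
move: cM => [e [H [cH HH]]].
have p1 z : is_path [set: M] z e (fun s => H (z, s)).
  have [h0 h1] := HH z; split => //.
  have cs : continuous (fun s : R => (z, s)) by cont.
  exact: (continuous_comp2 cs cH).
have [c _ f0 f1] := path_concatP (p1 x) (path_revP (p1 y)).
by exists (path_concat (fun s => H (x, s)) (path_rev (fun s => H (y, s)))).
Qed.

Lemma contractible_simply_connected : simply_connected (R := R) [set: M].
Proof.
split; first split.
- by move: cM => [e _]; exists e.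
- move=> x y _ _; have [F [cF F0 F1]] := contractible_path x y.
  by exists F.
- move=> x f [cf _ f0 f1]; apply: contractible_homotopic => //.
  exact: cst_continuous.
Qed.

End Contractible.

Section Lifting.
Variables (R : realType) (M T : topologicalType) (A : set T) (q : M -> T).
Hypothesis cq : covers R A q.

Definition is_lift (m : M) (f : R -> T) (G : R -> M) :=
  [/\ continuous G, G 0 = m & forall t, unitI t -> q (G t) = f t].

(* The end point of the lift of the path [f] starting at [m], and [m] itself if
   there is no such lift. *)
Definition endp (m : M) (f : R -> T) : M :=
  if pselect (exists G, is_lift m f G) is left h then projT1 (cid h) 1 else m.

Lemma endpE m f G : is_lift m f G -> endp m f = G 1.
Proof.
move=> [cG G0 qG]; rewrite /endp; case: pselect => [h|[]]; last by exists G.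
case: (cid h) => /= G' [cG' G'0 qG'].
apply: (cov_upl cq) => //; last exact: unitI1.
  by move=> t tI; rewrite qG // qG'.
by rewrite G0.
Qed.

Lemma lift_ex m (f : R -> T) : continuous f -> (forall t, unitI t -> A (f t)) ->
  q m = f 0 -> exists G, is_lift m f G /\ endp m f = G 1.
Proof.
move=> cf Af mf.
have [||||F [cF HF]] := cov_hlp cq (Z := R) (f := f \o snd) (f0 := fun _ => m).
- exact: (continuous_comp2 (@continuous_sndE R R) cf).
- by move=> z t tI; exact: Af.
- exact: contcst.
- by [].
have lf : is_lift m f (fun t => F (0, t)).
  have [F0 qF] := HF 0; split => //.
  have cs : continuous (fun t : R => ((0 : R), t)) by cont.
  exact: (continuous_comp2 cs cF).
by exists (fun t => F (0, t)); split => //; exact: (endpE lf).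
Qed.

Lemma lift_path m x y f : is_path A x y f -> q m = x ->
  exists G, is_lift m f G /\ endp m f = G 1.
Proof. by move=> [cf Af f0 f1] qm; apply: lift_ex => //; rewrite f0. Qed.

Lemma q_endp m x y f : is_path A x y f -> q m = x -> q (endp m f) = y.
Proof.
move=> pf qm; have [G [[cG G0 qG] ->]] := lift_path pf qm.
by rewrite qG; [have [] := pf|exact: unitI1].
Qed.

Lemma endp_eq m x y f f' : is_path A x y f -> q m = x ->
  (forall t, unitI t -> f t = f' t) -> endp m f = endp m f'.
Proof.
move=> pf qm ff'; have [G [[cG G0 qG] ->]] := lift_path pf qm.
by apply/esym/endpE; split => // t tI; rewrite qG // ff'.
Qed.

Lemma endp_cst m x : q m = x -> endp m (cst x) = m.
Proof.
move=> qm; apply: (@endpE m (cst x) (cst m)); split => //.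
exact: cst_continuous.
Qed.

Lemma endp_concat m x y z f g : is_path A x y f -> is_path A y z g -> q m = x ->
  endp m (path_concat f g) = endp (endp m f) g.
Proof.
move=> pf pg qm; have [F [[cF F0 qF] eF]] := lift_path pf qm.
have [G [[cG G0 qG] eG]] := lift_path pg (q_endp pf qm).
rewrite eF in G0 eG *; rewrite eG.
have pFG := path_concatP (A := setT) (x := m) (y := F 1) (z := G 1) (f := F) (g := G).
have [cFG _ FG0 FG1] : is_path setT m (G 1) (path_concat F G) by apply: pFG; split.
rewrite -FG1; apply: endpE; split => // t tI.
rewrite /path_concat; case: ifPn => h.
  by apply: qF; move: tI; rewrite /unitI; lra.
by apply: qG; move: tI h; rewrite /unitI; lra.
Qed.

Lemma endp_rev m x y f : is_path A x y f -> q m = x ->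
  endp (endp m f) (path_rev f) = m.
Proof.
move=> pf qm; have [F [[cF F0 qF] ->]] := lift_path pf qm.
rewrite -[RHS]F0 -(subrr 1); apply: (@endpE _ _ (fun t => F (1 - t))); split.
- have ca : continuous (fun t : R => 1 - t) by cont.
  exact: (continuous_comp2 ca cF).
- by rewrite subr0.
- by move=> t tI; apply: qF; move: tI; rewrite /unitI; lra.
Qed.

Lemma endp_rev' m x y f : is_path A x y f -> q m = y ->
  endp (endp m (path_rev f)) f = m.
Proof.
move=> pf qm; have := endp_rev (path_revP pf) qm.
rewrite (_ : path_rev (path_rev f) = f) //.
by apply/funext => t; rewrite /path_rev subKr.
Qed.

Lemma endp_inj m m' x y f : is_path A x y f -> q m = x -> q m' = x ->
  endp m f = endp m' f -> m = m'.
Proof.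
by move=> pf qm qm' e; rewrite -(endp_rev pf qm) e (endp_rev pf qm').
Qed.

(** The lifted homotopy starts from the constant [m]; the ends of its stages form a path over the
    constant end of the homotopy, so they are all equal. *)
Lemma endp_homotopic m x y f f' : is_path A x y f -> q m = x ->
  path_homotopic A f f' -> endp m f = endp m f'.
Proof.
move=> pf qm [H [cH HP]]; have [cf Af f0 f1] := pf.
have cHc : continuous (fun p : R * R => H (p.2, clamp p.1)).
  have ca : continuous (fun p : R * R => (p.2, clamp p.1)) by cont.
  exact: (continuous_comp2 ca cH).
have [||||F [cF HF]] := cov_hlp cq (Z := R)
  (f := fun p => H (p.2, clamp p.1)) (f0 := fun _ => m).
- by [].
- by move=> s t tI; have [] := HP t _ tI (clampI s).
- exact: contcst.
- by move=> s; rewrite qm -f0; have [_ _ _ -> _] := HP 0 _ unitI0 (clampI s).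
have cFs s : continuous (fun t => F (s, t)).
  have ca : continuous (fun t : R => (s, t)) by cont.
  exact: (continuous_comp2 ca cF).
have e0 : endp m f = F (0, 1).
  apply: (@endpE _ _ (fun t => F (0, t))); have [F0 qF] := HF 0; split => //.
  by move=> t tI; rewrite qF // clamp0; have [_ -> _ _ _] := HP t 0 tI unitI0.
have e1 : endp m f' = F (1, 1).
  apply: (@endpE _ _ (fun t => F (1, t))); have [F0 qF] := HF 1; split => //.
  by move=> t tI; rewrite qF // clamp_ge1 //; have [_ _ -> _ _] := HP t 1 tI unitI1.
rewrite e0 e1; apply/esym.
have cF1 : continuous (fun s => F (s, 1)).
  have ca : continuous (fun s : R => (s, 1 : R)) by cont.
  exact: (continuous_comp2 ca cF).
apply: (cov_upl cq cF1 (@contcst R M (F (0, 1)))) => //; last exact: unitI1.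
move=> s sI; have [_ ->] := HF s; last exact: unitI1.
have [_ ->] := HF 0; last exact: unitI1.
have [_ _ _ _ ->] := HP 1 _ unitI1 (clampI s).
by have [_ _ _ _ ->] := HP 1 _ unitI1 (clampI 0).
Qed.

Hypothesis cM : contractible R M.

(** Converse of [endp_homotopic] over a contractible cover: two lifts with the same ends are
    homotopic, and the homotopy projects. From here on end points may replace homotopy classes. *)
Lemma homotopic_endp m x y y' f f' : is_path A x y f -> is_path A x y' f' ->
  q m = x -> endp m f = endp m f' -> path_homotopic A f f'.
Proof.
move=> pf pf' qm e; have [F [[cF F0 qF] eF]] := lift_path pf qm.
have [F' [[cF' F'0 qF'] eF']] := lift_path pf' qm.
have h : path_homotopic [set: M] F F'.
  by apply: contractible_homotopic => //; [rewrite F0|rewrite -eF -eF'].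
have h' : path_homotopic A (q \o F) (q \o F').
  by apply: homotopic_comp h; [exact: (cov_cont cq)|move=> z _; exact: (cov_in cq)].
apply: (@homotopic_trans _ _ _ _ (q \o F)).
  by apply: homotopic_eq pf _ => t tI /=; rewrite qF.
apply: (homotopic_trans h'); apply: homotopic_sym.
by apply: homotopic_eq pf' _ => t tI /=; rewrite qF'.
Qed.

Lemma endp_surj m m' : exists f, is_path A (q m) (q m') f /\ endp m f = m'.
Proof.
have [F [cF F0 F1]] := contractible_path cM m m'.
exists (q \o F); split.
  split => //=; rewrite ?F0 ?F1 //; last by move=> t _; exact: (cov_in cq).
  exact: (continuous_comp2 cF (cov_cont cq)).
by rewrite -F1; apply: endpE.
Qed.

Lemma covers_path x y : A x -> A y -> exists f : R -> T, is_path A x y f.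
Proof.
move=> /(cov_surj cq)[m <-] /(cov_surj cq)[m' <-].
by have [f [pf _]] := endp_surj m m'; exists f.
Qed.

(** The contraction of [N], run backwards, is lifted from a constant. This constant is the end of
    the lift from [m0] of the track of [n0], so that the lifted homotopy runs back along that track
    to [m0]. *)
Lemma lift_contractible (N : topologicalType) (k : N -> T) (n0 : N) (m0 : M) :
  contractible R N -> continuous k -> (forall n, A (k n)) -> q m0 = k n0 ->
  exists phi : N -> M, [/\ continuous phi, forall n, q (phi n) = k n & phi n0 = m0].
Proof.
move=> [e [H [cH HH]]] ck Ak mk.
have ckH : continuous (fun p : N * R => k (H (p.1, 1 - p.2))).
  have ca : continuous (fun p : N * R => (p.1, 1 - p.2)) by cont.
  exact: (continuous_comp2 (continuous_comp2 ca cH) ck).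
have cr : continuous (fun t : R => k (H (n0, t))).
  have ca : continuous (fun t : R => (n0, t)) by cont.
  exact: (continuous_comp2 (continuous_comp2 ca cH) ck).
have [|||G [[cG G0 qG] _]] := @lift_ex m0 (fun t => k (H (n0, t))) => //.
  by rewrite mk; have [->] := HH n0.
have [|||F [cF HF]] := cov_hlp cq ckH (f0 := fun _ => G 1).
- by [].
- exact: contcst.
- by move=> n; rewrite /= subr0 qG; [have [_ ->] := HH n0; have [_ ->] := HH n|exact: unitI1].
exists (fun n => F (n, 1)); split.
- have ca : continuous (fun n : N => (n, 1 : R)) by cont.
  exact: (continuous_comp2 ca cF).
- by move=> n; have [_ ->] := HF n; [rewrite /= subrr; have [->] := HH n|exact: unitI1].
- have cF0 : continuous (fun t => F (n0, t)).
    have ca : continuous (fun t : R => (n0, t)) by cont.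
    exact: (continuous_comp2 ca cF).
  have cG1 : continuous (fun t : R => G (1 - t)).
    have ca : continuous (fun t : R => 1 - t) by cont.
    exact: (continuous_comp2 ca cG).
  rewrite (cov_upl cq cF0 cG1 _ _ unitI1) ?subrr //.
    move=> t tI; have [_ ->//] := HF n0; rewrite /= qG //.
    by move: tI; rewrite /unitI; lra.
  by have [-> _] := HF n0; rewrite subr0.
Qed.

End Lifting.

Lemma endp_map (R : realType) (M T M' T' : topologicalType) (A : set T)
    (q : M -> T) (A' : set T') (q' : M' -> T') (phi : M -> M') (k : T -> T')
    m x y (f : R -> T) : covers R A q -> covers R A' q' -> continuous phi ->
  (forall m, q' (phi m) = k (q m)) -> is_path A x y f -> q m = x ->
  endp q' (phi m) (k \o f) = phi (endp q m f).
Proof.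
move=> cq cq' cphi e pf qm; have [F [[cF F0 qF] ->]] := lift_path cq pf qm.
apply: (endpE cq' (G := phi \o F)); split => /=; first exact: (continuous_comp2 cF cphi).
  by rewrite F0.
by move=> t tI; rewrite e qF.
Qed.

(** * Evenly covered neighbourhoods *)

Section CoveringMap.
Variables (R : realType) (E B : topologicalType) (p : E -> B).
Hypothesis cp : covers R setT p.

Lemma cont_set_type (Z X : topologicalType) (S : set X) (f : Z -> S) :
  continuous (fun z => \val (f z)) -> continuous f.
Proof. by move=> h; apply: continuous_comp_initial. Qed.

Lemma val_continuous (X : topologicalType) (S : set X) :
  continuous (fun z : S => \val z).
Proof. exact: initial_continuous. Qed.

(** A neighbourhood contractible within itself is evenly covered: its sheets are indexed by the
    fibre over the centre, to which points move along the tracks of the contraction ([tr]) and from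
    which they come back ([sec]). *)
Lemma covers_covering_map :
  (forall b : B, exists (U : set B) (K : B * R -> B), [/\ open U, U b,
     continuous (fun x : U * R => K (\val x.1, x.2)) &
     forall y, U y -> [/\ K (y, 0) = y, K (y, 1) = b & forall t, U (K (y, t))]]) ->
  covering_map p.
Proof.
move=> loc; split; [exact: (cov_cont cp)|by move=> b _; have [e <-] := cov_surj cp (I : setT b); exists e|].
move=> b; have [U [K [oU Ub cK HK]]] := loc b.
exists U; split => //.
have cKy y : U y -> continuous (fun t => K (y, t)).
  move=> Uy.
  have ca : continuous (fun t : R => (exist _ y (mem_set Uy) : U, t)).
    by apply: continuous_pairR; [exact: contcst|exact: continuous_idE].
  exact: (continuous_comp2 ca cK).
have pK y : U y -> is_path setT y b (fun t => K (y, t)).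
  by move=> Uy; have [h0 h1 _] := HK y Uy; split => //; exact: cKy.
pose tr m := endp p m (fun t => K (p m, t)).
pose sec e y := endp p e (path_rev (fun t => K (y, t))).
have ptr m : U (p m) -> p (tr m) = b by move=> Um; exact: (q_endp cp (pK _ Um)).
have psec e y : p e = b -> U y -> p (sec e y) = y.
  by move=> pe Uy; exact: (q_endp cp (path_revP (pK _ Uy))).
have trsec e y : p e = b -> U y -> tr (sec e y) = e.
  by move=> pe Uy; rewrite /tr psec //; exact: (endp_rev' cp (pK _ Uy)).
have sectr m : U (p m) -> sec (tr m) (p m) = m.
  by move=> Um; exact: (endp_rev cp (pK _ Um)).
pose V e : set E := [set m | U (p m) /\ tr m = e].
exists [set V e | e in p @^-1` [set b]]; split.
- apply/seteqP; split => m /=.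
    by move=> Um; exists (V (tr m)) => //; exists (tr m) => //; exact: ptr.
  by move=> [_ [e _ <-]] [].
- move=> _ _ [e _ <-] [e' _ <-] [m [[_ h] [_ h']]].
  by rewrite -h -h'.
move=> _ [e /= pe <-]; split.
  rewrite openE => m [Um tm].
  (* Sheets are open: for m' near [m], the point [tr m'] is near [tr m] and in the same fibre, so
     local injectivity makes the two equal. *)
  have [V0 mV0 HV0] := cov_locinj cp (tr m).
  pose W : set E := p @^-1` U.
  have oW : open W by apply: open_comp => // x _; exact: (cov_cont cp).
  have cf : continuous (fun x : W * R => K (p (\val x.1), x.2)).
    pose j (x : W * R) : U * R :=
      (exist _ (p (\val x.1)) (mem_set (set_mem (valP x.1))), x.2).
    have cj : continuous j.
      apply: continuous_pairR; last exact: continuous_sndE.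
      apply: cont_set_type => /=.
      exact: (continuous_comp2 (continuous_comp2 (@continuous_fstE W R)
        (@val_continuous E W)) (cov_cont cp)).
    exact: (continuous_comp2 cj cK).
  have [|||F [cF HF]] := cov_hlp cp cf (f0 := fun w : W => \val w).
  + by [].
  + exact: val_continuous.
  + by move=> z /=; have [-> _ _] := HK _ (set_mem (valP z) : U (p (\val z))).
  have trF (w : W) : tr (\val w) = F (w, 1).
    apply: (endpE cp (G := fun t => F (w, t))).
    have ca : continuous (fun t : R => (w, t)) by cont.
    by have [F0 qF] := HF w; split => //; exact: (continuous_comp2 ca cF).
  have cF1 : continuous (fun w : W => F (w, 1)).
    have ca : continuous (fun w : W => (w, 1 : R)) by cont.
    exact: (continuous_comp2 ca cF).
  pose wm : W := exist _ m (mem_set Um).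
  have nO : nbhs wm [set w | V0 (F (w, 1))].
    by apply: cF1; rewrite -trF.
  move: nO => [U1 [[U2 oU2 <-] Om] HO'].
  have nm : nbhs m (U2 `&` W) by apply: open_nbhs_nbhs; split => //; exact: openI.
  apply: filterS nm => m' [Om' Wm']; split => //.
  have := HO' (exist _ m' (mem_set Wm')) Om' => /= h.
  rewrite -tm; apply: HV0; last by rewrite !ptr.
    by rewrite -(trF (exist _ m' (mem_set Wm'))) in h.
  exact: nbhs_singleton.
exists (sec e); split.
- split.
  + by move=> m [].
  + by move=> m m' /set_mem[Um tm] /set_mem[Um' tm'] e'; rewrite -(sectr m) // -(sectr m') // tm tm' e'.
  + by move=> y Uy; exists (sec e y); [split; [rewrite psec|exact: trsec]|exact: psec].
- apply/subspace_sigL_continuousP.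
  have cf : continuous (fun x : U * R => K (\val x.1, 1 - x.2)).
    have ca : continuous (fun x : U * R => (x.1, 1 - x.2)) by cont.
    exact: (continuous_comp2 ca cK).
  have [|||F [cF HF]] := cov_hlp cp cf (f0 := fun _ => e).
  + by [].
  + exact: contcst.
  + by move=> z /=; rewrite subr0; have [_ -> _] := HK _ (set_mem (valP z) : U (\val z)).
  rewrite (_ : sigL U (sec e) = fun w => F (w, 1)).
    have ca : continuous (fun w : U => (w, 1 : R)) by cont.
    exact: (continuous_comp2 ca cF).
  apply/funext => w; apply: (endpE cp (G := fun t => F (w, t))).
  have ca : continuous (fun t : R => (w, t)) by cont.
  by have [F0 qF] := HF w; split => //; exact: (continuous_comp2 ca cF).
- by move=> y Uy; split; [split; [rewrite psec|exact: trsec]|exact: psec].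
Qed.

End CoveringMap.

(** * Spaces of twisted paths *)

Definition to_set_type (X : Type) (S : set X) (x : X) (h : S x) : set_type S :=
  exist (fun x => x \in S) x (mem_set h).

Section Twisted.
Variables (R : realType) (M T L : topologicalType).

(* [Fx] is a space of paths [ga u] in [A] whose end point is the image by [g] of
   their origin, topologised so that continuous families of paths are
   continuous maps to [Fx]. *)
Record twisted_paths (A : set T) (g : T -> T) (Fx : set L) (ga : L -> R -> T) :
    Prop := TwistedPaths {
  tw_g : continuous g;
  tw_gA : forall z, A z -> A (g z);
  tw_cont : forall (Z : topologicalType) (k : Z -> L), continuous k ->
    (forall z, Fx (k z)) -> continuous (fun p : Z * R => ga (k p.1) p.2);
  tw_A : forall u t, Fx u -> A (ga u t);
  tw_tw : forall u, Fx u -> ga u 1 = g (ga u 0);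
  tw_inj : forall u v, Fx u -> Fx v ->
    (forall t, unitI t -> ga u t = ga v t) -> u = v;
  tw_ext : forall (Z : topologicalType) (f : Z * R -> T), continuous f ->
    (forall z t, unitI t -> A (f (z, t))) ->
    (forall z, f (z, 1) = g (f (z, 0))) ->
    exists k : Z -> L, continuous k /\ forall z, Fx (k z) /\
      forall t, unitI t -> ga (k z) t = f (z, t);
  tw_loc : forall u, Fx u -> exists (W : set L) (K : L * R -> L),
    [/\ W u, W `<=` Fx, (forall v, W v -> \forall v' \near v, Fx v' -> W v'),
      (forall (Z : topologicalType) (k : Z -> L), continuous k ->
        (forall z, W (k z)) -> continuous (fun p : Z * R => K (k p.1, p.2))) &
      forall v, W v -> [/\ K (v, 0) = v, K (v, 1) = u & forall t, W (K (v, t))]]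
}.

Variables (A : set T) (g : T -> T) (Fx : set L) (ga : L -> R -> T).
Hypothesis tw : twisted_paths A g Fx ga.

Definition joined (u v : L) := exists k : R -> L,
  [/\ continuous k, forall t, Fx (k t), k 0 = u & k 1 = v].

Lemma joined_sym u v : joined u v -> joined v u.
Proof.
move=> [k [ck Fk k0 k1]]; exists (path_rev k); split.
- have ca : continuous (fun t : R => 1 - t) by cont.
  exact: (continuous_comp2 ca ck).
- by move=> t; exact: Fk.
- by rewrite /path_rev subr0.
- by rewrite /path_rev subrr.
Qed.

Lemma joined_trans u v w : joined u v -> joined v w -> joined u w.
Proof.
move=> [k [ck Fk k0 k1]] [k' [ck' Fk' k'0 k'1]]; exists (path_concat k k').
have p1 : is_path setT u v k by split.
have p2 : is_path setT v w k' by split.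
have [c _ e0 e1] := path_concatP p1 p2; split => // t.
by rewrite /path_concat; case: ifP.
Qed.

Lemma joined_near u : Fx u -> \forall v \near u, Fx v -> joined u v.
Proof.
move=> Fu; have [W [K [Wu WF oW cK HK]]] := tw_loc tw Fu.
apply: filterS (oW u Wu) => v h /h Wv; apply: joined_sym.
have [h0 h1 h2] := HK v Wv; exists (fun t => K (v, t)); split => //.
  have := cK R (fun _ => v) (@contcst R L v) (fun _ => Wv) => c1.
  have ca : continuous (fun t : R => ((0 : R), t)) by cont.
  exact: (continuous_comp2 ca c1).
by move=> t; apply: WF; exact: h2.
Qed.

(** By [joined_near] the set of points joined to [u] is open and closed in the component of [u]. *)
Lemma joined_component u v : Fx u -> connected_component Fx u v <-> joined u v.
Proof.
move=> Fu; split; last first.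
  move=> [k [ck Fk k0 k1]].
  have cn : connected (k @` [set: R]).
    apply: connected_continuous_connected; last exact: continuous_subspaceT.
    by apply/connected_intervalP.
  have sub : k @` setT `<=` connected_component Fx u.
    apply: (connected_component_max _ _ cn); first by exists 0.
    by move=> _ [t _ <-]; exact: Fk.
  by apply: sub; exists 1.
set C := connected_component Fx u => Cv.
have CF w : C w -> Fx w by exact: connected_component_sub.
have cC : connected C by exact: component_connected.
have e : C `&` joined u = C.
  apply: cC.
  - exists u; split; first exact: connected_component_refl.
    by exists (fun _ => u); split => //; exact: contcst.
  - exists (interior [set w | Fx w -> joined u w]); first exact: open_interior.
    apply/seteqP; split => w [Cw h]; split => //.
      have := joined_near (CF w Cw); apply: filterS => w' h' Fw'.
      exact: joined_trans h (h' Fw').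
    by apply: (nbhs_singleton h); exact: CF.
  - exists (~` interior [set w | Fx w -> ~ joined u w]).
      by apply: open_closedC; exact: open_interior.
    apply/seteqP; split => w [Cw h]; split => //.
      by move=> /nbhs_singleton /(_ (CF w Cw)).
    apply: contrapT => nw; apply: h.
    have := joined_near (CF w Cw); apply: filterS => w' h' Fw' jw'.
    by apply: nw; exact: joined_trans jw' (joined_sym (h' Fw')).
by have [_] : (C `&` joined u) v by rewrite e.
Qed.

Variable q : M -> T.
Hypotheses (cq : covers R A q) (cM : contractible R M).

Let gc := tw_g tw.
Let ga_A := tw_A tw.

Lemma ga_path u : Fx u -> is_path A (ga u 0) (g (ga u 0)) (ga u).
Proof.
move=> Fu; split => //; last exact: (tw_tw tw).
  have := tw_cont tw (@contcst R L u) (fun _ => Fu) => c1.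
  have ca : continuous (fun t : R => ((0 : R), t)) by cont.
  exact: (continuous_comp2 ca c1).
by move=> t _; exact: ga_A.
Qed.

Lemma cont_origin (Z : topologicalType) (k : Z -> L) : continuous k ->
  (forall z, Fx (k z)) -> continuous (fun z => ga (k z) 0).
Proof.
move=> ck Fk; have := tw_cont tw ck Fk => c1.
have ca : continuous (fun z : Z => (z, 0 : R)) by cont.
exact: (continuous_comp2 ca c1).
Qed.

Lemma lift_family (Z : topologicalType) (k : Z -> L) (X : Z -> M) :
  continuous k -> (forall z, Fx (k z)) -> continuous X ->
  (forall z, q (X z) = ga (k z) 0) ->
  exists F : Z * R -> M, continuous F /\ forall z, [/\ F (z, 0) = X z,
    forall t, unitI t -> q (F (z, t)) = ga (k z) t & F (z, 1) = endp q (X z) (ga (k z))].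
Proof.
move=> ck Fk cX qX.
have [|F [cF HF]] := cov_hlp cq (tw_cont tw ck Fk) _ cX qX.
  by move=> z t _; exact: ga_A.
exists F; split => // z; have [F0 qF] := HF z; split => //.
apply/esym/(endpE cq (G := fun t => F (z, t))); split => //.
have ca : continuous (fun t : R => (z, t)) by cont.
exact: (continuous_comp2 ca cF).
Qed.

(* Being a lift of a path [ga u] with end point the image of its origin by a
   given lift of [g] is a closed and open condition. *)
Lemma lift_persist (phi : M -> M) (k : R -> L) (X : R -> M) : continuous phi ->
  (forall m, q (phi m) = g (q m)) -> continuous k -> (forall t, Fx (k t)) ->
  continuous X -> (forall t, unitI t -> q (X t) = ga (k t) 0) ->
  endp q (X 0) (ga (k 0)) = phi (X 0) ->
  forall t, unitI t -> endp q (X t) (ga (k t)) = phi (X t).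
Proof.
move=> cphi qphi ck Fk cX qX e0 t tI.
have ck' := continuous_comp2 (@clamp_continuous R) ck.
have cX' := continuous_comp2 (@clamp_continuous R) cX.
have [||F [cF HF]] := lift_family ck' _ cX' _.
- by move=> z; exact: Fk.
- by move=> z; apply: qX; exact: clampI.
have cF1 : continuous (fun s => F (s, 1)).
  have ca : continuous (fun s : R => (s, 1 : R)) by cont.
  exact: (continuous_comp2 ca cF).
have cp := continuous_comp2 cX cphi.
have := cov_upl cq cF1 cp _ _ tI => /=.
have [_ _ ->] := HF t; rewrite /= clamp_id //; apply.
  move=> s sI; have [_ -> //] := HF s; last exact: unitI1.
  by rewrite /= clamp_id // (tw_tw tw) // qphi qX.
by have [_ _ ->] := HF 0; rewrite /= clamp_id //; exact: unitI0.
Qed.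

(** * The contractible cover of a component *)

Section Component.
Variables (u : L) (Fu : Fx u).
Let C := connected_component Fx u.

Let CF w : C w -> Fx w. Proof. exact: connected_component_sub. Qed.

Lemma component_contractible_nbhs (b : C) : exists (U : set C) (K : C * R -> C),
  [/\ open U, U b, continuous (fun x : U * R => K (\val x.1, x.2)) &
     forall y, U y -> [/\ K (y, 0) = y, K (y, 1) = b & forall t, U (K (y, t))]].
Proof.
have Cb : C (\val b) := set_mem (valP b).
have [W [K [Wb WF oW cK HK]]] := tw_loc tw (CF Cb).
have CK y t : C y -> W y -> C (K (y, t)).
  move=> Cy Wy; apply: connected_component_trans Cy _.
  apply/joined_component; first exact: WF.
  have [h0 h1 h2] := HK y Wy; exists (fun s => K (y, s * t)); split.
  - have := cK R (fun _ => y) (@contcst R L y) (fun _ => Wy) => c1.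
    have ca : continuous (fun s : R => ((0 : R), s * t)) by cont.
    exact: (continuous_comp2 ca c1).
  - by move=> s; exact/WF/h2.
  - by rewrite mul0r.
  - by rewrite mul1r.
pose U : set C := [set y | W (\val y)].
(* Where the contraction leaves [C] the value is arbitrary; over [U] it stays in [C] ([CK]), since
   its tracks are paths in [Fx]. *)
pose K' (p : C * R) : C :=
  if pselect (C (K (\val p.1, p.2))) is left h
  then to_set_type h else p.1.
have K'E y t : W (\val y) -> \val (K' (y, t)) = K (\val y, t).
  move=> Wy; rewrite /K' /=; case: pselect => // -[].
  by apply: CK => //; exact: (set_mem (valP y)).
exists U, K'; split => //.
- rewrite openE => y Wy.
  have n1 : nbhs y [set z : C | Fx (\val z) -> W (\val z)] :=
    val_continuous (oW _ Wy).
  apply: filterS n1 => z h; apply: h; apply: CF; exact: (set_mem (valP z)).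
- apply: cont_set_type.
  have cv : continuous (fun x : U => \val (\val x)).
    exact: (continuous_comp2 (@val_continuous C U) (@val_continuous L C)).
  have c1 := cK U (fun x : U => \val (\val x)) cv (fun x => set_mem (valP x)).
  rewrite (_ : (fun z : U * R => _) = (fun p : U * R => K (\val (\val p.1), p.2))) //.
  by apply/funext => z; rewrite K'E //; exact: (set_mem (valP z.1)).
- move=> y Wy; have [h0 h1 h2] := HK _ Wy; split.
  + by apply: val_inj; rewrite K'E.
  + by apply: val_inj; rewrite K'E.
  + by move=> t; rewrite /U /= K'E.
Qed.

Variables (y0 : M) (phi : M -> M).
Hypotheses (qy0 : q y0 = ga u 0) (cphi : continuous phi).
Hypotheses (qphi : forall m, q (phi m) = g (q m)).
Hypotheses (phi0 : endp q y0 (ga u) = phi y0).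

Definition lifted_paths : set (L * M) := [set e | [/\ Fx e.1, q e.2 = ga e.1 0 &
  endp q e.2 (ga e.1) = phi e.2]].

Lemma lifted_pathsP (e : lifted_paths) : [/\ Fx (\val e).1,
  q (\val e).2 = ga (\val e).1 0 & endp q (\val e).2 (ga (\val e).1) = phi (\val e).2].
Proof. exact: (set_mem (valP e)). Qed.

(** In the first half of the contraction the lift, from x to phi x, is deformed with fixed ends into
    [P2 x], which runs along the contraction of [M] from x to its centre and on to phi x. This path
    depends on x only, so in the second half it is enough to contract x. *)
Lemma lifted_contractible : contractible R lifted_paths.
Proof.
pose E := lifted_paths : topologicalType.
have cE : continuous (fun e : E => \val e) by exact: val_continuous.
have c1 : continuous (fun e : E => (\val e).1) := continuous_comp2 cE (@continuous_fstE L M).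
have c2 : continuous (fun e : E => (\val e).2) := continuous_comp2 cE (@continuous_sndE L M).
have FE (e : E) : Fx (\val e).1 by have [] := lifted_pathsP e.
have [|G [cG HG]] := lift_family c1 FE c2 _.
  by move=> e; have [] := lifted_pathsP e.
have G1 e : G (e, 1) = phi (\val e).2.
  by have [_ _ ->] := HG e; have [] := lifted_pathsP e.
have G0 e : G (e, 0) = (\val e).2 by have [] := HG e.
move: cM => [m1 [H [cH HH]]].
have H0 z : H (z, 0) = z by have [] := HH z.
have H1 z : H (z, 1) = m1 by have [] := HH z.
(* The path [G] is pushed to the upper sides of the square [H (G t, s)]. *)
pose P1 (e : E) (s t : R) := H (G (e, (1 - s) * t + s * clamp (3 * t - 1)),
  s * Num.min (3 * t) (Num.min (3 - 3 * t) 1)).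
pose P2 (y : M) (t : R) := if t <= 2^-1 then H (y, Num.min (3 * t) 1)
  else H (phi y, Num.min (3 - 3 * t) 1).
pose P (x : E * R * R) := if x.1.2 <= 2^-1 then P1 x.1.1 (2 * x.1.2) x.2
  else P2 (H ((\val x.1.1).2, 2 * x.1.2 - 1)) x.2.
have cP1 (Z : topologicalType) (e : Z -> E) (s t : Z -> R) : continuous e ->
    continuous s -> continuous t -> continuous (fun z => P1 (e z) (s z) (t z)).
  move=> ce cs ct.
  have ca : continuous (fun z => (e z, (1 - s z) * t z + s z * clamp (3 * t z - 1))) by cont.
  have cb : continuous (fun z => (G (e z, (1 - s z) * t z + s z * clamp (3 * t z - 1)),
    s z * Num.min (3 * t z) (Num.min (3 - 3 * t z) 1))).
    apply: continuous_pairR; first exact: (continuous_comp2 ca cG).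
    by cont.
  exact: (continuous_comp2 cb cH).
have cP2 (Z : topologicalType) (y : Z -> M) (t : Z -> R) : continuous y ->
    continuous t -> continuous (fun z => P2 (y z) (t z)).
  move=> cy ct; apply: (@glue_continuous _ _ _ t) => //.
  - have ca : continuous (fun z => (y z, Num.min (3 * t z) 1)) by cont.
    exact: (continuous_comp2 ca cH).
  - have cp := continuous_comp2 cy cphi.
    have ca : continuous (fun z => (phi (y z), Num.min (3 - 3 * t z) 1)).
      by apply: continuous_pairR; [exact: cp|cont].
    exact: (continuous_comp2 ca cH).
  - move=> z ->; rewrite !min_r ?H1 //; lra.
have P11 e t : unitI t -> P1 e 1 t = P2 (\val e).2 t.
  move=> /andP[t0 t1]; rewrite /P1 /P2 subrr mul0r add0r !mul1r.
  have cl (s : R) : s <= 0 -> clamp s = 0.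
    by rewrite /clamp /Num.max /Num.min; do ![case: ifP]; lra.
  have [h1|h1] := leP t 3^-1.
    rewrite cl; last by lra.
    rewrite G0 ifT; last lra.
    by congr (H (_, _)); rewrite /Num.min; do ![case: ifP]; lra.
  have [h2|h2] := leP t (2 / 3).
    have -> : Num.min (3 * t) (Num.min (3 - 3 * t) 1) = 1.
      by rewrite /Num.min; do ![case: ifP]; lra.
    rewrite H1; case: ifP => h; rewrite (_ : Num.min _ _ = 1) ?H1 //;
      by rewrite /Num.min; case: ifP; lra.
  rewrite clamp_ge1; last by lra.
  rewrite G1 ifF; last by apply/negbTE; rewrite -ltNge; lra.
  by congr (H (_, _)); rewrite /Num.min; do ![case: ifP]; lra.
pose Pc (x : E * R * R) := P (x.1.1, clamp x.1.2, clamp x.2).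
have cPc : continuous Pc.
  apply: (@glue_continuous _ _ _ (fun x : E * R * R => clamp x.1.2)).
  - by cont.
  - by apply: cP1; cont.
  - apply: cP2; last by cont.
    have cc : continuous (fun x : E * R * R => 2 * clamp x.1.2 - 1) by cont.
    have cd : continuous (fun x : E * R * R => (\val x.1.1).2).
      have ce : continuous (fun x : E * R * R => x.1.1) by cont.
      exact: (continuous_comp2 ce c2).
    exact: (continuous_comp2 (continuous_pairR cd cc) cH).
  - move=> x ->; rewrite mulfV ?pnatr_eq0 // subrr H0 P11 //; exact: clampI.
(* At each stage the end is the image by [phi] of the origin, so the projections are twisted paths
   and [tw_ext] makes them points of [Fx]. *)
have Ptw e s : P (e, s, 1) = phi (P (e, s, 0)).
  rewrite /P /=; case: ifP => _.
    rewrite /P1 !mulr0 !mulr1 sub0r subr0 add0r.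
    have -> : clamp (3 - 1 : R) = 1 by apply: clamp_ge1; lra.
    have -> : clamp (- 1 : R) = 0.
      by rewrite /clamp /Num.max /Num.min; do ![case: ifP]; lra.
    rewrite (_ : Num.min 3 _ = 0 :> R); last by rewrite /Num.min; do ![case: ifP]; lra.
    rewrite (_ : Num.min 0 _ = 0 :> R); last by rewrite /Num.min; do ![case: ifP]; lra.
    by rewrite !mulr0 mulr1 !H0 subrK G1 G0.
  rewrite /P2 ifF; last by apply/negbTE; rewrite -ltNge; lra.
  rewrite ifT; last by rewrite invr_ge0 ler0n.
  by rewrite !mulr1 !mulr0 subrr !min_l ?H0 ?ler01.
have PcE e s t : Pc (e, s, t) = P (e, clamp s, clamp t) by [].
have cqP : continuous (fun x : (E * R) * R => q (Pc x)) :=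
  continuous_comp2 cPc (cov_cont cq).
have [||k [ck Hk]] := tw_ext tw cqP.
- by move=> z t _; exact: (cov_in cq).
- by move=> [e s]; rewrite !PcE clamp0 (clamp_ge1 (lexx 1)) Ptw qphi.
have kF z : Fx (k z) by have [] := Hk z.
have cPx e s : continuous (fun t => Pc (e, s, t)).
  have ca : continuous (fun t : R => (e, s, t)).
    by apply: continuous_pairR; [exact: contcst|exact: continuous_idE].
  exact: (continuous_comp2 ca cPc).
have P0 e t : unitI t -> P (e, 0, t) = G (e, t).
  move=> tI; rewrite /P /= invr_ge0 ler0n /P1 mulr0 !mul0r subr0 mul1r addr0.
  by rewrite H0.
have k0 e : k (e, 0) = (\val e).1.
  apply: (tw_inj tw) => // t tI; have [_ ->//] := Hk (e, 0).
  rewrite PcE clamp0 (clamp_id tI) P0 //.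
  by have [_ -> ] := HG e.
have mem e s : lifted_paths (k (e, clamp s), Pc (e, s, 0)).
  split => /=.
  - exact: kF.
  - have [_ ->] := Hk (e, clamp s); last exact: unitI0.
    by rewrite !PcE (clamp_id (clampI s)).
  - have -> : phi (Pc (e, s, 0)) = Pc (e, s, 1).
      by rewrite !PcE clamp0 (clamp_ge1 (lexx 1)) Ptw.
    apply: (endpE cq (G := fun t => Pc (e, s, t))); split => //.
    move=> t tI; have [_ ->//] := Hk (e, clamp s).
    by rewrite !PcE (clamp_id (clampI s)).
pose HE (x : E * R) : E := to_set_type (mem x.1 x.2).
have e00 : lifted_paths (u, y0) by split.
pose ee : E := to_set_type e00.
exists (HE (ee, 1)), HE; split.
  apply: cont_set_type => /=; apply: continuous_pairR.
    have ca : continuous (fun x : E * R => (x.1, clamp x.2)) by cont.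
    exact: (continuous_comp2 ca ck).
  have ca : continuous (fun x : E * R => (x.1, x.2, 0 : R)) by cont.
  exact: (continuous_comp2 ca cPc).
move=> e; split; apply: val_inj => /=.
  rewrite clamp0 k0 PcE clamp0 (P0 _ _ unitI0) G0 -surjective_pairing //.
have PE t : Pc (e, 1, t) = Pc (ee, 1, t).
  have h1 : (1 <= 2^-1 :> R) = false by apply/negbTE; rewrite -ltNge; lra.
  have h2 : 2 * 1 - 1 = 1 :> R by lra.
  by rewrite !PcE (clamp_ge1 (lexx 1)) /P /= h1 h2 !H1.
rewrite PE; congr (_, _); rewrite (clamp_ge1 (lexx 1)).
apply: (tw_inj tw) => // t tI.
by have [_ ->//] := Hk (e, 1); have [_ ->//] := Hk (ee, 1); rewrite PE.
Qed.

Lemma lifted_joined (e e' : lifted_paths) : exists (k : R -> L) (X : R -> M),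
  [/\ continuous k, continuous X, forall t, lifted_paths (k t, X t),
      \val e = (k 0, X 0) & \val e' = (k 1, X 1)].
Proof.
have [k [ck k0 k1]] := contractible_path lifted_contractible e e'.
have cv := continuous_comp2 ck (@val_continuous _ lifted_paths).
exists (fun t => (\val (k t)).1), (fun t => (\val (k t)).2); split.
- exact: (continuous_comp2 cv (@continuous_fstE L M)).
- exact: (continuous_comp2 cv (@continuous_sndE L M)).
- by move=> t; rewrite -surjective_pairing; exact: (set_mem (valP (k t))).
- by rewrite k0 -surjective_pairing.
- by rewrite k1 -surjective_pairing.
Qed.

Lemma lifted_in_component (e : lifted_paths) : C (\val e).1.
Proof.
have e0 : lifted_paths (u, y0) by split.
have [k [X [ck cX kX e1 e2]]] := lifted_joined (to_set_type e0) e.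
apply/joined_component => //; exists k; split => //.
- by move=> t; have [] := kX t.
- by move: e1 => /= -[].
- by rewrite e2.
Qed.

Definition lifted_proj (e : lifted_paths) : C :=
  to_set_type (lifted_in_component e).

Lemma val_lifted_proj e : \val (lifted_proj e) = (\val e).1.
Proof. by []. Qed.

(** A point of the cover is known from its projection and its coordinate in [M], so lifting reduces
    to lifting the origins of the paths; [lift_persist] keeps the resulting pairs in
    [lifted_paths]. *)
Lemma lifted_covers : covers R setT lifted_proj.
Proof.
have c1 : continuous (fun e : lifted_paths => (\val e).1).
  exact: (continuous_comp2 (@val_continuous _ lifted_paths) (@continuous_fstE L M)).
have c2 : continuous (fun e : lifted_paths => (\val e).2).
  exact: (continuous_comp2 (@val_continuous _ lifted_paths) (@continuous_sndE L M)).
have inj (e e' : lifted_paths) : lifted_proj e = lifted_proj e' ->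
    (\val e).2 = (\val e').2 -> e = e'.
  move=> /(congr1 val); rewrite !val_lifted_proj => h1 h2; apply: val_inj.
  by rewrite [LHS]surjective_pairing [RHS]surjective_pairing h1 h2.
have qv e : q (\val e).2 = ga (\val (lifted_proj e)) 0.
  by rewrite val_lifted_proj; have [] := lifted_pathsP e.
constructor => //.
- apply: cont_set_type; rewrite (_ : (fun e => _) = fun e => (\val e).1) //.
- move=> v _; have := set_mem (valP v) => /joined_component [//|k [ck Fk k0 k1]].
  have [||X [[cX X0 qX] _]] := lift_ex cq (m := y0) (cont_origin ck Fk).
  + by move=> t _; exact: ga_A.
  + by rewrite qy0 k0.
  have e1 : (lifted_paths) (\val v, X 1).
    split => /=.
    + by apply: CF; exact: (set_mem (valP v)).
    + by rewrite qX ?k1 //; exact: unitI1.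
    + rewrite -k1; apply: lift_persist => //; last exact: unitI1.
      by rewrite X0 k0.
  exists (to_set_type e1); apply: val_inj.
  by rewrite val_lifted_proj.
- move=> e; have [V mV HV] := cov_locinj cq (\val e).2.
  exists [set e' | V (\val e').2]; first exact: (c2 e _ mV).
  move=> e1 e2 /= V1 V2 E; apply: inj => //; apply: HV => //.
  by rewrite !qv E.
- move=> G G' cG cG' e e0 t tI; apply: inj; first exact: e.
  apply: (cov_upl cq (continuous_comp2 cG c2) (continuous_comp2 cG' c2)) => //.
    by move=> s sI; rewrite /= !qv e.
  by rewrite /= e0.
- move=> Z f f0 cf _ cf0 e0.
  have cvf := continuous_comp2 cf (@val_continuous L C).
  have Fvf z : Fx (\val (f z)) by apply: CF; exact: (set_mem (valP (f z))).
  have [||F [cF HF]] := cov_hlp cq (cont_origin cvf Fvf) _ (continuous_comp2 cf0 c2).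
  + by move=> z t _; apply: ga_A; exact: Fvf.
  + by move=> z; rewrite /= qv e0.
  have mem z t : unitI t -> lifted_paths (\val (f (z, t)), F (z, t)).
    move=> tI; have [F0 qF] := HF z; split => /=.
    + exact: Fvf.
    + by rewrite qF.
    + have ca : continuous (fun t : R => (z, t)) by cont.
      apply: (lift_persist cphi qphi (k := fun t => \val (f (z, t)))
        (X := fun t => F (z, t))) => //.
      * exact: (continuous_comp2 ca cvf).
      * exact: (continuous_comp2 ca cF).
      * rewrite F0 /= -e0 val_lifted_proj.
        by have [] := lifted_pathsP (f0 z).
  exists (fun p => to_set_type (mem p.1 (clamp p.2) (clampI p.2))).
  split.
    apply: cont_set_type => /=.
    have ca : continuous (fun p : Z * R => (p.1, clamp p.2)) by cont.
    apply: continuous_pairR; first exact: (continuous_comp2 ca cvf).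
    exact: (continuous_comp2 ca cF).
  move=> z; have [F0 qF] := HF z; split.
    apply: inj.
      by apply: val_inj; rewrite val_lifted_proj /= clamp0 -e0.
    by rewrite /= clamp0 F0.
  move=> t tI; apply: val_inj; rewrite val_lifted_proj /= clamp_id //.
- move=> v; have h : {in lifted_proj @^-1` [set v] &, injective (fun e => (\val e).2)}.
    move=> e e' /set_mem /= he /set_mem /= he' E; apply: inj => //.
    by rewrite he he'.
  rewrite -(eq_countable (inj_card_eq h)).
  apply: sub_countable (cov_count cq (ga (\val v) 0)); apply: subset_card_le.
  by move=> _ [e /= he <-]; rewrite qv he.
Qed.


End Component.


Lemma twisted_aspherical u : Fx u ->
  aspherical R (set_type (connected_component Fx u)).
Proof.
move=> Fu; have [y0 qy0] := cov_surj cq (ga_A 0 Fu).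
have [|||phi [cphi qphi phi0]] := lift_contractible cq cM
  (k := g \o q) (n0 := y0) (m0 := endp q y0 (ga u)).
- exact: (continuous_comp2 (cov_cont cq) gc).
- by move=> m; apply: (tw_gA tw); exact: (cov_in cq).
- by rewrite /= qy0; exact: (q_endp cq (ga_path Fu)).
exists (lifted_paths phi), (lifted_proj Fu qy0 cphi qphi (esym phi0)); split; last first.
  exact: (lifted_contractible Fu qy0 cphi qphi (esym phi0)).
split; last first.
  apply: contractible_simply_connected.
  exact: (lifted_contractible Fu qy0 cphi qphi (esym phi0)).
apply: (@covers_covering_map R).
  exact: (lifted_covers Fu qy0 cphi qphi (esym phi0)).
exact: component_contractible_nbhs.
Qed.

End Twisted.

(** * Monodromy *)

Lemma path_rev_concat (R : realType) (T : topologicalType) (f h : R -> T) : f 1 = h 0 ->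
  path_rev (path_concat f h) = path_concat (path_rev h) (path_rev f) :> (R -> T).
Proof.
move=> e; apply/funext => t; rewrite /path_rev /path_concat.
have [h1|h1] := ltP t 2^-1.
  rewrite ifF; last by apply/negbTE; rewrite -ltNge; lra.
  by rewrite ifT; [congr h; lra|lra].
rewrite ifT; last lra.
(* The two sides attribute the midpoint to different paths; [e] matches them. *)
have [->|h2] := eqVneq t 2^-1.
  rewrite lexx mulfV ?pnatr_eq0 // subrr -e; congr f; lra.
rewrite ifF; first by congr f; lra.
by apply/negbTE; rewrite -ltNge lt_neqAle eq_sym h2.
Qed.

Section OrbitGroup.
Variables (R : realType) (S : based_gspace).
Local Notation x0 := (bg_base S).
Implicit Types (a b : orbit_group R S) (h : bg_group S) (f : R -> bg_space S).

Lemma orbit_class_elt h f : is_orbit_path h f ->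
  orbit_elt (orbit_class h f) = h.
Proof.
move=> pf; have := orbit_repK (orbit_class h f).
by move=> /(orbit_classP (orbit_repP _) pf) [].
Qed.

Lemma orbit_class_rep h f : is_orbit_path h f ->
  path_homotopic (@bg_set S) (orbit_rep (orbit_class h f)) f.
Proof.
move=> pf; have := orbit_repK (orbit_class h f).
by move=> /(orbit_classP (orbit_repP _) pf) [].
Qed.

Lemma orbit_eqP a b : orbit_elt a = orbit_elt b ->
  path_homotopic (@bg_set S) (orbit_rep a) (orbit_rep b) -> a = b.
Proof.
move=> e h; rewrite -[a]orbit_repK -[b]orbit_repK.
by apply/(orbit_classP (orbit_repP a) (orbit_repP b)).
Qed.

Lemma orbit_elt1 : orbit_elt (1%g : orbit_group R S) = 1%g.
Proof. by have [] := orbit_reprP (mk_orbit_path (orbit_one_subproof R S)). Qed.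

Lemma orbit_eltM a b : orbit_elt (a * b)%g = (orbit_elt a * orbit_elt b)%g.
Proof. by have [] := orbit_reprP (orbit_path_mul (generic_quotient.repr a) (generic_quotient.repr b)). Qed.

Lemma orbit_eltV a : orbit_elt (a^-1)%g = ((orbit_elt a)^-1)%g.
Proof. by have [] := orbit_reprP (orbit_path_inv (generic_quotient.repr a)). Qed.

Lemma orbit_rep1 : path_homotopic (@bg_set S) (orbit_rep (1%g : orbit_group R S)) (cst x0).
Proof. by have [] := orbit_reprP (mk_orbit_path (orbit_one_subproof R S)). Qed.

Lemma orbit_repM a b : path_homotopic (@bg_set S) (orbit_rep (a * b)%g)
  (path_concat (orbit_rep a) (bg_act (orbit_elt a) \o orbit_rep b)).
Proof. by have [] := orbit_reprP (orbit_path_mul (generic_quotient.repr a) (generic_quotient.repr b)). Qed.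

Variables (M : topologicalType) (q : M -> bg_space S).
Hypotheses (cq : covers R (@bg_set S) q) (cM : contractible R M).
Variable m0 : M.
Hypothesis qm0 : q m0 = x0.

(** This is the test by which identities between braids are proved. *)
Lemma orbit_eq_endp a b : orbit_elt a = orbit_elt b ->
  endp q m0 (orbit_rep a) = endp q m0 (orbit_rep b) -> a = b.
Proof.
move=> e h; apply: orbit_eqP => //.
exact: (homotopic_endp cq cM (orbit_repP a) (orbit_repP b) qm0 h).
Qed.

Lemma orbit_class_endp h f : is_orbit_path h f ->
  endp q m0 (orbit_rep (orbit_class h f)) = endp q m0 f.
Proof.
move=> pf; have := endp_homotopic cq (orbit_repP (orbit_class h f)) qm0.
by apply; exact: orbit_class_rep.
Qed.

Lemma orbit_mul_endp a b : endp q m0 (orbit_rep (a * b)%g) =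
  endp q (endp q m0 (orbit_rep a)) (bg_act (orbit_elt a) \o orbit_rep b).
Proof.
have h := is_path_act (orbit_elt a) (orbit_repP b).
rewrite -(endp_concat cq (orbit_repP a) h qm0).
exact: (endp_homotopic cq (orbit_repP _) qm0 (orbit_repM a b)).
Qed.

Lemma orbit_elt_endp h m : q m = bg_act h x0 ->
  exists a, orbit_elt a = h /\ endp q m0 (orbit_rep a) = m.
Proof.
move=> qm; have [f [pf ef]] := endp_surj cq cM m0 m; rewrite qm0 qm in pf.
exists (orbit_class h f); split; first exact: orbit_class_elt.
by rewrite (orbit_class_endp pf).
Qed.

End OrbitGroup.

Section Monodromy.
Variables (R : realType) (M T L : topologicalType).
Variables (A : set T) (g : T -> T) (Fx : set L) (ga : L -> R -> T).
Hypothesis tw : twisted_paths A g Fx ga.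
Variable q : M -> T.
Hypotheses (cq : covers R A q) (cM : contractible R M).
Variables (x0 : T) (m0 : M).
Hypothesis qm0 : q m0 = x0.

Lemma path_g x y (f : R -> T) : is_path A x y f -> is_path A (g x) (g y) (g \o f).
Proof.
move=> [cf Af f0 f1]; split => /=; rewrite ?f0 ?f1 //.
  exact: (continuous_comp2 cf (tw_g tw)).
by move=> t tI; apply: (tw_gA tw); exact: Af.
Qed.

Definition mono_path (u : L) (eta : R -> T) : R -> T :=
  path_concat (path_concat eta (ga u)) (g \o path_rev eta).

Let endq := endp (R := R) q.

Section Loop.
Variables (u : L) (eta : R -> T).
Hypotheses (Fu : Fx u) (peta : is_path A x0 (ga u 0) eta).

Lemma mono_pathP : is_path A x0 (g x0) (mono_path u eta).
Proof.
apply: path_concatP; last exact: path_g (path_revP peta).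
exact: path_concatP peta (ga_path tw Fu).
Qed.

Lemma endp_mono : endq m0 (mono_path u eta) =
  endq (endq (endq m0 eta) (ga u)) (g \o path_rev eta).
Proof.
rewrite /endq; have pg := ga_path tw Fu.
rewrite (endp_concat cq (path_concatP peta pg) (path_g (path_revP peta)) qm0).
by rewrite (endp_concat cq peta pg qm0).
Qed.

Lemma q_eta : q (endq m0 eta) = ga u 0.
Proof. exact: (q_endp cq peta qm0). Qed.

(* The lift of [g] whose fixed points, in the sense of [lifted_paths], are the
   paths in the component of [u]. *)
Lemma mono_lift : exists phi : M -> M, [/\ continuous phi,
  forall m, q (phi m) = g (q m), phi m0 = endq m0 (mono_path u eta) &
  endq (endq m0 eta) (ga u) = phi (endq m0 eta)].
Proof.
have pg := ga_path tw Fu.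
have [|||phi [cphi qphi phi0]] := lift_contractible cq (k := g \o q) (n0 := m0)
  (m0 := endq m0 (mono_path u eta)) cM.
- exact: (continuous_comp2 (cov_cont cq) (tw_g tw)).
- by move=> m; apply: (tw_gA tw); exact: (cov_in cq).
- by rewrite /= qm0; exact: (q_endp cq mono_pathP qm0).
exists phi; split => //.
rewrite -(endp_map cq cq cphi qphi peta qm0) phi0 endp_mono.
apply/esym; have h := endp_rev' cq (path_g peta).
rewrite /endq (_ : g \o path_rev eta = path_rev (g \o eta)) // h //.
exact: (q_endp cq pg q_eta).
Qed.

End Loop.

(** [eta'] continues [eta] along the origins of the paths joining [u] to [v]. The lift of [g]
    attached to [u] persists there by [lift_persist], and both end points are its value at [m0]. *)
Lemma mono_joined u v eta : Fx u -> is_path A x0 (ga u 0) eta ->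
  joined R Fx u v -> exists eta', is_path A x0 (ga v 0) eta' /\
    endq m0 (mono_path v eta') = endq m0 (mono_path u eta).
Proof.
move=> Fu pe [k [ck Fk k0 k1]].
have pz : is_path A (ga u 0) (ga v 0) (fun t => ga (k t) 0).
  split; rewrite ?k0 ?k1 //; first exact: (cont_origin tw ck Fk).
  by move=> t _; exact: (tw_A tw).
have Fv : Fx v by rewrite -k1.
exists (path_concat eta (fun t => ga (k t) 0)); split; first exact: path_concatP pe pz.
have pe' := path_concatP pe pz.
have [phi [cphi qphi phi0 phiu]] := mono_lift Fu pe.
rewrite (endp_mono Fv pe') (endp_mono Fu pe).
have [|X [[cX X0 qX] eX]] := lift_path cq (m := endq m0 eta) pz.
  exact: q_eta.
have e1 : endq (X 1) (ga v) = phi (X 1).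
  rewrite -k1; apply: (lift_persist tw cq cphi qphi ck Fk cX qX) => //; last exact: unitI1.
  by rewrite X0 k0.
have e2 : endq m0 (path_concat eta (fun t => ga (k t) 0)) = X 1.
  by rewrite /endq (endp_concat cq pe pz qm0) -eX.
rewrite e2 e1.
have mp m y f : is_path A x0 y f -> q m = y ->
    endq (phi m) (g \o path_rev f) = phi (endq m (path_rev f)).
  by move=> pf qm; exact: (endp_map cq cq cphi qphi (path_revP pf) qm).
rewrite (mp _ _ _ pe'); last by rewrite -e2; exact: (q_endp cq pe' qm0).
rewrite phiu (mp _ _ _ pe); last exact: q_eta.
by rewrite -e2 /endq (endp_rev cq pe' qm0) (endp_rev cq pe qm0).
Qed.

(** Equal end points mean that [u] and [v] determine the same lift of [g]; both are then projections
    of points of one space [lifted_paths], which is contractible. *)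
Lemma mono_inj u v eta eta' : Fx u -> Fx v ->
  is_path A x0 (ga u 0) eta -> is_path A x0 (ga v 0) eta' ->
  endq m0 (mono_path v eta') = endq m0 (mono_path u eta) -> joined R Fx u v.
Proof.
move=> Fu Fv pe pe' e.
have [phi [cphi qphi phi0 phiu]] := mono_lift Fu pe.
have phiv : endq (endq m0 eta') (ga v) = phi (endq m0 eta').
  rewrite -(endp_map cq cq cphi qphi pe' qm0) phi0 -e endp_mono //.
  apply/esym; rewrite /endq (_ : g \o path_rev eta' = path_rev (g \o eta')) //.
  rewrite (endp_rev' cq (path_g pe')) //.
  exact: (q_endp cq (ga_path tw Fv) (q_eta pe')).
have lu : lifted_paths Fx ga q phi (u, endq m0 eta) by split => //; exact: q_eta.
have lv : lifted_paths Fx ga q phi (v, endq m0 eta') by split => //; exact: q_eta.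
have [k [X [ck cX kX e1 e2]]] := lifted_joined tw cq cM Fu (q_eta pe) cphi qphi phiu
  (to_set_type lu) (to_set_type lv).
exists k; split => //.
- by move=> t; have [] := kX t.
- by move: e1 => /= -[].
- by move: e2 => /= -[].
Qed.

(** A path from [x0] to [g x0] is itself the path of an element of [Fx] with origin [x0], so [eta]
    may be constant. *)
Lemma mono_surj (f : R -> T) : is_path A x0 (g x0) f ->
  exists u eta, [/\ Fx u, is_path A x0 (ga u 0) eta &
    endq m0 (mono_path u eta) = endq m0 f].
Proof.
move=> pf; have [cf Af f0 f1] := pf.
have [|||k [ck Hk]] := tw_ext tw (f := fun p : R * R => f p.2).
- exact: (continuous_comp2 (@continuous_sndE R R) cf).
- by move=> z t; exact: Af.
- by move=> z; rewrite /= f0 f1.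
have [Fu gu] := Hk 0; set u := k 0 in Fu gu.
have u0 : ga u 0 = x0 by rewrite gu //=; exact: unitI0.
have pe : is_path A x0 (ga u 0) (cst x0 : R -> T).
  rewrite u0; split => //; first exact: cst_continuous.
  by move=> t _; rewrite /= -f0; apply: Af; exact: unitI0.
exists u, (cst x0); split => //.
rewrite endp_mono // /endq (endp_cst cq qm0) // -(endp_eq cq pf qm0); last first.
  by move=> t tI; rewrite gu.
rewrite (_ : g \o path_rev (cst x0) = cst (g x0)) //.
by apply: (endp_cst cq); exact: (q_endp cq pf qm0).
Qed.

Lemma mono_conj u eta p : Fx u -> is_path A x0 (ga u 0) eta -> is_path A x0 x0 p ->
  endq m0 (mono_path u (path_concat p eta)) =
  endq m0 (path_concat (path_concat p (mono_path u eta)) (g \o path_rev p)).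
Proof.
move=> Fu pe pp; have pt := mono_pathP Fu pe.
have pg := ga_path tw Fu; have ppe := path_concatP pp pe.
rewrite (endp_mono Fu ppe) /endq.
rewrite (endp_concat cq (path_concatP pp pt) (path_g (path_revP pp)) qm0).
rewrite (endp_concat cq pp pe qm0) (endp_concat cq pp pt qm0).
have qp := q_endp cq pp qm0; move: qp; set m1 := endp q m0 p => qp.
rewrite /mono_path (endp_concat cq (path_concatP pe pg) (path_g (path_revP pe)) qp).
rewrite (endp_concat cq pe pg qp) path_rev_concat; last first.
  by have [_ _ _ ->] := pp; have [_ _ -> _] := pe.
rewrite comp_path_concat (endp_concat cq (path_g (path_revP pe)) (path_g (path_revP pp))) //.
exact: (q_endp cq pg (q_endp cq pe qp)).
Qed.

Lemma mono_change u eta eta' : Fx u -> is_path A x0 (ga u 0) eta ->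
  is_path A x0 (ga u 0) eta' -> exists p, is_path A x0 x0 p /\
  endq m0 (mono_path u eta') =
  endq m0 (path_concat (path_concat p (mono_path u eta)) (g \o path_rev p)).
Proof.
move=> Fu pe pe'; pose p := path_concat eta' (path_rev eta).
have pp : is_path A x0 x0 p := path_concatP pe' (path_revP pe).
exists p; split => //; rewrite -mono_conj //.
have ppe := path_concatP pp pe.
have e : endq m0 (path_concat p eta) = endq m0 eta'.
  rewrite /endq (endp_concat cq pp pe qm0) (endp_concat cq pe' (path_revP pe) qm0).
  by apply: (endp_rev' cq pe); exact: (q_endp cq pe' qm0).
have h : path_homotopic A (path_concat p eta) eta'.
  exact: (homotopic_endp cq cM ppe pe' qm0).
rewrite !endp_mono // e /endq.
have := homotopic_comp (tw_g tw) (tw_gA tw) h.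
have hr (f f' : R -> T) : path_homotopic A f f' -> path_homotopic A (path_rev f) (path_rev f').
  move=> [H [cH HP]]; exists (fun x => H (1 - x.1, x.2)); split.
    have ca : continuous (fun x : R * R => (1 - x.1, x.2)) by cont.
    exact: (continuous_comp2 ca cH).
  move=> t s tI sI /=; have tI' : unitI (1 - t) by move: tI; rewrite /unitI; lra.
  have [a1 a2 a3 a4 a5] := HP _ _ tI' sI; split => //.
    by rewrite subr0 /path_rev; have [_ _ _ _ ->] := HP 1 s unitI1 sI; rewrite subr0.
  by rewrite subrr /path_rev; have [_ _ _ -> _] := HP 0 s unitI0 sI; rewrite subrr.
move=> /hr hh; apply/esym.
apply: (endp_homotopic cq (path_g (path_revP ppe))) => //.
by rewrite (q_endp cq (ga_path tw Fu)) //; exact: (q_endp cq pe' qm0).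
Qed.

Hypothesis Ax0 : A x0.

(** * The fundamental group of a component *)

Section FundamentalGroup.
Variables (u : L) (eta : R -> T).
Hypotheses (Fu : Fx u) (peta : is_path A x0 (ga u 0) eta).
Let C := connected_component Fx u.
Let Cu : C u := connected_component_refl Fu.
Let y0 := endq m0 eta.

Let CF w : C w -> Fx w. Proof. exact: connected_component_sub. Qed.

Definition origin_path (w : R -> L) : R -> T := fun t => ga (w (clamp t)) 0.

Lemma origin_pathP v v' w : is_path C v v' w ->
  is_path A (ga v 0) (ga v' 0) (origin_path w).
Proof.
move=> [cw Cw w0 w1]; rewrite /origin_path; split.
- have cc := continuous_comp2 (@clamp_continuous R) cw.
  by apply: (cont_origin tw cc) => z; apply: CF; apply: Cw; exact: clampI.
- by move=> t tI; apply: (tw_A tw); apply: CF; apply: Cw; exact: clampI.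
- by rewrite clamp0 w0.
- by rewrite (clamp_ge1 (lexx 1)) w1.
Qed.

Lemma origin_path_homotopic w w' : path_homotopic C w w' ->
  path_homotopic A (origin_path w) (origin_path w').
Proof.
move=> [H [cH HP]]; exists (fun p => ga (H (clamp p.1, clamp p.2)) 0); split.
  have ca : continuous (fun p : R * R => (clamp p.1, clamp p.2)) by cont.
  apply: (cont_origin tw (continuous_comp2 ca cH)) => z; apply: CF.
  by have [] := HP _ _ (clampI z.1) (clampI z.2).
move=> t s tI sI /=; rewrite /origin_path clamp0 (clamp_ge1 (lexx 1)).
rewrite (clamp_id tI) (clamp_id sI).
have [h1 h2 h3 h4 h5] := HP t s tI sI.
have [_ h2' _ _ _] := HP t 0 tI unitI0.
have [_ _ h3' _ _] := HP t 1 tI unitI1.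
have [_ _ _ h4' _] := HP 0 s unitI0 sI.
have [_ _ _ _ h5'] := HP 1 s unitI1 sI.
by split; rewrite ?h2' ?h3' ?h4' ?h5' //; apply: (tw_A tw); exact: CF.
Qed.

Definition pi1_image (w : R -> L) : R -> T :=
  path_concat (path_concat eta (origin_path w)) (path_rev eta).

Lemma pi1_imageP w : is_path C u u w -> is_path A x0 x0 (pi1_image w).
Proof.
move=> /origin_pathP pw.
exact: path_concatP (path_concatP peta pw) (path_revP peta).
Qed.

Lemma endp_pi1_image w : is_path C u u w ->
  endq m0 (pi1_image w) = endq (endq y0 (origin_path w)) (path_rev eta).
Proof.
move=> /origin_pathP pw; rewrite /endq /pi1_image.
rewrite (endp_concat cq (path_concatP peta pw) (path_revP peta) qm0).
by rewrite (endp_concat cq peta pw qm0).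
Qed.

Lemma y0P : q y0 = ga u 0. Proof. exact: q_eta. Qed.

(** Both loops lift to [lifted_paths], with the same ends by assumption; the lifts are homotopic
    because that space is contractible. *)
Lemma pi1_image_inj w w' : is_path C u u w -> is_path C u u w' ->
  endq m0 (pi1_image w) = endq m0 (pi1_image w') -> path_homotopic C w w'.
Proof.
move=> pw pw'; rewrite !endp_pi1_image // => e.
have po := origin_pathP pw; have po' := origin_pathP pw'.
have {}e : endq y0 (origin_path w) = endq y0 (origin_path w').
  apply: (endp_inj cq (path_revP peta) _ _ e).
    exact: (q_endp cq po y0P).
  exact: (q_endp cq po' y0P).
have [phi [cphi qphi phi0 phiu]] := mono_lift Fu peta.
pose E := lifted_paths Fx ga q phi.
have lift_E v : is_path C u u v -> exists (X : R -> E),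
    [/\ continuous X, forall t, \val (X t) = (v (clamp t), (\val (X t)).2),
       (\val (X 0)).2 = y0 & (\val (X 1)).2 = endq y0 (origin_path v)].
  move=> pv; have [cv Cv v0 v1] := pv.
  have [X [[cX X0 qX] eX]] := lift_path cq (origin_pathP pv) y0P.
  have cv' := continuous_comp2 (@clamp_continuous R) cv.
  have Fv' t : Fx (v (clamp t)) by apply: CF; apply: Cv; exact: clampI.
  have mem t : E (v (clamp t), X (clamp t)).
    split => //=.
      by rewrite qX ?/origin_path ?(clamp_id (clampI t)) //; exact: clampI.
    have := lift_persist tw cq cphi qphi cv' Fv' cX qX _ (clampI t).
    by rewrite /= (clamp_id (clampI t)) clamp0 X0 v0; apply.
  exists (fun t => to_set_type (mem t)); split.
  - apply: cont_set_type => /=; apply: continuous_pairR => //.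
    exact: (continuous_comp2 (@clamp_continuous R) cX).
  - by [].
  - by rewrite /= clamp0 X0.
  - by rewrite /= (clamp_ge1 (lexx 1)) -eX.
have [X [cX X1 X2 X3]] := lift_E w pw; have [X' [cX' X1' X2' X3']] := lift_E w' pw'.
have [cw Cw w0 w1] := pw; have [cw' Cw' w0' w1'] := pw'.
have cE := lifted_contractible tw cq cM Fu y0P cphi qphi phiu.
have h : path_homotopic [set: E] X X'.
  apply: (contractible_homotopic cE) => //; apply: val_inj.
    by rewrite [LHS]X1 [RHS]X1' X2 X2' clamp0 w0 w0'.
  by rewrite [LHS]X1 [RHS]X1' X3 X3' e (clamp_ge1 (lexx 1)) w1 w1'.
have cf : continuous (fun e : E => (\val e).1).
  exact: (continuous_comp2 (@val_continuous _ E) (@continuous_fstE L M)).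
have fC z : [set: E] z -> C (\val z).1.
  by move=> _; exact: (lifted_in_component tw cq cM Fu y0P cphi qphi phiu).
have h' := homotopic_comp cf fC h.
have fw t : unitI t -> (\val (X t)).1 = w t by move=> tI; rewrite X1 /= (clamp_id tI).
have fw' t : unitI t -> (\val (X' t)).1 = w' t by move=> tI; rewrite X1' /= (clamp_id tI).
apply: (homotopic_trans (homotopic_eq pw (fun t tI => esym (fw t tI)))).
apply: (homotopic_trans h'); apply: homotopic_sym.
exact: (homotopic_eq pw' (fun t tI => esym (fw' t tI))).
Qed.

(** Let m1 be the end of the lift of [p]. Commutation says that the lift of the monodromy path from
    m1 ends at phi m1, that is, that [u] and the end of the lift of [eta] from m1 form a point of
    [lifted_paths]. A path to it from the pair of [u] and [y0] projects to the loop sought. *)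
Lemma pi1_image_comm p : is_path A x0 x0 p ->
  (endq m0 (path_concat p (mono_path u eta)) =
   endq m0 (path_concat (mono_path u eta) (g \o p))) <->
  exists w, is_path C u u w /\ endq m0 (pi1_image w) = endq m0 p.
Proof.
move=> pp; have pt := mono_pathP Fu peta.
have [phi [cphi qphi phi0 phiu]] := mono_lift Fu peta.
have pg := ga_path tw Fu.
rewrite /endq (endp_concat cq pp pt qm0) (endp_concat cq pt (path_g pp) qm0).
rewrite -/endq -phi0 /endq (endp_map cq cq cphi qphi pp qm0) -/endq.
have qp : q (endq m0 p) = x0 := q_endp cq pp qm0.
set m1 := endq m0 p in qp *.
have q1 : q (endq m1 eta) = ga u 0 := q_endp cq peta qp.
have e1 : endq m1 (mono_path u eta) = endq (endq (endq m1 eta) (ga u)) (g \o path_rev eta).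
  rewrite /endq (endp_concat cq (path_concatP peta pg) (path_g (path_revP peta)) qp).
  by rewrite (endp_concat cq peta pg qp).
have e2 : phi m1 = endq (phi (endq m1 eta)) (g \o path_rev eta).
  rewrite /endq (endp_map cq cq cphi qphi (path_revP peta) q1).
  by rewrite (endp_rev cq peta qp).
have E1 : endq m1 (mono_path u eta) = phi m1 <->
    lifted_paths Fx ga q phi (u, endq m1 eta).
  split.
    rewrite e1 e2 => /(endp_inj cq (path_g (path_revP peta))) h; split => //=.
    by apply: h; [exact: (q_endp cq pg q1)|rewrite qphi q1].
  by move=> [_ _ /= h]; rewrite e1 e2 /endq h.
rewrite E1; split.
  move=> l1; have l0 : lifted_paths Fx ga q phi (u, y0) by split => //; exact: y0P.
  have [k [X [ck cX kX k0 k1]]] := lifted_joined tw cq cM Fu y0P cphi qphi phiu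
    (to_set_type l0) (to_set_type l1).
  move: k0 k1 => /= -[k0 X0] [k1 X1].
  have pk : is_path C u u k.
    split => // t tI; apply/(joined_component tw) => //; exists (fun s => k (s * t)); split.
    - have ca : continuous (fun s : R => s * t) by cont.
      exact: (continuous_comp2 ca ck).
    - by move=> s; have [] := kX (s * t).
    - by rewrite mul0r.
    - by rewrite mul1r.
  exists k; split => //; rewrite endp_pi1_image //.
  have -> : endq y0 (origin_path k) = endq m1 eta.
    rewrite X1; apply: (endpE cq); split => // t tI.
    by rewrite /origin_path (clamp_id tI); have [] := kX t.
  exact: (endp_rev cq peta qp).
move=> [w [pw ew]]; have [cw Cw w0 w1] := pw.
have po := origin_pathP pw.
have [X [[cX X0 qX] eX]] := lift_path cq po y0P.
have -> : endq m1 eta = X 1.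
  rewrite -eX -ew endp_pi1_image // /endq; apply: (endp_rev' cq peta).
  exact: (q_endp cq po y0P).
have cw' := continuous_comp2 (@clamp_continuous R) cw.
have Fw' t : Fx (w (clamp t)) by apply: CF; apply: Cw; exact: clampI.
split => //=; first by rewrite -eX; exact: (q_endp cq po y0P).
have := lift_persist tw cq cphi qphi cw' Fw' cX qX _ unitI1.
by rewrite /= clamp0 (clamp_ge1 (lexx 1)) X0 w0 w1; apply.
Qed.

Lemma origin_path_concat w w' t : origin_path (path_concat w w') t =
  path_concat (origin_path w) (origin_path w') (clamp t).
Proof.
rewrite /origin_path /path_concat; have := clampI t; move: (clamp t) => s sI.
have [h|h] := boolP (s <= 2^-1).
  by rewrite [clamp (2 * s)]clamp_id //; move: sI; rewrite /unitI; lra.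
rewrite [clamp (2 * s - 1)]clamp_id //; move: sI h; rewrite /unitI -ltNge; lra.
Qed.

Lemma endp_pi1_concat w w' : is_path C u u w -> is_path C u u w' ->
  endq m0 (pi1_image (path_concat w w')) =
  endq (endq m0 (pi1_image w)) (pi1_image w').
Proof.
move=> pw pw'; have po := origin_pathP pw; have po' := origin_pathP pw'.
have pc := path_concatP pw pw'; rewrite endp_pi1_image //.
have yP := y0P.
have qw : q (endq y0 (origin_path w)) = ga u 0 := q_endp cq po yP.
have e1 : endq m0 (pi1_image w) = endq (endq y0 (origin_path w)) (path_rev eta).
  exact: endp_pi1_image.
have qr : q (endq m0 (pi1_image w)) = x0 := q_endp cq (pi1_imageP pw) qm0.
have e2 : endq y0 (origin_path (path_concat w w')) =
    endq (endq y0 (origin_path w)) (origin_path w').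
  rewrite /endq -(endp_concat cq po po' yP).
  apply: (endp_eq cq (origin_pathP pc) yP) => t tI.
  by rewrite origin_path_concat (clamp_id tI).
rewrite e2 {4}/endq {2}/pi1_image.
rewrite (endp_concat cq (path_concatP peta po') (path_revP peta) qr).
rewrite (endp_concat cq peta po' qr) -!/(endq _ _); congr (endp q _ _).
congr (endp q _ _); rewrite e1; apply/esym.
exact: (endp_rev' cq peta).
Qed.

Variables (S : based_gspace) (k : T -> bg_space S).
Hypotheses (ck : continuous k) (kA : forall z, A z -> bg_set (k z)).
Hypotheses (k0 : k x0 = bg_base S) (ckq : covers R (@bg_set S) (k \o q)).

Lemma endp_push m x y f : is_path A x y f -> q m = x ->
  endp (k \o q) m (k \o f) = endq m f.
Proof.
move=> pf qm; have [X [[cX X0 qX] eX]] := lift_path cq pf qm.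
rewrite /endq eX; apply: (endpE ckq); split => // t tI.
by rewrite /= qX.
Qed.

Lemma push_path x y f : is_path A x y f -> is_path (@bg_set S) (k x) (k y) (k \o f : R -> _).
Proof.
move=> [cf Af f0 f1]; split => /=; rewrite ?f0 ?f1 //.
  exact: (continuous_comp2 cf ck).
by move=> t tI; apply: kA; exact: Af.
Qed.

Lemma push_orbit p : is_path A x0 x0 p -> is_orbit_path (1%g : bg_group S) (k \o p : R -> _).
Proof. by move=> pp; have := push_path pp; rewrite /is_orbit_path bg_act1 k0. Qed.

(** Injectivity comes from [pi1_image_inj] and the image from [pi1_image_comm]. The map [k] leads to
    the space where braids live; it loses no information on loops, because [k \o q] is again a cover
    and computes the same end points. *)
Lemma pi1_iso : group_iso_onto (pi1 R Cu)
  [set b : orbit_group R S | exists p, [/\ is_path A x0 x0 p,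
     b = orbit_class 1%g (k \o p) &
     endq m0 (path_concat p (mono_path u eta)) =
     endq m0 (path_concat (mono_path u eta) (g \o p))]].
Proof.
have kqm : (k \o q) m0 = bg_base S by rewrite /= qm0.
have rp (a : pi1 R Cu) : is_path C u u (orbit_rep a) := orbit_repP a.
have ip (a : pi1 R Cu) := pi1_imageP (rp a).
exists (fun a : pi1 R Cu => orbit_class 1%g (k \o pi1_image (orbit_rep a))); split.
  move=> a b /=; apply: (orbit_eq_endp ckq cM kqm).
    by rewrite orbit_eltM !orbit_class_elt ?mulg1 //; exact: push_orbit (ip _).
  rewrite (orbit_mul_endp ckq kqm) !(orbit_class_endp ckq kqm) ?orbit_class_elt;
    try exact: push_orbit (ip _).
  have pb := push_orbit (ip b).
  have hb : path_homotopic (@bg_set S)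
      (bg_act 1%g \o orbit_rep (orbit_class 1%g (k \o pi1_image (orbit_rep b))))
      (k \o pi1_image (orbit_rep b)).
    have := orbit_class_rep pb; congr path_homotopic.
    by apply/funext => t /=; rewrite bg_act1.
  rewrite !(endp_push (ip _) qm0) -/endq.
  have qa : q (endq m0 (pi1_image (orbit_rep a))) = x0 := q_endp cq (ip a) qm0.
  have pb' : is_path (@bg_set S) (bg_base S) (bg_base S)
      (bg_act 1%g \o orbit_rep (orbit_class 1%g (k \o pi1_image (orbit_rep b))) : R -> _).
    have := is_path_act 1%g (orbit_repP (orbit_class 1%g (k \o pi1_image (orbit_rep b)))).
    by rewrite (orbit_class_elt pb) !bg_act1.
  rewrite (endp_homotopic ckq pb' _ hb) ?(endp_push (ip b) qa); last by rewrite /= qa.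
  have pc := path_concatP (rp a) (rp b).
  rewrite -/endq -endp_pi1_concat // !endp_pi1_image //; congr endq; rewrite /endq.
  apply: (endp_homotopic cq (origin_pathP (rp _)) y0P).
  exact: origin_path_homotopic (orbit_repM a b).
have pu (a : pi1 R Cu) : is_orbit_path (1%g : bg_group S) (k \o pi1_image (orbit_rep a) : R -> _).
  exact: push_orbit (ip a).
split.
- move=> a _ /=; exists (pi1_image (orbit_rep a)); split => //.
  by apply/pi1_image_comm => //; exists (orbit_rep a).
- move=> a b _ _ /= /(congr1 (fun x => endp (k \o q) m0 (orbit_rep x))).
  rewrite !(orbit_class_endp ckq kqm) // (endp_push (ip _) qm0) (endp_push (ip _) qm0).
  rewrite -/endq => /(pi1_image_inj (rp a) (rp b)) h.
  by apply: (orbit_eqP (S := pi1_gspace Cu) _ h); case: (orbit_elt a); case: (orbit_elt b).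
- move=> _ /= [p [pp -> /(pi1_image_comm pp)[w [pw ew]]]].
  have pw' : @is_orbit_path R (pi1_gspace Cu) tt w := pw.
  exists (@orbit_class R (pi1_gspace Cu) tt w) => //=.
  apply: (orbit_eq_endp ckq cM kqm).
    by rewrite !orbit_class_elt //; exact: push_orbit.
  rewrite !(orbit_class_endp ckq kqm) //; last exact: push_orbit.
  rewrite (endp_push (ip _) qm0) (endp_push pp qm0) -ew.
  rewrite !endp_pi1_image //; congr endq; rewrite /endq.
  apply: (endp_homotopic cq (origin_pathP (rp _)) y0P).
  apply: origin_path_homotopic; exact: (orbit_class_rep pw').
Qed.

End FundamentalGroup.

End Monodromy.

(** * From a relation to a bijection of components with classes *)

Section ComponentBijection.
Variables (L : topologicalType) (Fx : set L) (B : Type).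
Variables (rel : L -> B -> Prop) (cls : B -> set B) (K : set B).
Hypothesis rel_ex : forall u, Fx u -> exists b, rel u b.
Hypothesis rel_K : forall u b, Fx u -> rel u b -> K b.
Hypothesis rel_cls : forall u b b', Fx u -> rel u b -> cls b b' <-> rel u b'.
Hypothesis rel_comp : forall u v b, Fx u -> Fx v -> rel u b ->
  rel v b <-> connected_component Fx u v.
Hypothesis rel_surj : forall b, K b -> exists u, Fx u /\ rel u b.

(** A component is sent to all labels related to one of its members: sharing a label characterises
    components, and the labels of one member form one class. *)
Lemma component_bijection : exists F : set L -> set B,
  set_bij (components Fx) [set cls b | b in K] F /\
  forall u b, Fx u -> rel u b -> F (connected_component Fx u) = cls b.
Proof.
pose F (C : set L) : set B := [set b | exists u, C u /\ rel u b].
have FE u b : Fx u -> rel u b -> F (connected_component Fx u) = cls b.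
  move=> Fu ub; apply/seteqP; split => b' /=.
    move=> [v [Cv vb']]; have Fv : Fx v := connected_component_sub Cv.
    apply: (proj2 (rel_cls b' Fu ub)); apply: (proj2 (rel_comp Fv Fu vb')).
    exact: connected_component_sym.
  move=> h; exists u; split; last exact: (proj1 (rel_cls b' Fu ub)).
  exact: connected_component_refl.
exists F; split => //; split.
- move=> _ [u Fu <-]; have [b ub] := rel_ex Fu.
  by exists b; [exact: (rel_K Fu ub)|rewrite (FE u b)].
- move=> C C' /set_mem[u Fu <-] /set_mem[v Fv <-].
  have [b ub] := rel_ex Fu; have [b' vb'] := rel_ex Fv.
  rewrite (FE u b) // (FE v b') // => e.
  have vb : rel v b.
    by apply: (proj1 (rel_cls b Fv vb')); rewrite -e; apply: (proj2 (rel_cls b Fu ub)).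
  have uv : connected_component Fx u v := proj1 (rel_comp Fu Fv ub) vb.
  exact: same_connected_component.
- move=> _ [b Kb <-]; have [u [Fu ub]] := rel_surj Kb.
  by exists (connected_component Fx u); [exists u|exact: FE].
Qed.

End ComponentBijection.

(** * Loops on the circle *)

Section Circle.
Variable R : realType.

Lemma to_circleB (s t : R) : to_circle (s - t) = to_circle s - to_circle t.
Proof. by rewrite /to_circle raddfB. Qed.

Lemma to_circle_eq (s t : R) :
  to_circle s = to_circle t <-> exists m : int, s = t + m%:~R.
Proof.
rewrite /to_circle; split.
  move=> h; have : s - t \in integers R by rewrite Quotient.idealrBE; apply/eqP.
  move=> /intrP[m e].
  by exists m; rewrite -e addrC subrK.
move=> [m ->]; have : t + m%:~R - t \in integers R.
  by rewrite addrC addKr; apply/intrP; exists m.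
by rewrite Quotient.idealrBE => /eqP.
Qed.

Lemma to_circle_surj (x : circle R) : exists2 t : R, 0 <= t < 1 & x = to_circle t.
Proof.
have [t ->] : exists t : R, x = to_circle t by exists (generic_quotient.repr x); rewrite /to_circle reprK.
exists (t - (Num.floor t)%:~R).
  by have := floor_itv t; rewrite intrD; lra.
by apply/to_circle_eq; exists (Num.floor t); rewrite subrK.
Qed.

Lemma to_circle_continuous : continuous (@to_circle R).
Proof. by have := @pi_continuous _ (Quotient.quot (integers R)). Qed.

(** The quotient map is open: the preimage of the image of an interval is the union of its integer
    translates. *)
Lemma to_circle_near (t e : R) : 0 < e ->
  \forall x \near to_circle t, exists2 s, `|s - t| < e & x = to_circle s.
Proof.
move=> e0; set U := [set x : circle R | exists2 s, `|s - t| < e & x = to_circle s].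
suff oU : open U by apply: open_nbhs_nbhs; split => //; exists t; rewrite ?subrr ?normr0.
have -> : open U = open (@to_circle R @^-1` U) by [].
rewrite openE => s [s' ss' /to_circle_eq[m es]].
have d0 : 0 < e - `|s' - t| by rewrite subr_gt0.
change (nbhs s (@to_circle R @^-1` U)).
apply: filterS (near_R s d0) => r rs; exists (r - m%:~R); last first.
  by apply/to_circle_eq; exists m; rewrite subrK.
move: rs; rewrite es; have := ler_normD (r - (s' + m%:~R)) (s' - t).
rewrite (_ : _ + (s' - t) = r - m%:~R - t); [lra|ring].
Qed.

Variable V : topologicalType.
Local Notation loop := {compact-open, circle R -> V}.

(** The image in the circle of a compact interval around t is compact, so sending it into a given
    open set is an open condition on loops. *)
Lemma eval_continuous_at (v : loop) (t : R) : continuous (v : circle R -> V) ->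
  (fun p : loop * R => p.1 (to_circle p.2)) @ (v, t) --> v (to_circle t).
Proof.
move=> cv W; rewrite nbhsE => -[Q [oQ Qt] QW].
have cvt := continuous_comp2 to_circle_continuous cv.
have [e e0 eQ] : exists2 e : R, 0 < e & forall s, `|s - t| <= e -> Q (v (to_circle s)).
  have /nbhs_R[e e0 eQ] : nbhs t ((fun s => v (to_circle s)) @^-1` Q).
    by apply: cvt; exact: open_nbhs_nbhs.
  by exists (e / 2) => [|s h]; [lra|apply: eQ; lra].
pose K := @to_circle R @` `[t - e, t + e].
have cK : compact K.
  apply: continuous_compact; last exact: segment_compact.
  by apply: continuous_subspaceT; exact: to_circle_continuous.
exists ([set w : loop | w @` K `<=` Q], [set s | `|s - t| < e]) => /=.
  split; last exact: near_R.
  apply: open_nbhs_nbhs; split; first exact: compact_open_open.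
  move=> _ [_ [s /= se <-] <-]; apply: eQ.
  by move: se; rewrite in_itv /= ler_norml; lra.
move=> [w s] [/= wK se]; apply: QW; apply: wK; exists (to_circle s) => //.
by exists s => //; move: se; rewrite /= in_itv /= ltr_norml; lra.
Qed.

(** By currying, it is enough to have continuity on the product with the circle, which descends from
    the product with the line by [to_circle_near]. *)
Lemma loop_family_continuous (Z : topologicalType) (F : Z -> loop) :
  continuous (fun p : Z * R => F p.1 (to_circle p.2)) ->
  continuous F /\ forall z, continuous (F z : circle R -> V).
Proof.
move=> cF; apply: (@continuous_curry Z (circle R) V (fun p => F p.1 p.2)).
move=> [z x] W; have [t _ ->] := to_circle_surj x => Wt.
have /nbhs_prodR[U zU [e e0 UW]] := cF (z, t) W Wt.
exists (U, [set y | exists2 s, `|s - t| < e & y = to_circle s]) => /=.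
  by split => //; exact: to_circle_near.
by move=> [z' y] /= [Uz' [s se ->]]; exact: UW.
Qed.

End Circle.

Lemma eval_family (R : realType) (V Z : topologicalType)
    (k : Z -> {compact-open, circle R -> V}) : continuous k ->
  (forall z, continuous (k z : circle R -> V)) ->
  continuous (fun p : Z * R => k p.1 (to_circle p.2)).
Proof.
move=> ck ckz [z t]; have := @eval_continuous_at R V (k z) t (ckz z).
apply: (@cvg_comp _ _ _ (fun p : Z * R => (k p.1, p.2))
  (fun p => p.1 (to_circle p.2))).
have ca : continuous (fun p : Z * R => (k p.1, p.2)).
  apply: continuous_pairR; last exact: continuous_sndE.
  exact: (continuous_comp2 (@continuous_fstE Z R) ck).
exact: (ca (z, t)).
Qed.

Lemma for_continuous_pair (S U V : topologicalType) (a : S -> U) (b : S -> V) x :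
  {for x, continuous a} -> {for x, continuous b} ->
  {for x, continuous (fun p => (a p, b p))}.
Proof. by move=> ca cb; exact: (cvg_pair ca cb). Qed.

(** * Loops determined by one period *)

Section TwistedLoops.
Variables (R : realType) (n N : nat).
Local Notation C := (plane R).
Local Notation V := ('rV[C]_n).
Local Notation loop := {compact-open, circle R -> V}.

Definition mix (s : R) (x y : V) : V :=
  \row_j ((1 - s)%:C%C * x 0 j + s%:C%C * y 0 j).

Lemma mix0 x y : mix 0 x y = x.
Proof. by apply/rowP => j; rewrite mxE subr0 mul1r mul0r addr0. Qed.

Lemma mix1 x y : mix 1 x y = y.
Proof. by apply/rowP => j; rewrite mxE subrr mul1r mul0r add0r. Qed.

Lemma mixA s t x y : mix s (mix t x y) y = mix (s + t - s * t) x y.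
Proof.
apply/rowP => j; rewrite !mxE mulrDr !mulrA -!rmorphM /= -addrA -mulrDl -rmorphD.
by congr (_%:C%C * _ + _%:C%C * _); rewrite /=; ring.
Qed.

Lemma mix_continuous (T : topologicalType) (s : T -> R) (x y : T -> V) :
  continuous s -> continuous x -> continuous y ->
  continuous (fun p => mix (s p) (x p) (y p)).
Proof.
move=> cs cx cy; apply: cont_row => j.
have cC (f : T -> R) : continuous f -> continuous (fun p => (f p)%:C%C : C).
  by move=> cf; apply: Complex_continuous => //; exact: contcst.
rewrite (_ : (fun p => _) = fun p => (1 - s p)%:C%C * x p 0 j + (s p)%:C%C * y p 0 j :> C);
  last by apply/funext => p; rewrite mxE.
apply: contDC; apply: contMC.
- by apply: cC; cont.
- exact: (@cont_entry R T n x j cx).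
- exact: cC.
- exact: (@cont_entry R T n y j cy).
Qed.

Variables (A : set V) (g : V -> V).

(** Time is rescaled so that [0, 1] stands for an arc of length 1 / N, one period of the twisting
    condition. *)
Definition twisted_loops : set loop :=
  [set u | [/\ continuous (u : circle R -> V), forall x, A (u x) &
    forall t, u (to_circle (N%:R^-1 * (t + 1))) = g (u (to_circle (N%:R^-1 * t)))]].

Hypotheses (N0 : (0 < N)%N) (cg : continuous g) (gA : forall z, A z -> A (g z)).
Hypothesis gN : forall z, A z -> iter N g z = z.
Hypothesis g_mix : forall s x y, g (mix s x y) = mix s (g x) (g y).
Variables (A0 Q : set V).
Hypotheses (AE : forall z, A z <-> A0 z /\ Q z) (oQ : open Q).
Hypothesis A0_mix : forall s x y, A0 x -> A0 y -> A0 (mix s x y).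

(** Powers of [g] with integer exponent: reduction modulo N gives sense to negative ones, as the
    N-th iterate is the identity on [A]. *)
Let g_iter (m : int) (z : V) := iter `|(m %% N)%Z|%N g z.

Let NR : N%:R != 0 :> R. Proof. by rewrite pnatr_eq0 -lt0n. Qed.

Let g_iterS m z : A z -> g_iter (m + 1) z = g_iter m (g z).
Proof.
move=> Az; rewrite /g_iter -iterSr.
have Nz : N%:Z != 0 by rewrite eqz_nat -lt0n.
have h0 := modz_ge0 m Nz; have h1 : (m %% N)%Z < N by rewrite ltz_mod.
rewrite -modzDml; move: h0 h1; case: (m %% N)%Z => // r _.
rewrite ltz_nat => rN; rewrite -PoszD modz_nat !absz_nat addn1.
have [e|rN'] := eqVneq r.+1 N; first by rewrite e modnn gN.
by rewrite modn_small // ltn_neqAle rN'.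
Qed.

Let g_iter0 z : g_iter 0 z = z. Proof. by rewrite /g_iter mod0z. Qed.

Let iter_gA m z : A z -> A (g_iter m z).
Proof. by move=> Az; rewrite /g_iter; elim: absz => //= j; exact: gA. Qed.

Let g_iter_comm m z : g_iter m (g z) = g (g_iter m z).
Proof. by rewrite /g_iter -iterS -iterSr. Qed.

Let g_iter_continuous m : continuous (g_iter m).
Proof.
rewrite /g_iter; elim: absz => [|j IH]; first exact: continuous_idE.
exact: (continuous_comp2 IH cg).
Qed.

Section Extension.
Variables (Z : topologicalType) (f : Z * R -> V).
Hypotheses (cf : continuous f) (Af : forall z t, unitI t -> A (f (z, t))).
Hypothesis f1 : forall z, f (z, 1) = g (f (z, 0)).

(** One period extended to the line by the twisting condition. It has period N, hence descends to
    the circle. *)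
Let ext (p : Z * R) : V :=
  let m := Num.floor p.2 in g_iter m (f (p.1, p.2 - m%:~R)).

(** The right end is included thanks to [f1]; this is what allows consecutive pieces to be glued. *)
Let extE z t (m : int) : m%:~R <= t <= m%:~R + 1 ->
  ext (z, t) = g_iter m (f (z, t - m%:~R)).
Proof.
move=> /andP[h1]; rewrite le_eqVlt => /orP[/eqP e|h2].
  have fm : Num.floor t = m + 1.
    by apply: floor_def; rewrite e !intrD; lra.
  rewrite /ext /= fm g_iterS; last by apply: Af; rewrite e intrD /unitI; lra.
  rewrite e intrD subrr -f1; congr (g_iter _ (f (_, _))); ring.
have fm : Num.floor t = m by apply: floor_def; rewrite intrD; lra.
by rewrite /ext /= fm.
Qed.

Let ext_continuous : continuous ext.
Proof.
move=> [z t]; set m := Num.floor t.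
have mt : m%:~R <= t < m%:~R + 1 by have := floor_itv t; rewrite intrD.
pose piece (j : int) (p : Z * R) := g_iter j (f (p.1, p.2 - j%:~R)).
have cp j : continuous (piece j).
  have ca : continuous (fun p : Z * R => (p.1, p.2 - j%:~R)) by cont.
  exact: (continuous_comp2 (continuous_comp2 ca cf) (@g_iter_continuous j)).
have cgl : continuous (fun p : Z * R => if p.2 <= m%:~R then piece (m - 1) p else piece m p).
  apply: (glue_continuous (@continuous_sndE Z R) (cp (m - 1)) (cp m)).
  move=> [z' t'] /= ->; rewrite /piece /= rmorphB /=.
  rewrite -[in RHS](subrK 1 m) g_iterS; last first.
    by apply: Af; rewrite subrK subrr; exact: unitI0.
  by rewrite subrK subrr -f1; congr (g_iter _ (f (_, _))); ring.
apply: (continuous_at_near _ (cgl (z, t))).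
have [e e0 he] : exists2 e : R, 0 < e & e <= 1 /\ t + e <= m%:~R + 1.
  have [h|h] := leP (1 : R) (m%:~R + 1 - t); first by exists 1 => //; split; lra.
  by exists (m%:~R + 1 - t); [lra|split; lra].
apply: (nbhs_prodR' (N := setT) (e := e)) => //; first exact: filterT.
move=> z' s _; rewrite ltr_norml => se /=; case: ifPn => sm.
  by apply: extE; rewrite rmorphB /=; lra.
apply: extE; move: sm; rewrite -ltNge; lra.
Qed.

Lemma twisted_extension : exists k : Z -> loop, continuous k /\
  forall z, twisted_loops (k z) /\
    forall t, unitI t -> k z (to_circle (N%:R^-1 * t)) = f (z, t).
Proof.
(* [xget] picks some real representative; by periodicity the value does not depend on it ([kE]). *)
pose k (z : Z) : loop := fun x => ext (z, N%:R * xget 0 [set t | x = to_circle t]).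
have Eper z t : ext (z, t + N%:R) = ext (z, t).
  rewrite /ext /= -[N%:R]/(N%:~R) floorDrz // ?intr_int //.
  rewrite intrKfloor /g_iter modzDr intrD; congr (iter _ _ (f (_, _))); ring.
have Eperz z t (m : int) : ext (z, t + N%:R * m%:~R) = ext (z, t).
  have Epern j s : ext (z, s + N%:R * j%:R) = ext (z, s).
    elim: j s => [|j IH] s; first by rewrite mulr0 addr0.
    by rewrite -natr1 mulrDr mulr1 addrA Eper IH.
  case: m => j; first exact: Epern.
  rewrite NegzE mulrNz mulrN; have := Epern j.+1 (t - N%:R * j.+1%:R).
  by rewrite subrK => ->.
have kE z t : k z (to_circle t) = ext (z, N%:R * t).
  rewrite /k; case: xgetP => [s _ /= /to_circle_eq[m e]|/(_ t) []//].
  have -> : s = t + (- m)%:~R by rewrite e rmorphN /= addrK.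
  by rewrite mulrDr Eperz.
have [ck ckz] : continuous k /\ forall z, continuous (k z : circle R -> V).
  apply: loop_family_continuous.
  rewrite (_ : (fun p => _) = fun p : Z * R => ext (p.1, N%:R * p.2)); last first.
    by apply/funext => -[z' t']; rewrite kE.
  have ca : continuous (fun p : Z * R => (p.1, N%:R * p.2)) by cont.
  exact: (continuous_comp2 ca ext_continuous).
have NK (t : R) : N%:R * (N%:R^-1 * t) = t by rewrite mulrA mulfV // mul1r.
exists k; split => // z; split; last first.
  move=> t tI; rewrite kE NK (extE _ (m := 0)) ?subr0 ?g_iter0 //.
  by move: tI; rewrite /unitI add0r.
have fl t : unitI (t - (Num.floor t)%:~R).
  by have := floor_itv t; rewrite intrD /unitI; lra.
split => //.
- move=> x; have [t _ ->] := to_circle_surj x; rewrite kE /ext /=.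
  by apply: iter_gA; apply: Af.
- move=> t; rewrite !kE !NK (extE _ (m := Num.floor t + 1)); last first.
    by have := floor_itv t; rewrite !intrD; lra.
  rewrite /ext /= g_iterS ?g_iter_comm; last by apply: Af; rewrite intrD opprD addrACA subrr addr0.
  by congr (g (g_iter _ (f (_, _)))); rewrite intrD; ring.
Qed.

End Extension.

(** The conditions on a configuration split into those stable along segments ([A0]) and an open one
    ([Q]), so loops close to [u] can be moved to [u] along straight segments. *)
Lemma twisted_loops_paths : twisted_paths (R := R) A g twisted_loops
  (fun u t => u (to_circle (N%:R^-1 * t))).
Proof.
have ev (Z : topologicalType) (k : Z -> loop) : continuous k ->
    (forall z, twisted_loops (k z)) -> continuous (fun p : Z * R => k p.1 (to_circle p.2)).
  by move=> ck Fk; apply: eval_family => // z; have [] := Fk z.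
split; [exact: cg|exact: gA| | | | | |].
- move=> Z k ck Fk; have ca : continuous (fun p : Z * R => (p.1, N%:R^-1 * p.2)) by cont.
  exact: (continuous_comp2 ca (ev Z k ck Fk)).
- by move=> u t [_ ? _].
- by move=> u [_ _ h]; rewrite -h add0r.
- move=> u v [_ _ hu] [_ _ hv] uv; apply/funext => x.
  have [t /andP[t0 _] ->] := to_circle_surj x.
  have h (j : nat) s : unitI s -> u (to_circle (N%:R^-1 * (s + j%:R))) =
      v (to_circle (N%:R^-1 * (s + j%:R))).
    by move=> sI; elim: j => [|j IH]; [rewrite addr0 uv|rewrite -natr1 addrA hu hv IH].
  have := h (Num.truncn (N%:R * t)) (N%:R * t - (Num.truncn (N%:R * t))%:R).
  rewrite subrK mulrA mulVf // mul1r; apply.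
  have : 0 <= N%:R * t by rewrite mulr_ge0.
  by move=> /truncn_itv; rewrite -natr1 /unitI; lra.
- exact: twisted_extension.
move=> u Fu; have [cu Au tu] := Fu.
(* Whole segments to [u] are required to stay in [Q], which makes [W] stable under the deformation
   [K]. *)
pose W : set loop := [set v | twisted_loops v /\
  forall t s, unitI s -> Q (mix s (v (to_circle t)) (u (to_circle t)))].
pose K (p : loop * R) : loop := fun x => mix (clamp p.2) (p.1 x) (u x).
have cuR := continuous_comp2 (@to_circle_continuous R) cu.
have clampM (s t : R) : unitI s -> unitI t -> unitI (s + t - s * t).
  by rewrite /unitI => /andP[a b] /andP[c d]; apply/andP; split; nra.
have KW (Z : topologicalType) (k : Z -> loop) : continuous k ->
    (forall z, twisted_loops (k z)) -> continuous (fun p : Z * R => K (k p.1, p.2)) /\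
    forall p : Z * R, continuous (K (k p.1, p.2) : circle R -> V).
  move=> ck Fk; apply: loop_family_continuous; apply: mix_continuous.
  - have ca : continuous (fun p : Z * R * R => clamp p.1.2) by cont.
    exact: ca.
  - have ca : continuous (fun p : Z * R * R => (p.1.1, p.2)) by cont.
    exact: (continuous_comp2 ca (ev Z k ck Fk)).
  - exact: (continuous_comp2 (@continuous_sndE _ _) cuR).
exists W, K; split.
- split => // t s sI; rewrite (_ : mix _ _ _ = u (to_circle t)).
    by have /AE[] := Au (to_circle t).
  by apply/rowP => j; rewrite mxE -mulrDl -rmorphD /= subrK mul1r.
- by move=> v [].
- move=> v [Fv Wv]; have [cv Av tv] := Fv.
  (* An open condition over the compact set of pairs (time, position on the segment) persists for
     loops near [v]. *)
  have : \forall v' \near v, [set p : R * R | unitI p.1 /\ unitI p.2] `<=`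
      [set p | Q (mix p.2 (v' (to_circle p.1)) (u (to_circle p.1)))].
    have cI : compact [set t : R | unitI t].
      rewrite (_ : [set t | unitI t] = `[0, 1]%classic); first exact: segment_compact.
      by apply/seteqP; split => t; rewrite /= in_itv.
    have /compact_near_coveringP cK : compact [set p : R * R | unitI p.1 /\ unitI p.2].
      exact: (compact_setX cI cI).
    apply: (cK _ (nbhs v) (fun (v' : loop) (p : R * R) =>
      Q (mix p.2 (v' (to_circle p.1)) (u (to_circle p.1))))) => -[t s] [tI sI].
    have h : (fun p : R * R * loop => mix p.1.2 (p.2 (to_circle p.1.1)) (u (to_circle p.1.1)))
        @ ((t, s), v) --> mix s (v (to_circle t)) (u (to_circle t)).
      have cm : continuous (fun p : R * (V * V) => mix p.1 p.2.1 p.2.2).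
        apply: mix_continuous; first exact: continuous_fstE.
          exact: (continuous_comp2 (@continuous_sndE _ _) (@continuous_fstE _ _)).
        exact: (continuous_comp2 (@continuous_sndE _ _) (@continuous_sndE _ _)).
      apply: (@cvg_comp _ _ _ (fun p : R * R * loop => (p.1.2, (p.2 (to_circle p.1.1), u (to_circle p.1.1))))
        (fun p => mix p.1 p.2.1 p.2.2) _ _ _ _ (cm (s, (v (to_circle t), u (to_circle t))))).
      have c11 : continuous (fun p : R * R * loop => p.1.1).
        exact: (continuous_comp2 (@continuous_fstE _ _) (@continuous_fstE _ _)).
      have c12 : continuous (fun p : R * R * loop => p.1.2).
        exact: (continuous_comp2 (@continuous_fstE _ _) (@continuous_sndE _ _)).
      have ca : continuous (fun p : R * R * loop => (p.2, p.1.1)).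
        by apply: continuous_pairR => //; exact: continuous_sndE.
      have h1 : (fun p : R * R * loop => p.2 (to_circle p.1.1)) @ ((t, s), v) --> v (to_circle t).
        apply: (@cvg_comp _ _ _ (fun p : R * R * loop => (p.2, p.1.1))
          (fun p : loop * R => p.1 (to_circle p.2)) _ _ _ (ca ((t, s), v))).
        exact: (@eval_continuous_at R V v t cv).
      have h2 : (fun p : R * R * loop => u (to_circle p.1.1)) @ ((t, s), v) --> u (to_circle t).
        have c3 : continuous (fun p : R * R * loop => u (to_circle p.1.1)).
          exact: (continuous_comp2 c11 cuR).
        exact: (c3 ((t, s), v)).
      exact: (for_continuous_pair (c12 ((t, s), v)) (for_continuous_pair h1 h2)).
    apply: h; apply: open_nbhs_nbhs; split => //; exact: Wv.
  apply: filterS => v' Wv' Fv'; split => // t s sI.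
  have [t' /andP[t0 t1] e] := to_circle_surj (to_circle t).
  rewrite e; apply: (Wv' (t', s)); split => //=.
  by rewrite /unitI t0 ltW.
- move=> Z k ck Wk; have Fk z : twisted_loops (k z) by have [] := Wk z.
  by have [h _] := KW Z k ck Fk; exact: h.
- move=> v [Fv Wv]; have [cv Av tv] := Fv.
  split.
  + by apply/funext => x; rewrite /K /= clamp0 mix0.
  + by apply/funext => x; rewrite /K /= (clamp_ge1 (lexx 1)) mix1.
  move=> s; split; last first.
    move=> t s' s'I; rewrite /K /= mixA; apply: Wv; apply: clampM => //; exact: clampI.
  split.
  + have [_] := KW R (fun=> v) (@contcst _ _ _) (fun=> Fv).
    by move=> /(_ (0, s)).
  + move=> x; have [t _ ->] := to_circle_surj x; apply/AE; split; last exact: Wv (clampI s).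
    by apply: A0_mix; [have /AE[] := Av (to_circle t)|have /AE[] := Au (to_circle t)].
  + by move=> t; rewrite /K /= tv tu g_mix.
Qed.

End TwistedLoops.

(** * Loops fixed by the symmetry groups *)

Section IntPowers.
Variable G : groupType.
Implicit Types x y : G.

Lemma expgzS x (m : int) : expgz x (m + 1) = (expgz x m * x)%g.
Proof.
case: m => [m|[|m]].
- by rewrite -PoszD /= addn1 expgSr.
- by rewrite /= expg1 mulVg.
- have -> : Negz m.+1 + 1 = Negz m by lia.
  by rewrite /= [in RHS]expgS invgM mulgKV.
Qed.

Lemma expgzD x (m p : int) : expgz x (m + p) = (expgz x m * expgz x p)%g.
Proof.
elim: p => [|p IH|p IH].
- by rewrite addr0 /= expg0 mulg1.
- by rewrite -[p.+1]addn1 PoszD addrA !expgzS IH mulgA.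
apply: (mulIg x); rewrite -expgzS -mulgA -expgzS.
have -> : - p.+1%:Z + 1 = - p%:Z by lia.
by rewrite -IH; congr expgz; lia.
Qed.

Lemma expgz1 x : expgz x 1 = x. Proof. by rewrite /= expg1. Qed.

Lemma expgzN x (m : int) : expgz x (- m) = ((expgz x m)^-1)%g.
Proof. by apply: (mulIg (expgz x m)); rewrite -expgzD addNr mulVg. Qed.

Lemma expgzX x (m : int) (j : nat) : (expgz x m ^+ j)%g = expgz x (m * j%:Z).
Proof.
elim: j => [|j IH]; first by rewrite mulr0.
by rewrite expgSr IH -expgzD; congr expgz; lia.
Qed.

Lemma expgzM x (m p : int) : expgz x (m * p) = expgz (expgz x m) p.
Proof.
case: p => j; first by rewrite -expgzX.
by rewrite NegzE mulrN !expgzN -expgzX.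
Qed.

Lemma expgz_eq x (d : nat) (m p : int) : (x ^+ d)%g = 1%g ->
  (m = p %[mod d%:Z])%Z -> expgz x m = expgz x p.
Proof.
move=> xd /eqP; rewrite eqz_mod_dvd => /dvdzP[e me].
have -> : m = p + d%:Z * e by rewrite -(subrK p m) me; ring.
rewrite expgzD; have -> : expgz x (d%:Z * e) = 1%g.
  have h (j : nat) : expgz x (d%:Z * j%:Z) = 1%g by rewrite -[expgz x _]/(expgz x (d%:Z * j%:Z)) -expgzX /= xd expg1n.
  case: e {me} => j; first exact: h.
  by rewrite NegzE mulrN expgzN h invg1.
by rewrite mulg1.
Qed.

End IntPowers.

Lemma expgz_morph (G H : groupType) (f : G -> H) : {morph f : x y / (x * y)%g} ->
  forall x m, f (expgz x m) = expgz (f x) m.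
Proof.
move=> fM x m; have f1 : f 1%g = 1%g by apply: (mulIg (f 1%g)); rewrite -fM !mul1g.
have fX (j : nat) : f (x ^+ j)%g = (f x ^+ j)%g.
  by elim: j => [|j IH]; rewrite ?f1 // !expgSr fM IH.
case: m => j //=.
apply: (mulIg (f (x ^+ j.+1)%g)); rewrite -fM mulVg f1 fX mulVg //.
Qed.

(** * The orthogonal group acting on the plane *)

Section PlaneAction.
Variable R : realType.
Local Notation C := (plane R).
Implicit Types (A B : O2 R) (z w : C) (s t : R).

Definition expi t : C := Complex (cos t) (sin t).

Lemma expiD s t : expi (s + t) = expi s * expi t.
Proof. by apply/eqP; rewrite eq_complex /= cosD sinD; apply/andP; split; apply/eqP; ring. Qed.

Lemma expi0 : expi 0 = 1. Proof. by rewrite /expi cos0 sin0. Qed.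

Lemma expi_neq0 t : expi t != 0.
Proof.
apply/eqP => e; have /eqP := expi0; rewrite -(subrr t) expiD e mul0r eq_sym.
by rewrite oner_eq0.
Qed.

Lemma expi_nat t (m : nat) : expi (t *+ m) = expi t ^+ m.
Proof. by elim: m => [|m IH]; rewrite ?mulr0n ?expr0 ?expi0 // mulrS expiD IH exprS. Qed.

Lemma expi_2pi (m : int) : expi (2 * pi * m%:~R) = 1.
Proof.
have h (j : nat) : expi (2 * pi * j%:R) = 1.
  rewrite mulr_natr expi_nat (_ : expi _ = 1) ?expr1n //.
  by rewrite /expi mulr_natl cos2pi sin2pi.
case: m => j; first exact: h.
rewrite NegzE mulrNz mulrN; apply: (mulIf (expi_neq0 (2 * pi * j.+1%:R))).
by rewrite -expiD addNr expi0 mul1r h.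
Qed.

Lemma plane_act_rot t z : plane_act (rot t) z = expi t * z.
Proof.
case: z => a b; rewrite /plane_act /= !mxE /=; apply/eqP; rewrite eq_complex /=.
by apply/andP; split; apply/eqP; ring.
Qed.

Lemma plane_act_kappa z : plane_act (kappa R) z = Complex (complex.Re z) (- complex.Im z).
Proof.
case: z => a b; rewrite /plane_act /= !mxE /=; apply/eqP; rewrite eq_complex /=.
by apply/andP; split; apply/eqP; ring.
Qed.

Lemma plane_actD A z w : plane_act A (z + w) = plane_act A z + plane_act A w.
Proof.
case: z w => a b [c d]; rewrite /plane_act /=; apply/eqP; rewrite eq_complex /=.
by apply/andP; split; apply/eqP; ring.
Qed.

Lemma plane_actZ A (s : R) z : plane_act A (s%:C%C * z) = s%:C%C * plane_act A z.
Proof.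
case: z => a b; rewrite /plane_act /=; apply/eqP; rewrite eq_complex /=.
by apply/andP; split; apply/eqP; ring.
Qed.

Lemma plane_act_continuous A : continuous (plane_act A).
Proof.
have cr := @Re_continuous R; have ci := @Im_continuous R.
by apply: Complex_continuous; cont.
Qed.

Lemma plane_actM A B z : plane_act (A * B)%g z = plane_act A (plane_act B z).
Proof.
rewrite /plane_act /= !mxE !big_ord_recl !big_ord0 !addr0 /=.
have -> : lift ord0 ord0 = 1 :> 'I_2 by apply: val_inj.
by apply/eqP; rewrite eq_complex /=; apply/andP; split; apply/eqP; ring.
Qed.

Lemma plane_act1 z : plane_act 1%g z = z.
Proof.
case: z => a b; rewrite /plane_act /= !mxE /=; apply/eqP; rewrite eq_complex /=.
by apply/andP; split; apply/eqP; ring.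
Qed.

Lemma plane_act_inj A : injective (plane_act A).
Proof.
move=> z w e; rewrite -[z]plane_act1 -[w]plane_act1 -(mulVg A) !plane_actM e //.
Qed.

Lemma rotD s t : rot (s + t) = (rot s * rot t)%g.
Proof.
apply: val_inj; apply/matrixP => i j; rewrite !mxE !big_ord_recl big_ord0 !mxE.
by case: i => -[|[|//]] ?; case: j => -[|[|//]] ? //=; rewrite cosD || rewrite sinD; ring.
Qed.

Lemma rot0 : rot 0 = 1%g :> O2 R.
Proof.
apply: val_inj; apply/matrixP => i j; rewrite !mxE cos0 sin0.
by case: i => -[|[|//]] ?; case: j => -[|[|//]] ? //=; rewrite oppr0.
Qed.

Lemma rotZ t (m : int) : expgz (rot t) m = rot (t * m%:~R).
Proof.
have h (j : nat) : (rot t ^+ j)%g = rot (t * j%:R).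
  elim: j => [|j IH]; first by rewrite mulr0 rot0.
  by rewrite expgSr IH -rotD -natr1 mulrDr mulr1.
case: m => j /=; first exact: h.
apply: (mulIg (rot t ^+ j.+1)%g); rewrite mulVg h -rotD NegzE mulrNz mulrN addNr rot0 //.
Qed.

Lemma rot_2pi (m : int) : rot (2 * pi * m%:~R) = 1%g :> O2 R.
Proof.
have /eqP := expi_2pi m; rewrite eq_complex /= => /andP[/eqP c /eqP s].
apply: val_inj; apply/matrixP => i j; rewrite !mxE c s.
by case: i => -[|[|//]] ?; case: j => -[|[|//]] ? //=; rewrite oppr0.
Qed.

Lemma kappaK : (kappa R * kappa R)%g = 1%g.
Proof.
apply: val_inj; apply/matrixP => i j; rewrite !mxE !big_ord_recl big_ord0 !mxE.
by case: i => -[|[|//]] ?; case: j => -[|[|//]] ? //=; ring.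
Qed.

End PlaneAction.

Section ConfAction.
Variables (R : realType) (n : nat).
Local Notation C := (plane R).
Local Notation V := ('rV[C]_n).
Implicit Types (g h : (O2 R * Sym n)%type) (z : V).

Lemma conf_actE g z j : conf_act g z 0 j = plane_act g.1 (z 0 ((g.2 : {perm _})^-1%g j)).
Proof. by rewrite !mxE. Qed.

Lemma conf_actM g h z : conf_act (g * h)%g z = conf_act g (conf_act h z).
Proof.
apply/rowP => j; rewrite !conf_actE -plane_actM; congr (plane_act _ (z 0 _)).
by rewrite (_ : (g * h)%g.2 = ((h.2 : 'S_n) * (g.2 : 'S_n))%g :> 'S_n) // invMg permM.
Qed.

Lemma conf_act1 z : conf_act 1%g z = z.
Proof.
apply/rowP => j; rewrite conf_actE plane_act1.
by have := perm_act1 z => /(congr1 (fun w : V => w 0 j)); rewrite !mxE.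
Qed.

Lemma conf_act_continuous g : continuous (@conf_act R n g).
Proof.
apply: cont_row => j; rewrite (_ : (fun p => _) =
  fun z : V => plane_act g.1 (z 0 ((g.2 : {perm _})^-1%g j))); last first.
  by apply/funext => z; rewrite conf_actE.
apply: (continuous_comp2 _ (@plane_act_continuous R g.1)).
exact: (@cont_entry R V n id _ (@continuous_idE V)).
Qed.

Lemma conf_act_mix g s z w : conf_act g (mix s z w) = mix s (conf_act g z) (conf_act g w).
Proof. by apply/rowP => j; rewrite conf_actE [in LHS]mxE [RHS]mxE !conf_actE plane_actD !plane_actZ. Qed.

Lemma conf_act_conf g z : conf_space R n z -> conf_space R n (conf_act g z).
Proof.
move=> /(perm_act_conf g.2)[z0 zi].
have p0 : plane_act g.1 0 = 0 by rewrite -[0 in LHS](mul0r 0) (plane_actZ _ 0) mul0r.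
split.
  transitivity (plane_act g.1 (\sum_j perm_act g.2 z 0 j)); last by rewrite z0 p0.
  rewrite (big_morph (plane_act g.1) (plane_actD g.1) p0).
  by apply: eq_bigr => j _; rewrite !mxE.
by move=> i j; rewrite !mxE => /plane_act_inj h; apply: zi; rewrite !mxE.
Qed.

Lemma conf_act_iter g z (m : nat) : iter m (conf_act g) z = conf_act (g ^+ m)%g z.
Proof. by elim: m => [|m IH]; rewrite ?conf_act1 // iterS IH expgS conf_actM. Qed.

Lemma conf_act_fix g z (m : int) : conf_act g z = z -> conf_act (expgz g m) z = z.
Proof.
move=> gz; have h (j : nat) : conf_act (g ^+ j)%g z = z.
  by rewrite -conf_act_iter; elim: j => //= j ->.
by case: m => j /=; rewrite // -[in LHS](h j.+1) -conf_actM mulVg conf_act1.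
Qed.

Lemma expgz_pair g (m : int) : expgz g m = (expgz g.1 m, expgz g.2 m).
Proof.
rewrite -(@expgz_morph _ _ fst) // -(@expgz_morph _ _ snd) //.
by case: (expgz g m).
Qed.

Lemma conf_space_open : open [set z : V | injective (fun j => z 0 j)].
Proof.
rewrite openE => z zi.
have h (i j : 'I_n) : \forall w \near z, (w : V) 0 i = w 0 j -> i = j.
  have [->|ij] := eqVneq i j; first exact: near_all.
  have ce l : continuous (fun w : V => w 0 l) := @cont_entry R V n id l (@continuous_idE V).
  have cre l := continuous_comp2 (ce l) (@Re_continuous R).
  have cim l := continuous_comp2 (ce l) (@Im_continuous R).
  have : complex.Re (z 0 i) - complex.Re (z 0 j) != 0 \/
      complex.Im (z 0 i) - complex.Im (z 0 j) != 0.
    apply/orP; rewrite -negb_and !subr_eq0 -eq_complex.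
    by apply: contra ij => /eqP/zi->.
  case=> d.
    have /near_neqc/(_ d) : continuous (fun w : V => complex.Re (w 0 i) - complex.Re (w 0 j)).
      exact: (contD (cre i) (contN (cre j))).
    by apply: filterS => w + e; rewrite e subrr eqxx.
  have /near_neqc/(_ d) : continuous (fun w : V => complex.Im (w 0 i) - complex.Im (w 0 j)).
    exact: (contD (cim i) (contN (cim j))).
  by apply: filterS => w + e; rewrite e subrr eqxx.
have h' (i : 'I_n) : \forall w \near z, forall j, (w : V) 0 i = w 0 j -> i = j.
  exact: (@filter_forall V _ (fun j (w : V) => w 0 i = w 0 j -> i = j) (nbhs z) _ (h i)).
have := @filter_forall V _ (fun i (w : V) => forall j, w 0 i = w 0 j -> i = j) (nbhs z) (nbhs_filter z) h'.
by apply: filterS => w hw i j; exact: hw.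
Qed.

End ConfAction.

Section Sigma.
Variable n : nat.

Lemma sigma1X (m : nat) (j : 'I_n) :
  ((sigma1 n ^+ m)%g : 'S_n) j = iter m (@ordS n) j.
Proof.
elim: m j => [|m IH] j; first by rewrite perm1.
by rewrite expgS [LHS]permM IH iterS permE.
Qed.

Lemma iter_ordS (m : nat) (j : 'I_n) : iter m (@ordS n) j = ((j + m) %% n)%N :> nat.
Proof.
elim: m => [|m IH]; first by rewrite addn0 modn_small.
by rewrite /= IH -addn1 modnDml addn1 addnS.
Qed.

Lemma sigma1_order : (sigma1 n ^+ n)%g = 1%g.
Proof.
apply/permP => j; rewrite sigma1X perm1; apply: val_inj.
by have := iter_ordS n j; rewrite addnC modnDl modn_small.
Qed.

End Sigma.

Section FixedLoops.
Variables (R : realType) (n : nat).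
Local Notation C := (plane R).
Local Notation V := ('rV[C]_n).
Local Notation loop := {compact-open, circle R -> V}.
Implicit Types (u : loop) (z : V).

Lemma loop_act1 u : loop_act 1%g u = u.
Proof. by apply/funext => x; rewrite /loop_act conf_act1 [(1%g).2]/(0 : circle R) subr0. Qed.

Lemma loop_actM (g h : sym_group R n) u :
  loop_act (g * h)%g u = loop_act g (loop_act h u).
Proof.
apply/funext => x; rewrite /loop_act conf_actM; congr (conf_act _ (conf_act _ (u _))).
by rewrite [(g * h)%g.2]/((g.2 : circle R) + (h.2 : circle R)) opprD addrA.
Qed.

(** The elements fixing [u] form a subgroup. *)
Lemma fixed_generated (S : set (sym_group R n)) u :
  (forall g, generated S g -> loop_act g u = u) <->
  (forall g, S g -> loop_act g u = u).
Proof.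
split=> h g Sg; first by apply: h => H [_]; exact.
apply: (Sg [set g | loop_act g u = u]); split; last exact: h.
split => /=.
- exact: loop_act1.
- by move=> x y hx hy; rewrite loop_actM hy hx.
- by move=> x hx; rewrite -[in LHS]hx -loop_actM mulVg loop_act1.
Qed.

Lemma loop_act_fixed A s (theta : R) u : loop_act (sym_elt A s theta) u = u <->
  forall t, conf_act (A, s) (u (to_circle t)) = u (to_circle (t + theta)).
Proof.
split=> [h t|h].
  by rewrite -[in RHS]h /loop_act /= -to_circleB addrK.
apply/funext => x; have [t _ ->] := to_circle_surj x.
by rewrite /loop_act /= -to_circleB h subrK.
Qed.

Lemma shift_mul (v : R -> V) g (s : R) (m : int) :
  (forall t, v (t + s) = conf_act g (v t)) ->
  forall t, v (t + m%:~R * s) = conf_act (expgz g m) (v t).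
Proof.
move=> h; have hn (j : nat) t : v (t + j%:R * s) = conf_act (g ^+ j)%g (v t).
  elim: j => [|j IH]; first by rewrite mul0r addr0 conf_act1.
  by rewrite -natr1 mulrDl mul1r addrA h IH -conf_actM expgS.
case: m => j t; first exact: hn.
have := hn j.+1 (t - j.+1%:R * s); rewrite subrK => e.
rewrite NegzE mulrNz mulNr -[RHS]/(conf_act (g ^- j.+1)%g (v t)) e.
by rewrite -conf_actM mulVg conf_act1.
Qed.

Lemma sym_conf_spaceE (l c : nat) z : @sym_conf_space R n l c z <->
  conf_space R n z /\
  conf_act (rot (2 * pi * l%:R / c%:R), (sigma1 n ^+ (n %/ c))%g) z = z.
Proof.
split=> -[cz h]; split => //.
  apply/rowP => j; rewrite conf_actE /= -h; congr (z 0 _).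
  by rewrite -sigma1X permKV.
move=> j; rewrite -[in LHS]h conf_actE /= -sigma1X permK //.
Qed.

(** * Loops fixed by C(n, k/l) *)

Section Cyclic.
Variables (k l : nat) (b a : int).
Hypotheses (n0 : (0 < n)%N) (k0 : (0 < k)%N).
Let c := gcdn n k.
Hypothesis ab : a * n%:Z = c%:Z + b * k%:Z.
Let N := (n * k %/ c)%N.
Let g : (O2 R * Sym n)%type := (rot (2 * pi * a%:~R * l%:R / k%:R), expgz (sigma1 n) b).
Let Y := @sym_conf_space R n l c.

Let c0 : (0 < c)%N. Proof. by rewrite gcdn_gt0 n0. Qed.
Let nc : (n = (n %/ c) * c)%N. Proof. by rewrite divnK // dvdn_gcdl. Qed.
Let kc : (k = (k %/ c) * c)%N. Proof. by rewrite divnK // dvdn_gcdr. Qed.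
Let nR : n%:R != 0 :> R. Proof. by rewrite pnatr_eq0 -lt0n. Qed.
Let kR : k%:R != 0 :> R. Proof. by rewrite pnatr_eq0 -lt0n. Qed.
Let cR : c%:R != 0 :> R. Proof. by rewrite pnatr_eq0 -lt0n. Qed.
Let NE : N = (n %/ c * k)%N. Proof. by rewrite /N {1}nc mulnAC mulnK. Qed.
Let NR : N%:R^-1 = c%:R / (n%:R * k%:R) :> R.
Proof.
have ncR : n%:R = (n %/ c)%:R * c%:R :> R by rewrite -natrM -nc.
have dR : (n %/ c)%:R != 0 :> R by apply: contra nR => /eqP h; rewrite ncR h mul0r.
by rewrite NE natrM ncR; field; rewrite dR kR cR.
Qed.
Let aR : a%:~R * n%:R = c%:R + b%:~R * k%:R :> R.
Proof. by have := congr1 (fun m : int => m%:~R : R) ab; rewrite rmorphD !rmorphM. Qed.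

Let ncR : n%:R = (n %/ c)%:R * c%:R :> R. Proof. by rewrite -natrM -nc. Qed.
Let kcR : k%:R = (k %/ c)%:R * c%:R :> R. Proof. by rewrite -natrM -kc. Qed.
Let dR : (n %/ c)%:R != 0 :> R.
Proof. by apply: contra nR => /eqP h; rewrite ncR h mul0r. Qed.
Let eR : (k %/ c)%:R != 0 :> R.
Proof. by apply: contra kR => /eqP h; rewrite kcR h mul0r. Qed.

Let ab' : a * (n %/ c)%:Z = 1 + b * (k %/ c)%:Z.
Proof.
have cZ : c%:Z != 0 by rewrite eqz_nat -lt0n.
apply: (mulIf cZ); rewrite mulrDl mul1r -!mulrA -!PoszM -nc -kc; exact: ab.
Qed.

Let abR : a%:~R * (n %/ c)%:R = 1 + b%:~R * (k %/ c)%:R :> R.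
Proof. by have := congr1 (fun m : int => m%:~R : R) ab'; rewrite rmorphD !rmorphM. Qed.

Lemma twist_order z : iter N (conf_act g) z = z.
Proof.
rewrite conf_act_iter (_ : (g ^+ N)%g = 1%g) ?conf_act1 //.
rewrite -[(g ^+ N)%g]/(expgz g N%:Z) expgz_pair [g.1]/= [g.2]/= rotZ.
congr (_, _).
  rewrite -(rot_2pi R (a * l%:Z * (n %/ c)%:Z)); congr rot.
  by rewrite NE PoszM !rmorphM /=; field.
rewrite -expgzM.
rewrite (expgz_eq (p := 0) (sigma1_order n)) //.
apply/eqP; rewrite eqz_mod_dvd subr0.
have -> : N = (n * (k %/ c))%N by rewrite NE {2}nc {1}kc; lia.
by rewrite PoszM mulrCA dvdz_mulr.
Qed.

Let y : (O2 R * Sym n)%type := (rot (2 * pi * l%:R / c%:R), (sigma1 n ^+ (n %/ c))%g).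

(** The time shifts of the group are the multiples of 1 / N, with N = n k / c. As 1 / N = a / k - b
    / n, an element of shift 1 / N acts by [g]; those of shift 0 are the powers of [y], whose fixed
    set is Y. Conversely each generator acts as a power of [g] times a power of [y]. *)
Lemma C_fixed_loops : fixed_loops (C_group R n k l) = twisted_loops N Y (conf_act g).
Proof.
have expg1' (G : groupType) (m : int) : expgz (1%g : G) m = 1%g.
  by case: m => j; rewrite /= expg1n ?invg1.
apply/seteqP; split => u.
  move=> [[cu Xu]] /fixed_generated Gu.
  have h1 : forall t, u (to_circle (t + - n%:R^-1)) = conf_act (1%g, sigma1 n) (u (to_circle t)).
    by move=> t; rewrite -(proj1 (loop_act_fixed _ _ _ _) (Gu _ (or_introl erefl))).
  have h2 : forall t, u (to_circle (t + k%:R^-1)) =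
      conf_act (rot (2 * pi * l%:R / k%:R), 1%g) (u (to_circle t)).
    by move=> t; rewrite -(proj1 (loop_act_fixed _ _ _ _) (Gu _ (or_intror erefl))).
  pose v (t : R) := u (to_circle t).
  have h1' := shift_mul (v := v) _ h1; have h2' := shift_mul (v := v) _ h2.
  split => //.
    move=> x; apply/sym_conf_spaceE; split; first exact: Xu.
    have [t _ ->] := to_circle_surj x.
    (* Both shifts have length 1 / c and cancel, so this product of generators acts without moving
       time: it is [y]. *)
    have -> : to_circle t = to_circle (t + (n %/ c)%:Z%:~R * - n%:R^-1 + (k %/ c)%:Z%:~R * k%:R^-1).
      by congr to_circle; rewrite /= ncR kcR; field; rewrite dR eR cR.
    rewrite -[in RHS]/(v _) h2' h1' -conf_actM /v.
    have -> : t + (n %/ c)%:Z%:~R * - n%:R^-1 + (k %/ c)%:Z%:~R * k%:R^-1 = t.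
      by rewrite /= ncR kcR; field; rewrite dR eR cR.
    congr conf_act; rewrite !expgz_pair !expg1' rotZ; congr (_, _) => /=.
      by rewrite mulg1; congr rot; rewrite kcR; field; rewrite eR cR.
    by rewrite mul1g.
  move=> t; rewrite mulrDr mulr1.
  have -> : N%:R^-1 * t + N%:R^-1 = N%:R^-1 * t + b%:~R * - n%:R^-1 + a%:~R * k%:R^-1 :> R.
    rewrite -addrA; congr (_ + _); rewrite NR.
    have -> : c%:R = a%:~R * n%:R - b%:~R * k%:R :> R by rewrite aR addrK.
    by field; rewrite nR kR.
  rewrite -/(v _) h2' h1' -conf_actM; congr conf_act.
  rewrite !expgz_pair !expg1' rotZ; congr (_, _) => /=.
    by rewrite mulg1; congr rot; field.
  by rewrite mul1g.
move=> [cu Yu tu]; split.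
  by split => // x; have [] := Yu x.
have Yy x (m : int) : conf_act (expgz y m) (u x) = u x.
  by apply: conf_act_fix; have /sym_conf_spaceE[] := Yu x.
have tu' t : u (to_circle (t + N%:R^-1)) = conf_act g (u (to_circle t)).
  have NR0 : N%:R != 0 :> R by rewrite NE natrM mulf_neq0.
  have := tu (N%:R * t); rewrite mulrDr mulrA mulVf // mul1r mulr1; exact.
have h := shift_mul (v := fun t => u (to_circle t)) _ tu'.
apply/fixed_generated => _ /= [->|->]; apply/loop_act_fixed => t.
  have -> : t + - n%:R^-1 = t + (- (k %/ c)%:Z)%:~R * N%:R^-1.
    by rewrite NR rmorphN /= ncR kcR; field; rewrite dR eR cR.
  rewrite h -[in LHS](Yy _ (- a)) -conf_actM; congr conf_act.
  rewrite !expgz_pair !rotZ; congr (_, _) => /=.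
    by rewrite mul1g; congr rot; rewrite !rmorphN /= kcR; field; rewrite eR cR.
  rewrite -[(sigma1 n ^+ (n %/ c))%g]/(expgz (sigma1 n) (n %/ c)%:Z).
  rewrite -!(expgzM (sigma1 n)) -{1}(expgz1 (sigma1 n)) -expgzD; congr expgz.
  by rewrite mulrN [_ * a]mulrC ab'; ring.
have -> : t + k%:R^-1 = t + (n %/ c)%:Z%:~R * N%:R^-1.
  by rewrite NR /= ncR kcR; field; rewrite dR eR cR.
rewrite h -[in LHS](Yy _ b) -conf_actM; congr conf_act.
rewrite !expgz_pair !rotZ; congr (_, _) => /=.
  rewrite -rotD; congr rot; rewrite /=.
  transitivity (2 * pi * l%:R / k%:R * (a%:~R * (n %/ c)%:R) : R); last by field.
  by rewrite abR kcR; field; rewrite eR cR.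
rewrite mul1g -[(sigma1 n ^+ (n %/ c))%g]/(expgz (sigma1 n) (n %/ c)%:Z).
rewrite -[(expgz _ b ^+ _)%g]/(expgz (expgz (sigma1 n) b) (n %/ c)%:Z).
by rewrite -!(expgzM (sigma1 n)) mulrC.
Qed.

End Cyclic.

End FixedLoops.

Section Conjugation.
Variables (R : realType) (n : nat).
Hypothesis n0 : (0 < n)%N.
Let g : (O2 R * Sym n)%type := (kappa R, (sigma2 n)^-1%g).

Lemma sigma2_order : (sigma2 n ^+ n)%g = 1%g.
Proof. by rewrite /sigma2 -expgM mulnC expgM sigma1_order expg1n. Qed.

Lemma conj_twist_order (z : 'rV[plane R]_n) : iter (2 * n) (conf_act g) z = z.
Proof.
rewrite conf_act_iter (_ : (g ^+ (2 * n))%g = 1%g) ?conf_act1 //.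
rewrite -[(g ^+ _)%g]/(expgz g (2 * n)%N%:Z) expgz_pair; congr (_, _) => /=.
  by rewrite expgM expgS expg1 kappaK expg1n.
by rewrite mulnC expgM expVgn sigma2_order invg1 expg1n.
Qed.

(** The generator shifts time by -1 / (2 n), so advancing by 1 / (2 n) acts by its inverse; hence
    the inverse of [sigma2] in [g]. *)
Lemma C'2_fixed_loops : fixed_loops (C'2_group R n) =
  twisted_loops (2 * n) (conf_space R n) (conf_act g).
Proof.
have gE : (g * (kappa R, sigma2 n))%g = 1%g.
  by congr (_, _); rewrite /= ?kappaK ?mulVg.
have gE' : ((kappa R, sigma2 n) * g)%g = 1%g.
  by congr (_, _); rewrite /= ?kappaK ?mulgV.
have NR : (2 * n)%:R = 2 * n%:R :> R by rewrite natrM.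
have N0 : 2 * n%:R != 0 :> R by rewrite -NR pnatr_eq0 muln_eq0 -lt0n /= n0.
apply/seteqP; split => u.
  move=> [[cu Xu]] /fixed_generated Gu; split => // t.
  have := proj1 (loop_act_fixed _ _ _ _) (Gu _ erefl) (((2 * n)%N%:R^-1 : R) * (t + 1)).
  rewrite mulrDr mulr1 NR addrK => <-.
  by rewrite -conf_actM gE conf_act1.
move=> [cu Yu tu]; split => //; apply/fixed_generated => _ /= ->.
apply/loop_act_fixed => t.
have := tu ((2 * n)%:R * (t - (2 * n)%:R^-1)).
rewrite NR mulrBr mulfV // subrK mulrA mulVf // mul1r => ->.
rewrite -conf_actM gE' conf_act1; congr (u (to_circle _)).
by rewrite mulrBr mulrA mulVf // mul1r mulr1.
Qed.

End Conjugation.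

(** * Braids corresponding to twisted paths *)

Section Correspondence.
Variables (R : realType) (M T L : topologicalType).
Variables (A : set T) (g : T -> T) (Fx : set L) (ga : L -> R -> T).
Hypothesis tw : twisted_paths A g Fx ga.
Variable q : M -> T.
Hypotheses (cq : covers R A q) (cM : contractible R M).
Variables (x0 : T) (m0 : M).
Hypotheses (qm0 : q m0 = x0) (Ax0 : A x0).
Variables (S : based_gspace) (k : T -> bg_space S).
Hypotheses (ck : continuous k) (kA : forall z, A z -> bg_set (k z)).
Hypotheses (k0 : k x0 = bg_base S) (ckq : covers R (@bg_set S) (k \o q)).
(* For the groups C(n, k/l), [rt] is the rotation undoing that of [g]. *)
Variables (h : T -> T) (rt : R * T -> T).
Hypotheses (ch : continuous h) (hA : forall z, A z -> A (h z)).
Hypotheses (crt : continuous rt) (rtA : forall t z, A z -> A (rt (t, z))).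
Hypotheses (rt0 : forall z, A z -> rt (0, z) = z).
Hypotheses (rt1 : forall z, A z -> rt (1, g z) = h z).
Variable pi : bg_group S.
Hypothesis kh0 : k (h x0) = bg_act pi (bg_base S).
Local Notation G := (orbit_group R S).
Variable bar : G -> G.
Hypothesis bar_loop : forall p (b : G), is_path A x0 x0 p -> orbit_elt b = 1%g ->
  path_homotopic (@bg_set S) (orbit_rep b) (k \o p) ->
  orbit_elt (bar b) = 1%g /\
  path_homotopic (@bg_set S) (bg_act pi \o orbit_rep (bar b)) (k \o (h \o p)).

Let endq := endp (R := R) q.
Let endk := endp (R := R) (k \o q).
Let kq0 : (k \o q) m0 = bg_base S. Proof. by rewrite /= qm0. Qed.

Definition lift_end (b : G) : M := endk m0 (orbit_rep b).

Let mono := mono_path (R := R) g ga.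

Definition end_path (z : T) : R -> T := fun t => rt (t, g z).

Definition full_mono (u : L) (eta : R -> T) : R -> T :=
  path_concat (mono u eta) (end_path x0).

Definition corresponds (u : L) (beta : G) := exists eta,
  [/\ is_path A x0 (ga u 0) eta, orbit_elt beta = pi &
      lift_end beta = endq m0 (full_mono u eta)].

(** This is the group of pure braids when [k] is the identity, and P_{m,1(c)} when [k] takes c-th
    powers. *)
Definition closed_lift : set G := [set b | orbit_elt b = 1%g /\ q (lift_end b) = x0].

Definition corr_coset : set G := [set b | orbit_elt b = pi /\ q (lift_end b) = h x0].

Let gA z : A z -> A (g z). Proof. exact: (tw_gA tw). Qed.

Lemma end_pathP z : A z -> is_path A (g z) (h z) (end_path z).
Proof.
move=> Az; split; rewrite /end_path.
- have ca : continuous (fun t : R => (t, g z)) by cont.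
  exact: (continuous_comp2 ca crt).
- by move=> t _; apply: rtA; exact: gA.
- by rewrite rt0 //; exact: gA.
- by rewrite rt1.
Qed.

(** The square rt (s, g (p t)) has the sides [g \o p] and [h \o p] and the two end paths: undoing
    the rotation can be done before or after moving the point. *)
Lemma end_path_square m p x y : is_path A x y p -> q m = g x ->
  endq (endq m (g \o p)) (end_path y) = endq (endq m (end_path x)) (h \o p).
Proof.
move=> pp qm; have [cp Ap p0 p1] := pp.
have Ax : A x by rewrite -p0; apply: Ap; exact: unitI0.
have Ay : A y by rewrite -p1; apply: Ap; exact: unitI1.
have pgp : is_path A (g x) (g y) (g \o p) := path_g tw pp.
have php : is_path A (h x) (h y) (h \o p).
  split; rewrite /= ?p0 ?p1 //; first exact: (continuous_comp2 cp ch).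
  by move=> t tI; apply: hA; exact: Ap.
pose sq (r : R * R) : T := rt (r.2, g (p r.1)).
have csq : continuous sq.
  have ca : continuous (fun r : R * R => (r.2, g (p r.1))).
    apply: continuous_pairR; first exact: continuous_sndE.
    exact: (continuous_comp2 (@continuous_fstE R R) (continuous_comp2 cp (tw_g tw))).
  exact: (continuous_comp2 ca crt).
have Asq t s : unitI t -> unitI s -> A (sq (t, s)).
  by move=> tI sI; apply: rtA; apply: gA; exact: Ap.
have pb : is_path A (g x) (g y) (fun t => sq (t, 0)).
  have [c1 A1 e0 e1] := pgp; split.
  - have ca : continuous (fun t : R => (t, 0 : R)) by cont.
    exact: (continuous_comp2 ca csq).
  - by move=> t tI; apply: Asq => //; exact: unitI0.
  - by rewrite /sq /= rt0 // p0; exact: gA.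
  - by rewrite /sq /= rt0 // p1; exact: gA.
have pxy := end_pathP Ax; have pyy := end_pathP Ay.
have e : endq m (g \o p) = endq (endq (endq m (end_path x)) (h \o p)) (path_rev (end_path y)).
  have qx := q_endp cq pxy qm; have qh := q_endp cq php qx.
  have eb : (fun s => sq (0, s)) = end_path x by apply/funext => s; rewrite /sq /= p0.
  have ey : (fun s => sq (1, 1 - s)) = path_rev (end_path y).
    by apply/funext => s; rewrite /sq /= p1.
  have ph : is_path A (h x) (h y) (fun t => sq (t, 1)).
    split; rewrite /sq /= ?p0 ?p1 ?rt1 //; last first.
      by move=> t tI; apply: rtA; apply: gA; exact: Ap.
    have ca : continuous (fun t : R => (t, 1 : R)) by cont.
    exact: (continuous_comp2 ca csq).
  have eh : endp q (endp q m (end_path x)) (fun t => sq (t, 1)) =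
      endp q (endp q m (end_path x)) (h \o p).
    by apply/esym/(endp_eq cq php qx) => t tI; rewrite /sq /= rt1 //; exact: Ap.
  have hs := square_homotopy csq Asq; rewrite eb ey in hs.
  rewrite /endq -eh.
  rewrite -(endp_concat cq ph (path_revP pyy) qx).
  rewrite -(endp_concat cq pxy (path_concatP ph (path_revP pyy)) qm).
  rewrite -(endp_homotopic cq pb qm hs).
  apply: (endp_eq cq pgp qm) => t tI; rewrite /sq /= rt0 //; apply: gA; exact: Ap.
rewrite e; apply: (endp_rev' cq pyy).
exact: (q_endp cq php (q_endp cq pxy qm)).
Qed.

Lemma lift_end_push b p y : is_path A x0 y p ->
  path_homotopic (@bg_set S) (orbit_rep b) (k \o p) -> lift_end b = endq m0 p.
Proof.
move=> pp hb; rewrite /lift_end /endk (endp_homotopic ckq (orbit_repP b) kq0 hb).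
exact: (endp_push cq ckq pp qm0).
Qed.

Lemma lift_end_path b : exists p, [/\ is_path A x0 (q (lift_end b)) p,
  endq m0 p = lift_end b & path_homotopic (@bg_set S) (orbit_rep b) (k \o p)].
Proof.
have [F [[cF F0 qF] eF]] := lift_path ckq (orbit_repP b) kq0.
exists (q \o F); split.
- split; rewrite /= ?F0 //.
  + exact: (continuous_comp2 cF (cov_cont cq)).
  + by move=> t _; exact: (cov_in cq).
  + by rewrite -eF.
- by rewrite /endq (endpE cq (G := F)) //.
- by apply: (homotopic_eq (orbit_repP b)) => t tI; rewrite /= -qF.
Qed.

Lemma lift_endM a b p y : orbit_elt a = 1%g -> q (lift_end a) = x0 ->
  is_path A x0 y p -> path_homotopic (@bg_set S) (orbit_rep b) (k \o p) ->
  lift_end (a * b)%g = endq (lift_end a) p.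
Proof.
move=> a1 qa pp hb; rewrite /lift_end /endk (orbit_mul_endp ckq kq0) a1.
have -> : bg_act 1%g \o orbit_rep b = orbit_rep b.
  by apply/funext => t; rewrite /= bg_act1.
rewrite -/endk -/(lift_end a).
have kqa : (k \o q) (lift_end a) = bg_base S by rewrite /= qa.
rewrite /endk (endp_homotopic ckq (orbit_repP b) kqa hb).
exact: (endp_push cq ckq pp qa).
Qed.

Lemma lift_end_bar a b p : orbit_elt a = pi -> q (lift_end a) = h x0 ->
  is_path A x0 x0 p -> orbit_elt b = 1%g ->
  path_homotopic (@bg_set S) (orbit_rep b) (k \o p) ->
  lift_end (a * bar b)%g = endq (lift_end a) (h \o p).
Proof.
move=> api qa pp b1 hb; have [e1 hbar] := bar_loop pp b1 hb.
rewrite /lift_end /endk (orbit_mul_endp ckq kq0) api -/endk -/(lift_end a).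
have kqa : (k \o q) (lift_end a) = bg_act pi (bg_base S) by rewrite /= qa.
have pb := is_path_act pi (orbit_repP (bar b)); rewrite e1 bg_act1 in pb.
rewrite /endk (endp_homotopic ckq pb kqa hbar).
have ph : is_path A (h x0) (h x0) (h \o p).
  have [cp Ap p0 p1] := pp; split; rewrite /= ?p0 ?p1 //.
    exact: (continuous_comp2 cp ch).
  by move=> t tI; apply: hA; exact: Ap.
exact: (endp_push cq ckq ph qa).
Qed.

Lemma full_monoP u eta : Fx u -> is_path A x0 (ga u 0) eta ->
  is_path A x0 (h x0) (full_mono u eta).
Proof. by move=> Fu pe; exact: path_concatP (mono_pathP tw Fu pe) (end_pathP Ax0). Qed.

Lemma corresponds_class u b : Fx u -> corresponds u b <->
  exists eta, is_path A x0 (ga u 0) eta /\ b = orbit_class pi (k \o full_mono u eta).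
Proof.
move=> Fu; have po eta : is_path A x0 (ga u 0) eta ->
    is_orbit_path pi (k \o full_mono u eta : R -> _).
  move=> pe; have := push_path ck kA (full_monoP Fu pe).
  by rewrite k0 kh0.
have pe' eta : is_path A x0 (ga u 0) eta ->
    endk m0 (k \o full_mono u eta) = endq m0 (full_mono u eta).
  by move=> pe; exact: (endp_push cq ckq (full_monoP Fu pe) qm0).
split=> -[eta].
  move=> [pe bpi be]; exists eta; split => //; have pk := po eta pe.
  apply: (orbit_eq_endp ckq cM kq0); first by rewrite (orbit_class_elt pk).
  rewrite (orbit_class_endp ckq kq0 pk) -/endk pe' //.
move=> [pe ->]; have pk := po eta pe; exists eta; split => //.
  by rewrite (orbit_class_elt pk).
by rewrite /lift_end /endk (orbit_class_endp ckq kq0 pk) -/endk pe'.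
Qed.

Lemma corresponds_ex u : Fx u -> exists b, corresponds u b.
Proof.
move=> Fu; have [eta pe] := covers_path cq cM Ax0 (tw_A tw 0 Fu).
have pf := full_monoP Fu pe.
have qm : (k \o q) (endq m0 (full_mono u eta)) = bg_act pi (bg_base S).
  by rewrite /= (q_endp cq pf qm0).
have [b [bpi be]] := orbit_elt_endp ckq cM kq0 qm.
by exists b, eta.
Qed.

Lemma corresponds_coset u b : Fx u -> corresponds u b -> corr_coset b.
Proof.
move=> Fu [eta [pe bpi be]]; split => //; rewrite be.
exact: (q_endp cq (full_monoP Fu pe) qm0).
Qed.

Lemma corresponds_component u v b : Fx u -> Fx v -> corresponds u b ->
  corresponds v b <-> connected_component Fx u v.
Proof.
move=> Fu Fv [eta [pe bpi be]]; have pm := mono_pathP tw Fu pe.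
split.
  move=> [eta' [pe' _]]; rewrite be => e; apply/(joined_component tw) => //.
  apply: (mono_inj tw cq cM qm0 Fu Fv pe pe'); apply: esym.
  have pm' := mono_pathP tw Fv pe'.
  move: e; rewrite /endq /full_mono (endp_concat cq pm (end_pathP Ax0) qm0).
  rewrite (endp_concat cq pm' (end_pathP Ax0) qm0) => e.
  apply: (endp_inj cq (end_pathP Ax0) _ _ e).
    exact: (q_endp cq pm qm0).
  exact: (q_endp cq pm' qm0).
move=> /(joined_component tw _ Fu) j.
have [eta' [pe' e]] := mono_joined tw cq cM qm0 Fu pe j.
exists eta'; split => //; rewrite be /endq /full_mono.
have pm' := mono_pathP tw Fv pe'.
rewrite (endp_concat cq pm (end_pathP Ax0) qm0) (endp_concat cq pm' (end_pathP Ax0) qm0).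
by rewrite e.
Qed.

Lemma corresponds_surj b : corr_coset b -> exists u, Fx u /\ corresponds u b.
Proof.
move=> [bpi qb]; have [p [pp ep hp]] := lift_end_path b; rewrite qb in pp.
have pr := path_revP (end_pathP Ax0).
have [u [eta [Fu pe e]]] := mono_surj tw cq qm0 (path_concatP pp pr).
exists u; split => //; exists eta; split => //.
have pm := mono_pathP tw Fu pe.
rewrite /endq /full_mono (endp_concat cq pm (end_pathP Ax0) qm0) e.
rewrite (endp_concat cq pp pr qm0) -ep.
by apply/esym; apply: (endp_rev' cq (end_pathP Ax0)); exact: (q_endp cq pp qm0).
Qed.

Definition twisted_classes (b : G) : set G :=
  [set (p * b * (bar p)^-1)%g | p in closed_lift].

Section Loop.
Variables (u : L) (eta : R -> T) (b : G).
Hypotheses (Fu : Fx u) (pe : is_path A x0 (ga u 0) eta).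
Hypotheses (bpi : orbit_elt b = pi) (be : lift_end b = endq m0 (full_mono u eta)).

Lemma lift_end_mul p l : orbit_elt p = 1%g -> is_path A x0 x0 l ->
  path_homotopic (@bg_set S) (orbit_rep p) (k \o l) ->
  lift_end (p * b)%g = endq (endq (endq m0 l) (mono u eta)) (end_path x0).
Proof.
move=> p1 pl hp; have pm := mono_pathP tw Fu pe.
have ep := lift_end_push pl hp; have qp := q_endp cq pl qm0.
have [f [pf ef hf]] := lift_end_path b.
have qb : q (lift_end b) = h x0.
  by rewrite be; exact: (q_endp cq (full_monoP Fu pe) qm0).
rewrite qb in pf; rewrite (lift_endM _ _ pf hf) // ?ep //.
rewrite /endq -(endp_concat cq pm (end_pathP Ax0) qp).
apply: (endp_homotopic cq pf qp).
apply: (homotopic_endp cq cM pf (full_monoP Fu pe) qm0).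
by rewrite -[RHS]be.
Qed.

(** Prefixing [eta] by the loop [l] conjugates the monodromy by [l] on the left and [g \o l] on the
    right. Across the end path the latter becomes [h \o l], which represents the action of [pi] on
    [bar p]. *)
Lemma lift_end_twist p l b' : orbit_elt p = 1%g -> is_path A x0 x0 l ->
  path_homotopic (@bg_set S) (orbit_rep p) (k \o l) -> orbit_elt b' = pi ->
  lift_end b' = endq m0 (full_mono u (path_concat l eta)) ->
  b' = (p * b * (bar p)^-1)%g.
Proof.
move=> p1 pl hp b'pi be'; have pm := mono_pathP tw Fu pe.
have [bar1 _] := bar_loop pl p1 hp.
suff e : (b' * bar p)%g = (p * b)%g by rewrite -e mulgK.
have ple := path_concatP pl pe; have pm' := mono_pathP tw Fu ple.
have qb' : q (lift_end b') = h x0.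
  by rewrite be'; exact: (q_endp cq (full_monoP Fu ple) qm0).
apply: (orbit_eq_endp ckq cM kq0); first by rewrite !orbit_eltM bar1 p1 b'pi bpi mulg1 mul1g.
rewrite -/endk -!/(lift_end _) (lift_end_bar b'pi qb' pl p1 hp) be' (lift_end_mul p1 pl hp).
have pgr := path_g tw (path_revP pl).
have -> : endq m0 (full_mono u (path_concat l eta)) =
    endp q (endp q m0 (mono u (path_concat l eta))) (end_path x0).
  exact: (endp_concat cq pm' (end_pathP Ax0) qm0).
rewrite (mono_conj tw cq qm0 Fu pe pl) (endp_concat cq (path_concatP pl pm) pgr qm0).
rewrite (endp_concat cq pl pm qm0) -!/(endq _ _).
have ql : q (endq m0 l) = x0 := q_endp cq pl qm0.
have qt : q (endq (endq m0 l) (mono u eta)) = g x0 := q_endp cq pm ql.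
rewrite (end_path_square (path_revP pl) qt).
have ph : is_path A (h x0) (h x0) (h \o l).
  have [cp Ap p0 p1'] := pl; split; rewrite /= ?p0 ?p1' //.
    exact: (continuous_comp2 cp ch).
  by move=> t tI; apply: hA; exact: Ap.
apply: (endp_rev' cq ph).
exact: (q_endp cq (end_pathP Ax0) qt).
Qed.

Lemma corresponds_classes b' : twisted_classes b b' <-> corresponds u b'.
Proof.
split.
  move=> [p [p1 qp] <-]; have [l [pl el hl]] := lift_end_path p; rewrite qp in pl.
  have ple := path_concatP pl pe; have pf := full_monoP Fu ple.
  have qm : (k \o q) (endq m0 (full_mono u (path_concat l eta))) = bg_act pi (bg_base S).
    by rewrite /= (q_endp cq pf qm0).
  have [b'' [b''pi be'']] := orbit_elt_endp ckq cM kq0 qm.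
  by rewrite -(lift_end_twist p1 pl hl b''pi be''); exists (path_concat l eta).
move=> [eta' [pe' b'pi be']].
have [l [pl el]] := mono_change tw cq cM qm0 Fu pe pe'.
have pk := push_orbit ck kA k0 pl.
exists (orbit_class 1%g (k \o l)).
  split; first exact: orbit_class_elt.
  by rewrite (lift_end_push pl (orbit_class_rep pk)) (q_endp cq pl qm0).
apply/esym; apply: (lift_end_twist _ pl (orbit_class_rep pk)) => //.
  exact: orbit_class_elt.
rewrite be' /endq /full_mono.
have ple := path_concatP pl pe.
rewrite (endp_concat cq (mono_pathP tw Fu pe') (end_pathP Ax0) qm0).
rewrite (endp_concat cq (mono_pathP tw Fu ple) (end_pathP Ax0) qm0).
by rewrite el (mono_conj tw cq qm0 Fu pe pl).
Qed.

(** Carrying [g \o l] across the end path translates the commutation with the monodromy found in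
    [pi1_iso] into an equation between braids. *)
Lemma corresponds_pi1 : group_iso_onto (pi1 R (connected_component_refl Fu))
  [set p | closed_lift p /\ (p * b = b * bar p)%g].
Proof.
have := pi1_iso tw cq cM qm0 Fu pe ck kA k0 ckq; congr group_iso_onto.
have pm := mono_pathP tw Fu pe.
have key p l : orbit_elt p = 1%g -> is_path A x0 x0 l ->
    path_homotopic (@bg_set S) (orbit_rep p) (k \o l) ->
    (p * b = b * bar p)%g <-> endq m0 (path_concat l (mono u eta)) =
     endq m0 (path_concat (mono u eta) (g \o l)).
  move=> p1 pl hp; have [bar1 _] := bar_loop pl p1 hp.
  have qb : q (lift_end b) = h x0.
    by rewrite be; exact: (q_endp cq (full_monoP Fu pe) qm0).
  have pgl := path_g tw pl; have ql : q (endq m0 l) = x0 := q_endp cq pl qm0.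
  have qt : q (endq m0 (mono u eta)) = g x0 := q_endp cq pm qm0.
  have e1 := lift_end_mul p1 pl hp.
  have e2 : lift_end (b * bar p)%g = endq (endq (endq m0 (mono u eta)) (g \o l)) (end_path x0).
    rewrite (lift_end_bar bpi qb pl p1 hp) be (end_path_square pl qt).
    congr (endq _ _); exact: (endp_concat cq pm (end_pathP Ax0) qm0).
  rewrite /endq (endp_concat cq pl pm qm0) (endp_concat cq pm pgl qm0) -!/(endq _ _).
  split.
    move=> /(congr1 lift_end); rewrite e1 e2 => e.
    apply: (endp_inj cq (end_pathP Ax0) _ _ e).
      exact: (q_endp cq pm ql).
    exact: (q_endp cq pgl qt).
  move=> e; apply: (orbit_eq_endp ckq cM kq0).
    by rewrite !orbit_eltM bar1 p1 mulg1 mul1g.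
  by rewrite -/endk -!/(lift_end _) e1 e2 e.
apply/seteqP; split => p /=.
  move=> [l [pl -> e]]; have pk := push_orbit ck kA k0 pl.
  have hp := orbit_class_rep pk; have p1 := orbit_class_elt pk.
  split; last by apply/(key _ _ p1 pl hp).
  split => //; by rewrite (lift_end_push pl hp) (q_endp cq pl qm0).
move=> [[p1 qp] e]; have [l [pl el hl]] := lift_end_path p; rewrite qp in pl.
exists l; split => //; last by apply/(key _ _ p1 pl hl).
have pk := push_orbit ck kA k0 pl.
apply: orbit_eqP; first by rewrite (orbit_class_elt pk).
apply: (homotopic_trans hl); apply: homotopic_sym; exact: orbit_class_rep.
Qed.

End Loop.

Theorem correspondence : exists F : set L -> set G,
  set_bij (components Fx) [set twisted_classes b | b in corr_coset] F /\
  forall u b, Fx u -> corresponds u b ->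
    F (connected_component Fx u) = twisted_classes b.
Proof.
apply: component_bijection.
- exact: corresponds_ex.
- exact: corresponds_coset.
- move=> u b b' Fu [eta [pe bpi be]]; exact: (corresponds_classes Fu pe bpi be).
- exact: corresponds_component.
- exact: corresponds_surj.
Qed.

Theorem twisted_correspondence :
  let rel u b := exists eta, is_path A x0 (ga u 0) eta /\
    b = orbit_class pi (k \o full_mono u eta) in
  (exists F : set L -> set G,
    set_bij (components Fx) [set twisted_classes b | b in corr_coset] F /\
    forall u b, Fx u -> rel u b -> F (connected_component Fx u) = twisted_classes b) /\
  forall u (Fu : Fx u), [/\ aspherical R (set_type (connected_component Fx u)),
    exists b, rel u b & forall b, rel u b ->
      group_iso_onto (pi1 R (connected_component_refl Fu))
        [set p | closed_lift p /\ (p * b = b * bar p)%g]].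
Proof.
move=> rel; split.
  have [F [bF FE]] := correspondence; exists F; split => // u b Fu /(corresponds_class b Fu).
  exact: FE.
move=> u Fu; split.
- exact: (twisted_aspherical tw cq cM Fu).
- by have [b /(corresponds_class b Fu)] := corresponds_ex Fu; exists b.
- move=> b /(corresponds_class b Fu)[eta [pe bpi be]].
  exact: (corresponds_pi1 Fu pe bpi be).
Qed.

End Correspondence.

(** * The exponential and power maps *)

Section ExponentialCover.
Variable R : realType.
Local Notation C := (plane R).
Implicit Types (p : R * R) (z w : C).

Definition cexp p : C := (expR p.1)%:C%C * expi p.2.

Lemma cexpE p : cexp p = Complex (expR p.1 * cos p.2) (expR p.1 * sin p.2).
Proof. by apply/eqP; rewrite eq_complex /=; apply/andP; split; apply/eqP; ring. Qed.

Lemma cexpD p p' : cexp (p.1 + p'.1, p.2 + p'.2) = cexp p * cexp p'.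
Proof. by rewrite /cexp /= expRD expiD rmorphM /=; ring. Qed.

Lemma cexp0 : cexp (0, 0) = 1.
Proof. by rewrite /cexp /= expR0 expi0 mulr1. Qed.

Lemma cexp_neq0 p : cexp p != 0.
Proof.
rewrite mulf_neq0 ?expi_neq0 // eq_complex /= eqxx andbT.
by rewrite gt_eqF // expR_gt0.
Qed.

Lemma cexpX p (c : nat) : cexp p ^+ c = cexp (c%:R * p.1, c%:R * p.2).
Proof.
elim: c => [|c IH]; first by rewrite expr0 !mul0r cexp0.
by rewrite exprS IH -cexpD /= -natr1 !mulrDl !mul1r [p.1 + _]addrC [p.2 + _]addrC.
Qed.

Lemma cexp_continuous : continuous cexp.
Proof.
rewrite (_ : cexp = fun p => Complex (expR p.1 * cos p.2) (expR p.1 * sin p.2)); last first.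
  by apply/funext => p; rewrite cexpE.
have c1 := continuous_comp2 (@continuous_fstE R R) (@continuous_expR R).
have c2 := continuous_comp2 (@continuous_sndE R R) (@continuous_cos R).
have c3 := continuous_comp2 (@continuous_sndE R R) (@continuous_sin R).
by apply: Complex_continuous; apply: contM.
Qed.

(** For 0 < t < 2 pi the positive sin (t / 2) would contradict cos t = 1 by the formula for the
    double angle; negative t reduces to -t. *)
Lemma expi_eq1 (t : R) : expi t = 1 -> `|t| < 2 * pi -> t = 0.
Proof.
have key s : expi s = 1 -> 0 <= s < 2 * pi -> s = 0.
  move=> /eqP; rewrite eq_complex /= => /andP[/eqP c1 _] /andP[s0 s1].
  apply/eqP; rewrite eq_le s0 andbT leNgt; apply/negP => s0'.
  have : 0 < sin (s / 2) by apply: sin_gt0_pi; apply/andP; split; lra.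
  have := cos_mulr2n (s / 2); rewrite (_ : s / 2 *+ 2 = s) ?mulr2n; last by field.
  rewrite c1; have := cos2Dsin2 (s / 2); nra.
move=> e; rewrite ltr_norml => /andP[h1 h2].
have [t0|t0] := leP 0 t; first by apply: key => //; rewrite t0.
suff : - t = 0 by lra.
apply: key; last by apply/andP; split; lra.
by rewrite -[LHS]mul1r -e -expiD subrr expi0.
Qed.

Lemma cexp_inj p p' : cexp p = cexp p' -> `|p.2 - p'.2| < 2 * pi -> p = p'.
Proof.
rewrite !cexpE => -[e1 e2] h.
have n2 (q : R * R) : (expR q.1 * cos q.2) ^+ 2 + (expR q.1 * sin q.2) ^+ 2 = expR q.1 ^+ 2.
  by rewrite !exprMn -mulrDr cos2Dsin2 mulr1.
have e3 : expR p.1 = expR p'.1.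
  have : expR p.1 ^+ 2 = expR p'.1 ^+ 2 by rewrite -!n2 e1 e2.
  by move=> /eqP; rewrite eqrXn2 ?expR_ge0 // => /eqP.
have e4 : p.1 = p'.1 := expR_inj e3.
have x0 : expR p'.1 != 0 by rewrite gt_eqF // expR_gt0.
move: e1 e2; rewrite e3 => /(mulfI x0) c /(mulfI x0) s.
have : p.2 - p'.2 = 0.
  apply: expi_eq1 => //; rewrite /expi cosB sinB c s.
  apply/eqP; rewrite eq_complex /=; apply/andP; split; apply/eqP; last ring.
  by rewrite -!expr2 cos2Dsin2.
move=> /eqP; rewrite subr_eq0 => /eqP e5.
by rewrite [LHS]surjective_pairing e4 e5 -surjective_pairing.
Qed.

(* The principal determination of the logarithm, for [0 < Re z]. *)
Definition clog z : R * R :=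
  let phi := atan (complex.Im z / complex.Re z) in (ln (complex.Re z / cos phi), phi).

Let cos_atan_gt0 (x : R) : 0 < cos (atan x).
Proof. by apply: cos_gt0_pihalf; rewrite atan_gtNpi2 atan_ltpi2. Qed.

Lemma clogK z : 0 < complex.Re z -> cexp (clog z) = z.
Proof.
case: z => a b /= a0; rewrite cexpE /=; set phi := atan (b / a).
have c0 : 0 < cos phi := cos_atan_gt0 _.
rewrite lnK ?qualifE /= ?divr_gt0 // mulfVK ?gt_eqF //.
have t : sin phi / cos phi = b / a by have := atanK (b / a).
have -> : a / cos phi * sin phi = a * (sin phi / cos phi) by ring.
by rewrite t; congr Complex; field; rewrite gt_eqF.
Qed.

Lemma clog_bound z : `|(clog z).2| < pi / 2.
Proof. by rewrite ltr_norml /= atan_gtNpi2 atan_ltpi2. Qed.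

Lemma clog_continuous z : 0 < complex.Re z -> {for z, continuous clog}.
Proof.
move=> a0.
have ci : (fun w : C => complex.Im w) @ z --> complex.Im z := @Im_continuous R z.
have cr : (fun w : C => complex.Re w) @ z --> complex.Re z := @Re_continuous R z.
have cd : {for z, continuous (fun w : C => complex.Im w / complex.Re w)}.
  by apply: (cvgM ci (cvgV _ cr)); rewrite gt_eqF.
have cphi : {for z, continuous (fun w : C => atan (complex.Im w / complex.Re w))}.
  exact: (continuous_comp cd (@continuous_atan R _)).
have cc : (fun w : C => cos (atan (complex.Im w / complex.Re w))) @ z -->
    cos (atan (complex.Im z / complex.Re z)).
  exact: (continuous_comp cphi (@continuous_cos R _)).
have cq : {for z, continuous (fun w : C => complex.Re w / cos (atan (complex.Im w / complex.Re w)))}.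
  by apply: (cvgM cr (cvgV _ cc)); rewrite gt_eqF.
apply: for_continuous_pair => //.
apply: (continuous_comp cq); apply: continuous_ln.
by rewrite divr_gt0.
Qed.

(* Quotients of two points of this sector have positive real part. *)
Let sector (a : C) : set C :=
  [set z | `|complex.Im (z / a)| < complex.Re (z / a)].

Let sector_div a z w : a != 0 -> sector a z -> sector a w -> 0 < complex.Re (w / z).
Proof.
rewrite /sector /= => a0 hz hw.
have z0 : z / a != 0.
  by apply/eqP => e; move: hz; rewrite e /= normr0 ltxx.
have -> : w / z = (w / a) / (z / a).
  rewrite invf_div mulrA divfK //.
move: hz hw z0; case: (w / a) => r s; case: (z / a) => p q /=.
rewrite !ltr_norml => /andP[h1 h2] /andP[h3 h4] _.
rewrite /= mulrN opprK !mulrA -mulrDl divr_gt0 //; nra.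
Qed.

Lemma expi_pi : expi (pi : R) = -1.
Proof. by rewrite /expi cospi sinpi; apply/eqP; rewrite eq_complex /= oppr0 !eqxx. Qed.

Lemma expi_eq1P (t : R) : expi t = 1 -> exists m : int, t = 2 * pi * m%:~R.
Proof.
move=> e; have pi0 := pi_gt0 R; have p0 : 2 * pi != 0 :> R by rewrite gt_eqF //; lra.
set m := Num.floor (t / (2 * pi)); exists m.
have := floor_itv (t / (2 * pi)); rewrite -/m intrD => /andP[h1 h2].
have et : t = t / (2 * pi) * (2 * pi) by rewrite mulfVK.
suff : t - 2 * pi * m%:~R = 0 by move=> /eqP; rewrite subr_eq0 => /eqP.
apply: expi_eq1; last by rewrite ltr_norml; apply/andP; split; rewrite et; nra.
apply: (mulIf (expi_neq0 (2 * pi * m%:~R))).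
by rewrite -expiD subrK e expi_2pi mulr1.
Qed.

(** In the closed upper half plane the argument is an arccosine; the other points are opposites of
    these. *)
Lemma cexp_surj z : z != 0 -> exists p, cexp p = z.
Proof.
have key w : 0 <= complex.Im w -> w != 0 -> exists p, cexp p = w.
  case: w => x y /= y0; rewrite eq_complex /= negb_and => w0.
  have n0 : 0 < x ^+ 2 + y ^+ 2.
    rewrite lt_neqAle addr_ge0 ?sqr_ge0 // andbT eq_sym paddr_eq0 ?sqr_ge0 //.
    by rewrite !sqrf_eq0 negb_and.
  set r := Num.sqrt (x ^+ 2 + y ^+ 2); have r0 : 0 < r by rewrite sqrtr_gt0.
  have rr : r ^+ 2 = x ^+ 2 + y ^+ 2 by rewrite sqr_sqrtr // ltW.
  have y2 := sqr_ge0 y.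
  have xr : -1 <= x / r <= 1.
    by rewrite ler_pdivlMr // ler_pdivrMr //; apply/andP; split; nra.
  exists (ln r, acos (x / r)); rewrite cexpE /= lnK ?qualifE //.
  rewrite acosK // sin_acos //.
  have -> : 1 - (x / r) ^+ 2 = (y / r) ^+ 2.
    have : r ^+ 2 - x ^+ 2 = y ^+ 2 by rewrite rr; ring.
    by rewrite !expr_div_n => <-; field; rewrite gt_eqF.
  rewrite sqrtr_sqr (ger0_norm (divr_ge0 y0 (ltW r0))).
  by congr Complex; field; rewrite gt_eqF.
move=> z0; have [h|h] := leP 0 (complex.Im z); first exact: key.
have [||p e] := key (- z).
- by case: z h {z0} => a b /=; lra.
- by rewrite oppr_eq0.
- exists (p.1, p.2 + pi); have := cexpD p (0, pi).
  by rewrite /= addr0 => ->; rewrite e /cexp /= expR0 mul1r expi_pi mulrN1 opprK.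
Qed.

Lemma clog1 : clog 1 = (0, 0).
Proof.
have r1 : 0 < complex.Re (1 : C) by rewrite /= ltr01.
apply: cexp_inj; first by rewrite clogK // cexp0.
have := clog_bound 1; have := pi_gt0 R; rewrite subr0; lra.
Qed.

Let sector_open a : open (sector a).
Proof.
rewrite openE => z; rewrite /sector /= => h.
have cd : continuous (fun w : C => w / a).
  by apply: contMC; [exact: continuous_idE|exact: contcst].
have cr := continuous_comp2 cd (@Re_continuous R).
have ci := continuous_comp2 cd (@Im_continuous R).
have cf : continuous (fun w : C => complex.Re (w / a) - `|complex.Im (w / a)|).
  exact: (contD cr (contN (contnorm ci))).
have h' : 0 < complex.Re (z / a) - `|complex.Im (z / a)| by lra.
by have := near_gtc cf h'; apply: filterS => w /=; lra.
Qed.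

Lemma cexp_covers : covers R [set z : C | z != 0] cexp.
Proof.
have pi0 := pi_gt0 R; apply: lt_covers; last first.
- move=> a; have [[p0 e0]|no] := pselect (exists p, cexp p = a); last first.
    rewrite (_ : _ @^-1` _ = set0); first exact: countable0.
    by apply/seteqP; split => // p /= e; apply: no; exists p.
  apply: (@sub_countable _ _ _ [set (p0.1, p0.2 + 2 * pi * m%:~R) | m in [set: int]]).
    apply: subset_card_le => p /= e.
    have e1 : cexp (p.1 - p0.1, p.2 - p0.2) = 1.
      have := cexpD (p.1 - p0.1, p.2 - p0.2) p0; rewrite /= !subrK -surjective_pairing e e0.
      have a0 : a != 0 by rewrite -e0 cexp_neq0.
      by move=> /(congr1 (fun z => z / a)); rewrite mulfK // divff.
    have [e2 e3] : expR (p.1 - p0.1) = 1 /\ expi (p.2 - p0.2) = 1.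
      move: e1; rewrite cexpE /= => -[e2 e3].
      have e4 : expR (p.1 - p0.1) ^+ 2 = 1.
        transitivity (expR (p.1 - p0.1) ^+ 2 * (cos (p.2 - p0.2) ^+ 2 + sin (p.2 - p0.2) ^+ 2)).
          by rewrite cos2Dsin2 mulr1.
        by rewrite mulrDr -!exprMn e2 e3 expr1n expr0n addr0.
      have e5 : expR (p.1 - p0.1) = 1.
        by apply/eqP; rewrite -(@eqrXn2 _ 2) ?expR_ge0 // e4 expr1n.
      by split => //; move: e2 e3; rewrite e5 !mul1r /expi => -> ->.
    have [m em] := expi_eq1P e3; exists m => //.
    rewrite -em addrC subrK [RHS]surjective_pairing; congr (_, _).
    have := congr1 (@ln R) e2; rewrite expRK ln1; lra.
  exact: (sub_countable (card_image_le _ _) (countableP _)).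
- exact: cexp_surj.
- move=> a /= a0; exists (sector a).
  exists (fun m y => (m.1 + (clog (y / cexp m)).1, m.2 + (clog (y / cexp m)).2)).
  split; first by rewrite /sector /= divff //= normr0 ltr01.
  split; first exact: sector_open.
  move=> m Um; have m0 := cexp_neq0 m.
  have pos m' y : sector a (cexp m') -> sector a y -> 0 < complex.Re (y / cexp m').
    by move=> h1 h2; exact: sector_div a0 h1 h2.
  have sK m' y : sector a (cexp m') -> sector a y ->
      cexp (m'.1 + (clog (y / cexp m')).1, m'.2 + (clog (y / cexp m')).2) = y.
    by move=> h1 h2; rewrite cexpD clogK ?pos // mulrCA divff ?cexp_neq0 // mulr1.
  split.
  - by rewrite divff // clog1 !addr0 -surjective_pairing.
  - move=> y Uy; split; first exact: sK.
    have cl : {for y, continuous (fun w : C => clog (w / cexp m))}.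
      have cd : continuous (fun w : C => w / cexp m).
        by apply: contMC; [exact: continuous_idE|exact: contcst].
      exact: (continuous_comp (cd y) (clog_continuous (pos _ _ Um Uy))).
    have ca : continuous (fun p : R * R => (m.1 + p.1, m.2 + p.2)) by cont.
    exact: (continuous_comp cl (ca _)).
  have n1 : \forall m' \near m, sector a (cexp m').
    apply: cexp_continuous; apply: open_nbhs_nbhs; split => //; exact: sector_open.
  have n2 : \forall m' \near m, `|m'.2 - m.2| < pi / 2.
    have cf : continuous (fun p : R * R => `|p.2 - m.2|) by cont.
    by apply: (near_ltc cf); rewrite subrr normr0; lra.
  move: n1 n2; apply: filterS2 => m' Um' hm' y Uy.
  apply: cexp_inj; first by rewrite !sK.
  (* The two angles differ by three terms, each less than pi / 2 in absolute value, hence by less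
     than 2 pi, and [cexp_inj] applies. *)
  have := clog_bound (y / cexp m); have := clog_bound (y / cexp m'); move: hm' => /=.
  by rewrite !ltr_norml; lra.
- exact: cexp_neq0.
- exact: cexp_continuous.
Qed.

End ExponentialCover.

Section PrimitiveRoot.
Variables (R : realType) (l c : nat).
Local Notation C := (plane R).
Hypotheses (c0 : (0 < c)%N) (lc : coprime l c).

Definition root_l : C := expi (2 * pi * l%:R / c%:R).

Lemma root_prim : c.-primitive_root root_l.
Proof.
have cR : c%:R != 0 :> R by rewrite pnatr_eq0 -lt0n.
have rX (j : nat) : root_l ^+ j = expi (2 * pi * (j%:R * l%:R / c%:R)).
  by rewrite /root_l -expi_nat -mulr_natl; congr expi; field.
apply/andP; split => //; apply/forallP => i; rewrite unity_rootE rX.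
apply/eqP; apply/idP/idP.
  move=> /eqP/expi_eq1P[m]; have p0 : 2 * pi != 0 :> R by have := pi_gt0 R; lra.
  move=> /(mulfI p0) e.
  have e' : (i.+1 * l)%N%:Z = m * c%:Z.
    by apply: (@intr_inj R); rewrite PoszM !rmorphM /= -e; field.
  have : (c %| i.+1 * l)%N.
    have : (c%:Z %| (i.+1 * l)%N%:Z)%Z by rewrite e' dvdz_mull.
    by rewrite dvdzE !absz_nat.
  rewrite Gauss_dvdl 1?coprime_sym // => /dvdn_leq -/(_ isT) h.
  by rewrite eqn_leq h andbT; have := ltn_ord i.
move=> /eqP ->; have -> : c%:R * l%:R / c%:R = l%:R :> R by field.
by rewrite (expi_2pi R l) eqxx.
Qed.

End PrimitiveRoot.

Section ContC.
Variables (R : realType) (T : topologicalType).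
Local Notation C := (plane R).

Lemma contVC (f : T -> C) : (forall x, f x != 0) -> continuous f ->
  continuous (fun x => (f x)^-1).
Proof.
move=> nz cf; have cr := continuous_comp2 cf (@Re_continuous R).
have ci := continuous_comp2 cf (@Im_continuous R).
pose n2 x := complex.Re (f x) * complex.Re (f x) + complex.Im (f x) * complex.Im (f x).
have cn : continuous n2 by apply: contD; apply: contM.
have n0 x : n2 x != 0.
  have := nz x; rewrite eq_complex /= negb_and /n2 -!expr2.
  by rewrite paddr_eq0 ?sqr_ge0 // !sqrf_eq0 negb_and.
rewrite (_ : (fun x => _) = fun x => Complex (complex.Re (f x) / n2 x) (- (complex.Im (f x) / n2 x))).
  have cV := contV n0 cn.
  by apply: Complex_continuous; [apply: contM|apply: contN; apply: contM].
by apply/funext => x; rewrite /n2; case: (f x) => a b /=; rewrite -!expr2.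
Qed.

Lemma near_neqC (f : T -> C) x : continuous f -> f x != 0 ->
  \forall y \near x, f y != 0.
Proof.
move=> cf; have cr := continuous_comp2 cf (@Re_continuous R).
have ci := continuous_comp2 cf (@Im_continuous R).
rewrite eq_complex /= negb_and => /orP[] h.
  by have := near_neqc cr h; apply: filterS => y; apply: contra => /= /eqP ->.
by have := near_neqc ci h; apply: filterS => y; apply: contra => /= /eqP ->.
Qed.

End ContC.

(** * The covering by c-th powers *)

Section PowerCover.
Variables (R : realType) (c : nat) (zeta : plane R).
Local Notation C := (plane R).
Hypothesis prim : c.-primitive_root zeta.
Variables (M : topologicalType) (m : nat) (q : M -> 'rV[C]_m).
Hypothesis cq : covers R (sep_conf zeta (m := m)) q.

Definition pow_row (w : 'rV[C]_m) : 'rV[C]_m := \row_j w 0 j ^+ c.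

Let c0 : (0 < c)%N. Proof. exact: prim_order_gt0 prim. Qed.
Let cR : c%:R != 0 :> R. Proof. by rewrite pnatr_eq0 -lt0n. Qed.

Lemma pow_row_continuous : continuous pow_row.
Proof.
apply: cont_row => j; rewrite (_ : (fun p => _) = fun w : 'rV[C]_m => w 0 j ^+ c); last first.
  by apply/funext => w; rewrite mxE.
apply: contXC; exact: (@cont_entry R _ m id j (@continuous_idE _)).
Qed.

Lemma pow_eq (z w : C) : w != 0 -> z ^+ c = w ^+ c -> exists k : 'I_c, z = zeta ^+ k * w.
Proof.
move=> w0 e; have : (z / w) ^+ c = 1 by rewrite expr_div_n e divff // expf_neq0.
by move=> /(prim_rootP prim)[k ek]; exists k; rewrite -ek divfK.
Qed.

Lemma zeta_pow (k : nat) (w : C) : (zeta ^+ k * w) ^+ c = w ^+ c.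
Proof. by rewrite exprMn exprAC (prim_expr_order prim) expr1n mul1r. Qed.

Lemma pow_rowP w : punctured_conf R m (pow_row w) <-> sep_conf zeta w.
Proof.
split=> -[w0 wi].
  split=> [j|i j k e].
    by have := w0 j; rewrite mxE expf_eq0 c0.
  by apply: wi; rewrite !mxE e zeta_pow.
split=> [j|i j]; first by rewrite mxE expf_neq0.
by rewrite !mxE => /pow_eq[//|k]; exact: wi.
Qed.

Lemma row_root u : punctured_conf R m u -> exists w, pow_row w = u.
Proof.
move=> [u0 _]; have /choice[p ep] : forall j, exists p, cexp p = u 0 j.
  by move=> j; apply: cexp_surj.
exists (\row_j cexp ((p j).1 / c%:R, (p j).2 / c%:R)); apply/rowP => j.
rewrite !mxE cexpX /= -ep [in RHS](surjective_pairing (p j)).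
have d (x : R) : c%:R * (x / c%:R) = x by rewrite mulrC divfK.
by rewrite !d.
Qed.

(** A nonzero number stays away from its multiples by nontrivial roots of unity, so close
    configurations with equal powers are equal. *)
Lemma pow_row_locinj (w : 'rV[C]_m) : sep_conf zeta w ->
  exists2 V : set 'rV[C]_m, nbhs w V &
    forall w1 w2, V w1 -> V w2 -> pow_row w1 = pow_row w2 -> w1 = w2.
Proof.
move=> [w0 wi].
have n1 : \forall p \near ((w, w) : 'rV[C]_m * 'rV[C]_m), forall (j : 'I_m) (k : 'I_c),
    (p : 'rV[C]_m * 'rV[C]_m).1 0 j = zeta ^+ k * p.2 0 j -> k = 0 :> nat.
  have h (j : 'I_m) (k : 'I_c) : \forall p \near ((w, w) : 'rV[C]_m * 'rV[C]_m),
      (p : 'rV[C]_m * 'rV[C]_m).1 0 j = zeta ^+ k * p.2 0 j -> k = 0 :> nat.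
    have [k0|k0] := eqVneq (k : nat) 0%N; first exact: near_all.
    have cf : continuous (fun p : 'rV[C]_m * 'rV[C]_m => p.1 0 j - zeta ^+ k * p.2 0 j).
      apply: contDC; first exact: (@cont_entry R _ m fst j (@continuous_fstE _ _)).
      apply: contNC; apply: contMC; first exact: contcst.
      exact: (@cont_entry R _ m snd j (@continuous_sndE _ _)).
    have nz : w 0 j - zeta ^+ k * w 0 j != 0.
      rewrite -{1}[w 0 j]mul1r -mulrBl mulf_neq0 // subr_eq0 -(expr0 zeta).
      by rewrite (eq_prim_root_expr prim) mod0n modn_small // eq_sym.
    have := near_neqC (x := (w, w)) cf nz; apply: filterS => p + e; by rewrite e subrr eqxx.
  have h' j := @filter_forall _ _ (fun (k : 'I_c) (p : 'rV[C]_m * 'rV[C]_m) =>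
    p.1 0 j = zeta ^+ k * p.2 0 j -> k = 0 :> nat) (nbhs (w, w)) (nbhs_filter (w, w)) (h j).
  exact: (@filter_forall _ _ (fun j (p : 'rV[C]_m * 'rV[C]_m) => forall k : 'I_c,
    p.1 0 j = zeta ^+ k * p.2 0 j -> k = 0 :> nat) (nbhs (w, w)) (nbhs_filter (w, w)) h').
have n2 : \forall w' \near w, forall j : 'I_m, (w' : 'rV[C]_m) 0 j != 0.
  have h (j : 'I_m) : \forall w' \near w, (w' : 'rV[C]_m) 0 j != 0.
    exact: (near_neqC (@cont_entry R _ m id j (@continuous_idE _)) (w0 j)).
  exact: (@filter_forall _ _ (fun j (w' : 'rV[C]_m) => w' 0 j != 0) (nbhs w) (nbhs_filter w) h).
case: n1 => -[N1 N2] /= [h1 h2] h3.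
exists (N1 `&` N2 `&` [set w' | forall j, w' 0 j != 0]).
  by apply: filterI => //; exact: filterI.
move=> w1 w2 [[a1 a2] a3] [[b1 b2] b3] e; apply/rowP => j.
have := congr1 (fun v : 'rV[C]_m => v 0 j) e; rewrite /= !mxE => /(pow_eq (b3 j))[k ek].
by have := h3 (w1, w2) (conj a1 b2) j k ek => k0; rewrite ek k0 mul1r.
Qed.

(** Multiplied by c, a logarithm of [r] lifts the constant 1 from (0, 0), hence vanishes. *)
Lemma root_lift_unique (r : R -> C) : continuous r -> r 0 = 1 ->
  (forall t, unitI t -> r t ^+ c = 1) -> forall t, unitI t -> r t = 1.
Proof.
move=> cr r0 rc t tI; have cE := cexp_covers R.
have pr : is_path [set z : C | z != 0] 1 (r 1) r.
  split => // s sI /=; apply/eqP => e; have := rc s sI.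
  by rewrite e expr0n gtn_eqF // => /eqP; rewrite eq_sym oner_eq0.
have [X [[cX X0 qX] _]] := lift_path cE pr (cexp0 R).
have cX' : continuous (fun s => (c%:R * (X s).1, c%:R * (X s).2)) by cont.
have [e1 e2] : (c%:R * (X t).1, c%:R * (X t).2) = (0, 0).
  apply: (cov_upl cE (G := fun s => (c%:R * (X s).1, c%:R * (X s).2)) (G' := cst (0, 0))
    cX' (@contcst _ _ _)) => //; last by rewrite X0 /= !mulr0.
  by move=> s sI; rewrite -cexpX qX // rc //= cexp0.
rewrite -qX // (surjective_pairing (X t)).
move/eqP: e1; rewrite mulf_eq0 (negbTE cR) /= => /eqP ->.
by move/eqP: e2; rewrite mulf_eq0 (negbTE cR) /= => /eqP ->; rewrite cexp0.
Qed.

(** Unique lifting reduces, by ratios of coordinates, to curves of roots of unity. For homotopies,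
    the ratio of each coordinate to its initial value has a logarithm; dividing it by c lifts the
    homotopy through the power map, and [q] lifts the result. *)
Lemma pow_row_covers : covers R (punctured_conf R m) (pow_row \o q).
Proof.
have ce j (f : M -> 'rV[C]_m) : continuous f -> continuous (fun x => f x 0 j).
  exact: cont_entry.
have cpq := continuous_comp2 (cov_cont cq) pow_row_continuous.
constructor.
- exact: cpq.
- by move=> x; apply/pow_rowP; exact: (cov_in cq).
- move=> u pu; have [w ew] := row_root pu.
  have /(cov_surj cq)[x qx] : sep_conf zeta w by apply/pow_rowP; rewrite ew.
  by exists x; rewrite /= qx.
- move=> x; have [V1 n1 h1] := cov_locinj cq x.
  have [V2 n2 h2] := pow_row_locinj (cov_in cq x).
  exists (V1 `&` q @^-1` V2).
    apply: filterI => //; exact: (cov_cont cq).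
  move=> x1 x2 [a1 b1] [a2 b2] /= e; apply: h1 => //; exact: h2.
- move=> G G' cG cG' e e0; apply: (cov_upl cq) => // t tI; apply/rowP => j.
  have nz F s : q (F s) 0 j != 0 by have [+ _] := cov_in cq (F s); apply.
  have cr : continuous (fun s => q (G s) 0 j / q (G' s) 0 j).
    have c1 : continuous (fun s => q (G s) 0 j : C) := @cont_entry R _ m _ j (continuous_comp2 cG (cov_cont cq)).
    have c2 : continuous (fun s => q (G' s) 0 j : C) := @cont_entry R _ m _ j (continuous_comp2 cG' (cov_cont cq)).
    apply: contMC; first exact: c1.
    apply: contVC; first by move=> s; exact: nz.
    exact: c2.
  have := root_lift_unique cr _ _ tI; rewrite /= e0 divff // => /(_ erefl) h.
  suff : q (G t) 0 j / q (G' t) 0 j = 1.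
    by move=> /(congr1 (fun z => z * q (G' t) 0 j)); rewrite mulfVK // mul1r.
  apply: h => s sI; have := congr1 (fun w : 'rV[C]_m => w 0 j) (e s sI); rewrite /= !mxE.
  by rewrite expr_div_n => ->; rewrite divff // expf_neq0.
- move=> Z f f0 cf Af cf0 e0.
  have fz z j : f (z, 0) 0 j != 0 by have [+ _] := Af z 0 unitI0; apply.
  pose r j (p : Z * R) := f (p.1, clamp p.2) 0 j / f (p.1, 0) 0 j.
  have cr j : continuous (r j).
    have ca : continuous (fun p : Z * R => (p.1, clamp p.2)) by cont.
    have cb : continuous (fun p : Z * R => (p.1, 0 : R)) by cont.
    apply: contMC; first exact: (@cont_entry R _ m _ j (continuous_comp2 ca cf)).
    apply: contVC; first by move=> p; exact: fz.
    exact: (@cont_entry R _ m _ j (continuous_comp2 cb cf)).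
  have /choice[H HP] : forall j, exists H : Z * R -> R * R, continuous H /\
      forall z, H (z, 0) = (0, 0) /\ forall t, unitI t -> cexp (H (z, t)) = r j (z, t).
    move=> j; apply: (cov_hlp (cexp_covers R) (cr j) _ (@contcst _ _ (0, 0))).
      move=> z t tI /=; rewrite mulf_neq0 ?invr_neq0 //.
      by have [+ _] := Af z _ (clampI t); apply.
    by move=> z; rewrite cexp0 /r /= clamp0 divff.
  pose w (p : Z * R) : 'rV[C]_m :=
    \row_j (q (f0 p.1) 0 j * cexp ((H j p).1 / c%:R, (H j p).2 / c%:R)).
  have cw : continuous w.
    apply: cont_row => j; rewrite (_ : (fun p => _) = fun p : Z * R =>
      q (f0 p.1) 0 j * cexp ((H j p).1 / c%:R, (H j p).2 / c%:R)); last first.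
      by apply/funext => p; rewrite mxE.
    have [cH _] := HP j.
    apply: contMC.
      apply: (@cont_entry R _ m _ j); apply: (continuous_comp2 _ (cov_cont cq)).
      exact: (continuous_comp2 (@continuous_fstE _ _) cf0).
    have ca : continuous (fun p : Z * R => ((H j p).1 / c%:R, (H j p).2 / c%:R)) by cont.
    exact: (continuous_comp2 ca (@cexp_continuous R)).
  have d (x : R) : c%:R * (x / c%:R) = x by rewrite mulrC divfK.
  have pw z t : unitI t -> pow_row (w (z, t)) = f (z, t).
    move=> tI; apply/rowP => j; rewrite !mxE exprMn cexpX /= !d -surjective_pairing.
    have [_ /(_ z)[_ ->]] := HP j; last by [].
    have := congr1 (fun v : 'rV[C]_m => v 0 j) (e0 z); rewrite /= mxE => ->.
    by rewrite /r /= (clamp_id tI) mulrCA divff // mulr1.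
  have [||F [cF FP]] := cov_hlp cq cw _ cf0.
  - by move=> z t tI; apply/pow_rowP; rewrite pw //; exact: Af.
  - move=> z; apply/rowP => j; rewrite mxE /=; have [_ /(_ z)[-> _]] := HP j.
    by rewrite /= !mul0r cexp0 mulr1.
  exists F; split => // z; have [-> hF] := FP z; split => // t tI.
  by rewrite /= hF // pw.
- move=> a; have [[x0 e0]|no] := pselect (exists x, pow_row (q x) = a); last first.
    rewrite (_ : _ @^-1` _ = set0); first exact: countable0.
    by apply/seteqP; split => // x /= e; apply: no; exists x.
  (* Points of one fibre differ by a root of unity in each coordinate, so the fibre lies in finitely
     many fibres of [q]. *)
  apply: (@sub_countable _ _ _ (\bigcup_(k in [set: {ffun 'I_m -> 'I_c}])
    (q @^-1` [set \row_j (zeta ^+ k j * q x0 0 j)]))); last first.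
    by apply: bigcup_countable => [|k _]; [exact: countableP|exact: (cov_count cq)].
  apply: subset_card_le => x /= e.
  have /choice[k ek] : forall j, exists k : 'I_c, q x 0 j = zeta ^+ k * q x0 0 j.
    move=> j; apply: pow_eq; first by have [+ _] := cov_in cq x0; apply.
    by have := congr1 (fun v : 'rV[C]_m => v 0 j) (etrans e (esym e0)); rewrite /= !mxE.
  exists [ffun j => k j] => //=; apply/rowP => j; by rewrite mxE ffunE.
Qed.

End PowerCover.

(** * Symmetric configurations *)

Section Centre.
Variables (R : realType) (m : nat).
Local Notation C := (plane R).

(* The configuration of X^(m+1) with differences [w] to its point 0. *)
Definition uncentre (w : 'rV[C]_m) : 'rV[C]_m.+1 :=
  \row_j (oapp (w 0) 0 (unlift ord0 j) - (\sum_i w 0 i) / m.+1%:R).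

Lemma centre_continuous : continuous (@centre_point0 R m).
Proof.
apply: cont_row => j; rewrite (_ : (fun p => _) =
  fun z : 'rV[C]_m.+1 => z 0 (lift ord0 j) - z 0 ord0); last first.
  by apply/funext => z; rewrite mxE.
apply: contDC; last apply: contNC; exact: (@cont_entry R _ m.+1 id _ (@continuous_idE _)).
Qed.

Lemma uncentre_continuous : continuous uncentre.
Proof.
apply: cont_row => j; rewrite (_ : (fun p => _) = fun w : 'rV[C]_m =>
  oapp (w 0) 0 (unlift ord0 j) - (\sum_i w 0 i) / m.+1%:R); last first.
  by apply/funext => z; rewrite mxE.
have ce i : continuous (fun w : 'rV[C]_m => w 0 i) := @cont_entry R _ m id i (@continuous_idE _).
apply: contDC; last apply: contNC.
  by case: (unlift ord0 j) => [i|] /=; [exact: ce|exact: contcst].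
apply: contMC; last exact: contcst.
exact: cont_sumC.
Qed.

Lemma uncentreK w : centre_point0 (uncentre w) = w.
Proof. by apply/rowP => j; rewrite !mxE liftK unlift_none /= opprB addrA subrK subr0. Qed.

Lemma centreK (z : 'rV[C]_m.+1) : \sum_j z 0 j = 0 -> uncentre (centre_point0 z) = z.
Proof.
move=> z0; have mC : m.+1%:R != 0 :> C by rewrite pnatr_eq0.
have e : \sum_i centre_point0 z 0 i = - (m.+1%:R * z 0 ord0).
  have -> : \sum_i centre_point0 z 0 i = \sum_(i < m) z 0 (lift ord0 i) - \sum_(i < m) z 0 ord0.
    by rewrite -sumrB; apply: eq_bigr => i _; rewrite mxE.
  move: z0; rewrite big_ord_recl => /eqP; rewrite addrC addr_eq0 => /eqP ->.
  rewrite sumr_const card_ord -[_ *+ m]mulr_natl -natr1; ring.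
apply/rowP => j; rewrite mxE e mulNr mulrAC divff // mul1r opprK.
by case: unliftP => [i|] -> /=; rewrite ?add0r // mxE subrK.
Qed.

Lemma uncentre_sum w : \sum_j uncentre w 0 j = 0.
Proof.
have mC : m.+1%:R != 0 :> C by rewrite pnatr_eq0.
under eq_bigr do rewrite mxE.
rewrite sumrB sumr_const card_ord -[(_ / _) *+ _]mulr_natr divfK // big_ord_recl unlift_none /= add0r.
by under eq_bigr do rewrite liftK; rewrite subrr.
Qed.

Lemma centre_conf z : conf_space R m.+1 z -> punctured_conf R m (centre_point0 z).
Proof.
move=> [_ zi]; split => [j|i j]; rewrite !mxE.
  by rewrite subr_eq0; apply/eqP => /zi.
by move=> /addIr/zi/lift_inj.
Qed.

Lemma uncentre_conf w : punctured_conf R m w -> conf_space R m.+1 (uncentre w).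
Proof.
move=> [w0 wi]; split; first exact: uncentre_sum.
move=> i j; rewrite !mxE => /addIr.
case: unliftP => [i' ->|->]; case: unliftP => [j' ->|->] //=; first by move=> /wi ->.
  by move=> e; have := w0 i'; rewrite e eqxx.
by move=> e; have := w0 j'; rewrite -e eqxx.
Qed.

Lemma uncentre_covers (M : topologicalType) (q : M -> 'rV[C]_m) :
  covers R (punctured_conf R m) q -> covers R (conf_space R m.+1) (uncentre \o q).
Proof.
move=> cq; apply: (covers_homeo cq uncentre_continuous centre_continuous).
- by move=> w pw; rewrite uncentreK; split => //; exact: uncentre_conf.
- move=> z cz; split; first exact: centre_conf.
  by apply: centreK; have [] := cz.
Qed.

Lemma sep_conf1 : sep_conf (1 : C) (m := m) = punctured_conf R m.
Proof.
apply/seteqP; split => w [w0 wi]; split => //.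
  by move=> i j e; apply: (wi i j 0%N); rewrite expr0 mul1r.
by move=> i j k; rewrite expr1n mul1r; exact: wi.
Qed.

Lemma conf_cover : exists (M : topologicalType) (q : M -> 'rV[C]_m.+1),
  covers R (conf_space R m.+1) q /\ contractible R M.
Proof.
have p1 : 1.-primitive_root (1 : C).
  by apply/andP; split => //; apply/forallP => -[[|//] ?]; rewrite unity_rootE expr1n !eqxx.
have [M [q [cq cM]]] := sep_conf_cover p1 m.
rewrite sep_conf1 in cq; exists M, (uncentre \o q); split => //.
exact: uncentre_covers.
Qed.

End Centre.

Section SymmetricConfigurations.
Variables (R : realType) (n l c : nat).
Local Notation C := (plane R).
Hypotheses (n0 : (0 < n)%N) (cn : (c %| n)%N) (c1 : (1 < c)%N) (lc : coprime l c).
Let m := (n %/ c)%N.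
Let zeta : C := root_l R l c.
Let Y := @sym_conf_space R n l c.
Let c0 : (0 < c)%N := ltnW c1.
Let prim : c.-primitive_root zeta := root_prim R c0 lc.
Let mc : n = (c * m)%N. Proof. by rewrite mulnC divnK. Qed.
Let m0 : (0 < m)%N. Proof. by rewrite divn_gt0 // dvdn_leq. Qed.

Definition shift (j : 'I_n) : 'I_n := iter m (@ordS n) j.

Lemma shiftE j : shift j = ((j + m) %% n)%N :> nat.
Proof. exact: iter_ordS. Qed.

Lemma sym_confP z : Y z <-> conf_space R n z /\ forall j, z 0 (shift j) = zeta * z 0 j.
Proof.
by split=> -[cz h]; split => // j; [rewrite h plane_act_rot|rewrite plane_act_rot -h].
Qed.

Lemma iter_shift a j : iter a shift j = ((j + a * m) %% n)%N :> nat.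
Proof.
elim: a => [|a IH] /=; first by rewrite addn0 modn_small.
by rewrite shiftE IH modnDml mulSn -addnA [(a * _ + _)%N]addnC.
Qed.

Lemma sym_conf_iter z a j : Y z -> z 0 (iter a shift j) = zeta ^+ a * z 0 j.
Proof.
move=> /sym_confP[_ h]; elim: a => [|a IH]; first by rewrite expr0 mul1r.
by rewrite iterS h IH exprS mulrA.
Qed.

Definition sym_res (z : 'rV[C]_n) : 'rV[C]_m := \row_j z 0 (widen_ord (leq_div n c) j).

Definition sym_ext (w : 'rV[C]_m) : 'rV[C]_n :=
  \row_j (zeta ^+ (j %/ m) * row_nth w (j %% m)).

Lemma sym_extK w : sym_res (sym_ext w) = w.
Proof.
apply/rowP => j; rewrite !mxE /= divn_small // modn_small // expr0 mul1r.
by rewrite (row_nthE _ (ltn_ord j)); congr (w 0 _); exact: val_inj.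
Qed.

Lemma sym_ext_shift w j : sym_ext w 0 (shift j) = zeta * sym_ext w 0 j.
Proof.
rewrite !mxE shiftE mulrA -exprS; have jn := ltn_ord j.
have am : (j %/ m < c)%N by rewrite ltn_divLR // -mc.
have -> : ((j + m) %% n = (j %/ m).+1 %% c * m + j %% m)%N.
  have ej : (j + m = (j %/ m).+1 * m + j %% m)%N.
    by rewrite {1}(divn_eq j m) addnAC -mulSnr.
  rewrite ej; have [e|ne] := eqVneq (j %/ m).+1 c.
    rewrite e modnn mul0n add0n -mc modnDl modn_small //.
    by rewrite (leq_trans (ltn_pmod _ m0)) // leq_div.
  have ac : ((j %/ m).+1 < c)%N by rewrite ltn_neqAle ne am.
  rewrite [((j %/ m).+1 %% c)%N]modn_small // modn_small //.
  rewrite [X in (_ < X)%N]mc (@leq_trans ((j %/ m).+2 * m)) //.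
    by rewrite [((j %/ m).+2 * m)%N]mulSnr ltn_add2l ltn_pmod.
  by rewrite leq_mul2r ac orbT.
rewrite divnMDl // [(j %% m %/ m)%N]divn_small ?ltn_pmod // addn0.
by rewrite modnMDl modn_mod (prim_expr_mod prim).
Qed.

Lemma sym_resK z : Y z -> sym_ext (sym_res z) = z.
Proof.
move=> Yz; apply/rowP => j; rewrite mxE.
have jm : (j %% m < m)%N by rewrite ltn_pmod.
rewrite (row_nthE _ jm) mxE -(sym_conf_iter _ _ Yz); congr (z 0 _).
apply: val_inj; rewrite /= iter_shift /= addnC -divn_eq modn_small //.
Qed.

Lemma sym_res_sep z : Y z -> sep_conf zeta (sym_res z).
Proof.
move=> Yz; have /sym_confP[[_ zi] hz] := Yz; split.
  move=> j; rewrite mxE; apply/eqP => e.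
  have /zi/(congr1 (@nat_of_ord n)) : z 0 (shift (widen_ord (leq_div n c) j)) = z 0 (widen_ord (leq_div n c) j).
    by rewrite hz e mulr0.
  rewrite shiftE /= modn_small; first by lia.
  have mm : (2 * m <= n)%N by rewrite [X in (_ <= X)%N]mc leq_mul2r c1 orbT.
  have := ltn_ord j; rewrite -/m; lia.
move=> i j k; rewrite !mxE -(sym_conf_iter _ _ Yz) => /zi/(congr1 (@nat_of_ord n)).
rewrite iter_shift /= => /(congr1 (fun x => x %% m)%N).
have mn : (m %| n)%N by rewrite mc dvdn_mull.
rewrite (modn_dvdm _ mn) addnC modnMDl !modn_small // => e; exact: val_inj.
Qed.

(** The sum vanishes because it is invariant under multiplication by zeta, which is not 1 as c > 1.
    Equal coordinates come from the same point of [w], and then from the same power of zeta. *)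
Lemma sym_ext_conf w : sep_conf zeta w -> Y (sym_ext w).
Proof.
move=> [w0 wi]; apply/sym_confP; split; last exact: sym_ext_shift.
split.
  set S := \sum_j _; have e : S = zeta * S.
    rewrite mulr_sumr {1}/S (reindex_inj (@perm_inj _ (sigma1 n ^+ m)%g)).
    by apply: eq_bigr => j _; rewrite sigma1X -/(shift j) sym_ext_shift.
  have z1 : 1 - zeta != 0.
    rewrite subr_eq0 eq_sym -(expr1 zeta) -(prim_order_dvd prim).
    by rewrite gtnNdvd.
  apply/eqP; rewrite -(mulrI_eq0 _ (mulfI z1)) mulrBl mul1r -e subrr //.
have rn j (jm : (j < m)%N) : row_nth w j = w 0 (Ordinal jm) := row_nthE w jm.
move=> i j; rewrite !mxE !(rn _ (ltn_pmod _ m0)) => e.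
have lt j' : ((j' : 'I_n) %/ m < c)%N by rewrite ltn_divLR // -mc.
have : w 0 (Ordinal (ltn_pmod i m0)) =
    zeta ^+ (c - i %/ m + j %/ m) * w 0 (Ordinal (ltn_pmod j m0)).
  rewrite exprD -mulrA -e mulrA -exprD subnK ?(prim_expr_order prim) ?mul1r //.
  exact: ltnW.
move=> /wi ij; move: (ij) => /(congr1 (@nat_of_ord m)) /= mij.
move: e; rewrite ij => /(mulIf (w0 _)) /eqP; rewrite (eq_prim_root_expr prim).
rewrite !modn_small // => /eqP dij; apply: val_inj.
by rewrite /= (divn_eq i m) (divn_eq j m) mij dij.
Qed.

Lemma sym_ext_continuous : continuous sym_ext.
Proof.
apply: cont_row => j; rewrite (_ : (fun p => _) = fun w : 'rV[C]_m =>
  zeta ^+ (j %/ m) * row_nth w (j %% m)); last by apply/funext => w; rewrite mxE.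
apply: contMC; first exact: contcst.
rewrite /row_nth; case: insubP => [i _ _|_] /=; last exact: contcst.
exact: (@cont_entry R _ m id i (@continuous_idE _)).
Qed.

Lemma sym_res_continuous : continuous sym_res.
Proof.
apply: cont_row => j; rewrite (_ : (fun p => _) = fun z : 'rV[C]_n =>
  z 0 (widen_ord (leq_div n c) j)); last by apply/funext => w; rewrite mxE.
exact: (@cont_entry R _ n id _ (@continuous_idE _)).
Qed.

Lemma power_mapE z : power_map c z = pow_row c (sym_res z).
Proof. by apply/rowP => j; rewrite !mxE. Qed.

Lemma power_map_continuous : continuous (@power_map R n c).
Proof.
rewrite (_ : @power_map R n c = pow_row c (m := m) \o sym_res); last first.
  by apply/funext => z; exact: power_mapE.
exact: (continuous_comp2 sym_res_continuous (@pow_row_continuous R c m)).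
Qed.

Lemma power_map_conf z : Y z -> punctured_conf R m (power_map c z).
Proof. by move=> /sym_res_sep sz; rewrite power_mapE; apply/(pow_rowP prim). Qed.

(** One contractible space covers both Y and, through c-th powers, X^(m+1); this is what lets a
    braid on m + 1 strings be lifted to Y. *)
Lemma sym_conf_cover : exists (M : topologicalType) (q : M -> 'rV[C]_n),
  [/\ covers R Y q, contractible R M &
      covers R (conf_space R m.+1) ((@uncentre R m \o @power_map R n c) \o q)].
Proof.
have [M [q [cq cM]]] := sep_conf_cover prim m.
exists M, (sym_ext \o q); split => //.
  apply: (covers_homeo cq sym_ext_continuous sym_res_continuous).
    by move=> w sw; rewrite sym_extK; split => //; exact: sym_ext_conf.
  by move=> z Yz; split; [exact: sym_res_sep|exact: sym_resK].
have := uncentre_covers (pow_row_covers prim cq); congr (covers _ _ _).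
by apply/funext => x /=; rewrite power_mapE sym_extK.
Qed.

End SymmetricConfigurations.

(** * Braids of coprime and conjugate symmetric loops *)

Section TwistedConfigurations.
Variables (R : realType) (n N : nat).
Local Notation C := (plane R).
Local Notation V := ('rV[C]_n).
Variables (y g : (O2 R * Sym n)%type).
Hypotheses (N0 : (0 < N)%N) (gN : forall z : V, iter N (conf_act g) z = z).
Hypothesis yg : (y * g = g * y)%g.

(** The centre condition and invariance under [y] are linear, hence stable along segments, and
    distinctness is open; the fixed set of [y] is stable under [g] because the two commute. *)
Lemma fixed_conf_twisted (A : set V) :
  (forall z, A z <-> conf_space R n z /\ conf_act y z = z) ->
  twisted_paths (R := R) A (conf_act g) (twisted_loops N A (conf_act g))
    (fun u t => u (to_circle (N%:R^-1 * t))).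
Proof.
move=> AE; pose A0 : set V := [set z : V | \sum_j z 0 j = 0 /\ conf_act y z = z].
pose Q : set V := [set z : V | injective (fun j => z 0 j)].
apply: (@twisted_loops_paths R n N A (conf_act g) N0 _ _ _ _ A0 Q).
- exact: conf_act_continuous.
- move=> z /AE[cz yz]; apply/AE; split; first exact: conf_act_conf.
  by rewrite -conf_actM yg conf_actM yz.
- by move=> z _; exact: gN.
- by move=> s z w; exact: conf_act_mix.
- move=> z; split; first by move=> /AE[[z0 zi] yz].
  by move=> [[z0 yz] zi]; apply/AE.
- exact: conf_space_open.
- move=> s z w [z0 yz] [w0 yw]; split; last by rewrite conf_act_mix yz yw.
  under eq_bigr do rewrite mxE.
  by rewrite big_split /= -!mulr_sumr z0 w0 !mulr0 addr0.
Qed.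

End TwistedConfigurations.

Section Rotation.
Variables (R : realType) (n : nat) (theta : R).
Local Notation C := (plane R).
Local Notation V := ('rV[C]_n).

Definition rotate (p : R * V) : V := conf_act (rot (2 * pi * p.1 * theta), 1%g) p.2.

Lemma rotateE p j : rotate p 0 j = expi (2 * pi * p.1 * theta) * p.2 0 j.
Proof.
rewrite /rotate conf_actE /= plane_act_rot; congr (_ * p.2 0 _).
by rewrite (_ : (1%g : Sym n) = (1%g : 'S_n)) // invg1 perm1.
Qed.

Lemma rotate_continuous : continuous rotate.
Proof.
apply: cont_row => j; rewrite (_ : (fun p => _) = fun p : R * V =>
  expi (2 * pi * p.1 * theta) * p.2 0 j :> C); last by apply/funext => p; rewrite rotateE.
apply: contMC; last exact: (@cont_entry R _ n snd j (@continuous_sndE _ _)).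
have ca : continuous (fun p : R * V => 2 * pi * p.1 * theta) by cont.
apply: Complex_continuous.
  exact: (continuous_comp2 ca (@continuous_cos R)).
exact: (continuous_comp2 ca (@continuous_sin R)).
Qed.

Lemma rotate0 z : rotate (0, z) = z.
Proof. by rewrite /rotate /= mulr0 mul0r rot0 -[RHS]conf_act1. Qed.

End Rotation.

(** * The standard generators and their permutations *)

Section HalfTurn.
Variables (R : realType) (n : nat) (i : 'I_n).
Hypothesis i1 : (i.+1 < n)%N.
Local Notation C := (plane R).

Lemma ordS_val : ordS i = i.+1 :> nat. Proof. by rewrite /= modn_small. Qed.

(** Displacement of the point [i] at time t, for a clockwise turn of radius 1 / 2; the point [i + 1]
    moves by the opposite amount. *)
Definition half_shift (t : R) : C := (1 - expi (- pi * t)) / 2.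

Lemma half_turnE t j : @half_turn R n i t 0 j = base_conf R n 0 j +
  (if j == i then half_shift t else if j == ordS i then - half_shift t else 0).
Proof.
have ij : (ordS i == i) = false.
  by apply/negbTE/eqP => /(congr1 (@nat_of_ord n)); rewrite ordS_val; lia.
have xi : base_conf R n 0 (ordS i) = base_conf R n 0 i + 1.
  rewrite !mxE ordS_val -natr1 rmorphB /= rmorphD /= rmorphB /=; ring.
rewrite mxE !inE plane_act_rot /half_shift.
have [->|ji] := eqVneq j i; first by rewrite /= xi; field.
by have [->|jS] := eqVneq j (ordS i); rewrite /= ?xi ?addr0 //; field.
Qed.

Lemma half_shift_Re t : 0 <= complex.Re (half_shift t) <= 1.
Proof.
have -> : complex.Re (half_shift t) = (1 - cos (- pi * t)) / 2.
  by rewrite /half_shift /=; field.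
have := cos_le1 (- pi * t); have := cos_geN1 (- pi * t).
by move=> h1 h2; apply/andP; split; lra.
Qed.

Lemma half_turn_path : is_path (conf_space R n) (base_conf R n)
  (perm_act (tperm i (ordS i) : Sym n) (base_conf R n)) (@half_turn R n i).
Proof.
have ij : (ordS i == i) = false.
  by apply/negbTE/eqP => /(congr1 (@nat_of_ord n)); rewrite ordS_val; lia.
have xi : base_conf R n 0 (ordS i) = base_conf R n 0 i + 1.
  rewrite !mxE ordS_val -natr1 rmorphB /= rmorphD /= rmorphB /=; ring.
have re j : complex.Re (base_conf R n 0 j) = j%:R - n.-1%:R / 2 by rewrite mxE.
have e1 : half_shift 1 = 1.
  rewrite /half_shift mulr1 (_ : expi (- pi) = -1); last first.
    by rewrite /expi cosN sinN cospi sinpi; apply/eqP; rewrite eq_complex /= !oppr0 !eqxx.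
  by rewrite opprK; field.
split.
- apply: cont_row => j; rewrite (_ : (fun p => _) = fun t => base_conf R n 0 j +
    (if j == i then half_shift t else if j == ordS i then - half_shift t else 0));
    last by apply/funext => t; rewrite half_turnE.
  have ch : continuous half_shift.
    apply: contMC; last exact: contcst.
    apply: contDC; first exact: contcst.
    apply: contNC; have ca : continuous (fun t : R => - pi * t) by cont.
    apply: Complex_continuous.
      exact: (continuous_comp2 ca (@continuous_cos R)).
    exact: (continuous_comp2 ca (@continuous_sin R)).
  apply: contDC; first exact: contcst.
  case: (j == i); first exact: ch.
  by case: (j == ordS i); [exact: contNC|exact: contcst].
- move=> t _; split.
    under eq_bigr do rewrite half_turnE.
    rewrite big_split /=; have [-> _] := base_confP R n; rewrite add0r.
    rewrite (bigD1 i) //= eqxx (bigD1 (ordS i)) /=; last by rewrite ij.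
    rewrite ij eqxx big1 ?addr0 ?subrr //.
    by move=> j /andP[/negbTE -> /negbTE ->].
  (* Real parts separate the fixed points from each other and from the moving ones, which stay in
     the strip between their initial places; the two moving points differ by expi (- pi t). *)
  have [b0 b1] := andP (half_shift_Re t).
  have far j : j != i -> j != ordS i -> (j%:R <= i%:R - 1 :> R) \/ (i%:R + 2 <= j%:R :> R).
    move=> ji jS; have {}ji : (j != i :> nat) by [].
    have {}jS : (j != i.+1 :> nat) by rewrite -ordS_val.
    have [h|h] : (j < i)%N \/ (i.+2 <= j)%N by lia.
      by left; rewrite lerBrDr natr1 ler_nat.
    by right; rewrite -[2]/(2%:R) -natrD addn2 ler_nat.
  have reE j : complex.Re (half_turn i t 0 j) = j%:R - n.-1%:R / 2 +
      (if j == i then complex.Re (half_shift t) else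
       if j == ordS i then - complex.Re (half_shift t) else 0).
    rewrite half_turnE -re; case: (half_shift t) => a b.
    by case: (base_conf R n 0 j) => p r /=; case: (j == i) => //=; case: (j == ordS i).
  have inE j j' : complex.Re (half_turn i t 0 j) = complex.Re (half_turn i t 0 j') ->
      j != i -> j != ordS i -> j = j'.
    clear xi e1; rewrite !reE => + ji jS; rewrite (negbTE ji) (negbTE jS).
    have := far j ji jS.
    have [->|j'i] := eqVneq j' i; first by move=> h e; exfalso; case: h => h; lra.
    have [->|j'S] := eqVneq j' (ordS i).
      by rewrite ordS_val -natr1 => h e; exfalso; case: h => h; lra.
    by move=> _ e; apply: val_inj; apply/eqP; rewrite -(eqr_nat R); apply/eqP => /=; lra.
  have half_neq : half_turn i t 0 i = half_turn i t 0 (ordS i) -> False.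
    rewrite !half_turnE eqxx ij eqxx xi /half_shift => e.
    have : expi (- pi * t) = 0.
      have -> : expi (- pi * t) = 1 - 2 * ((1 - expi (- pi * t)) / 2) by field.
      have -> : 2 * ((1 - expi (- pi * t)) / 2) = (base_conf R n 0 i + (1 - expi (- pi * t)) / 2)
          - (base_conf R n 0 i + 1 - (1 - expi (- pi * t)) / 2) + 1 by field.
      by rewrite e; ring.
    by move=> /eqP; rewrite (negbTE (expi_neq0 _)).
  move=> j j' /= e; have re' := congr1 (@complex.Re R) e.
  have [ji|ji] := eqVneq j i; have [j'i|j'i] := eqVneq j' i; first by rewrite ji j'i.
  + have [j'S|j'S] := eqVneq j' (ordS i); last exact/esym/inE.
    by move: e; rewrite ji j'S => /half_neq.
  + have [jS|jS] := eqVneq j (ordS i); last exact: inE.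
    by move: e; rewrite j'i jS => /esym/half_neq.
  have [jS|jS] := eqVneq j (ordS i); last exact: inE.
  have [j'S|j'S] := eqVneq j' (ordS i); last exact/esym/inE.
  by rewrite jS j'S.
- apply/rowP => j; rewrite half_turnE /half_shift mulr0 expi0 subrr mul0r oppr0.
  by rewrite !if_same addr0.
- apply/rowP => j; rewrite half_turnE e1 [RHS]mxE tpermV.
  case: tpermP => [->|->|/eqP/negbTE -> /eqP/negbTE ->]; rewrite ?eqxx ?ij ?addr0 ?xi //.
  by rewrite addrK.
Qed.

Lemma braid_gen_perm : braid_perm (@braid_gen R n i) = tperm i (ordS i) :> 'S_n.
Proof. exact: (@orbit_class_elt R (braid_gspace R n) _ _ half_turn_path). Qed.

End HalfTurn.

Section BraidPermutations.
Variable R : realType.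

Lemma braid_perm1 n : braid_perm (1%g : braid R n) = 1%g.
Proof. exact: (@orbit_elt1 R (braid_gspace R n)). Qed.

Lemma braid_permM n (a b : braid R n) : braid_perm (a * b)%g = (braid_perm a * braid_perm b)%g.
Proof. exact: (@orbit_eltM R (braid_gspace R n)). Qed.

Lemma symM n (s t : Sym n) j : ((s * t)%g : 'S_n) j = (s : 'S_n) ((t : 'S_n) j).
Proof. by rewrite -permM. Qed.

Let adj n (i : 'I_n) : Sym n := tperm i (ordS i).

(** The transpositions act from right to left: an index from [d] on and below the last meets just
    one that moves it, upwards, while the last index is carried down by all of them to [d]. *)
Lemma adj_prod n (d : nat) (j : 'I_n) : (d < n)%N ->
  ((\prod_(i < n | (d <= i)%N && (i.+1 < n)%N) adj i)%g : 'S_n) j =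
  (if (j < d)%N then j : nat else if (j.+1 < n)%N then j.+1 else d) :> nat.
Proof.
case: n j => // n j; rewrite !ltnS => dn.
pose F (k : nat) : Sym n.+1 := adj (inord k).
have -> : (\prod_(i < n.+1 | (d <= i)%N && (i.+1 < n.+1)%N) adj i)%g =
    (\prod_(d <= k < n) F k)%g.
  rewrite (eq_bigr (fun i : 'I_n.+1 => F i)); last by move=> i _; rewrite /F inord_val.
  rewrite -(big_mkord (fun k => (d <= k) && (k < n))%N F) big_mkcond big_nat_recr //=.
  rewrite ltnn andbF mulg1 (@big_cat_nat _ _ _ d) //= big_nat_cond big1 ?mul1g; last first.
    by move=> k; rewrite andbT => /andP[_ kd]; rewrite leqNgt kd.
  rewrite [LHS]big_nat_cond [RHS]big_nat_cond; apply: eq_bigr => k.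
  by rewrite andbT => /andP[-> ->].
have [e de] : exists e, (d + e)%N = n by exists (n - d)%N; rewrite subnKC.
elim: e d j de {dn} => [|e IH] d j de.
  rewrite addn0 in de; subst d; rewrite big_geq // perm1.
  by case: ltnP => h //; apply/eqP; rewrite eqn_leq h andbT -ltnS.
have dn : (d < n)%N by lia.
have de' : (d.+1 + e)%N = n by lia.
rewrite big_ltn // symM; have := IH d.+1 j de'.
set x := (_ : 'S_n.+1) j => ex.
have vd : (inord d : 'I_n.+1) = d :> nat by rewrite (@inordK n) // ltnS ltnW.
have vS : ordS (inord d : 'I_n.+1) = d.+1 :> nat by rewrite ordS_val vd // ltnS.
rewrite /F /adj; case: tpermP => [e1|e1|/eqP n1 /eqP n2].
- have xd : x = d :> nat by rewrite e1.
  rewrite vS; move: ex; rewrite xd; do !case: ifP => ?; lia.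
- have xd : x = d.+1 :> nat by rewrite e1.
  rewrite vd; move: ex; rewrite xd; do !case: ifP => ?; lia.
have xd : (x != d :> nat) by rewrite -vd.
have xd' : (x != d.+1 :> nat) by rewrite -vS.
by move: ex xd xd'; do !case: ifP => ?; lia.
Qed.

Lemma delta_perm n : braid_perm (delta R n) = sigma1 n.
Proof.
rewrite /delta (big_morph (@braid_perm R n) (@braid_permM n) (braid_perm1 n)).
rewrite (eq_bigr (@adj n)); last by move=> i i1; exact: braid_gen_perm.
apply/permP => j; apply: val_inj; rewrite permE /=.
have n0 : (0 < n)%N by rewrite (leq_ltn_trans _ (ltn_ord j)).
have := adj_prod j n0; rewrite /= => ->; have := ltn_ord j.
rewrite leq_eqVlt => /orP[/eqP e|h]; last by rewrite h modn_small.
by rewrite e ltnn modnn.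
Qed.

End BraidPermutations.

Section Braids.
Variables (R : realType) (n : nat).
Local Notation V := ('rV[plane R]_n).

Lemma sym_conf_space1 (l : nat) : @sym_conf_space R n l 1 = conf_space R n.
Proof.
apply/seteqP; split => z; first by case.
move=> cz; split => // j; rewrite divr1 plane_act_rot (expi_2pi R l) mul1r.
congr (z 0 _); apply: val_inj; rewrite divn1.
by have := iter_ordS n j; rewrite modnDr modn_small.
Qed.

Lemma expg_pairM (g g' : (O2 R * Sym n)%type) : (g * g')%g = ((g.1 * g'.1)%g, (g.2 * g'.2)%g).
Proof. by []. Qed.

Lemma conf_act_perm (s : Sym n) (z : V) : conf_act (1%g, s) z = perm_act s z.
Proof. by apply/rowP => j; rewrite conf_actE plane_act1 mxE. Qed.

Lemma rotate_back (theta : R) (s : Sym n) (z : V) :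
  rotate (- theta) (1, conf_act (rot (2 * pi * theta), s) z) = perm_act s z.
Proof.
rewrite /rotate -conf_actM expg_pairM /= -rotD mul1g.
rewrite (_ : _ + _ = 0) ?rot0 ?conf_act_perm //; ring.
Qed.

Lemma closed_lift_pure (M : topologicalType) (q : M -> V) (m0 : M) :
  covers R (conf_space R n) q -> q m0 = base_conf R n ->
  closed_lift (S := braid_gspace R n) q (base_conf R n) m0 id = pure_braids R n.
Proof.
move=> cq qm0; apply/seteqP; split => b; first by case.
move=> b1; split => //; rewrite /lift_end.
have h := q_endp cq (orbit_repP b) qm0.
by rewrite [LHS]h [orbit_elt b]b1 bg_act1.
Qed.

Lemma corr_coset_perm (M : topologicalType) (q : M -> V) (m0 : M) (s : Sym n)
    (h : V -> V) :
  covers R (conf_space R n) q -> q m0 = base_conf R n ->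
  h (base_conf R n) = perm_act s (base_conf R n) ->
  corr_coset (S := braid_gspace R n) q (base_conf R n) m0 id h s =
  [set b : braid R n | braid_perm b = s].
Proof.
move=> cq qm0 hs; apply/seteqP; split => b; first by case.
move=> b1; split => //; rewrite /lift_end.
have e := q_endp cq (orbit_repP b) qm0.
by rewrite [LHS]e [orbit_elt b]b1 hs.
Qed.

Lemma left_coset_pure (x : braid R n) :
  left_coset x (pure_braids R n) = [set b | braid_perm b = braid_perm x].
Proof.
apply/seteqP; split => b /=.
  by move=> [p p1 <-]; rewrite braid_permM [braid_perm p]p1 mulg1.
move=> e; exists (x^-1 * b)%g; last by rewrite mulKVg.
rewrite /pure_braids /= braid_permM e.
by have -> : braid_perm (x^-1)%g = ((braid_perm x)^-1)%g := orbit_eltV x; rewrite mulVg.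
Qed.

End Braids.

Theorem coprime_case (R : realType) (n k l : nat) (b : int) :
  (0 < n)%N -> (0 < k)%N -> coprime n k -> (b * k%:Z = -1 %[mod n%:Z])%Z ->
  let Fix := fixed_loops (C_group R n k l) in
  let P := pure_braids R n in
  (exists F : set {compact-open, circle R -> 'rV[plane R]_n} -> set (braid R n),
     set_bij (components Fix)
       [set conj_class P beta | beta in left_coset (expgz (delta R n) b) P] F /\
     forall u beta, Fix u -> braid_of_loop_coprime k l b u beta ->
       F (connected_component Fix u) = conj_class P beta) /\
  (forall u (Fu : Fix u),
     [/\ aspherical R (set_type (connected_component Fix u)),
         exists beta, braid_of_loop_coprime k l b u beta &
         forall beta, braid_of_loop_coprime k l b u beta ->
           group_iso_onto (pi1 R (connected_component_refl Fu))
             [set p | P p /\ (p * beta = beta * p)%g]]).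
Proof.
case: n => // n _ k0 /eqP c1 bk Fix P.
(* By the congruence, (1 + b k) / n is an integer; it is the exponent of the rotation in an element
   of the group with the least positive time shift. *)
have [a ab] : exists a : int, a * n.+1%:Z = 1 + b * k%:Z.
  move/eqP: bk; rewrite eqz_mod_dvd opprK => /dvdzP[a ea]; exists a.
  by rewrite -ea addrC.
have ab' : a * n.+1%:Z = (gcdn n.+1 k)%:Z + b * k%:Z by rewrite c1.
have kR : k%:R != 0 :> R by rewrite pnatr_eq0 -lt0n.
have aR : a%:~R = (1 + b%:~R * k%:R) / n.+1%:R :> R.
  have := congr1 (fun m : int => m%:~R : R) ab; rewrite rmorphD !rmorphM /= => <-.
  by rewrite mulfK // pnatr_eq0.
pose s : Sym n.+1 := expgz (sigma1 n.+1) b.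
pose theta : R := (1 + b%:~R * k%:R) / n.+1%:R * l%:R / k%:R.
pose g : (O2 R * Sym n.+1)%type := (rot (2 * pi * theta), s).
have gE : (rot (2 * pi * a%:~R * l%:R / k%:R), s) = g by rewrite aR /g /theta !mulrA.
have FE : Fix = twisted_loops (n.+1 * k) (conf_space R n.+1) (conf_act g).
  by rewrite /Fix (C_fixed_loops R l _ k0 ab') // c1 divn1 sym_conf_space1 gE.
have gN z : iter (n.+1 * k) (conf_act g) z = z.
  have := twist_order l _ k0 ab' z; rewrite c1 divn1 gE; exact.
have tw : twisted_paths (R := R) (conf_space R n.+1) (conf_act g) Fix
    (fun u => loop_path u (n.+1%:R * k%:R)^-1).
  have N0 : (0 < n.+1 * k)%N by rewrite muln_gt0.
  rewrite FE /loop_path -natrM; apply: (fixed_conf_twisted (y := 1%g)) => //.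
    by rewrite mul1g mulg1.
  by move=> z; rewrite conf_act1; split => [cz|[]].
have [M [q [cq cM]]] := conf_cover R n.
have [m0 qm0] := cov_surj cq (base_confP R n.+1).
have cid := @continuous_idE 'rV[plane R]_n.+1.
have bar_loop p (be : braid R n.+1) :
    is_path (conf_space R n.+1) (base_conf R n.+1) (base_conf R n.+1) p ->
    orbit_elt be = 1%g -> path_homotopic (conf_space R n.+1) (orbit_rep be) (id \o p) ->
    orbit_elt be = 1%g /\ path_homotopic (conf_space R n.+1)
      (@perm_act R _ s \o orbit_rep be) (id \o (@perm_act R _ s \o p)).
  move=> pp e h; split => //; apply: (homotopic_comp _ _ h).
    exact: perm_act_continuous.
  exact: perm_act_conf.
have := twisted_correspondence (S := braid_gspace R n.+1) (k := id) (bar := id)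
  (h := @perm_act R _ s) (rt := @rotate R _ (- theta)) (pi := s)
  tw cq cM qm0 (base_confP R n.+1) cid (fun _ => id) erefl cq
  (@perm_act_continuous R _ s) (@perm_act_conf R _ s) (@rotate_continuous R _ _)
  (fun t z => @conf_act_conf R _ _ z) (fun z _ => rotate0 _ z)
  (fun z _ => rotate_back theta s z) erefl bar_loop.
have clE := closed_lift_pure cq qm0.
have relE u beta : braid_of_loop_coprime k l b u beta <-> exists eta,
    is_path (conf_space R n.+1) (base_conf R n.+1)
      (loop_path u (n.+1%:R * k%:R)^-1 0) eta /\
    beta = @orbit_class R (braid_gspace R n.+1) s (id \o full_mono (conf_act g)
      (fun u => loop_path u (n.+1%:R * k%:R)^-1) (base_conf R n.+1) (@rotate R _ (- theta)) u eta).
  rewrite /braid_of_loop_coprime /loop_path mulr0 -/s.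
  have -> : 2 * pi * ((1 + b%:~R * k%:R) / n.+1%:R) * l%:R / k%:R = 2 * pi * theta.
    by rewrite /theta !mulrA.
  by [].
have twE : (fun be => twisted_classes (S := braid_gspace R n.+1) q (base_conf R n.+1) m0 id id be)
    = conj_class P.
  by apply/funext => be; rewrite /twisted_classes clE.
rewrite clE (corr_coset_perm cq qm0 erefl) twE /=.
have -> : left_coset (expgz (delta R n.+1) b) P = [set be | braid_perm be = s].
  rewrite left_coset_pure (expgz_morph (@braid_permM R n.+1)) delta_perm //.
move=> [[F [bF FE']] H]; split.
  exists F; split => // u beta Fu /relE h; by rewrite (FE' _ _ Fu h) -twE.
move=> u Fu; have [asph [be hb] iso] := H u Fu; split; first exact: asph.
  by exists be; apply/relE; exact: hb.
by move=> beta /relE; exact: iso.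
Qed.

(** * The involution of braids induced by conjugation *)

Section Bar.
Variables (R : realType) (n : nat).
Local Notation V := ('rV[plane R]_n).
Local Notation S := (braid_gspace R n).
Local Notation bar := (@braid_bar R n).

Definition conf_conj : V -> V := conf_act (kappa R, 1%g).

Lemma conf_conjE : map_mx (plane_act (kappa R)) = conf_conj.
Proof. by apply/funext => z; rewrite /conf_conj /conf_act /= perm_act1. Qed.

Lemma conf_conjK z : conf_conj (conf_conj z) = z.
Proof. by rewrite /conf_conj -conf_actM expg_pairM /= kappaK mulg1 conf_act1. Qed.

Lemma conf_conj_perm s z : conf_conj (perm_act s z) = perm_act s (conf_conj z).
Proof.
by rewrite /conf_conj -!conf_act_perm -!conf_actM !expg_pairM /= !mul1g !mulg1.
Qed.

Lemma conf_conj_base : conf_conj (base_conf R n) = base_conf R n.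
Proof. by apply/rowP => j; rewrite -conf_conjE !mxE plane_act_kappa /= oppr0. Qed.

Lemma conf_conj_homotopic (f f' : R -> V) : path_homotopic (conf_space R n) f f' ->
  path_homotopic (conf_space R n) (conf_conj \o f) (conf_conj \o f').
Proof. by apply: homotopic_comp; [exact: conf_act_continuous|exact: conf_act_conf]. Qed.

Lemma bar_orbit_path (b : braid R n) :
  @is_orbit_path R S (braid_perm b) (conf_conj \o braid_path b : R -> V).
Proof.
have [cf Af f0 f1] := orbit_repP b; split => /=.
- exact: (continuous_comp2 cf (@conf_act_continuous R n _)).
- by move=> t tI; apply: conf_act_conf; exact: Af.
- by rewrite [braid_path b 0]f0 conf_conj_base.
- by rewrite [braid_path b 1]f1 [bg_act _ _]/(perm_act _ _) conf_conj_perm conf_conj_base.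
Qed.

Lemma barE (b : braid R n) : bar b = @orbit_class R S (braid_perm b) (conf_conj \o braid_path b).
Proof. by rewrite /braid_bar conf_conjE. Qed.

Lemma bar_perm (b : braid R n) : braid_perm (bar b) = braid_perm b.
Proof. by rewrite barE; exact: (orbit_class_elt (bar_orbit_path b)). Qed.

Lemma bar_path (b : braid R n) : path_homotopic (conf_space R n)
  (braid_path (bar b)) (conf_conj \o braid_path b).
Proof. by rewrite barE; exact: (orbit_class_rep (bar_orbit_path b)). Qed.

Lemma barK : involutive bar.
Proof.
move=> b; apply: (@orbit_eqP R S); first by rewrite -!/(braid_perm _) !bar_perm.
apply: (homotopic_trans (bar_path (bar b))).
have := conf_conj_homotopic (bar_path b); congr path_homotopic.
by apply/funext => t /=; rewrite conf_conjK.
Qed.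

End Bar.

(** There is no rotation to undo, so [rt] is the projection and the end path is constant. The
    correspondence lands in the coset of the inverse of [sigma2]. Since the inverse of p b bar(p)^-1
    is bar(p) b^-1 p^-1 and bar is an involution, inversion carries its twisted classes to those of
    the coset of [sigma2]. *)
Theorem conjugate_case (R : realType) (n : nat) : (0 < n)%N ->
  let Fix := fixed_loops (C'2_group R n) in
  let P := pure_braids R n in
  (exists F : set {compact-open, circle R -> 'rV[plane R]_n} -> set (braid R n),
     set_bij (components Fix)
       [set twisted_class P beta | beta in left_coset (delta R n ^+ (n.+1)./2)%g P] F /\
     forall u beta, Fix u -> braid_of_loop_conj u beta ->
       F (connected_component Fix u) = twisted_class P (beta^-1)%g) /\
  (forall u (Fu : Fix u),
     [/\ aspherical R (set_type (connected_component Fix u)),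
         exists beta, braid_of_loop_conj u beta &
         forall beta, braid_of_loop_conj u beta ->
           group_iso_onto (pi1 R (connected_component_refl Fu))
             [set p | P p /\ (p * beta = beta * braid_bar p)%g]]).
Proof.
case: n => // n _ Fix P.
pose s : Sym n.+1 := ((sigma2 n.+1)^-1)%g.
pose g : (O2 R * Sym n.+1)%type := (kappa R, s).
have gE z : conf_act g z = perm_act s (conf_conj z).
  by rewrite -conf_act_perm /conf_conj -conf_actM expg_pairM /= mul1g mulg1.
have gb : conf_act g (base_conf R n.+1) = perm_act s (base_conf R n.+1).
  by rewrite gE conf_conj_base.
have tw : twisted_paths (R := R) (conf_space R n.+1) (conf_act g) Fix
    (fun u => loop_path u (2 * n.+1%:R)^-1).
  rewrite /Fix C'2_fixed_loops // /loop_path -(natrM _ 2).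
  apply: (fixed_conf_twisted (y := 1%g)) => //; first exact: conj_twist_order.
    by rewrite mul1g mulg1.
  by move=> z; rewrite conf_act1; split => [cz|[]].
have [M [q [cq cM]]] := conf_cover R n.
have [m0 qm0] := cov_surj cq (base_confP R n.+1).
have cid := @continuous_idE 'rV[plane R]_n.+1.
have bar_loop p (be : braid R n.+1) :
    is_path (conf_space R n.+1) (base_conf R n.+1) (base_conf R n.+1) p ->
    orbit_elt be = 1%g -> path_homotopic (conf_space R n.+1) (orbit_rep be) (id \o p) ->
    orbit_elt (braid_bar be) = 1%g /\ path_homotopic (conf_space R n.+1)
      (@perm_act R _ s \o orbit_rep (braid_bar be)) (id \o (conf_act g \o p)).
  move=> pp e h; split; first by rewrite -[LHS]/(braid_perm _) bar_perm.
  have h1 := homotopic_trans (bar_path be) (conf_conj_homotopic h).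
  have := homotopic_comp (@perm_act_continuous R _ s) (@perm_act_conf R _ s) h1.
  by congr path_homotopic; apply/funext => t /=; rewrite gE.
have := twisted_correspondence (S := braid_gspace R n.+1) (k := id)
  (bar := @braid_bar R n.+1) (h := conf_act g) (rt := snd) (pi := s)
  tw cq cM qm0 (base_confP R n.+1) cid (fun _ => id) erefl cq
  (@conf_act_continuous R _ g) (@conf_act_conf R _ g) (@continuous_sndE _ _)
  (fun t z => id) (fun z _ => erefl) (fun z _ => erefl) gb bar_loop.
have clE := closed_lift_pure cq qm0.
have relE u beta : Fix u -> braid_of_loop_conj u beta <-> exists eta,
    is_path (conf_space R n.+1) (base_conf R n.+1)
      (loop_path u (2 * n.+1%:R)^-1 0) eta /\
    beta = @orbit_class R (braid_gspace R n.+1) s (id \o full_mono (conf_act g)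
      (fun u => loop_path u (2 * n.+1%:R)^-1) (base_conf R n.+1) snd u eta).
  move=> Fu; have e0 : loop_path u (2 * n.+1%:R)^-1 0 = u (to_circle 0).
    by rewrite /loop_path mulr0.
  (* The constant end path is dropped up to homotopy, since the braid attached to the loop has no
     rotation factor. *)
  have key eta : is_path (conf_space R n.+1) (base_conf R n.+1)
      (loop_path u (2 * n.+1%:R)^-1 0) eta ->
    @orbit_class R (braid_gspace R n.+1) s (id \o full_mono (conf_act g)
      (fun u => loop_path u (2 * n.+1%:R)^-1) (base_conf R n.+1) snd u eta) =
    @orbit_class R (braid_gspace R n.+1) s (mono_path (conf_act g)
      (fun u => loop_path u (2 * n.+1%:R)^-1) u eta).
    move=> pe; have pm := mono_pathP tw Fu pe; rewrite gb in pm.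
    have pc : is_path (conf_space R n.+1) (perm_act s (base_conf R n.+1))
        (perm_act s (base_conf R n.+1)) (end_path (conf_act g) snd (base_conf R n.+1) : R -> _).
      rewrite /end_path /= gb; split => //; first exact: contcst.
      by move=> t _; apply: perm_act_conf; exact: base_confP.
    apply: (proj2 (@orbit_classP R (braid_gspace R n.+1) s _ s _ (path_concatP pm pc) pm)); split; first by [].
    by rewrite /end_path /= gb; exact: (homotopic_concat_1r pm).
  split=> -[eta [pe ->]]; exists eta; rewrite ?key ?e0 //; rewrite e0 in pe => //.
rewrite clE (corr_coset_perm cq qm0 gb).
have twE be : twisted_classes (S := braid_gspace R n.+1) q (base_conf R n.+1) m0 id
    (@braid_bar R n.+1) be = twisted_class P be.
  by rewrite /twisted_classes clE.
have -> : left_coset (delta R n.+1 ^+ (n.+2)./2)%g P = [set be | braid_perm be = sigma2 n.+1].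
  rewrite left_coset_pure.
  have -> // : braid_perm (delta R n.+1 ^+ (n.+2)./2)%g = sigma2 n.+1.
  by have := expgz_morph (@braid_permM R n.+1) (delta R n.+1) (n.+2)./2%:Z; rewrite delta_perm.
move=> [[F [[Ff Fi Fs] FE]] H].
pose inv (X : set (braid R n.+1)) := [set (x^-1)%g | x in X].
have invK X : inv (inv X) = X.
  apply/seteqP; split => x; first by move=> [_ [y Xy <-] <-]; rewrite invgK.
  by move=> Xx; exists (x^-1)%g; [exists x|rewrite invgK].
have permV (b : braid R n.+1) : braid_perm (b^-1)%g = ((braid_perm b)^-1)%g := orbit_eltV b.
have Pbar p : P p -> P (braid_bar p) by rewrite /P /pure_braids /= bar_perm.
have inv_cls be : inv (twisted_class P be) = twisted_class P (be^-1)%g.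
  apply/seteqP; split => x.
    move=> [_ [p Pp <-] <-]; exists (braid_bar p); first exact: Pbar.
    by rewrite barK !invgM invgK mulgA.
  move=> [p Pp <-]; exists (braid_bar p * be * (braid_bar (braid_bar p))^-1)%g.
    by exists (braid_bar p) => //; exact: Pbar.
  by rewrite barK !invgM invgK mulgA.
split.
  exists (fun C => inv (F C)); split; last first.
    move=> u beta Fu /(relE _ _ Fu) h; by rewrite (FE _ _ Fu h) twE inv_cls.
  split.
  - move=> C /Ff [be /= beP <-]; exists (be^-1)%g; last by rewrite twE inv_cls.
    by rewrite /= permV beP invgK.
  - move=> C C' CC CC' /(congr1 inv); rewrite !invK; exact: Fi.
  - move=> _ [be /= beP <-].
    have /Fs[C CC FC] : [set twisted_classes (S := braid_gspace R n.+1) q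
        (base_conf R n.+1) m0 id (@braid_bar R n.+1) b | b in [set b | braid_perm b = s]]
        (twisted_class P (be^-1)%g).
      by exists (be^-1)%g; rewrite ?twE //= permV beP.
    by exists C => //; rewrite FC inv_cls invgK.
move=> u Fu; have [asph [be hb] iso] := H u Fu; split; first exact: asph.
  by exists be; apply/(relE _ _ Fu); exact: hb.
by move=> beta /(relE _ _ Fu); exact: iso.
Qed.

(** * Winding angles of braids *)

Section PolarLifts.
Variable R : realType.
Local Notation C := (plane R).
Local Notation Cx := [set z : C | z != 0].
Implicit Types (f : R -> C) (x d : R * R).

Lemma endp_cexp_shift x d f y : cexp d = 1 -> is_path Cx (cexp x) y f ->
  endp (@cexp R) (x.1 + d.1, x.2 + d.2) f =
  ((endp (@cexp R) x f).1 + d.1, (endp (@cexp R) x f).2 + d.2).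
Proof.
move=> d1 pf; have [X [[cX X0 qX] ->]] := lift_path (cexp_covers R) pf erefl.
apply: (endpE (cexp_covers R) (G := fun t => ((X t).1 + d.1, (X t).2 + d.2))); split.
- by cont.
- by rewrite X0.
- by move=> t tI; rewrite (cexpD (X t) d) d1 mulr1 qX.
Qed.

(** In the right half plane the principal logarithm is a lift, and its angle vanishes at a real end
    point. *)
Lemma endp_cexp_half_plane x f y : is_path Cx (cexp x) y f -> x.2 = 0 ->
  (forall t, unitI t -> 0 < complex.Re (f t)) -> complex.Im y = 0 ->
  (endp (@cexp R) x f).2 = 0.
Proof.
move=> [cf Af f0 f1] x2 pos y0; have pi0 := pi_gt0 R.
have -> : endp (@cexp R) x f = clog (f (clamp 1)).
  apply: (endpE (cexp_covers R) (G := fun t => clog (f (clamp t)))); split.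
  - move=> t; have cc := continuous_comp2 (@clamp_continuous R) cf.
    by apply: (continuous_comp (cc t)); apply: clog_continuous; apply: pos; exact: clampI.
  - rewrite clamp0; apply: cexp_inj; first by rewrite clogK ?pos //; exact: unitI0.
    by rewrite x2 subr0; have := clog_bound (f 0); lra.
  - by move=> t tI; rewrite (clamp_id tI) clogK // pos.
by rewrite (clamp_ge1 (lexx 1)) f1 /clog /= y0 mul0r atan0.
Qed.

Lemma norm_cexp x : `|cexp x| = (expR x.1)%:C%C :> C.
Proof.
rewrite cexpE normc_def /=.
rewrite !exprMn -mulrDr cos2Dsin2 mulr1 sqrtr_sqr ger0_norm //; exact: expR_ge0.
Qed.

(** Two continuous choices of the angle along a path differ by a constant multiple of 2 pi, by
    unique lifting of the constant 1. *)
Lemma windsP x f y (w : int) : is_path Cx (cexp x) y f ->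
  winds f w <-> (endp (@cexp R) x f).2 - x.2 = 2 * pi * w%:~R.
Proof.
move=> pf; have [cf Af f0 f1] := pf.
have [X [[cX X0 qX] ->]] := lift_path (cexp_covers R) pf erefl.
have p0 : 2 * pi != 0 :> R by have := pi_gt0 R; lra.
have c2 : continuous (fun t => (X t).2) by cont.
split.
  move=> [theta [cth fth th1]].
  have key t : unitI t -> (X t).2 - 2 * pi * theta t = x.2 - 2 * pi * theta 0.
    move=> tI.
    have e s : unitI s -> cexp (0, (X s).2 - 2 * pi * theta s) = 1.
      move=> sI; rewrite /cexp expR0 mul1r /=.
      have h := fth s sI; rewrite plane_act_rot -qX // norm_cexp mulrC /cexp in h.
      have nz : (expR (X s).1)%:C%C != 0 :> C.
        by rewrite eq_complex /= eqxx andbT gt_eqF // expR_gt0.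
      have {}h := mulfI nz h; apply: (mulIf (expi_neq0 (2 * pi * theta s))).
      by rewrite -expiD subrK mul1r.
    have ct : continuous (fun s => (0 : R, (X s).2 - 2 * pi * theta s)) by cont.
    have := cov_upl (cexp_covers R) ct (@contcst _ _ (0 : R, x.2 - 2 * pi * theta 0)).
    move=> h; suff [//] : (0, (X t).2 - 2 * pi * theta t) = (0, x.2 - 2 * pi * theta 0) :> R * R.
    apply: (h _ _ t tI); last by rewrite X0.
    by move=> s sI; rewrite e //; have := e 0 unitI0; rewrite X0.
  have := key 1 unitI1; rewrite -th1; lra.
move=> h; exists (fun t => (X t).2 / (2 * pi)); split.
- by cont.
- move=> t tI; rewrite plane_act_rot -qX // norm_cexp mulrCA divff // mulr1.
  by rewrite mulrC /cexp.
by rewrite X0 -mulrBl h mulrC mulKf.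
Qed.

End PolarLifts.

Section Angles.
Variables (R : realType) (m : nat).
Local Notation C := (plane R).
Local Notation Cx := [set z : C | z != 0].
Local Notation V := ('rV[C]_m.+1).
Local Notation S := (braid_gspace R m.+1).
Implicit Types (b : braid R m.+1) (j : 'I_m).

Definition diff j (z : V) : C := z 0 (lift ord0 j) - z 0 ord0.

Lemma diff_continuous j : continuous (diff j).
Proof.
apply: contDC; last apply: contNC; exact: (@cont_entry R V m.+1 id _ (@continuous_idE V)).
Qed.

Lemma diff_neq0 j z : conf_space R m.+1 z -> Cx (diff j z).
Proof. by move=> [_ zi]; rewrite /diff /= subr_eq0; apply/eqP => /zi. Qed.

Definition base_log j : R * R := (ln j.+1%:R, 0).

Lemma diff_base j : diff j (base_conf R m.+1) = cexp (base_log j).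
Proof.
rewrite /diff !mxE /cexp /= expi0 mulr1 lnK ?qualifE /= ?ltr0Sn //.
by rewrite -rmorphB /=; congr (_ %:C)%C; rewrite /bump /= add1n; ring.
Qed.

Definition path_angle j (f : R -> V) : R * R := endp (@cexp R) (base_log j) (diff j \o f).

Definition angle j b : R * R := path_angle j (braid_path b).

Lemma diff_path j x y (f : R -> V) : is_path (conf_space R m.+1) x y f ->
  is_path Cx (diff j x) (diff j y) (diff j \o f).
Proof.
move=> [cf Af f0 f1]; split; rewrite /= ?f0 ?f1 //.
- exact: (continuous_comp2 cf (@diff_continuous j)).
- by move=> t tI; apply: diff_neq0; exact: Af.
Qed.

Lemma diff_path_base j y (f : R -> V) : is_path (conf_space R m.+1) (base_conf R m.+1) y f ->
  is_path Cx (cexp (base_log j)) (diff j y) (diff j \o f).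
Proof. by rewrite -diff_base; exact: diff_path. Qed.

Lemma path_angle_homotopic j y (f f' : R -> V) :
  is_path (conf_space R m.+1) (base_conf R m.+1) y f ->
  path_homotopic (conf_space R m.+1) f f' -> path_angle j f = path_angle j f'.
Proof.
move=> pf h; apply: (endp_homotopic (cexp_covers R) (diff_path_base j pf)) => //.
by apply: homotopic_comp h; [exact: diff_continuous|move=> z; exact: diff_neq0].
Qed.

Definition fix0 b := (braid_perm b : 'S_m.+1) ord0 = ord0.

Lemma diff_perm (s : Sym m.+1) j j' z : (s : 'S_m.+1) ord0 = ord0 ->
  (s : 'S_m.+1) (lift ord0 j') = lift ord0 j -> diff j (perm_act s z) = diff j' z.
Proof. by move=> s0 sj; rewrite /diff !mxE -sj -{2}s0 !permK. Qed.

(** String j ends [a] at the place of j' and then follows string j' of [b]; at that moment its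
    logarithm differs from the one at the base point by a period, which shifts the rest of the
    lift. *)
Lemma angleM a b j j' : fix0 a ->
  (braid_perm a : 'S_m.+1) (lift ord0 j') = lift ord0 j ->
  (angle j (a * b)%g).2 = (angle j a).2 + (angle j' b).2.
Proof.
move=> a0 aj; have pa := orbit_repP a; have pb := orbit_repP b.
have pb' := is_path_act (orbit_elt a) pb.
have e : angle j (a * b)%g = endp (@cexp R) (angle j a) (diff j' \o braid_path b).
  have -> : diff j' \o braid_path b = diff j \o (perm_act (braid_perm a) \o braid_path b).
    by apply/funext => t; rewrite /= (diff_perm _ a0 aj).
  have pd := diff_path_base j pa; have pd' := diff_path j pb'.
  have := endp_concat (cexp_covers R) pd pd' erefl.
  rewrite -comp_path_concat => <-.
  exact: (path_angle_homotopic j (orbit_repP (a * b)%g) (orbit_repM a b)).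
have qa : cexp (angle j a) = cexp (base_log j').
  rewrite (q_endp (cexp_covers R) (diff_path_base j pa) erefl).
  by rewrite [bg_act _ _]/(perm_act (braid_perm a) (base_conf R m.+1)) (diff_perm _ a0 aj) diff_base.
set x := angle j a in qa e *.
have d1 : cexp (x.1 - (base_log j').1, x.2 - (base_log j').2) = 1.
  have := cexpD (x.1 - (base_log j').1, x.2 - (base_log j').2) (base_log j').
  rewrite /= !subrK -surjective_pairing qa => h.
  by apply: (mulIf (cexp_neq0 (base_log j'))); rewrite -h mul1r.
have := endp_cexp_shift d1 (diff_path_base j' pb).
rewrite /= [_ + (x.1 - _)]addrC [_ + (x.2 - _)]addrC !subrK -surjective_pairing e => ->.
by rewrite /= subr0 addrC.
Qed.

Lemma fix0_lift b j : fix0 b -> exists j', (braid_perm b : 'S_m.+1) (lift ord0 j') = lift ord0 j.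
Proof.
move=> b0; have e : (braid_perm b : 'S_m.+1) ((braid_perm b : 'S_m.+1)^-1%g (lift ord0 j)) = lift ord0 j.
  by rewrite permKV.
move: e; case: (unliftP ord0 ((braid_perm b : 'S_m.+1)^-1%g (lift ord0 j))) => [j' ->|->] e.
  by exists j'.
by move: e; rewrite [LHS]b0 => e; have := neq_lift ord0 j; rewrite -e eqxx.
Qed.

Lemma fix0M a b : fix0 a -> fix0 b -> fix0 (a * b)%g.
Proof. by rewrite /fix0 braid_permM symM => a0 ->. Qed.

Lemma fix01 : fix0 1%g. Proof. by rewrite /fix0 braid_perm1 perm1. Qed.

(** Additive on the braids fixing 0, because these only permute the strings over which the sum runs;
    it will tell conjugacy classes apart. *)
Definition total_angle b : R := \sum_j (angle j b).2.

Lemma total_angleM a b : fix0 a -> total_angle (a * b)%g = total_angle a + total_angle b.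
Proof.
move=> a0; have /choice[r hr] := fun j => @fix0_lift a j a0.
have ri : injective r.
  by move=> j j' e; have := hr j; rewrite e hr => /lift_inj.
rewrite /total_angle [X in _ + X](reindex_inj ri) -big_split /=.
by apply: eq_bigr => j _; apply: angleM.
Qed.

End Angles.

(** * Angles of the generators and of [delta_hat] *)

Section Generators.
Variables (R : realType) (m : nat).
Hypothesis m0 : (0 < m)%N.
Local Notation C := (plane R).
Local Notation V := ('rV[C]_m.+1).
Local Notation S := (braid_gspace R m.+1).
Local Notation gen := (@braid_gen R m.+1).
Implicit Types (b : braid R m.+1) (j : 'I_m) (i : 'I_m.+1).

Lemma angle1 j : (angle j (1%g : braid R m.+1)).2 = 0.
Proof.
have -> : angle j (1%g : braid R m.+1) = path_angle j (cst (base_conf R m.+1)).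
  exact: (path_angle_homotopic j (orbit_repP (1%g : braid R m.+1)) (orbit_rep1 R S)).
rewrite /path_angle (_ : diff j \o _ = cst (diff j (base_conf R m.+1))) //.
by rewrite (endp_cst (cexp_covers R)) // diff_base.
Qed.

Let unwound b := fix0 b /\ forall j, (angle j b).2 = 0.

Let unwoundM a b : unwound a -> unwound b -> unwound (a * b)%g.
Proof.
move=> [a0 az] [b0 bz]; split; first exact: fix0M.
by move=> j; have [j' hj] := fix0_lift j a0; rewrite (angleM b a0 hj) az bz addr0.
Qed.

Let unwound1 : unwound 1%g. Proof. split; [exact: fix01|exact: angle1]. Qed.

Lemma angle_gen j i : (i.+1 < m.+1)%N -> angle j (gen i) = path_angle j (@half_turn R m.+1 i).
Proof.
move=> i1; apply: (path_angle_homotopic j (orbit_repP (gen i))).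
exact: (@orbit_class_rep R S _ _ (half_turn_path R i1)).
Qed.

Lemma Re_diff_base j : complex.Re (diff j (base_conf R m.+1)) = j.+1%:R.
Proof. by rewrite diff_base cexpE /= cos0 mulr1 lnK // qualifE /= ltr0Sn. Qed.

Lemma Im_diff_perm j (s : Sym m.+1) : complex.Im (diff j (perm_act s (base_conf R m.+1))) = 0.
Proof. by rewrite /diff !mxE /= subrr. Qed.

Lemma diff_half_turn j i t : (i.+1 < m.+1)%N ->
  diff j (@half_turn R m.+1 i t) = diff j (base_conf R m.+1) +
   ((if lift ord0 j == i then half_shift t else
     if lift ord0 j == ordS i then - half_shift t else 0) -
    (if ord0 == i then half_shift t else if ord0 == ordS i then - half_shift t else 0)).
Proof. by move=> i1; rewrite /diff !half_turnE //; ring. Qed.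

Let ordS_neq0 (i : 'I_m.+1) : (i.+1 < m.+1)%N -> (ord0 == ordS i) = false.
Proof. by move=> i1; apply/negbTE/eqP => /(congr1 (@nat_of_ord _)); rewrite ordS_val. Qed.

(** This half turn leaves the point 0 in place and all other points to its right. *)
Lemma angle_gen_pos j i : (0 < i)%N -> (i.+1 < m.+1)%N -> (angle j (gen i)).2 = 0.
Proof.
move=> i0 i1; rewrite angle_gen //.
have pf := diff_path_base j (half_turn_path R i1).
apply: (endp_cexp_half_plane pf) => //.
  move=> t _ /=; rewrite diff_half_turn // ordS_neq0 //.
  have -> : (ord0 == i) = false by apply/negbTE; rewrite eq_sym -lt0n.
  have [h0 h1] := andP (half_shift_Re t); have hb := Re_diff_base j.
  have jR : 0 <= j%:R :> R by [].
  rewrite subr0; case: eqP => _; last case: eqP => [e|_].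
  - move: hb h0; case: (diff _ _) => a b'; case: (half_shift t) => p q /=.
    rewrite -natr1; lra.
  - have j1 : 1 <= j%:R :> R.
      have : nat_of_ord (lift ord0 j) = i.+1 by rewrite e ordS_val.
      by rewrite /= /bump /= add1n => -[->]; rewrite ler1n.
    move: hb h1; case: (diff _ _) => a b'; case: (half_shift t) => p q /=.
    rewrite -natr1; lra.
  by rewrite addr0 hb.
exact: Im_diff_perm.
Qed.

Let tperm0 (i : 'I_m.+1) : (0 < i)%N -> (i.+1 < m.+1)%N -> tperm i (ordS i) ord0 = ord0.
Proof.
move=> i0 i1; rewrite tpermD //; last by rewrite eq_sym ordS_neq0.
by rewrite -val_eqE /= -lt0n.
Qed.

Lemma gen_unwound (i : 'I_m.+1) : (0 < i)%N && (i < m)%N -> unwound (gen i).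
Proof.
move=> /andP[i0 im]; split; last by move=> j; exact: angle_gen_pos.
by rewrite /fix0 braid_gen_perm // tperm0.
Qed.

Let i1 : ((ord0 : 'I_m.+1).+1 < m.+1)%N. Proof. by rewrite ltnS. Qed.

Lemma gen0_sqr_perm : braid_perm (gen ord0 ^+ 2)%g = 1%g.
Proof.
rewrite expgS expg1 braid_permM; apply/permP => j.
by rewrite symM braid_gen_perm // tpermK perm1.
Qed.

(** In the clockwise full turn the difference of the first two points is expi (- 2 pi t), whence the
    angle; the other points stay to the right of the point 0. *)
Lemma gen0_sqr_angle j : (angle j (gen ord0 ^+ 2)%g).2 = if j == 0 :> nat then - (2 * pi) else 0.
Proof.
rewrite expgS expg1; set h := @half_turn R m.+1 ord0; set s : Sym m.+1 := tperm ord0 (ordS ord0).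
have ph := half_turn_path R i1.
have ph' := @is_path_act R S s _ _ _ ph.
have -> : angle j (gen ord0 * gen ord0)%g = path_angle j (path_concat h (perm_act s \o h)).
  apply: (path_angle_homotopic j (orbit_repP (gen ord0 * gen ord0)%g)).
  apply: (homotopic_trans (orbit_repM (gen ord0) (gen ord0))).
  have es : orbit_elt (gen ord0) = s by exact: (orbit_class_elt (S := S) ph).
  have hr : path_homotopic (conf_space R m.+1) (orbit_rep (gen ord0)) h.
    exact: (@orbit_class_rep R S _ _ ph).
  rewrite es; apply: homotopic_concat => //; last first.
    exact: (@homotopic_act R S s _ _ hr).
  have [_ _ _ ->] := orbit_repP (gen ord0); have [_ _ r0 _] := orbit_repP (gen ord0).
  by rewrite es /= r0.
have pc := path_concatP ph ph'.
have pd := diff_path_base j pc.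
have diffs (z : 'rV[plane R]_m.+1) : diff j (perm_act s z) = z 0 (s (lift ord0 j)) - z 0 (ordS ord0).
  by rewrite /diff !mxE /s tpermV tpermL.
have hE (t : R) i := half_turnE i1 t i.
case: eqP => [j0|/eqP j0].
  have ej : lift ord0 j = ordS ord0 by apply: ord_inj; rewrite lift0 ordS_val // j0.
  have d0 t : diff j (h t) = expi (- pi * t).
    rewrite diff_half_turn // ej eqxx ordS_neq0 // eqxx eq_sym ordS_neq0 // diff_base.
    rewrite /base_log j0 ln1 cexp0 /half_shift; by field.
  have d1 t : diff j (perm_act s (h t)) = - expi (- pi * t).
    by rewrite diffs ej /s tpermR -d0 /diff ej opprB.
  have -> : path_angle j (path_concat h (perm_act s \o h)) = (0, - (2 * pi)); last by [].
  rewrite -[X in (_, X)]mulr1.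
  apply: (endpE (cexp_covers R) (G := fun t => (0, - (2 * pi) * t))); split.
  - by cont.
  - by rewrite mulr0 /base_log j0 ln1.
  move=> t _; rewrite /cexp expR0 mul1r /= /path_concat; case: ifP => _ /=.
    by rewrite d0; congr expi; ring.
  rewrite d1 (_ : - pi * (2 * t - 1) = - (2 * pi) * t + pi); last by ring.
  by rewrite expiD expi_pi mulrN1 opprK.
have j1 : 1 <= j%:R :> R by rewrite ler1n lt0n.
have jne : (lift ord0 j == ordS ord0) = false.
  apply/negbTE/eqP => /(congr1 (@nat_of_ord _)); rewrite lift0 ordS_val // => -[e].
  by rewrite e eqxx in j0.
have jn0 : (lift ord0 j == ord0) = false by rewrite eq_sym; apply/negbTE/neq_lift.
have dh t : diff j (h t) = diff j (base_conf R m.+1) - half_shift t.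
  by rewrite diff_half_turn // jne jn0 eqxx add0r.
have dh' t : diff j (perm_act s (h t)) = diff j (base_conf R m.+1) - 1 + half_shift t.
  rewrite diffs /s tpermD; last 2 first.
  - exact: neq_lift.
  - by rewrite eq_sym jne.
  rewrite !hE jne jn0 eqxx eq_sym ordS_neq0 // /diff.
  have -> : base_conf R m.+1 0 (ordS ord0) = base_conf R m.+1 0 ord0 + 1.
    by rewrite !mxE ordS_val // rmorphB /= rmorphB /=; ring.
  by rewrite addr0; ring.
apply: (endp_cexp_half_plane pd) => //.
  move=> t tI; suff: 0 < complex.Re (diff j (path_concat h (perm_act s \o h) t)) by [].
  rewrite /path_concat.
  have hb := Re_diff_base j; rewrite -natr1 in hb.
  case: ifP => _.
    have [h0 h1] := andP (half_shift_Re (2 * t)).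
    rewrite dh; move: hb h0 h1; case: (diff _ _) => a b'; case: (half_shift _) => p q /=; lra.
  have [h0 h1] := andP (half_shift_Re (2 * t - 1)).
  rewrite [(perm_act s \o h) _]/(perm_act s (h (2 * t - 1))) dh'; move: hb h0 h1; case: (diff _ _) => a b'; case: (half_shift _) => p q /=; lra.
have := Im_diff_perm j (s * s)%g; rewrite perm_actM; exact.
Qed.

Lemma delta_hat_angle j : (angle j (delta_hat R m)).2 = if j == 0 :> nat then - (2 * pi) else 0.
Proof.
have [_ hz] : unwound (\prod_(i < m.+1 | (0 < i)%N && (i < m)%N) gen i)%g.
  exact: (big_ind unwound unwound1 unwoundM gen_unwound).
rewrite /delta_hat (@angleM R m _ _ j j) ?hz ?addr0 ?gen0_sqr_angle //.
  by rewrite /fix0 gen0_sqr_perm perm1.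
by rewrite gen0_sqr_perm perm1.
Qed.

Lemma delta_hat_perm : fix0 (delta_hat R m) /\
  forall j, (braid_perm (delta_hat R m) : 'S_m.+1) (lift ord0 j) = lift ord0 (ordS j).
Proof.
have e i : ((braid_perm (delta_hat R m) : 'S_m.+1) i) = (if (i < 1)%N then i : nat else
    if (i.+1 < m.+1)%N then i.+1 else 1%N) :> nat.
  rewrite /delta_hat braid_permM gen0_sqr_perm mul1g.
  rewrite (big_morph (@braid_perm R m.+1) (@braid_permM R m.+1) (braid_perm1 R m.+1)).
  rewrite (eq_bigr (fun i : 'I_m.+1 => (tperm i (ordS i) : Sym m.+1))); last first.
    by move=> i' /andP[_ h]; apply/permP => i''; rewrite braid_gen_perm.
  by have := @adj_prod m.+1 1 i i1.
split; first by apply: val_inj; rewrite /= e.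
move=> j; apply: val_inj; rewrite [LHS]e !lift0 /=.
have := ltn_ord j; rewrite leq_eqVlt => /orP[/eqP h|h].
  by rewrite [j.+1]h ltnn modnn.
by rewrite ltnS h modn_small.
Qed.

End Generators.

(** * Graded braids *)

Lemma expgz0 (G : groupType) (x : G) : expgz x 0 = 1%g.
Proof. by []. Qed.

Section SymmetricBraids.
Variables (R : realType) (n l c : nat).
Local Notation C := (plane R).
Hypotheses (n0 : (0 < n)%N) (cn : (c %| n)%N) (c1 : (1 < c)%N) (lc : coprime l c).
Let m := (n %/ c)%N.
Let c0 : (0 < c)%N := ltnW c1.
Let m0 : (0 < m)%N. Proof. by rewrite divn_gt0 // dvdn_leq. Qed.
Let cR : c%:R != 0 :> R. Proof. by rewrite pnatr_eq0 -lt0n. Qed.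
Let prim : c.-primitive_root (root_l R l c) := root_prim R c0 lc.
Local Notation V := ('rV[C]_n).
Local Notation S := (braid_gspace R m.+1).
Local Notation Y := (@sym_conf_space R n l c).
Local Notation widen := (widen_ord (leq_div n c)).
Let sg (i : int) : Sym n := expgz (sigma1 n) i.
Let cyc (i : int) : Sym m.+1 := expgz (braid_perm (delta_hat R m)) i.

Definition collapse (z : V) : 'rV[C]_m.+1 := uncentre (power_map c z).

Lemma collapse_continuous : continuous collapse.
Proof. exact: (continuous_comp2 (@power_map_continuous R n c) (@uncentre_continuous R m)). Qed.

Lemma collapse_conf z : Y z -> conf_space R m.+1 (collapse z).
Proof. by move=> Yz; apply: uncentre_conf; exact: (power_map_conf n0 cn c1 lc). Qed.

Lemma diffE (j : 'I_m) (z : 'rV[C]_m.+1) : diff j z = centre_point0 z 0 j.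
Proof. by rewrite mxE. Qed.

Lemma diff_inj (z z' : 'rV[C]_m.+1) : \sum_i z 0 i = 0 -> \sum_i z' 0 i = 0 ->
  (forall j : 'I_m, diff j z = diff j z') -> z = z'.
Proof.
move=> z0 z0' h; rewrite -(centreK z0) -(centreK z0'); congr uncentre.
by apply/rowP => j; rewrite -!diffE.
Qed.

Lemma diff_collapse (j : 'I_m) z : diff j (collapse z) = z 0 (widen j) ^+ c.
Proof. by rewrite diffE uncentreK mxE. Qed.

Lemma sym_entry z (i : 'I_n) : Y z ->
  z 0 i = root_l R l c ^+ (i %/ m) * row_nth (sym_res c z) (i %% m).
Proof. by move=> Yz; rewrite -{1}(sym_resK n0 cn c1 Yz) mxE. Qed.

Lemma sym_entry_widen (z : V) (j : 'I_m) : row_nth (sym_res c z) j = z 0 (widen j).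
Proof. by rewrite (row_nthE _ (ltn_ord j)) mxE; congr (z 0 _); apply: val_inj. Qed.

Lemma sym_entry_pow z (i i' : 'I_n) : Y z -> i = i' %[mod m] -> z 0 i ^+ c = z 0 i' ^+ c.
Proof.
move=> Yz e; rewrite !(sym_entry _ Yz) e !exprMn -!exprM ![(_ * c)%N]mulnC !exprM.
by rewrite (prim_expr_order prim) !expr1n.
Qed.

Lemma sym_eq z z' : Y z -> Y z' ->
  (forall j : 'I_m, z 0 (widen j) = z' 0 (widen j)) -> z = z'.
Proof.
move=> Yz Yz' h; rewrite -(sym_resK n0 cn c1 Yz) -(sym_resK n0 cn c1 Yz').
by congr sym_ext; apply/rowP => j; rewrite !mxE.
Qed.

(** The point y in the definition of the corresponding braid, made of positive c-th roots of the
    base configuration; by [sym_base_uniq] it is the only choice. *)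
Definition sym_base : V := sym_ext l (\row_(j < m) cexp (ln j.+1%:R / c%:R, 0 : R)).

Lemma sym_base_widen (j : 'I_m) : sym_base 0 (widen j) = cexp (ln j.+1%:R / c%:R, 0 : R).
Proof.
have := congr1 (fun w : 'rV[C]_m => w 0 j)
  (sym_extK l (\row_(j < m) cexp (ln j.+1%:R / c%:R, 0 : R))).
by rewrite !mxE.
Qed.

Let base_pow (j : 'I_m) : cexp (ln j.+1%:R / c%:R, 0 : R) ^+ c = diff j (base_conf R m.+1).
Proof. by rewrite diff_base cexpX /= mulr0 mulrC divfK. Qed.

Lemma power_map_base : power_map c sym_base = centre_point0 (base_conf R m.+1).
Proof. by apply/rowP => j; rewrite -diffE -base_pow mxE -/m -sym_base_widen. Qed.

Lemma collapse_base : collapse sym_base = base_conf R m.+1.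
Proof. by rewrite /collapse power_map_base centreK //; have [] := base_confP R m.+1. Qed.

Lemma sym_base_conf : Y sym_base.
Proof.
apply: (sym_ext_conf n0 cn c1 lc); apply/(pow_rowP prim).
have -> : pow_row c (\row_(j < m) cexp (ln j.+1%:R / c%:R, 0 : R)) = centre_point0 (base_conf R m.+1).
  by apply/rowP => j; rewrite -diffE -base_pow !mxE.
exact: centre_conf (base_confP R m.+1).
Qed.

Lemma sym_base_pos (j : 'I_m) : 0 < sym_base 0 (widen j).
Proof. by rewrite sym_base_widen cexpE /= ltcE /= sin0 cos0 mulr0 mulr1 eqxx expR_gt0. Qed.

Lemma sym_base_uniq y : Y y -> (forall j : 'I_m, 0 < y 0 (widen j)) ->
  power_map c y = centre_point0 (base_conf R m.+1) -> y = sym_base.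
Proof.
move=> Yy y0; rewrite -power_map_base => e; apply: (sym_eq Yy sym_base_conf) => j.
have {}e : y 0 (widen j) ^+ c = sym_base 0 (widen j) ^+ c by rewrite -!diff_collapse /collapse e.
by apply: (pexpIrn c0 _ _ e); rewrite nnegrE ltW // sym_base_pos.
Qed.

Lemma rot_cycle_comm s t (i j : int) :
  ((rot s, sg i) * (rot t, sg j) = (rot t, sg j) * (rot s, sg i) :> O2 R * Sym n)%g.
Proof. by rewrite !expg_pairM /= -!rotD addrC /sg -!expgzD [(i + j)%R]addrC. Qed.

Lemma sg_conf i t z : Y z <-> Y (conf_act (rot t, sg i) z).
Proof.
have yg s j := rot_cycle_comm (2 * pi * l%:R / c%:R) s m j.
have key s j w : Y w -> Y (conf_act (rot s, sg j) w).
  move=> /sym_conf_spaceE[cw yw]; apply/sym_conf_spaceE; split; first exact: conf_act_conf.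
  by rewrite -[(sigma1 n ^+ _)%g]/(sg m) -conf_actM yg conf_actM yw.
split; first exact: key.
move=> /(key (- t) (- i)); rewrite -conf_actM expg_pairM /= -rotD addNr rot0 /sg -expgzD addNr.
by rewrite expgz0 conf_act1.
Qed.

Lemma sg_perm i z : Y z <-> Y (perm_act (sg i) z).
Proof. by rewrite -conf_act_perm -rot0; exact: sg_conf. Qed.

Let cycE := delta_hat_perm R m0.

(** Coordinates with indices congruent modulo m have the same c-th power, so the cycle on n points
    descends to the cycle on m points, which is the permutation of [delta_hat]. *)
Lemma collapse_sigma1 z : Y z ->
  collapse (perm_act (sigma1 n) z) = perm_act (cyc 1) (collapse z).
Proof.
move=> Yz; have Yz' : Y (perm_act (sigma1 n) z) by have := proj1 (sg_perm 1 z) Yz; rewrite /sg expgz1.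
apply: diff_inj; first by have [] := collapse_conf Yz'.
  by have [] := perm_act_conf (cyc 1) (collapse_conf Yz).
move=> j; have [d0 dS] := cycE.
have [j' ->] : exists j', j = ordS j' by exists (ord_pred j); rewrite ord_predK.
rewrite /cyc expgz1 (diff_perm _ d0 (dS j')) !diff_collapse mxE.
apply: (sym_entry_pow Yz); set i := ((sigma1 n : 'S_n)^-1)%g _.
have e : ordS i = widen (ordS j').
  by rewrite -(permKV (sigma1 n : 'S_n) (widen (ordS j'))) -/i [RHS]permE.
have /eqP := congr1 (fun i : nat => i %% m)%N (congr1 (@nat_of_ord n) e).
rewrite /= (modn_dvdm _ (_ : m %| n)%N) ?modn_mod; last by rewrite -(divnK cn) dvdn_mulr.
by rewrite -(addn1 i) -(addn1 j') eqn_modDr => /eqP.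
Qed.

Lemma collapse_perm i z : Y z -> collapse (perm_act (sg i) z) = perm_act (cyc i) (collapse z).
Proof.
have nat_case (k : nat) w : Y w -> collapse (perm_act (sg k) w) = perm_act (cyc k) (collapse w).
  move=> Yw; elim: k => [|k IH]; first by rewrite /sg /cyc !expgz0 !perm_act1.
  rewrite intS /sg /cyc !expgzD !perm_actM -IH expgz1 collapse_sigma1 ?/cyc ?expgz1 //.
  exact: (proj1 (sg_perm k w) Yw).
case: i => k Yz; first exact: nat_case.
have Yz' := proj1 (sg_perm (Negz k) z) Yz.
have := nat_case k.+1 _ Yz'; rewrite -perm_actM /sg -expgzD NegzE subrr expgz0 perm_act1 => ->.
by rewrite -perm_actM /cyc -expgzD addNr expgz0 perm_act1.
Qed.

Lemma cyc0 i : (cyc i : 'S_m.+1) ord0 = ord0.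
Proof.
have [d0 _] := cycE.
have nat_case (k : nat) : (cyc k : 'S_m.+1) ord0 = ord0.
  elim: k => [|k IH]; first exact: perm1.
  transitivity ((braid_perm (delta_hat R m) : 'S_m.+1) ((cyc k : 'S_m.+1) ord0)).
    by rewrite /cyc intS expgzD expgz1 symM.
  by rewrite IH.
case: i => k //; have := nat_case k.+1.
have := symM (cyc (Negz k)) (cyc k.+1) ord0.
by rewrite /cyc -expgzD NegzE addNr expgz0 => h e; rewrite e in h; rewrite -h perm1.
Qed.

Local Notation conf := (conf_space R m.+1).

(* These braids form a group graded by [i]: the part of degree 0 is P_{m,1(c)}
   and that of degree b consists of the braids corresponding to loops. *)
Definition coloured (i : int) (b : braid R m.+1) := braid_perm b = cyc i /\
  exists p : R -> V, is_path Y sym_base (perm_act (sg i) sym_base) p /\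
    path_homotopic conf (braid_path b) (collapse \o p).

Lemma collapse_path (x y : V) (p : R -> V) : is_path Y x y p -> is_path conf (collapse x) (collapse y) (collapse \o p).
Proof.
move=> [cp Yp p0 p1]; split; rewrite /= ?p0 ?p1 //.
- exact: (continuous_comp2 cp collapse_continuous).
- by move=> t tI; apply: collapse_conf; exact: Yp.
Qed.

Lemma perm_path i (x y : V) (p : R -> V) : is_path Y x y p ->
  is_path Y (perm_act (sg i) x) (perm_act (sg i) y) (perm_act (sg i) \o p).
Proof.
move=> [cp Yp p0 p1]; split; last 2 first.
- by rewrite /= p0.
- by rewrite /= p1.
- exact: (continuous_comp2 cp (@perm_act_continuous R n _)).
- by move=> t tI; exact: (proj1 (sg_perm i _) (Yp t tI)).
Qed.

Lemma collapse_perm_path i (x y : V) (p : R -> V) : is_path Y x y p ->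
  path_homotopic conf (perm_act (cyc i) \o (collapse \o p)) (collapse \o (perm_act (sg i) \o p)).
Proof.
move=> pp; have [_ Yp _ _] := pp.
have pc := @is_path_act R S (cyc i) _ _ _ (collapse_path pp).
by apply: (homotopic_eq pc) => t tI; rewrite /= collapse_perm //; exact: Yp.
Qed.

Lemma collapse_orbit i (p : R -> V) : is_path Y sym_base (perm_act (sg i) sym_base) p ->
  @is_orbit_path R S (cyc i) (collapse \o p : R -> _).
Proof.
move=> pp; have := collapse_path pp.
by rewrite (collapse_perm _ sym_base_conf) collapse_base.
Qed.

Lemma colouredM i j a b : coloured i a -> coloured j b -> coloured (i + j) (a * b)%g.
Proof.
move=> [ea [p [pp hp]]] [eb [r [pr hr]]]; split; first by rewrite braid_permM ea eb /cyc expgzD.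
have pr' := perm_path i pr; rewrite -perm_actM -expgzD in pr'.
exists (path_concat p (perm_act (sg i) \o r)); split; first exact: (path_concatP pp pr').
rewrite comp_path_concat; apply: (homotopic_trans (orbit_repM a b)).
rewrite [orbit_elt a]ea; apply: homotopic_concat => //.
  have [_ _ _ ->] := orbit_repP a; have [_ _ b0 _] := orbit_repP b.
  by rewrite /= b0 [orbit_elt a]ea.
apply: (homotopic_trans (@homotopic_act R S (cyc i) _ _ hr)).
exact: (collapse_perm_path i pr).
Qed.

Lemma coloured1 : coloured 0 1%g.
Proof.
split; first exact: braid_perm1.
exists (cst sym_base); rewrite perm_act1; split; first 
  by split => //; [exact: contcst|move=> t _; exact: sym_base_conf].
have := orbit_rep1 R S; rewrite /= -collapse_base; exact.
Qed.

Lemma colouredV i a : coloured i a -> coloured (- i) (a^-1)%g.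
Proof.
move=> [ea [p [pp hp]]].
have pr := perm_path (- i) (path_revP pp).
rewrite -perm_actM -expgzD addNr expgz0 perm_act1 in pr.
have po := collapse_orbit pr.
pose a' := @orbit_class R S (cyc (- i)) (collapse \o (perm_act (sg (- i)) \o path_rev p)).
have ea' : orbit_elt a' = cyc (- i) := orbit_class_elt po.
have ca : coloured i a by split => //; exists p.
have ca' : coloured (- i) a'.
  by split => //; exists (perm_act (sg (- i)) \o path_rev p); split => //; exact: (orbit_class_rep po).
suff -> : (a^-1)%g = a' by [].
suff e : (a * a')%g = 1%g by rewrite -[RHS](mulKg a) e mulg1.
apply: (@orbit_eqP R S).
  by rewrite orbit_eltM [orbit_elt a]ea ea' orbit_elt1 /cyc -expgzD subrr.
have pe := collapse_path pp.
apply: (homotopic_trans (orbit_repM a a')).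
apply: (homotopic_trans (g := path_concat (collapse \o p) (collapse \o path_rev p))).
  rewrite [orbit_elt a]ea; apply: homotopic_concat => //.
    have [_ _ _ ->] := orbit_repP a; have [_ _ b0 _] := orbit_repP a'.
    by rewrite /= b0 [orbit_elt a]ea.
  apply: (homotopic_trans (@homotopic_act R S (cyc i) _ _ (orbit_class_rep po))).
  apply: (homotopic_trans (collapse_perm_path i pr)).
  have := homotopic_refl (collapse_path (path_revP pp)); congr path_homotopic.
  by apply/funext => t /=; rewrite -perm_actM -expgzD subrr expgz0 perm_act1.
apply: (homotopic_trans (homotopic_concat_rev pe)).
by rewrite collapse_base; apply: homotopic_sym; exact: (orbit_rep1 R S).
Qed.

Lemma colouredX i (k : int) a : coloured i a -> coloured (i * k) (expgz a k).
Proof.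
move=> ca; have nat_case (j : nat) : coloured (i * j) (expgz a j).
  elim: j => [|j IH]; first by rewrite mulr0; exact: coloured1.
  by rewrite intS mulrDr mulr1 expgzD expgz1; exact: colouredM.
case: k => j; first exact: nat_case.
by rewrite NegzE mulrN; exact: (colouredV (nat_case j.+1)).
Qed.

Lemma coloured_fix0 i b : coloured i b -> fix0 b.
Proof. by move=> [e _]; rewrite /fix0 e cyc0. Qed.

Lemma coloured_coset i x : coloured i x ->
  left_coset x (coloured 0) = coloured i.
Proof.
move=> cx; apply/seteqP; split => b.
  by move=> [p cp <-]; rewrite -(addr0 i); exact: colouredM.
move=> cb; exists (x^-1 * b)%g; last exact: mulKVg.
by rewrite /= -[0](addNr i); apply: colouredM => //; exact: colouredV.
Qed.

(** Taking c-th powers multiplies logarithms by c, so the end of a path in Y is recovered from its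
    image on dividing the logarithm by c. *)
Lemma path_angle_collapse (j : 'I_m) (y : V) (p : R -> V) : is_path Y sym_base y p ->
  y 0 (widen j) = cexp ((path_angle j (collapse \o p)).1 / c%:R, (path_angle j (collapse \o p)).2 / c%:R).
Proof.
move=> pp; pose f t := p t 0 (widen j).
have entry0 z : Y z -> z 0 (widen j) != 0.
  by move=> /(sym_res_sep n0 cn c1 lc)[/(_ j)]; rewrite mxE.
have pf : is_path [set z : C | z != 0] (cexp (ln j.+1%:R / c%:R, 0 : R)) (y 0 (widen j)) f.
  have [cp Yp p0 p1] := pp; split; rewrite /f ?p0 ?p1 ?sym_base_widen //.
    exact: (@cont_entry R R n p (widen j) cp).
  by move=> t /Yp/entry0.
have [X [[cX X0 qX] eX]] := lift_path (cexp_covers R) pf erefl.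
have -> : path_angle j (collapse \o p) = (c%:R * (X 1).1, c%:R * (X 1).2).
  apply: (endpE (cexp_covers R) (G := fun t => (c%:R * (X t).1, c%:R * (X t).2))); split.
  - by cont.
  - by rewrite X0 /= mulr0 mulrC divfK.
  - by move=> t tI; rewrite -cexpX qX //= diff_collapse.
rewrite /= ![c%:R * _]mulrC !mulfK // -surjective_pairing qX ?unitI1 //.
by have [_ _ _ ->] := pf.
Qed.

Lemma angle_log (b : braid R m.+1) (j : 'I_m) (s : 'I_m) :
  diff j (braid_path b 1) = cexp (base_log R s) -> (angle j b).1 = ln s.+1%:R.
Proof.
move=> e; have pb := diff_path_base j (orbit_repP b).
have [_ _ _ b1] := orbit_repP b.
have := q_endp (cexp_covers R) pb erefl; rewrite -b1 [diff j _]e => /(congr1 Num.norm).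
rewrite !norm_cexp => -[] /expR_inj; exact.
Qed.

End SymmetricBraids.

(** * Degrees of braids read off their angles *)

Section ColouredBraids.
Variables (R : realType) (n l c : nat).
Local Notation C := (plane R).
Hypotheses (n0 : (0 < n)%N) (cn : (c %| n)%N) (c1 : (1 < c)%N) (lc : coprime l c).
Let m := (n %/ c)%N.
Let c0 : (0 < c)%N := ltnW c1.
Let m0 : (0 < m)%N. Proof. by rewrite divn_gt0 // dvdn_leq. Qed.
Let cR : c%:R != 0 :> R. Proof. by rewrite pnatr_eq0 -lt0n. Qed.
Let prim : c.-primitive_root (root_l R l c) := root_prim R c0 lc.
Local Notation V := ('rV[C]_n).
Local Notation S := (braid_gspace R m.+1).
Local Notation Y := (@sym_conf_space R n l c).
Local Notation widen := (widen_ord (leq_div n c)).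
Local Notation base := (sym_base R n l c).
Local Notation conf := (conf_space R m.+1).
Let sg (i : int) : Sym n := expgz (sigma1 n) i.
Let cyc (i : int) : Sym m.+1 := expgz (braid_perm (delta_hat R m)) i.
Local Notation coloured := (@coloured R n l c).
Local Notation collapse := (@collapse R n c).

Let Ybase : Y base. Proof. exact: sym_base_conf. Qed.
Let Yrot i : Y (perm_act (sg i) base). Proof. exact: (proj1 (sg_perm l c i base) Ybase). Qed.

Lemma coloured_ex i : exists b, coloured i b.
Proof.
have [M [q [cq cM _]]] := sym_conf_cover R n0 cn c1 lc.
have [x qx] := cov_surj cq Ybase; have [y qy] := cov_surj cq (Yrot i).
have [p [pp _]] := endp_surj cq cM x y; rewrite qx qy in pp.
have po := collapse_orbit n0 cn c1 lc pp.
exists (@orbit_class R S (cyc i) (collapse \o p)); split; first exact: (orbit_class_elt po).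
by exists p; split => //; exact: (orbit_class_rep po).
Qed.

Lemma braid_lift (b : braid R m.+1) : exists y p, is_path Y base y p /\
  path_homotopic conf (braid_path b) (collapse \o p).
Proof.
have [M [q [cq cM ckq]]] := sym_conf_cover R n0 cn c1 lc.
have [x qx] := cov_surj cq Ybase.
have k0 : collapse base = bg_base S := collapse_base R n l c1.
have [p [pp _ hp]] := lift_end_path (S := S) (k := collapse) cq qx k0 ckq b.
by exists (q (lift_end (S := S) q x collapse b)), p.
Qed.

Lemma braid_lift_angle (b : braid R m.+1) y p (j : 'I_m) : is_path Y base y p ->
  path_homotopic conf (braid_path b) (collapse \o p) ->
  y 0 (widen j) = cexp ((angle j b).1 / c%:R, (angle j b).2 / c%:R).
Proof.
move=> pp hp; rewrite (path_angle_collapse n0 cn c1 lc j pp).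
by rewrite /angle (path_angle_homotopic j (orbit_repP b) hp).
Qed.

Lemma coloured_angle i b : braid_perm b = cyc i -> coloured i b <->
  forall j : 'I_m, perm_act (sg i) base 0 (widen j) =
    cexp ((angle j b).1 / c%:R, (angle j b).2 / c%:R).
Proof.
move=> eb; split.
  by move=> [_ [p [pp hp]]] j; exact: (braid_lift_angle j pp hp).
move=> h; split => //; have [y [p [pp hp]]] := braid_lift b.
suff ey : y = perm_act (sg i) base by rewrite ey in pp; exists p.
have Yy : Y y by have [_ Yp _ <-] := pp; exact: (Yp 1 unitI1).
apply: (sym_eq n0 cn c1 Yy (Yrot i)) => j.
by rewrite (braid_lift_angle j pp hp) -h.
Qed.

Let widen_base j : base 0 (widen j) = cexp (ln j.+1%:R / c%:R, 0 : R) := sym_base_widen R l j.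

(** The lift of a pure braid closes up exactly when each angle divided by c is a multiple of 2 pi,
    that is, when c divides the winding numbers. *)
Lemma coloured0 : coloured 0 = pure_braids_mod R m c.
Proof.
apply/seteqP; split => b.
  move=> cb; have b1 : braid_perm b = 1%g by have [] := cb.
  split => // j; have /(coloured_angle (i := 0) b1)/(_ j) := cb.
  have lj : (angle j b).1 = ln j.+1%:R.
    apply: (angle_log (s := j)); have [_ _ _ h] := @orbit_repP R S b.
    by rewrite [braid_path b 1]h [orbit_elt b]b1 [bg_act _ _]perm_act1 diff_base.
  rewrite perm_act1 widen_base lj /cexp /= expi0 mulr1.
  have nz : (expR (ln j.+1%:R / c%:R))%:C%C != 0 :> C.
    by rewrite eq_complex /= eqxx andbT gt_eqF // expR_gt0.
  rewrite -{1}[(expR _)%:C%C]mulr1 => /(mulfI nz)/esym/expi_eq1P[w ew].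
  exists (c%:Z * w); split; last exact: dvdz_mulr.
  apply/(windsP _ (diff_path_base j (orbit_repP b))); rewrite subr0 rmorphM /=.
  rewrite -[LHS]/(angle j b).2 -(divfK cR (angle j b).2) ew; ring.
move=> [b1 wb]; apply/(coloured_angle (i := 0)) => // j.
have lj : (angle j b).1 = ln j.+1%:R.
  apply: (angle_log (s := j)); have [_ _ _ h] := @orbit_repP R S b.
  by rewrite [braid_path b 1]h [orbit_elt b]b1 [bg_act _ _]perm_act1 diff_base.
have [w [/(windsP _ (diff_path_base j (orbit_repP b))) ww /dvdzP[v wv]]] := wb j.
have aw : (angle j b).2 = 2 * pi * w%:~R by rewrite -ww subr0.
rewrite perm_act1 widen_base lj aw wv rmorphM /= /cexp /=; congr (_ * _).
by rewrite !mulrA mulfK // expi_2pi expi0.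
Qed.

(** Only the first string has a nonzero angle, -2 pi, which becomes -2 pi / c in the lift. In the
    permuted base point this coordinate is zeta^(c-1) times the last of the first m, and the two
    agree because zeta has angle 2 pi / c when l = 1 mod c. *)
Lemma coloured_delta_hat : l = 1 %[mod c] -> coloured 1 (delta_hat R m).
Proof.
move=> l1; have [d0 dS] := delta_hat_perm R m0.
have e1 : braid_perm (delta_hat R m) = cyc 1 by rewrite /cyc expgz1.
apply/coloured_angle => // j.
have [j' ->] : exists j', j = ordS j' by exists (ord_pred j); rewrite ord_predK.
have -> : (angle (ordS j') (delta_hat R m)).1 = ln j'.+1%:R.
  apply: (angle_log (s := j')); have [_ _ _ h] := @orbit_repP R S (delta_hat R m).
  by rewrite [braid_path _ _]h [LHS](diff_perm _ d0 (dS j')) diff_base.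
rewrite delta_hat_angle // mxE /sg expgz1; set i := ((sigma1 n : 'S_n)^-1)%g _.
have e : (i.+1 %% n = j'.+1 %% m)%N.
  have : ordS i = widen (ordS j') by rewrite -(permKV (sigma1 n : 'S_n) (widen (ordS j'))) -/i [RHS]permE.
  by move/(congr1 (@nat_of_ord n)).
(* When the index wraps around, the preimage of 0 under the n-cycle is n - 1 = (c - 1) m + (m -
   1). *)
have := ltn_ord j'; rewrite leq_eqVlt => /orP[/eqP jm|jm].
  have ein : i = n.-1 :> nat.
    move: e; rewrite jm modnn; have := ltn_ord i; rewrite leq_eqVlt => /orP[/eqP h _|h]; first by rewrite -[in RHS]h.
    by rewrite modn_small.
  have nm : n = (c.-1 * m + m)%N by rewrite -mulSnr prednK // mulnC divnK.
  have e2 : n.-1 = (c.-1 * m + j')%N by rewrite nm -[X in (_ + X)%N]jm addnS.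
  rewrite (sym_entry n0 cn c1 i Ybase) ein e2 divnMDl // modnMDl.
  rewrite divn_small ?ltn_ord // modn_small ?ltn_ord // addn0.
  rewrite sym_entry_widen widen_base /= jm modnn /= /cexp /= expi0 mulr1 mulrC; congr (_ * _).
  apply: (mulfI (expi_neq0 (2 * pi / c%:R))).
  rewrite -expiD mulNr subrr expi0.
  have -> : expi (2 * pi / c%:R) = root_l R l c :> C.
    rewrite -[LHS](expr1 _).
    have p1 := root_prim R c0 (coprime1n c); rewrite /root_l mulr1 in p1.
    have := eq_prim_root_expr p1 l 1; rewrite l1 eqxx => /eqP <-.
    by rewrite -expi_nat /root_l; congr expi; rewrite -mulr_natr; ring.
  by rewrite -exprS prednK // (prim_expr_order prim).
have jm' : (j'.+1 < m)%N by rewrite jm.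
have ei : i = j' :> nat.
  move: e; rewrite [(j'.+1 %% m)%N]modn_small //; have := ltn_ord i; rewrite leq_eqVlt => /orP[/eqP ->|h].
    by rewrite modnn.
  by rewrite modn_small // => -[].
have -> : i = widen j' by apply: val_inj.
by rewrite widen_base /= modn_small // mul0r.
Qed.

Lemma total_angle1 : total_angle (1%g : braid R m.+1) = 0.
Proof. by rewrite /total_angle big1 // => j _; exact: angle1. Qed.

(** A full turn of the base point about the origin is a closed path in Y, whose c-th powers turn c
    times. *)
Lemma coloured_full_turn : exists t, coloured 0 t /\ total_angle t != 0.
Proof.
pose p : R -> V := fun s => rotate 1 (s, base).
have rotY t : Y (rotate 1 (t, base)).
  by have := proj1 (sg_conf l c 0 (2 * pi * t * 1) base) Ybase; rewrite expgz0.
have pp : is_path Y base base p.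
  split; rewrite /p.
  - apply: (@continuous_comp2 R (R * V)%type V (fun s => (s, base)) (rotate 1)).
      by apply: continuous_pairR; [exact: continuous_idE|exact: contcst].
    exact: rotate_continuous.
  - by move=> t _; exact: rotY.
  - exact: rotate0.
  - by apply/rowP => j; rewrite rotateE /= !mulr1 -[2 * pi]mulr1 (expi_2pi R 1) mul1r.
have pp' : is_path Y base (perm_act (sg 0) base) p by rewrite perm_act1.
have po := collapse_orbit n0 cn c1 lc pp'.
have hp := orbit_class_rep po.
exists (@orbit_class R S (cyc 0) (collapse \o p)); split.
  by split; [exact: (orbit_class_elt po)|exists p].
set t := orbit_class _ _.
have at2 j : (angle j t).2 = 2 * pi * c%:R.
  rewrite /angle (path_angle_homotopic j (orbit_repP t) hp).
  rewrite [path_angle _ _](endpE (cexp_covers R) (G := fun s => (ln j.+1%:R : R, 2 * pi * c%:R * s))) ?mulr1 //.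
  split; [by cont|by rewrite mulr0|].
  move=> s _; rewrite /= diff_collapse /p rotateE widen_base exprMn cexpX -expi_nat /=.
  rewrite mulr0 [c%:R * (_ / _)]mulrC divfK // /cexp /= expi0 !mulr1 [RHS]mulrC; congr (_ * expi _).
  by rewrite -mulr_natr; ring.
have -> : total_angle t = \sum_(j < m) (2 * pi * c%:R) by apply: eq_bigr => j _; exact: at2.
rewrite sumr_const card_ord mulrn_eq0 negb_or -lt0n m0 /= !mulf_neq0 //.
by rewrite gt_eqF // pi_gt0.
Qed.

(** These braids are separated by end points of lifts, which lie in one countable fibre. *)
Lemma countable_braids (s : Sym m.+1) : countable [set b : braid R m.+1 | braid_perm b = s].
Proof.
have [M [q [cq cM]]] := conf_cover R m.
have [x qx] := cov_surj cq (base_confP R m.+1).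
pose f (b : braid R m.+1) := endp q x (braid_path b).
have fi : {in [set b : braid R m.+1 | braid_perm b = s] &, injective f}.
  move=> a b; rewrite !inE /= => ea eb e.
  by apply: (orbit_eq_endp (S := S) cq cM qx) => //; rewrite [LHS]ea -eb.
have := inj_card_eq fi; rewrite card_eq_le => /andP[_ h].
apply: (sub_countable h); apply: (sub_countable (subset_card_le _)
  (cov_count cq (perm_act s (base_conf R m.+1)))) => _ [b /= eb <-].
by rewrite /f /= (q_endp cq (orbit_repP b) qx) [orbit_elt b]eb.
Qed.

(* The total angle is invariant under conjugation and separates the [x t^i]. *)
Lemma card_coloured_classes (s : Sym m.+1) (X : set (braid R m.+1)) x :
  X `<=` [set b | braid_perm b = s] -> X x -> fix0 x ->
  (forall p, coloured 0 p -> X (x * p)%g) ->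
  ([set conj_class (coloured 0) b | b in X] #= [set: nat])%card.
Proof.
move=> Xs Xx x0 Xp; have [t [ct t0]] := coloured_full_turn.
rewrite card_eq_le; apply/andP; split.
  by apply: (card_le_trans (card_image_le _ _)); exact: (sub_countable (subset_card_le Xs) (countable_braids s)).
pose f (i : nat) := conj_class (coloured 0) (x * t ^+ i)%g.
have cti (i : nat) : coloured 0 (t ^+ i)%g.
  by have := colouredX n0 cn c1 lc i ct; rewrite mul0r.
have fix_t i : fix0 (t ^+ i)%g := coloured_fix0 n0 cn c1 (cti i).
have tot i : total_angle (x * t ^+ i)%g = total_angle x + total_angle t *+ i.
  rewrite total_angleM //; congr (_ + _); elim: i => [|i IH]; first exact: total_angle1.
  by rewrite expgS total_angleM ?IH ?mulrS //; exact: (fix_t 1).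
have tot_conj p b : coloured 0 p -> fix0 b -> total_angle (p * b * p^-1)%g = total_angle b.
  move=> cp b0; have p0 := coloured_fix0 n0 cn c1 cp.
  rewrite total_angleM; last exact: fix0M.
  rewrite total_angleM // addrAC -total_angleM // mulgV total_angle1 add0r //.
have fi : {in [set: nat] &, injective f}.
  move=> i j _ _ e.
  have : conj_class (coloured 0) (x * t ^+ j)%g (x * t ^+ i)%g.
    rewrite -[conj_class _ _]e; exists 1%g; first exact: coloured1.
    by rewrite mul1g invg1 mulg1.
  move=> [p cp ep]; have := tot_conj p (x * t ^+ j)%g cp (fix0M x0 (fix_t j)).
  rewrite ep (tot i) (tot j) => /addrI; rewrite -(mulr_natr _ i) -(mulr_natr _ j).
  by move=> /(mulfI t0)/eqP; rewrite eqr_nat => /eqP.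
have := inj_card_eq fi; rewrite card_eq_le => /andP[_ h].
apply: (card_le_trans h); apply: subset_card_le => _ [i _ <-].
by exists (x * t ^+ i)%g => //; exact: Xp.
Qed.

End ColouredBraids.

(** * Loops with gcd(n, k) > 1 *)

Section GcdCase.
Variables (R : realType) (n k l : nat) (b : int).
Local Notation C := (plane R).
Let c := gcdn n k.
Hypotheses (n0 : (0 < n)%N) (k0 : (0 < k)%N) (kl : coprime k l).
Hypotheses (c1 : (1 < c)%N) (bk : (b * k%:Z = - c%:Z %[mod n%:Z])%Z).
Let m := (n %/ c)%N.
Let cn : (c %| n)%N. Proof. exact: dvdn_gcdl. Qed.
Let lc : coprime l c. Proof. by rewrite coprime_sym; apply: coprime_dvdl kl; exact: dvdn_gcdr. Qed.
Let cR : c%:R != 0 :> R. Proof. by rewrite pnatr_eq0 -lt0n ltnW. Qed.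
Let nR : n%:R != 0 :> R. Proof. by rewrite pnatr_eq0 -lt0n. Qed.
Let kR : k%:R != 0 :> R. Proof. by rewrite pnatr_eq0 -lt0n. Qed.
Local Notation V := ('rV[C]_n).
Local Notation S := (braid_gspace R m.+1).
Local Notation Y := (@sym_conf_space R n l c).
Local Notation base := (sym_base R n l c).
Local Notation conf := (conf_space R m.+1).
Local Notation coloured := (@coloured R n l c).
Local Notation collapse := (@collapse R n c).
Let Fix := fixed_loops (C_group R n k l).
Let s : Sym n := expgz (sigma1 n) b.
Let s' : Sym m.+1 := expgz (braid_perm (delta_hat R m)) b.
Let theta : R := (c%:R + b%:~R * k%:R) / n%:R * l%:R / k%:R.
Let g : (O2 R * Sym n)%type := (rot (2 * pi * theta), s).
Let w : R := c%:R / (n%:R * k%:R).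
Let rt := @rotate R n (- theta).
Let mono := full_mono (conf_act g) (fun u => loop_path u w) base rt.

Let Ybase : Y base. Proof. exact: sym_base_conf. Qed.
Let Ys z : Y z -> Y (perm_act s z). Proof. exact: (proj1 (sg_perm l c b z)). Qed.

Let rtY t z : Y z -> Y (rt (t, z)).
Proof. by move=> Yz; have := proj1 (sg_conf l c 0 (2 * pi * t * (- theta)) z) Yz; rewrite expgz0. Qed.

Let rt1 z : Y z -> rt (1, conf_act g z) = perm_act s z.
Proof. by move=> _; exact: rotate_back. Qed.

Let kbase : collapse base = bg_base S. Proof. exact: collapse_base. Qed.

Let ks : collapse (perm_act s base) = bg_act (s' : bg_group S) (bg_base S).
Proof. by rewrite -kbase; exact: (collapse_perm n0 cn c1 lc b Ybase). Qed.

Let tw : twisted_paths (R := R) Y (conf_act g) Fix (fun u => loop_path u w).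
Proof.
have [a ab] : exists a : int, a * n%:Z = c%:Z + b * k%:Z.
  move/eqP: bk; rewrite eqz_mod_dvd opprK => /dvdzP[a ea]; exists a.
  by rewrite -ea addrC.
have aR : a%:~R = (c%:R + b%:~R * k%:R) / n%:R :> R.
  have := congr1 (fun m : int => m%:~R : R) ab; rewrite rmorphD !rmorphM /= => <-.
  by rewrite mulfK.
have gE : (rot (2 * pi * a%:~R * l%:R / k%:R), s) = g by rewrite aR /g /theta !mulrA.
rewrite /Fix (C_fixed_loops R l n0 k0 ab) gE /loop_path.
have ck : (c %| n * k)%N by rewrite dvdn_mulr.
have -> : w = ((n * k) %/ c)%:R^-1 :> R.
  have e : (n * k)%:R = ((n * k) %/ c)%:R * c%:R :> R by rewrite -natrM divnK.
  rewrite /w -natrM e invfM mulrCA divff // mulr1 //.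
apply: (fixed_conf_twisted (y := (rot (2 * pi * l%:R / c%:R), sigma1 n ^+ (n %/ c))%g)).
- by rewrite divn_gt0 ?(ltnW c1) // dvdn_leq // muln_gt0 n0 k0.
- by move=> z; have := twist_order l n0 k0 ab z; rewrite gE; exact.
- exact: (@rot_cycle_comm R n _ _ (n %/ c)%N b).
- by move=> z; exact: sym_conf_spaceE.
Qed.

Let monoP u eta : Fix u -> is_path Y base (loop_path u w 0) eta ->
  is_path Y base (perm_act s base) (mono u eta).
Proof.
move=> Fu pe; exact: (full_monoP tw Ybase (@rotate_continuous R n (- theta)) rtY
  (fun z _ => rotate0 (- theta) z) rt1 Fu pe).
Qed.

Let loop0 u : loop_path u w 0 = u (to_circle 0) :> V.
Proof. by rewrite /loop_path mulr0. Qed.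

(** Taking c-th powers multiplies the angle of the rotation back by c, whence the angle a c l / k in
    the definition of the braid. *)
Let power_mono u eta : power_map c \o mono u eta = path_concat
  (power_map c \o path_concat (path_concat eta (loop_path u w)) (conf_act g \o path_rev eta))
  (rotation_path (- ((c%:R + b%:~R * k%:R) / n%:R * c%:R * l%:R / k%:R)) (power_map c (conf_act g base))).
Proof.
rewrite /mono /full_mono comp_path_concat; congr path_concat; apply/funext => t.
apply/rowP => j; transitivity (rt (t, conf_act g base) 0 (widen_ord (leq_div n c) j) ^+ c).
  exact: mxE.
rewrite /rotation_path /rt rotateE exprMn -expi_nat [RHS]conf_actE plane_act_rot invg1 perm1 [in RHS]mxE.
congr (expi _ * _).
by rewrite -mulr_natr /theta /=; field; rewrite nR kR.
Qed.

Lemma braid_of_loop_gcdE u beta : Fix u -> braid_of_loop_gcd k l b u beta <->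
  exists eta, is_path Y base (loop_path u w 0) eta /\
    beta = @orbit_class R S s' (collapse \o mono u eta).
Proof.
move=> Fu; rewrite /braid_of_loop_gcd -/c -/m -/s -/w.
have gE : (rot (2 * pi * ((c%:R + b%:~R * k%:R) / n%:R) * l%:R / k%:R), s) = g.
  by rewrite /g /theta !mulrA.
rewrite gE loop0; split.
  move=> [y [eta [[Yy ypos ybase] [pe b0 hb]]]].
  have ey := sym_base_uniq n0 cn c1 lc Yy ypos ybase.
  rewrite ey in pe hb; exists eta; split => //.
  have pe' := pe; rewrite -loop0 in pe'.
  have pm := monoP Fu pe'; have po := collapse_orbit n0 cn c1 lc pm.
  have h : path_homotopic conf (braid_path beta) (collapse \o mono u eta).
    have pb := orbit_repP beta; have [_ Xb _ _] := pb.
    apply: (homotopic_trans (homotopic_eq pb _)).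
      by move=> t tI; rewrite -[LHS](centreK (proj1 (Xb t tI))).
    have := homotopic_comp (@uncentre_continuous R m) (@uncentre_conf R m) hb.
    by rewrite -power_mono.
  (* The definition only requires [beta] to fix 0; the ends of the homotopy determine the whole
     permutation, the base points being distinct. *)
  have e1 : braid_perm beta = s'.
    have [_ _ _ e] := orbit_repP beta; have [_ _ _ e'] := po.
    have [H [_ hH]] := h; have [_ h0 h1 _ h2] := hH 1 1 unitI1 unitI1.
    have [_ h0' _ _ _] := hH 1 0 unitI1 unitI0.
    have eb : perm_act (braid_perm beta) (base_conf R m.+1) = perm_act s' (base_conf R m.+1).
      by rewrite -[LHS]e -[RHS]e' -h1 h2.
    have [_ bi] := base_confP R m.+1.
    apply/(@invg_inj 'S_m.+1)/permP => j; apply: bi.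
    by have := congr1 (fun z : 'rV[C]_m.+1 => z 0 j) eb; rewrite !mxE.
  apply: (@orbit_eqP R S); first by rewrite (orbit_class_elt po).
  exact: (homotopic_trans h (homotopic_sym (orbit_class_rep po))).
move=> [eta [pe ->]].
exists base, eta; split; first split => //.
- by move=> j; exact: sym_base_pos.
- exact: power_map_base.
have pe' := pe; rewrite -loop0 in pe'.
have po := collapse_orbit n0 cn c1 lc (monoP Fu pe').
split => //.
  by rewrite /braids_fix0 /= /braid_perm (orbit_class_elt po); exact: cyc0.
rewrite -power_mono.
have := homotopic_comp (@centre_continuous R m) (@centre_conf R m) (orbit_class_rep po).
congr path_homotopic; apply/funext => t /=; exact: uncentreK.
Qed.

Theorem gcd_case :
  let P := pure_braids_mod R m c in
  (exists F : set {compact-open, circle R -> 'rV[plane R]_n} -> set (braid R m.+1),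
     set_bij (components Fix)
       [set conj_class P beta | beta in left_coset (expgz (delta_hat R m) b) P] F /\
     (l = 1 %[mod c] -> forall u beta, Fix u -> braid_of_loop_gcd k l b u beta ->
        F (connected_component Fix u) = conj_class P beta)) /\
  (forall u (Fu : Fix u),
     [/\ aspherical R (set_type (connected_component Fix u)),
         exists beta, braid_of_loop_gcd k l b u beta &
         forall beta, braid_of_loop_gcd k l b u beta ->
           group_iso_onto (pi1 R (connected_component_refl Fu))
             [set p | P p /\ (p * beta = beta * p)%g]]).
Proof.
move=> P; have [M [q [cq cM ckq]]] := sym_conf_cover R n0 cn c1 lc.
have [x qx] := cov_surj cq Ybase.
have bar_loop p (be : braid R m.+1) : is_path Y base base p ->
    orbit_elt be = 1%g -> path_homotopic conf (orbit_rep be) (collapse \o p) ->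
    orbit_elt be = 1%g /\ path_homotopic conf
      (@perm_act R _ s' \o orbit_rep be) (collapse \o (@perm_act R _ s \o p)).
  move=> pp e h; split => //.
  apply: (homotopic_trans (@homotopic_act R S s' _ _ h)).
  exact: (collapse_perm_path n0 cn c1 lc b pp).
have := twisted_correspondence (S := S) (k := collapse) (bar := id)
  (h := @perm_act R _ s) (rt := rt) (pi := s')
  tw cq cM qx Ybase (@collapse_continuous R n c) (collapse_conf n0 cn c1 lc) kbase ckq
  (@perm_act_continuous R _ s) Ys (@rotate_continuous R n (- theta)) rtY
  (fun z _ => rotate0 (- theta) z) rt1 ks bar_loop.
(* Degree i means that the lift ends at the base point permuted by the i-th power of [sigma1]. For i
   = 0 and i = b these are the subgroup and the coset of the general correspondence. *)
have lift_coloured i : coloured i =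
    corr_coset (S := S) q base x collapse (@perm_act R _ (expgz (sigma1 n) i))
      (expgz (braid_perm (delta_hat R m)) i).
  apply/seteqP; split => be.
    move=> [e [p [pp hp]]]; split => //.
    by rewrite (lift_end_push (S := S) cq qx kbase ckq pp hp) (q_endp cq pp qx).
  move=> [e qe]; split => //.
  have [p [pp _ hp]] := lift_end_path (S := S) (k := collapse) cq qx kbase ckq be.
  by exists p; rewrite qe in pp.
have clE : closed_lift (S := S) q base x collapse = P.
  rewrite /P -(coloured0 R n0 cn c1 lc) lift_coloured /corr_coset /closed_lift.
  by rewrite !expgz0 perm_act1.
have twE : (fun be => twisted_classes (S := S) q base x collapse id be) = conj_class P.
  by apply/funext => be; rewrite /twisted_classes clE.
rewrite clE -(lift_coloured b) twE => -[[F [bF FE]] H]; split; last first.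
  move=> u Fu; have [asph [be hb] iso] := H u Fu; split; first exact: asph.
    by exists be; apply/(braid_of_loop_gcdE _ Fu); exact: hb.
  by move=> beta /(braid_of_loop_gcdE _ Fu); exact: iso.
have FE' u beta : Fix u -> braid_of_loop_gcd k l b u beta ->
    F (connected_component Fix u) = conj_class P beta.
  by move=> Fu /(braid_of_loop_gcdE _ Fu) h; rewrite (FE _ _ Fu h) -twE.
have P0 : P = coloured 0 := esym (coloured0 R n0 cn c1 lc).
have [l1|l1] := pselect (l = 1 %[mod c]).
  (* Here [delta_hat] has degree 1, so its b-th power has degree b and the two cosets coincide. *)
  exists F; split=> [|_]; last exact: FE'.
  have := colouredX n0 cn c1 lc b (coloured_delta_hat R n0 cn c1 lc l1); rewrite mul1r => cx.
  by rewrite P0 (coloured_coset n0 cn c1 lc cx) -P0.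
(* Otherwise [delta_hat ^ b] need not have degree b, but both sets of classes are
   countably infinite. *)
have d0 : fix0 (expgz (delta_hat R m) b).
  rewrite /fix0 (expgz_morph (@braid_permM R m.+1)); exact: cyc0.
have [be cb] := coloured_ex R n0 cn c1 lc b.
have card1 : ([set conj_class P beta | beta in coloured b] #= [set: nat])%card.
  rewrite P0; apply: (card_coloured_classes n0 cn c1 lc (s := s') (x := be)) => //.
  - by move=> y [].
  - exact: (coloured_fix0 n0 cn c1 cb).
  - by move=> p cp; rewrite -(addr0 b); exact: colouredM.
have card2 : ([set conj_class P beta | beta in left_coset (expgz (delta_hat R m) b) P] #= [set: nat])%card.
  rewrite P0; apply: (card_coloured_classes n0 cn c1 lc
    (s := braid_perm (expgz (delta_hat R m) b)) (x := expgz (delta_hat R m) b)) => //.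
  - by move=> _ [p [p1 _] <-]; rewrite /= braid_permM p1 mulg1.
  - exists 1%g; [exact: coloured1|exact: mulg1].
  - by move=> p cp; exists p.
have /card_set_bijP[G bG] := card_eq_trans card1 (card_esym card2).
by exists (G \o F); split => //; exact: (set_bij_comp bF bG).
Qed.

End GcdCase.

Theorem theorem5p7 (R : realType) (n : nat) (n_ge3 : (3 <= n)%N) :
  [/\ (* G = C(n, k/l), gcd(n, k) = 1 *)
      forall (k l : nat) (b : int),
        (0 < k)%N -> (0 < l)%N -> coprime k l -> coprime n k ->
        (b * k%:Z = -1 %[mod n%:Z])%Z ->
        let Fix := fixed_loops (C_group R n k l) in
        let P := pure_braids R n in
        (exists F : set {compact-open, circle R -> 'rV[plane R]_n} ->
                    set (braid R n),
           set_bij (components Fix)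
             [set conj_class P beta |
               beta in left_coset (expgz (delta R n) b) P] F /\
           forall u beta, Fix u -> braid_of_loop_coprime k l b u beta ->
             F (connected_component Fix u) = conj_class P beta) /\
        (forall u (Fu : Fix u),
           [/\ aspherical R (set_type (connected_component Fix u)),
               exists beta, braid_of_loop_coprime k l b u beta &
               forall beta, braid_of_loop_coprime k l b u beta ->
                 group_iso_onto (pi1 R (connected_component_refl Fu))
                   [set p | P p /\ (p * beta = beta * p)%g]]),
      (* G = C(n, k/l), gcd(n, k) = c > 1 *)
      forall (k l : nat) (b : int),
        (0 < k)%N -> (0 < l)%N -> coprime k l ->
        let c := gcdn n k in
        (1 < c)%N -> (b * k%:Z = - c%:Z %[mod n%:Z])%Z ->
        let Fix := fixed_loops (C_group R n k l) in
        let P := pure_braids_mod R (n %/ c) c in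
        (exists F : set {compact-open, circle R -> 'rV[plane R]_n} ->
                    set (braid R (n %/ c).+1),
           set_bij (components Fix)
             [set conj_class P beta |
               beta in left_coset (expgz (delta_hat R (n %/ c)) b) P] F /\
           (l = 1 %[mod c] ->
            forall u beta, Fix u -> braid_of_loop_gcd k l b u beta ->
              F (connected_component Fix u) = conj_class P beta)) /\
        (forall u (Fu : Fix u),
           [/\ aspherical R (set_type (connected_component Fix u)),
               exists beta, braid_of_loop_gcd k l b u beta &
               forall beta, braid_of_loop_gcd k l b u beta ->
                 group_iso_onto (pi1 R (connected_component_refl Fu))
                   [set p | P p /\ (p * beta = beta * p)%g]]) &
      (* G = C'(n, 2), n odd *)
      odd n ->
        let Fix := fixed_loops (C'2_group R n) in
        let P := pure_braids R n in
        (exists F : set {compact-open, circle R -> 'rV[plane R]_n} ->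
                    set (braid R n),
           set_bij (components Fix)
             [set twisted_class P beta |
               beta in left_coset (delta R n ^+ (n.+1)./2)%g P] F /\
           forall u beta, Fix u -> braid_of_loop_conj u beta ->
             F (connected_component Fix u) = twisted_class P (beta^-1)%g) /\
        (forall u (Fu : Fix u),
           [/\ aspherical R (set_type (connected_component Fix u)),
               exists beta, braid_of_loop_conj u beta &
               forall beta, braid_of_loop_conj u beta ->
                 group_iso_onto (pi1 R (connected_component_refl Fu))
                   [set p | P p /\ (p * beta = beta * braid_bar p)%g]])
  ].
Proof.
have n0 : (0 < n)%N by rewrite (leq_trans _ n_ge3).
split.
- by move=> k l b k0 _ _ nk bk; exact: coprime_case.
- by move=> k l b k0 _ kl c c1 bk; exact: gcd_case.
- by move=> _; exact: conjugate_case.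
Qed.
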